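(* Let $1<p\le 3$ and $\varepsilon>0$, and set $\omega_p:=\max\{-1,\tfrac12-\tfrac{2}{p-1}\}$. There exists a constant $C_\varepsilon>0$ (depending on $\varepsilon$ and on the fixed exponent $p$) such that for every $\eta\in(0,\tfrac12)$ there is a $\delta>0$ with the following property. Let $(f,g)$ be radial initial data with $$\|(f,g)-(\psi^1(0,\cdot),\psi^1_t(0,\cdot))\|_{\mathcal E(3/2)}<\delta .$$ Then there exists $T\in(1-\eta,1+\eta)$ such that the Cauchy problem $$\partial_t^2\psi-\Delta\psi=|\psi|^{p-1}\psi,\qquad \psi(0,\cdot)=f,\quad \partial_t\psi(0,\cdot)=g$$ has a unique radial solution $\psi:\mathcal C_T\to\mathbb R$, and this solution satisfies $$(T-t)^{\frac{5-p}{2(p-1)}}\,\|(\psi(t,\cdot),\psi_t(t,\cdot))-(\psi^T(t,\cdot),\psi^T_t(t,\cdot))\|_{\mathcal E(T-t)}\le C_\varepsilon\,(T-t)^{|\omega_p|-\varepsilon}$$ for all $t\in[0,T)$.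
   Context: All functions are real-valued; the space dimension is $3$ and radial functions on $\mathbb R^3$ are written as functions of $r=|x|$, so that $\Delta\psi=\psi_{rr}+\frac2r\psi_r$. For $T>0$, $\mathcal C_T=\{(t,r):t\in(0,T),\ r\in[0,T-t]\}$ is the backward lightcone of $(T,0)$. Put $\kappa_0=\frac{2(p+1)}{(p-1)^2}$; the fundamental self-similar solution is $\psi^T(t,r)=\kappa_0^{\frac1{p-1}}(T-t)^{-\frac2{p-1}}$, and $\psi^1$ is $\psi^T$ with $T=1$. Local energy norm: for $R>0$ and $(f,g)\in C^1[0,R]\times C[0,R]$, $$\|(f,g)\|_{\mathcal E(R)}^2=\int_0^R|rf'(r)+f(r)|^2\,dr+\int_0^R r^2|g(r)|^2\,dr ;$$ radial initial data are pairs $(f,g)\in C^1[0,\frac32]\times C[0,\frac32]$. The same formula, with $rf'+f=(rf)'$ in the weak sense, is used for pairs with $rf\in H^1(0,R)$ vanishing at $r=0$ and $rg\in L^2(0,R)$; this is how the norm of $(\psi,\psi_t)-(\psi^T,\psi^T_t)$ is understood. Notion of solution (mild solution in similarity coordinates): Let $\mathcal H=L^2(0,1)\times L^2(0,1)$. Define $\tilde L_0$ on $\mathcal D(\tilde L_0)=\{\mathbf u=(u_1,u_2)\in C^1[0,1]\times C^1[0,1]:u_1(0)=0\}$ by $$\tilde L_0\mathbf u(\rho)=\begin{pmatrix}u_2'(\rho)-\rho u_1'(\rho)-\frac2{p-1}u_1(\rho)\\ u_1'(\rho)-\rho u_2'(\rho)-\frac2{p-1}u_2(\rho)\end{pmatrix},$$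 let $L_0$ be its closure, $L'\mathbf u(\rho)=\begin{pmatrix}p\kappa_0\int_0^\rho u_2(s)ds\\0\end{pmatrix}$, and $L=L_0+L'$ with $\mathcal D(L)=\mathcal D(L_0)$; $L$ generates a strongly continuous semigroup $S(\tau)$, $\tau\ge0$, on $\mathcal H$. Let $\mathbf N(\mathbf u)(\rho)=\begin{pmatrix}n\left(\frac1\rho\int_0^\rho u_2(s)ds,\rho\right)\\0\end{pmatrix}$ with $n(x,\rho)=\rho\left(|\kappa_0^{\frac1{p-1}}+x|^{p-1}(\kappa_0^{\frac1{p-1}}+x)-p\kappa_0x-\kappa_0^{\frac p{p-1}}\right)$. A function $\psi$ is a radial solution on $\mathcal C_T$ of the Cauchy problem with data $(f,g)$ if $$\psi(t,r)=\psi^T(t,r)+(T-t)^{-\frac2{p-1}}r^{-1}\int_0^r\phi_2\left(-\log(T-t),\tfrac{r'}{T-t}\right)dr',$$ $$\psi_t(t,r)=\psi^T_t(t,r)+(T-t)^{-\frac2{p-1}}r^{-1}\phi_1\left(-\log(T-t),\tfrac r{T-t}\right),$$ where $\Phi(\tau)=(\phi_1(\tau,\cdot),\phi_2(\tau,\cdot))$, $\Phi\in C([-\log T,\infty),\mathcal H)$, satisfies $$\Phi(\tau)=S(\tau+\log T)\mathbf u_0+\int_{-\log T}^\tau S(\tau-\tau')\mathbf N(\Phi(\tau'))\,d\tau',\qquad\tau\ge-\log T,$$ with $$\mathbf u_0(\rho)=\begin{pmatrix}\rho\left[T^{\frac{p+1}{p-1}}g(T\rho)-\frac2{p-1}\kappa_0^{\frac1{p-1}}\right]\\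 T^{\frac2{p-1}}\left[T\rho f'(T\rho)+f(T\rho)\right]-\kappa_0^{\frac1{p-1}}\end{pmatrix}.$$ Uniqueness means uniqueness (for the given $T$) of such a $\Phi$ in $C([-\log T,\infty),\mathcal H)$. *)

(* Defs.v *)
From HB Require Import structures.
From mathcomp Require Import all_boot all_order all_algebra.
From mathcomp Require Import all_classical all_reals all_analysis.
Import Order.TTheory GRing.Theory Num.Theory.
Import numFieldNormedType.Exports.

Set Implicit Arguments.
Unset Strict Implicit.
Unset Printing Implicit Defensive.

Local Open Scope classical_set_scope.
Local Open Scope ring_scope.

Section Norms.
Context {R : realType}.
Implicit Types (f g u w : R -> R) (D : set R) (r : R).

(* Representatives: elements of L^2 x L^2 are handled as pairs of functions,
   always up to almost-everywhere equality on the domain under consideration. *)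
Definition fpair : Type := ((R -> R) * (R -> R))%type.

Definition integral_sqr D u : \bar R :=
  (\int[lebesgue_measure]_(x in D) (u x ^+ 2)%:E)%E.

Definition square_integrable D u : Prop :=
  measurable_fun D u /\ (integral_sqr D u < +oo)%E.

Definition norm2 D (u : fpair) : \bar R :=
  ((integral_sqr D u.1 + integral_sqr D u.2) `^ 2^-1)%E.

(* The endpoints of [a, b] are covered by the continuous extension [df] of the
   derivative. *)
Definition C1_on (a b : R) f : Prop :=
  {within `[a, b], continuous f} /\
  exists2 df : R -> R, {within `[a, b], continuous df} &
    forall x : R, a < x < b -> is_derive x (1 : R) f (df x).

Definition radial_data f g : Prop :=
  C1_on 0 (3 / 2) f /\ {within `[0, 3 / 2], continuous g}.

Definition energy_norm r f g : \bar R :=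
  norm2 `[0, r] (fun s => s * derive1 f s + f s, fun s => s * g s).

Definition test_function r (theta : R -> R) : Prop :=
  (forall (n : nat) (x : R), derivable (derive1n n theta) x 1) /\
  exists a b : R, [/\ 0 < a, a < b, b < r &
    forall x : R, ~~ (a <= x <= b) -> theta x = 0].

Definition weak_derivative r u w : Prop :=
  [/\ square_integrable `]0, r[ u, square_integrable `]0, r[ w &
    forall theta, test_function r theta ->
      \int[lebesgue_measure]_(x in `]0, r[) (u x * derive1 theta x)
      = - \int[lebesgue_measure]_(x in `]0, r[) (w x * theta x)].

(* [nrm] is the energy norm of [(f, g)], with [(s f)'] the weak derivative: this
   includes that [s f] is in [H^1(0, r)] and vanishes at [0], and that [s g] is
   in [L^2(0, r)]. *)
Definition is_weak_energy_norm r f g (nrm : R) : Prop :=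
  exists w : R -> R, [/\ weak_derivative r (fun s => s * f s) w,
    (fun s => s * f s) @ 0^'+ --> (0 : R),
    square_integrable `]0, r[ (fun s => s * g s) &
    norm2 `]0, r[ (w, fun s => s * g s) = nrm%:E].

End Norms.
Arguments fpair R : clear implicits.

Section HilbertSpace.
Context {R : realType}.
Implicit Types (u v : fpair R) (S : R -> fpair R -> fpair R).

Definition inH u : Prop :=
  square_integrable `]0, 1[ u.1 /\ square_integrable `]0, 1[ u.2.

Definition Hnorm u : \bar R := norm2 `]0, 1[ u.

Definition Heq u v : Prop :=
  ae_eq lebesgue_measure `]0, 1[%classic u.1 v.1 /\
  ae_eq lebesgue_measure `]0, 1[%classic u.2 v.2.

(* Riemann integral over [a, b], for [a <= b], of an H-valued function: limit in
   H of the tagged Riemann sums as the mesh tends to 0. *)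
Definition is_Hintegral (F : R -> fpair R) (a b : R) (v : fpair R) : Prop :=
  forall e : R, 0 < e -> exists2 d : R, 0 < d &
    forall (n : nat) (t s : nat -> R),
      t 0 = a -> t n = b ->
      (forall i, (i < n)%N -> t i <= s i <= t i.+1 /\ t i.+1 - t i < d) ->
      (Hnorm (\sum_(i < n) (t i.+1 - t i) *: F (s i) - v)%R < e%:E)%E.

Record C0_semigroup S : Prop := {
  sg_stable : forall (tau : R) u, 0 <= tau -> inH u -> inH (S tau u);
  sg_linear : forall (tau a : R) u v, 0 <= tau -> inH u -> inH v ->
    Heq (S tau (a *: u + v)) (a *: S tau u + S tau v);
  sg_bounded : forall tau : R, 0 <= tau -> exists M : R,
    forall u, inH u -> (Hnorm (S tau u) <= M%:E * Hnorm u)%E;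
  sg_0 : forall u, inH u -> Heq (S 0 u) u;
  sg_add : forall (s t : R) u, 0 <= s -> 0 <= t -> inH u ->
    Heq (S (s + t) u) (S s (S t u));
  sg_continuous : forall u, inH u ->
    Hnorm (S tau u - u)%R @[tau --> 0^'+] --> 0%E }.

(* The graph of the generator. *)
Definition generator S u v : Prop :=
  [/\ inH u, inH v &
    Hnorm (h^-1 *: (S h u - u) - v)%R @[h --> 0^'+] --> 0%E].

End HilbertSpace.

Section Wave.
Context {R : realType}.
Variable p : R.
Implicit Types (u v : fpair R) (f g : R -> R) (T t : R).

Definition kappa0 : R := 2 * (p + 1) / (p - 1) ^+ 2.

Definition psi_ss T t : R :=
  kappa0 `^ (p - 1)^-1 * (T - t) `^ (- (2 / (p - 1))).

Definition omega_p : R := Num.max (- 1) (2^-1 - 2 / (p - 1)).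

Definition dom_L0t u : Prop :=
  [/\ C1_on 0 1 u.1, C1_on 0 1 u.2 & u.1 0 = 0].

Definition L0t u : fpair R :=
  (fun rho => derive1 u.2 rho - rho * derive1 u.1 rho - 2 / (p - 1) * u.1 rho,
   fun rho => derive1 u.1 rho - rho * derive1 u.2 rho - 2 / (p - 1) * u.2 rho).

(* [L0_graph u v]: the pair [(u, v)] is in the graph of the closure of [L0t]. *)
Definition L0_graph u v : Prop :=
  [/\ inH u, inH v & exists U : nat -> fpair R,
    [/\ forall n, dom_L0t (U n),
        Hnorm (U n - u)%R @[n --> \oo] --> 0%E &
        Hnorm (L0t (U n) - v)%R @[n --> \oo] --> 0%E]].

Definition Lprime u : fpair R :=
  (fun rho => p * kappa0 * \int[lebesgue_measure]_(s in `[0, rho]) u.2 s,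
   fun=> 0).

(* The graph of the sum of that closure and [Lprime]. *)
Definition L_graph u v : Prop := L0_graph u (v - Lprime u).

Definition nonlin (x rho : R) : R :=
  rho * (`|kappa0 `^ (p - 1)^-1 + x| `^ (p - 1) * (kappa0 `^ (p - 1)^-1 + x)
         - p * kappa0 * x - kappa0 `^ (p / (p - 1))).

Definition nonlinN u : fpair R :=
  (fun rho =>
     nonlin (rho^-1 * \int[lebesgue_measure]_(s in `[0, rho]) u.2 s) rho,
   fun=> 0).

Definition initial_datum T f g : fpair R :=
  (fun rho => rho * (T `^ ((p + 1) / (p - 1)) * g (T * rho)
                     - 2 / (p - 1) * kappa0 `^ (p - 1)^-1),
   fun rho => T `^ (2 / (p - 1)) * (T * rho * derive1 f (T * rho) + f (T * rho))
              - kappa0 `^ (p - 1)^-1).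

Definition mild_solution T f g (Phi : R -> fpair R) : Prop :=
  [/\ forall tau : R, - ln T <= tau -> inH (Phi tau),
      forall tau : R, - ln T <= tau ->
        Hnorm (Phi s - Phi tau)%R
          @[s --> within [set s | - ln T <= s] (nbhs tau)] --> 0%E &
      exists S : R -> fpair R -> fpair R,
        [/\ C0_semigroup S,
            forall u v, generator S u v <-> L_graph u v &
            forall tau : R, - ln T <= tau ->
              is_Hintegral (fun s => S (tau - s) (nonlinN (Phi s))) (- ln T) tau
                (Phi tau - S (tau + ln T) (initial_datum T f g))]].

Definition unique_mild_solution T f g : Prop :=
  forall Phi1 Phi2, mild_solution T f g Phi1 -> mild_solution T f g Phi2 ->
    forall tau : R, - ln T <= tau -> Heq (Phi1 tau) (Phi2 tau).

(* [psit t] is the derivative at time [t] of [psi] as a function with values in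
   the radial L^2 space of every ball strictly inside the lightcone. *)
Definition time_derivative T (psi psit : R -> R -> R) : Prop :=
  forall t r : R, 0 < t < T -> 0 < r < T - t ->
    integral_sqr `[0, r]
        (fun s => s * ((psi (t + h) s - psi t s) / h - psit t s))
      @[h --> 0^'] --> 0%E.

(* At [r = 0] the formulas are singular; as an element of the energy space, a
   solution is determined by its values for [r > 0]. *)
Definition radial_solution T f g (psi psit : R -> R -> R) : Prop :=
  time_derivative T psi psit /\
  exists2 Phi, mild_solution T f g Phi &
    forall t r : R, 0 <= t < T -> 0 < r <= T - t ->
      psi t r = psi_ss T t + (T - t) `^ (- (2 / (p - 1))) * r^-1 *
        \int[lebesgue_measure]_(s in `[0, r])
          (Phi (- ln (T - t))).2 (s / (T - t))
      /\
      psit t r = derive1 (psi_ss T) t + (T - t) `^ (- (2 / (p - 1))) * r^-1 *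
        (Phi (- ln (T - t))).1 (r / (T - t)).

End Wave.

(* Main.v *)
(* Write a = 2/(p-1).  In similarity coordinates a perturbation of psi^T solves
   Phi' = L Phi + N(Phi).  With odd first and even second component, the bounded
   degree polynomial pairs are invariant under L, so exp(tau L) is a linear flow
   of coefficients there; an energy estimate and density extend it to the whole
   Hilbert space, and a semigroup is determined by its generator.

   Let the polynomial w encode the pair (odd part of w, even part of w).  A
   first-order change of unknown b turns the linear equation into
     b_tau = (1 - x) b_x - a b + a (a + 1) int_0^x X + const,  X the odd part of b.
   Along characteristics the data contract like e^((1/2 - a) tau) in L^2, and the
   integral term is a contraction in the sup norm with weight e^(mu tau) (1 + A x)
   because a (a + 1) < (a + 1 + mu) (a + 2 + mu), that is, because mu > -1.  The
   constant feeds only the eigenvector ((a + 1) rho, 1) of eigenvalue 1, which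
   reflects the freedom in T.  So, up to this eigenvector, orbits decay like
   e^(mu tau) for every mu in (-1, 0) with mu >= 1/2 - a.

   By Hardy's inequality N is Lipschitz with a constant of first order at 0.
   The Lyapunov-Perron map, which subtracts the component along the eigenvector,
   therefore has a decaying fixed point for all small data u0; it is a solution
   exactly when a scalar h(u0) vanishes.  For the data u0(T) of the theorem
   h(u0(T)) = kappa_0^(1/(p-1)) a (T - 1) + small terms, so it vanishes for some
   T near 1 by the intermediate value theorem. *)

Require Import Defs.
From HB Require Import structures.
From mathcomp Require Import all_boot all_order all_algebra.
From mathcomp Require Import all_classical all_reals all_analysis.
From mathcomp Require Import measurable_realfun.
From mathcomp Require Import ring lra zify.
Import Order.TTheory GRing.Theory Num.Theory.
Import numFieldNormedType.Exports.

Set Implicit Arguments.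
Unset Strict Implicit.
Unset Printing Implicit Defensive.

Local Open Scope classical_set_scope.
Local Open Scope ring_scope.

(** The change of unknown is chosen so that the unstable eigenvector becomes a constant: the
    constant forcing in the transport equation then feeds only the unstable direction, and
    differences of [b] between two points do not see it. Decay is read off the characteristics, with
    no spectral analysis of the generator. The sup norm cannot be applied to [b] itself, because the
    data are only in L^2. The freely transported part is split off; it enters the integral term only
    through its antiderivative, which is Hoelder continuous of exponent 1/2, and the weighted sup
    norm acts on the remainder. The bound [p <= 3] enters twice: it gives a >= 1, hence omega_p <=
    -1/2, and it makes the nonlinearity grow slowly enough for its factor rho to absorb the
    singularity at the origin. The notion of solution knows its semigroup only through the
    generator, and lets it act on functions rather than on classes. So the generator of the
    constructed semigroup is computed exactly, and uniqueness of solutions also rests on uniqueness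
    of semigroups. The time derivative of psi exists although orbits are only continuous, because
    psi depends on a component which the nonlinearity does not enter. *)

(* Linear identities in a left module are decided by comparing, atom by atom,
   the scalar coefficients of both sides. *)
Inductive lexpr (K : Type) :=
| LAtom of nat | LZero | LAdd of lexpr K & lexpr K | LOpp of lexpr K
| LScale of K & lexpr K.
Arguments LAtom {K}. Arguments LZero {K}.

Section LinearExpr.
Variables (K : comNzRingType) (V : lmodType K).

Fixpoint leval (env : seq V) (e : lexpr K) : V := match e with
  | LAtom n => nth 0 env n | LZero => 0
  | LAdd a b => leval env a + leval env b | LOpp a => - leval env a
  | LScale r a => r *: leval env a end.

Fixpoint lcoef (e : lexpr K) (i : nat) : K := match e with
  | LAtom n => if Nat.eqb n i then 1 else 0 | LZero => 0
  | LAdd a b => lcoef a i + lcoef b i | LOpp a => - lcoef a i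
  | LScale r a => r * lcoef a i end.

Fixpoint lagree (n : nat) (e1 e2 : lexpr K) : Prop := match n with
  | 0%N => True | m.+1 => lcoef e1 m = lcoef e2 m /\ lagree m e1 e2 end.

Lemma leval_coef env e : leval env e = \sum_(i < size env) lcoef e i *: nth 0 env i.
Proof.
elim: e => [n||a IHa b IHb|a IHa|r a IHa] /=; rewrite ?IHa ?IHb.
- have [h|h] := ltnP n (size env).
    rewrite (bigD1 (Ordinal h))//= PeanoNat.Nat.eqb_refl scale1r big1 ?addr0// => i.
    rewrite -val_eqE /= => ni; case: PeanoNat.Nat.eqb_spec => [e|_]; last by rewrite scale0r.
    by rewrite e eqxx in ni.
  rewrite nth_default// big1// => i _; case: PeanoNat.Nat.eqb_spec => [e|_]; last by rewrite scale0r.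
  by have := ltn_ord i; rewrite -e ltnNge h.
- by rewrite big1// => i _; rewrite scale0r.
- by rewrite -big_split; apply: eq_bigr => i _; rewrite scalerDl.
- by rewrite -sumrN; apply: eq_bigr => i _; rewrite scaleNr.
- by rewrite scaler_sumr; apply: eq_bigr => i _; rewrite scalerA.
Qed.

Lemma lagreeP env e1 e2 : lagree (size env) e1 e2 -> leval env e1 = leval env e2.
Proof.
rewrite !leval_coef; elim: (size env) => [|n IH] /=; first by rewrite !big_ord0.
by move=> [e /IH]; rewrite !big_ord_recr /= e => ->.
Qed.

End LinearExpr.

Ltac lfind x env := lazymatch env with
  | cons x _ => constr:(0%N)
  | cons _ ?l => let n := lfind x l in constr:(S n) end.
Ltac lmem x env := lazymatch env with
  | nil => constr:(false) | cons x _ => constr:(true) | cons _ ?l => lmem x l end.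
Ltac lcollect env t := lazymatch t with
  | (?a + ?b)%R => let e := lcollect env a in lcollect e b
  | (- ?a)%R => lcollect env a
  | (_ *: ?a)%R => lcollect env a
  | 0%R => env
  | _ => let b := lmem t env in
         lazymatch b with true => env | false => constr:(cons t env) end end.
Ltac lreify K env t := lazymatch t with
  | (?a + ?b)%R => let a' := lreify K env a in let b' := lreify K env b in constr:(LAdd a' b')
  | (- ?a)%R => let a' := lreify K env a in constr:(LOpp a')
  | (?r *: ?a)%R => let a' := lreify K env a in constr:(LScale r a')
  | 0%R => constr:(@LZero K)
  | _ => let n := lfind t env in constr:(@LAtom K n) end.
Ltac linmod K := lazymatch goal with
  | |- @eq ?V ?s ?t =>
    let env := lcollect (@nil V) s in let env := lcollect env t in
    let s' := lreify K env s in let t' := lreify K env t in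
    apply: (@lagreeP _ _ env s' t'); cbn [lagree size lcoef Nat.eqb];
    repeat split; try ring end.

Goal forall (R : realType) (V : normedModType R) (a b c : V) (x y : R),
  a - b - (x + y) *: c = - (b + y *: c) + a - x *: c.
Proof. move=> R V a b c x y. linmod R. Qed.

(** * The Hilbert space of pairs *)

Section SquareIntegrable.
Context {R : realType}.
Notation mu := (@lebesgue_measure R).
Implicit Types (D : set R) (u v w : R -> R).

Lemma measurable_EFinM D u v : measurable_fun D u -> measurable_fun D v ->
  measurable_fun D (fun x => (u x * v x)%:E).
Proof.
by move=> m1 m2; apply/(measurable_EFinP D (fun x => u x * v x)); exact: measurable_funM.
Qed.

Lemma measurable_EFinX2 D u : measurable_fun D u ->
  measurable_fun D (fun x => (u x ^+ 2)%:E).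
Proof.
by move=> m1; apply/(measurable_EFinP D (fun x => u x ^+ 2)); exact: measurable_funX.
Qed.

Lemma sqi_mul D u v : measurable D ->
  square_integrable D u -> square_integrable D v ->
  mu.-integrable D (EFin \o (fun x => u x * v x)).
Proof.
move=> mD [mu_ iu] [mv iv].
apply/integrableP; split.
  by apply/measurable_EFinP; exact: measurable_funM.
apply: (@le_lt_trans _ _ (\int[mu]_(x in D) ((u x ^+ 2)%:E + (v x ^+ 2)%:E))%E).
  apply: ge0_le_integral => //=.
  - apply/(measurable_EFinP D (fun x => `|u x * v x|)).
    exact: (measurableT_comp _ (measurable_funM mu_ mv)).
  - by apply: emeasurable_funD; exact: measurable_EFinX2.
  - move=> x Dx; rewrite lee_fin normrM -(real_normK (num_real (u x))).
    rewrite -(real_normK (num_real (v x))).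
    have := sqr_ge0 (`|u x| - `|v x|); have := sqr_ge0 (`|u x| + `|v x|); nra.
rewrite ge0_integralD//=.
- by rewrite lte_add_pinfty.
- by move=> x _; rewrite lee_fin sqr_ge0.
- exact: measurable_EFinX2.
- by move=> x _; rewrite lee_fin sqr_ge0.
- exact: measurable_EFinX2.
Qed.

Lemma int_scale D a u : measurable D -> mu.-integrable D (EFin \o u) ->
  mu.-integrable D (EFin \o (fun x => a * u x)).
Proof.
by move=> mD iu; exact: (@integrableZl _ _ R mu D mD a (EFin \o u) iu).
Qed.

Lemma int_add D u v : measurable D -> mu.-integrable D (EFin \o u) ->
  mu.-integrable D (EFin \o v) ->
  mu.-integrable D (EFin \o (fun x => u x + v x)).
Proof.
move=> mD iu iv.
exact: (@integrableD _ _ R mu D mD (EFin \o u) (EFin \o v) iu iv).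
Qed.

Definition ip D u v : R := \int[mu]_(x in D) (u x * v x).

Lemma ipC D u v : ip D u v = ip D v u.
Proof. by apply: eq_Rintegral => x _; rewrite mulrC. Qed.

Lemma ip_ge0 D u : 0 <= ip D u u.
Proof. by apply: Rintegral_ge0 => x _; rewrite -expr2 sqr_ge0. Qed.

Lemma integral_sqrE D u : measurable D -> square_integrable D u ->
  integral_sqr D u = (ip D u u)%:E.
Proof.
move=> mD su; rewrite /ip /Rintegral fineK.
  by apply: eq_integral => x _; rewrite expr2.
exact/integrable_fin_num/sqi_mul.
Qed.

Lemma sqi_intP D u : measurable D -> measurable_fun D u ->
  mu.-integrable D (EFin \o (fun x => u x * u x)) -> square_integrable D u.
Proof.
move=> mD mu_ iu; split => //.
have /integrableP[_] := iu; congr (_ < _)%E; apply: eq_integral => x _ /=.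
by rewrite -expr2 ger0_norm// sqr_ge0.
Qed.

Lemma sqiZ D a u : measurable D -> square_integrable D u ->
  square_integrable D (fun x => a * u x).
Proof.
move=> mD su; apply: sqi_intP => //; first exact: (measurable_funM _ su.1).
have := int_scale (a * a) mD (sqi_mul mD su su).
by congr integrable; apply/funext => x /=; congr EFin; ring.
Qed.

Lemma sqiD D u v : measurable D -> square_integrable D u ->
  square_integrable D v -> square_integrable D (fun x => u x + v x).
Proof.
move=> mD su sv; apply: sqi_intP => //; first exact: (measurable_funD su.1 sv.1).
have h1 := sqi_mul mD su su; have h2 := sqi_mul mD sv sv.
have h3 := int_scale 2 mD (sqi_mul mD su sv).
have := int_add mD (int_add mD h1 h2) h3.
by congr integrable; apply/funext => x /=; congr EFin; ring.
Qed.

Lemma sqi_cst D a : measurable D -> (mu D < +oo)%E ->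
  square_integrable D (fun=> a).
Proof.
move=> mD muD; split => //.
by rewrite /integral_sqr integral_cst// lte_mul_pinfty// lee_fin sqr_ge0.
Qed.

Lemma sqi0 D : square_integrable D (fun=> 0 : R).
Proof.
by split => //; rewrite /integral_sqr integral0_eq// => x _; rewrite expr0n.
Qed.

Lemma ipDl D u v w : measurable D -> square_integrable D u ->
  square_integrable D v -> square_integrable D w ->
  ip D (fun x => u x + v x) w = ip D u w + ip D v w.
Proof.
move=> mD su sv sw; rewrite /ip -RintegralD//; last 2 first.
- exact: sqi_mul.
- exact: sqi_mul.
by apply: eq_Rintegral => x _; rewrite mulrDl.
Qed.

Lemma ipZl D a u w : measurable D -> square_integrable D u ->
  square_integrable D w -> ip D (fun x => a * u x) w = a * ip D u w.
Proof.
move=> mD su sw; rewrite /ip -RintegralZl//; last exact: sqi_mul.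
by apply: eq_Rintegral => x _; rewrite mulrA.
Qed.

Lemma ip_eq0 D u : measurable D -> square_integrable D u -> ip D u u = 0 ->
  ae_eq mu D u (fun=> 0).
Proof.
move=> mD su h.
have : integral_sqr D u = 0%E by rewrite integral_sqrE// h.
rewrite /integral_sqr.
have -> : (\int[mu]_(x in D) (u x ^+ 2)%:E = \int[mu]_(x in D) `|(u x ^+ 2)%:E|)%E.
  by apply: eq_integral => x _; rewrite gee0_abs// lee_fin sqr_ge0.
move/ae_eq_integral_abs => H.
have /H : measurable_fun D (EFin \o (fun x => u x ^+ 2)).
  exact: measurable_EFinX2 su.1.
move=> /(_ mD); apply: filterS => x /= xE Dx.
by have /eqP := xE Dx; rewrite eqe sqrf_eq0 => /eqP.
Qed.

Lemma ae_eq_ip D u u' v v' : measurable D ->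
  measurable_fun D u -> measurable_fun D u' -> measurable_fun D v ->
  measurable_fun D v' -> ae_eq mu D u u' -> ae_eq mu D v v' ->
  ip D u v = ip D u' v'.
Proof.
move=> mD mu1 mu2 mv1 mv2 e1 e2; rewrite /ip /Rintegral; congr fine.
apply: ae_eq_integral => //; try exact: measurable_EFinM.
by apply: filterS2 e1 e2 => x h1 h2 Dx; rewrite h1// h2.
Qed.

Lemma ae_eq_sqi D u v : measurable D -> square_integrable D u ->
  measurable_fun D v -> ae_eq mu D u v -> square_integrable D v.
Proof.
move=> mD [mu1 iu] mv e; split => //; move: iu; congr (_ < _)%E.
apply: ae_eq_integral => //; try exact: measurable_EFinX2.
by apply: filterS e => x h1 Dx; rewrite h1.
Qed.

End SquareIntegrable.

Section Pairs.
Context {R : realType}.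
Notation mu := (@lebesgue_measure R).
Implicit Types (D : set R) (u v w : fpair R).

Definition inL2 D u := square_integrable D u.1 /\ square_integrable D u.2.
Definition ip2 D u v : R := ip D u.1 v.1 + ip D u.2 v.2.
Definition nrm D u : R := Num.sqrt (ip2 D u u).

Lemma ip2C D u v : ip2 D u v = ip2 D v u.
Proof. by rewrite /ip2 ipC (ipC _ u.2). Qed.

Lemma ip2_ge0 D u : 0 <= ip2 D u u.
Proof. by rewrite addr_ge0 ?ip_ge0. Qed.

Lemma nrm_ge0 D u : 0 <= nrm D u. Proof. exact: sqrtr_ge0. Qed.

Lemma nrm_sqr D u : nrm D u ^+ 2 = ip2 D u u.
Proof. by rewrite sqr_sqrtr// ip2_ge0. Qed.

Lemma norm2E D u : measurable D -> inL2 D u -> norm2 D u = (nrm D u)%:E.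
Proof.
move=> mD [u1 u2]; rewrite /norm2 !integral_sqrE// -EFinD poweR_EFin.
by rewrite powR12_sqrt ?ip2_ge0.
Qed.

Lemma inL2Z D a u : measurable D -> inL2 D u -> inL2 D (a *: u).
Proof. by move=> mD [u1 u2]; split; exact: sqiZ. Qed.

Lemma inL2D D u v : measurable D -> inL2 D u -> inL2 D v -> inL2 D (u + v).
Proof. by move=> mD [u1 u2] [v1 v2]; split; exact: sqiD. Qed.

Lemma inL2N D u : measurable D -> inL2 D u -> inL2 D (- u).
Proof. by move=> mD hu; rewrite -scaleN1r; exact: inL2Z. Qed.

Lemma inL2B D u v : measurable D -> inL2 D u -> inL2 D v -> inL2 D (u - v).
Proof. by move=> mD hu hv; apply: inL2D => //; exact: inL2N. Qed.

Lemma inL20 D : inL2 D 0. Proof. by split; exact: sqi0. Qed.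

Lemma ip2Dl D u v w : measurable D -> inL2 D u -> inL2 D v -> inL2 D w ->
  ip2 D (u + v) w = ip2 D u w + ip2 D v w.
Proof.
move=> mD [u1 u2] [v1 v2] [w1 w2]; rewrite /ip2.
by rewrite (ipDl mD u1 v1 w1) (ipDl mD u2 v2 w2); ring.
Qed.

Lemma ip2Zl D a u w : measurable D -> inL2 D u -> inL2 D w ->
  ip2 D (a *: u) w = a * ip2 D u w.
Proof.
move=> mD [u1 u2] [w1 w2]; rewrite /ip2.
by rewrite (ipZl a mD u1 w1) (ipZl a mD u2 w2); ring.
Qed.

Lemma nrmZ D a u : measurable D -> inL2 D u -> nrm D (a *: u) = `|a| * nrm D u.
Proof.
move=> mD hu; rewrite /nrm ip2Zl//; last exact: inL2Z.
rewrite ip2C ip2Zl// mulrA -expr2 sqrtrM ?sqr_ge0// sqrtr_sqr.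
by [].
Qed.

Lemma nrm_comb_sqr D a b u v : measurable D -> inL2 D u -> inL2 D v ->
  ip2 D (a *: u + b *: v) (a *: u + b *: v) =
  a ^+ 2 * ip2 D u u + 2 * a * b * ip2 D u v + b ^+ 2 * ip2 D v v.
Proof.
move=> mD hu hv; have hau := inL2Z a mD hu; have hbv := inL2Z b mD hv.
have h := inL2D mD hau hbv.
rewrite ip2Dl// !ip2Zl// !(ip2C D _ (_ + _)) !ip2Dl// !ip2Zl//.
by rewrite (ip2C D v u); ring.
Qed.

(** The form [H a b] is nonnegative for all [a] and [b]. The choice [(B, - C)] gives
    [B * (A * B - C ^ 2) >= 0]; when [B = 0], the choice [(- C, A + 1)] leaves
    [- C ^ 2 * (A + 2) >= 0], which forces [C = 0]. *)
Lemma ip2_cauchy_schwarz D u v : measurable D -> inL2 D u -> inL2 D v ->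
  `|ip2 D u v| <= nrm D u * nrm D v.
Proof.
move=> mD hu hv; rewrite -ler_sqr ?nnegrE ?mulr_ge0 ?nrm_ge0//.
rewrite real_normK ?num_real// exprMn !nrm_sqr.
set A := ip2 D u u; set B := ip2 D v v; set C := ip2 D u v.
have H a b : 0 <= a ^+ 2 * A + 2 * a * b * C + b ^+ 2 * B.
  by rewrite -nrm_comb_sqr// ip2_ge0.
have A0 : 0 <= A := ip2_ge0 _ _; have B0 : 0 <= B := ip2_ge0 _ _.
have [B1|] := ltP 0 B.
  rewrite -(ler_pM2l B1); have := H B (- C); nra.
move=> B1; have {B1}BE : B = 0 by apply/le_anti/andP.
rewrite BE mulr0; have := H (- C) (A + 1); rewrite BE mulr0 addr0.
move=> h; have h2 : 0 <= C ^+ 2 * (A - 2 * (A + 1)) by move: h; congr (0 <= _); ring.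
have := sqr_ge0 C; nra.
Qed.

Lemma nrmD D u v : measurable D -> inL2 D u -> inL2 D v ->
  nrm D (u + v) <= nrm D u + nrm D v.
Proof.
move=> mD hu hv; rewrite -ler_sqr ?nnegrE ?addr_ge0 ?nrm_ge0// sqrrD !nrm_sqr.
have -> : u + v = 1 *: u + 1 *: v by rewrite !scale1r.
rewrite nrm_comb_sqr//; have := ip2_cauchy_schwarz mD hu hv.
have := ler_norm (ip2 D u v); lra.
Qed.

Lemma nrm0 D : nrm D 0 = 0.
Proof.
rewrite /nrm; have -> : ip2 D 0 0 = 0.
  by rewrite /ip2 /ip /Rintegral !integral0_eq ?addr0// => x _; rewrite mulr0.
by rewrite sqrtr0.
Qed.

Definition aeq D u v := ae_eq mu D u.1 v.1 /\ ae_eq mu D u.2 v.2.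

Lemma nrm_eq0 D u : measurable D -> inL2 D u -> nrm D u = 0 -> aeq D u 0.
Proof.
move=> mD [u1 u2] /eqP; rewrite sqrtr_eq0 => h.
have h1 := ip_ge0 D u.1; have h2 := ip_ge0 D u.2.
by split; apply: ip_eq0 => //; move: h; rewrite /ip2; lra.
Qed.

Lemma aeq_nrm D u v : measurable D -> inL2 D u -> inL2 D v -> aeq D u v ->
  nrm D u = nrm D v.
Proof.
move=> mD [[? ?] [? ?]] [[? ?] [? ?]] [e1 e2]; rewrite /nrm /ip2.
by congr (Num.sqrt (_ + _)); exact: ae_eq_ip.
Qed.

Lemma aeq_refl D u : aeq D u u. Proof. by split; exact: ae_eq_refl. Qed.

Lemma aeq_sym D u v : aeq D u v -> aeq D v u.
Proof. by move=> [h1 h2]; split; [move: h1|move: h2]; apply: filterS => x h Dx; rewrite h. Qed.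

Lemma aeq_trans D u v w : aeq D u v -> aeq D v w -> aeq D u w.
Proof. by move=> [h1 h2] [k1 k2]; split; [exact: ae_eq_trans h1 k1|exact: ae_eq_trans h2 k2]. Qed.

Lemma aeqD D u v u' v' : aeq D u u' -> aeq D v v' -> aeq D (u + v) (u' + v').
Proof.
move=> [h1 h2] [k1 k2]; split; [apply: filterS2 h1 k1|apply: filterS2 h2 k2];
  by move=> x hx kx Dx; rewrite /= !fctE hx// kx.
Qed.

Lemma aeqZ D a u u' : aeq D u u' -> aeq D (a *: u) (a *: u').
Proof.
by move=> [h1 h2]; split; [apply: filterS h1|apply: filterS h2];
  move=> x hx Dx; rewrite /= !fctE hx.
Qed.

End Pairs.

(** * Completeness of L^2 *)

Section RieszFischer.
Context {R : realType}.
Notation mu := (@lebesgue_measure R).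
Implicit Types (D : set R) (u v w : R -> R).

Definition snrm D u : R := Num.sqrt (ip D u u).

Lemma snrmE D u : snrm D u = nrm D (u, fun=> 0).
Proof.
rewrite /nrm /ip2 /=; have -> : ip D (fun=> 0) (fun=> 0) = 0 :> R.
  by rewrite /ip /Rintegral integral0_eq// => x _; rewrite mulr0.
by rewrite addr0.
Qed.

Lemma snrm_ge0 D u : 0 <= snrm D u. Proof. exact: sqrtr_ge0. Qed.

Lemma snrm_sqr D u : snrm D u ^+ 2 = ip D u u.
Proof. by rewrite sqr_sqrtr// ip_ge0. Qed.

Lemma sqi_pair D u : square_integrable D u -> inL2 D (u, fun=> 0).
Proof. by move=> su; split => //; exact: sqi0. Qed.

Lemma snrmD D u v : measurable D -> square_integrable D u ->
  square_integrable D v -> snrm D (fun x => u x + v x) <= snrm D u + snrm D v.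
Proof.
move=> mD su sv; rewrite !snrmE.
have := nrmD mD (sqi_pair su) (sqi_pair sv); congr (nrm D _ <= _).
by congr pair; apply/funext => x; rewrite !fctE /= addr0.
Qed.

Lemma snrmZ D a u : measurable D -> square_integrable D u ->
  snrm D (fun x => a * u x) = `|a| * snrm D u.
Proof.
move=> mD su; rewrite !snrmE -nrmZ//; last exact: sqi_pair.
by congr (nrm D (_, _)); apply/funext => x; rewrite !fctE /= scaler0.
Qed.

Lemma sqiB D u v : measurable D -> square_integrable D u ->
  square_integrable D v -> square_integrable D (fun x => u x - v x).
Proof.
move=> mD su sv.
have -> : (fun x => u x - v x) = (fun x => u x + -1 * v x).
  by apply/funext => x; rewrite mulN1r.
by apply: sqiD => //; exact: sqiZ.
Qed.

Lemma snrmB D u v : measurable D -> square_integrable D u ->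
  square_integrable D v -> snrm D (fun x => u x - v x) <= snrm D u + snrm D v.
Proof.
move=> mD su sv.
have -> : (fun x => u x - v x) = (fun x => u x + -1 * v x).
  by apply/funext => x; rewrite mulN1r.
rewrite (le_trans (snrmD mD su (sqiZ _ mD sv)))// snrmZ//.
by rewrite normrN1 mul1r.
Qed.

Lemma snrm_abs D u : snrm D (fun x => `|u x|) = snrm D u.
Proof.
congr Num.sqrt; apply: eq_Rintegral => x _.
by rewrite -normrM -expr2 ger0_norm// sqr_ge0.
Qed.

Lemma sqi_abs D u : square_integrable D u ->
  square_integrable D (fun x => `|u x|).
Proof.
move=> [mu_ iu]; split; first exact: measurableT_comp.
by move: iu; congr (_ < _)%E; apply: eq_integral => x _; rewrite real_normK ?num_real.
Qed.

Lemma sqi_sum D (d : nat -> R -> R) N : measurable D ->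
  (forall n, square_integrable D (d n)) ->
  square_integrable D (fun x => \sum_(i < N) d i x) /\
  snrm D (fun x => \sum_(i < N) d i x) <= \sum_(i < N) snrm D (d i).
Proof.
move=> mD sd; elim: N => [|N [IH1 IH2]].
  have -> : (fun x => \sum_(i < 0) d i x) = (fun=> 0) :> (R -> R).
    by apply/funext => x; rewrite big_ord0.
  split; first exact: sqi0.
  by rewrite big_ord0 snrmE nrm0.
have -> : (fun x => \sum_(i < N.+1) d i x) =
    (fun x => (\sum_(i < N) d i x) + d N x).
  by apply/funext => x; rewrite big_ord_recr.
split; first exact: sqiD.
by rewrite big_ord_recr /= (le_trans (snrmD mD IH1 (sd N)))// lerD2r.
Qed.

Lemma sum_half_lt2 N : \sum_(i < N) (2^-1 : R) ^+ i <= 2.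
Proof.
suff -> : \sum_(i < N) (2^-1 : R) ^+ i = 2 - 2 * 2^-1 ^+ N.
  by rewrite gerBl mulr_ge0// exprn_ge0// invr_ge0.
elim: N => [|N IH]; first by rewrite big_ord0 expr0; lra.
by rewrite big_ord_recr /= IH exprS; lra.
Qed.

Lemma snrm_cauchy_tail D (u_ : nat -> R -> R) n m : measurable D ->
  (forall n, square_integrable D (u_ n)) ->
  (forall n, snrm D (fun x => u_ n.+1 x - u_ n x) <= 2^-1 ^+ n) ->
  snrm D (fun x => u_ (n + m)%N x - u_ n x) <= 2 * 2^-1 ^+ n.
Proof.
move=> mD su hu.
suff : snrm D (fun x => u_ (n + m)%N x - u_ n x) <= \sum_(i < m) 2^-1 ^+ (n + i).
  move/le_trans; apply; under eq_bigr do rewrite exprD.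
  rewrite -mulr_sumr mulrC ler_wpM2r ?exprn_ge0 ?invr_ge0//.
  exact: sum_half_lt2.
elim: m => [|m IH].
  rewrite big_ord0 addn0.
  have -> : (fun x => u_ n x - u_ n x) = (fun=> 0) :> (R -> R).
    by apply/funext => x; rewrite subrr.
  by rewrite snrmE nrm0.
have -> : (fun x => u_ (n + m.+1)%N x - u_ n x) =
   (fun x => (u_ (n + m)%N x - u_ n x) + (u_ (n + m).+1 x - u_ (n + m)%N x)).
  by apply/funext => x; rewrite addnS; ring.
rewrite (le_trans (snrmD mD _ _))//; [exact: sqiB|exact: sqiB|].
by rewrite big_ord_recr /= lerD.
Qed.

(** The partial sums of the absolute increments have L^2 norm at most 2, so monotone convergence for
    their squares gives an integrable, hence almost everywhere finite, limit. Where it is finite,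
    the telescoping series converges absolutely. *)
Lemma ae_cvg_of_fast_cauchy D (u_ : nat -> R -> R) : measurable D ->
  (forall n, square_integrable D (u_ n)) ->
  (forall n, snrm D (fun x => u_ n.+1 x - u_ n x) <= 2^-1 ^+ n) ->
  {ae mu, forall x, D x -> cvgn (u_ ^~ x)}.
Proof.
move=> mD su hu.
pose d n x : R := `|u_ n.+1 x - u_ n x|.
have sd n : square_integrable D (d n) by apply: sqi_abs; exact: sqiB.
pose g N x := ((\sum_(i < N) d i x) ^+ 2)%:E.
have gle N : (\int[mu]_(x in D) g N x <= 4%:E)%E.
  have [s1 s2] := sqi_sum N mD sd.
  rewrite -[leLHS]/(integral_sqr D (fun x => \sum_(i < N) d i x)).
  rewrite integral_sqrE// lee_fin -snrm_sqr.
  have -> : 4 = 2 ^+ 2 :> R by ring.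
  rewrite ler_sqr ?nnegrE ?snrm_ge0// (le_trans s2)//.
  rewrite (le_trans _ (sum_half_lt2 N))// ler_sum// => i _.
  by rewrite /d snrm_abs.
have mg N : measurable_fun D (g N).
  by apply: measurable_EFinX2; have [[]] := sqi_sum N mD sd.
have g0 N x : D x -> (0 <= g N x)%E by move=> _; rewrite lee_fin sqr_ge0.
have d0 n x : 0 <= d n x by exact: normr_ge0.
have gnd x : D x -> {homo g^~ x : n m / (n <= m)%N >-> (n <= m)%E}.
  move=> _ n m nm; rewrite lee_fin ler_sqr ?nnegrE ?sumr_ge0//.
  by rewrite -(subnKC nm) big_split_ord /= lerDl sumr_ge0.
have mct := monotone_convergence mu mD mg g0 gnd.
have lim4 : (\int[mu]_(x in D) limn (g^~ x) <= 4%:E)%E.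
  rewrite mct; apply: lime_le; last by near=> N; exact: gle.
  apply: ereal_nondecreasing_is_cvgn => n m nm; apply: ge0_le_integral;
    [exact: mD|exact: g0|exact: mg|exact: mg|by move=> x Dx; exact: gnd].
have mlim : measurable_fun D (fun x => limn (g^~ x)).
  apply: (emeasurable_fun_cvg g) => // x Dx.
  by apply: ereal_nondecreasing_is_cvgn; exact: gnd.
have il : mu.-integrable D (fun x => limn (g^~ x)).
  apply/integrableP; split => //.
  have -> : (\int[mu]_(x in D) `|limn (g^~ x)| = \int[mu]_(x in D) limn (g^~ x))%E.
    apply: eq_integral => x /set_mem Dx; rewrite gee0_abs//.
    apply: lime_ge; last by near=> N; exact: g0.
    by apply: ereal_nondecreasing_is_cvgn; exact: gnd.
  by rewrite (le_lt_trans lim4)// ltry.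
have := @integrable_ae _ _ R mu D mD _ il; apply: filterS => x /[swap] Dx /(_ Dx) fx.
suff : cvgn (series (fun n => u_ n.+1 x - u_ n x)).
  move=> /cvg_ex[l hl]; apply/cvg_ex; exists (l + u_ 0%N x).
  have -> : u_ ^~ x = (fun n => series (fun n => u_ n.+1 x - u_ n x) n + u_ 0%N x).
    apply/funext => n; rewrite /series /= telescope_sumr//; ring.
  by apply: cvgD => //; exact: cvg_cst.
apply: normed_cvg; apply: nondecreasing_is_cvgn.
  by apply: nondecreasing_series => *; exact: normr_ge0.
exists (fine (limn (g^~ x)) + 1) => _ [N _ <-].
have gl : (g N x <= limn (g ^~ x))%E.
  apply: lime_ge; last by exists N => // m /= Nm; exact: gnd.
  by apply: ereal_nondecreasing_is_cvgn; exact: gnd.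
have -> : [normed series (fun n => u_ n.+1 x - u_ n x)] N = \sum_(i < N) d i x.
  by rewrite /= /series /= big_mkord.
move: gl; rewrite -(fineK fx) lee_fin.
(* The inequality [s <= s ^ 2 + 1] passes from the bound on the squares to one on the partial
   sums. *)
set s := \sum_(_ < _) _ => h.
by have := sqr_ge0 (s - 1); nra.
Unshelve. all: by end_near. Qed.

(** The almost everywhere limit is also the L^2 limit, by Fatou's lemma for the squares of
    [h (n + m) - h n] as [m] grows. *)
Lemma riesz_fischer D (u_ : nat -> R -> R) : measurable D ->
  (forall n, square_integrable D (u_ n)) ->
  (forall n, snrm D (fun x => u_ n.+1 x - u_ n x) <= 2^-1 ^+ n) ->
  exists2 u, square_integrable D u &
    forall n, snrm D (fun x => u_ n x - u x) <= 2 * 2^-1 ^+ n.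
Proof.
move=> mD su hu; have [N [mN N0 hN]] := ae_cvg_of_fast_cauchy mD su hu.
have cN x : D x -> ~ N x -> cvgn (u_ ^~ x).
  by move=> Dx Nx; apply: contrapT => h; apply/Nx/hN => /(_ Dx).
(* Setting the functions to 0 on the exceptional null set makes the limit exist at every point of
   [D], hence measurable. *)
pose h n (x : R) : R := \1_(~` N) x * u_ n x.
have hE n x : ~ N x -> h n x = u_ n x.
  by move=> Nx; rewrite /h indicE mem_set// mul1r.
have h_ae n : ae_eq mu D (h n) (u_ n).
  exists N; split => // x /= hx; apply: contrapT => Nx; apply: hx => _.
  exact: hE.
have mh n : measurable_fun D (h n).
  apply: measurable_funM; last exact: (su n).1.
  exact/measurable_indic/measurableC.
have sh n : square_integrable D (h n).
  apply: (ae_eq_sqi mD (su n)) => //.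
  by apply: filterS (h_ae n) => x e Dx; rewrite e.
have ch x : D x -> h ^~ x @ \oo --> limn (h ^~ x).
  move=> Dx; have [Nx|Nx] := pselect (N x).
    suff -> : h ^~ x = fun=> 0 by exact: is_cvg_cst.
    apply/funext => n; rewrite /h indicE memNset ?mul0r//.
  suff -> : h ^~ x = u_ ^~ x by exact: cN.
  by apply/funext => n; rewrite hE.
pose u (x : R) : R := limn (h ^~ x).
have mu_ : measurable_fun D u by exact: measurable_fun_cvg mh ch.
have tail n m : snrm D (fun x => h (n + m)%N x - h n x) <= 2 * 2^-1 ^+ n.
  rewrite (le_trans _ (snrm_cauchy_tail n m mD su hu))// le_eqVlt; apply/orP; left.
  apply/eqP; congr Num.sqrt; apply: ae_eq_ip => //; try
    by [apply: measurable_funB|apply: measurable_funB; [exact: (su _).1|exact: (su _).1]];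
  by apply: filterS2 (h_ae (n + m)%N) (h_ae n) => x e1 e2 Dx; rewrite e1// e2.
have key n : (integral_sqr D (fun x => h n x - u x)%R <= ((2 * 2^-1 ^+ n) ^+ 2)%:E)%E.
  have -> : integral_sqr D (fun x => h n x - u x) =
      (\int[mu]_(x in D) limn_einf (fun m => ((h (n + m)%N x - h n x) ^+ 2)%:E))%E.
    apply: eq_integral => x /set_mem Dx.
    have c : (fun m => ((h (n + m)%N x - h n x) ^+ 2)%:E) @ \oo -->
        ((h n x - u x) ^+ 2)%:E.
      apply: cvg_EFin; first by near=> m.
      have -> : (h n x - u x) ^+ 2 = (u x - h n x) * (u x - h n x) by ring.
      have c1 : (fun m => h (n + m)%N x - h n x) @ \oo --> u x - h n x.
        apply: cvgB; last exact: cvg_cst.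
        have := ch x Dx; rewrite -(cvg_shiftn n) => /=.
        by under eq_fun do rewrite addnC.
      rewrite /comp /=; under eq_fun do rewrite expr2.
      by apply: cvgM.
    by rewrite is_cvg_limn_einfE; [rewrite (cvg_lim _ c)|apply/cvg_ex; eexists; exact: c].
  apply: (le_trans (fatou mu mD _ _)).
  - by move=> m; apply: measurable_EFinX2; exact: measurable_funB.
  - by move=> m x _; rewrite lee_fin sqr_ge0.
  rewrite limn_einf_lim; apply: lime_le; first exact: is_cvg_einfs.
  near=> k; apply: ereal_inf_le; exists
    (\int[mu]_(x in D) ((h (n + k)%N x - h n x) ^+ 2)%:E)%E.
    by exists k => /=.
  rewrite -[leLHS]/(integral_sqr D (fun x => h (n + k)%N x - h n x)).
  rewrite integral_sqrE//; last exact: sqiB.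
  by rewrite lee_fin -snrm_sqr ler_sqr ?nnegrE ?snrm_ge0// mulr_ge0// exprn_ge0// invr_ge0.
have shu n : square_integrable D (fun x => h n x - u x).
  by split; [exact: measurable_funB|rewrite (le_lt_trans (key n))// ltry].
exists u.
  have -> : u = (fun x => h 0%N x - (h 0%N x - u x)) by apply/funext => x; ring.
  exact: sqiB.
move=> n; have : snrm D (fun x => h n x - u x) <= 2 * 2^-1 ^+ n.
  rewrite -ler_sqr ?nnegrE ?snrm_ge0 ?mulr_ge0 ?exprn_ge0 ?invr_ge0// snrm_sqr.
  by have := key n; rewrite integral_sqrE.
apply: le_trans; rewrite le_eqVlt; apply/orP; left.
apply/eqP; congr Num.sqrt; apply: ae_eq_ip => //; try
  by [apply: measurable_funB; [exact: (su _).1|]|apply: measurable_funB].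
all: by apply: filterS (h_ae n) => x e1 Dx; rewrite e1.
Unshelve. all: by end_near. Qed.

End RieszFischer.

(** * The space of classes of square integrable pairs *)

Section Space.
Context {R : realType}.
Notation mu := (@lebesgue_measure R).
Notation I01 := (`]0%R, 1%R[%classic : set R).
Implicit Types (u v w : fpair R).

Lemma mI01 : measurable I01. Proof. exact: measurable_itv. Qed.

(** The set from which the choice is made depends only on the class of [u]. Equivalent pairs thus
    have equal representatives, and the quotient can be carried by the fixed points of [rep]. *)
Definition rep u : fpair R := xget 0 [set v | inH v /\ Heq u v].

Lemma repP u : inH u -> inH (rep u) /\ Heq u (rep u).
Proof. by move=> hu; rewrite /rep; case: xgetP => [v _ //|/(_ u)[]]; split=> //; exact: aeq_refl. Qed.

Lemma rep_eq u v : Heq u v -> rep u = rep v.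
Proof.
move=> uv; rewrite /rep; congr xget; apply/seteqP; split => w [hw e]; split => //.
  exact: aeq_trans (aeq_sym uv) e.
exact: aeq_trans uv e.
Qed.

Definition is_rep u : bool := `[< inH u /\ rep u = u >].

Lemma is_rep_rep u : inH u -> is_rep (rep u).
Proof. by move=> hu; have [h e] := repP hu; apply/asboolP; split => //; apply/rep_eq/aeq_sym. Qed.

End Space.

Definition Vsp (R : realType) : Type := {u : fpair R | is_rep u}.
HB.instance Definition _ (R : realType) := gen_eqMixin (Vsp R).
HB.instance Definition _ (R : realType) := gen_choiceMixin (Vsp R).

Section SpaceOps.
Context {R : realType}.
Notation mu := (@lebesgue_measure R).
Notation I01 := (`]0%R, 1%R[%classic : set R).
Notation V := (Vsp R).
Implicit Types (u v w : fpair R) (x y z : V).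

Definition vrep x : fpair R := sval x.

Lemma vrep_inH x : inH (vrep x).
Proof. by case: x => u /= /asboolP[]. Qed.

Lemma rep0_is_rep : is_rep (rep (0 : fpair R)).
Proof. by apply: is_rep_rep; exact: inL20. Qed.

(** A pair outside the space is sent to the zero class, so that [cls] is total. *)
Definition cls u : V :=
  match pselect (inH u) with
  | left h => exist _ (rep u) (is_rep_rep h)
  | right _ => exist _ (rep 0) rep0_is_rep
  end.

Lemma vrep_inj x y : vrep x = vrep y -> x = y.
Proof. by case: x y => [u hu] [v hv] /= e; apply: eq_exist. Qed.

Lemma vrep_cls u : inH u -> vrep (cls u) = rep u.
Proof. by rewrite /cls; case: pselect. Qed.

Lemma clsK u : inH u -> Heq (vrep (cls u)) u.
Proof. by move=> hu; rewrite vrep_cls//; have [_ /aeq_sym] := repP hu. Qed.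

Lemma vrepK x : cls (vrep x) = x.
Proof.
apply: vrep_inj; rewrite vrep_cls; last exact: vrep_inH.
by case: x => u /= /asboolP[].
Qed.

Lemma cls_eq u v : inH u -> inH v -> Heq u v -> cls u = cls v.
Proof. by move=> hu hv e; apply: vrep_inj; rewrite !vrep_cls//; exact: rep_eq. Qed.

Lemma cls_inj u v : inH u -> inH v -> cls u = cls v -> Heq u v.
Proof.
move=> hu hv e; apply: aeq_trans (clsK hv); rewrite -e.
exact/aeq_sym/clsK.
Qed.

Let mI := @mI01 R.

(* The operations are sealed so that unification never unfolds the quotient. *)
Fact vadd_key : {f : V -> V -> V | forall x y, f x y = cls (vrep x + vrep y)}.
Proof. by exists (fun x y => cls (vrep x + vrep y)). Qed.
Fact vopp_key : {f : V -> V | forall x, f x = cls (- vrep x)}.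
Proof. by exists (fun x => cls (- vrep x)). Qed.
Fact vscale_key : {f : R -> V -> V | forall a x, f a x = cls (a *: vrep x)}.
Proof. by exists (fun a x => cls (a *: vrep x)). Qed.
Fact vzero_key : {z : V | z = cls 0}.
Proof. by exists (cls 0). Qed.
Fact vnorm_key : {f : V -> R | forall x, f x = nrm I01 (vrep x)}.
Proof. by exists (fun x => nrm I01 (vrep x)). Qed.

Definition vadd := sval vadd_key.
Definition vopp := sval vopp_key.
Definition vscale := sval vscale_key.
Definition vzero := sval vzero_key.
Definition vnorm := sval vnorm_key.

Let vaddE x y : vadd x y = cls (vrep x + vrep y). Proof. exact: (svalP vadd_key). Qed.
Let voppE x : vopp x = cls (- vrep x). Proof. exact: (svalP vopp_key). Qed.
Let vscaleE a x : vscale a x = cls (a *: vrep x). Proof. exact: (svalP vscale_key). Qed.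
Let vzeroE : vzero = cls 0. Proof. exact: (svalP vzero_key). Qed.
Let vnormE x : vnorm x = nrm I01 (vrep x). Proof. exact: (svalP vnorm_key). Qed.

Let hD u v : inH u -> inH v -> inH (u + v). Proof. exact: inL2D. Qed.
Let hZ a u : inH u -> inH (a *: u). Proof. exact: inL2Z. Qed.
Let hN u : inH u -> inH (- u). Proof. exact: inL2N. Qed.
Let h0 : inH (0 : fpair R). Proof. exact: inL20. Qed.
#[local] Hint Resolve hD hZ hN h0 vrep_inH : core.

Let clsD u v : inH u -> inH v -> vadd (cls u) (cls v) = cls (u + v).
Proof. by move=> hu hv; rewrite vaddE; apply: cls_eq; auto; apply: aeqD; exact: clsK. Qed.
Let clsZ a u : inH u -> vscale a (cls u) = cls (a *: u).
Proof. by move=> hu; rewrite vscaleE; apply: cls_eq; auto; apply: aeqZ; exact: clsK. Qed.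

Let elimV (P : V -> Prop) : (forall u, inH u -> P (cls u)) -> forall x, P x.
Proof. by move=> h x; rewrite -(vrepK x); exact/h/vrep_inH. Qed.

Let clsN u : inH u -> vopp (cls u) = cls (- u).
Proof.
move=> hu; rewrite voppE; apply: cls_eq; auto; rewrite -scaleN1r -[X in Heq _ X]scaleN1r.
by apply: aeqZ; exact: clsK.
Qed.

Let vaddA : associative vadd.
Proof.
elim/elimV => u hu; elim/elimV => v hv; elim/elimV => w hw.
by rewrite !clsD ?addrA; auto.
Qed.
Let vaddC : commutative vadd.
Proof. by elim/elimV => u hu; elim/elimV => v hv; rewrite !clsD// addrC. Qed.
Let vadd0 : left_id vzero vadd.
Proof. by elim/elimV => u hu; rewrite vzeroE clsD// add0r. Qed.
Let vaddN : left_inverse vzero vopp vadd.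
Proof. by elim/elimV => u hu; rewrite clsN// clsD ?addNr ?vzeroE; auto. Qed.

HB.instance Definition _ := GRing.isZmodule.Build V vaddA vaddC vadd0 vaddN.

Let vscaleA a b x : vscale a (vscale b x) = vscale (a * b) x.
Proof. by elim/elimV: x => u hu; rewrite !clsZ ?scalerA; auto. Qed.
Let vscale1 : left_id 1 vscale.
Proof. by elim/elimV => u hu; rewrite clsZ ?scale1r. Qed.
Let vscaleDr : right_distributive vscale +%R.
Proof.
move=> a; elim/elimV => u hu; elim/elimV => v hv.
by rewrite -[_ + _]/(vadd _ _) -[RHS]/(vadd _ _) !(clsD, clsZ) ?scalerDr; auto.
Qed.
Let vscaleDl x : {morph vscale^~ x : a b / a + b}.
Proof.
move=> a b; elim/elimV: x => u hu.
by rewrite -[RHS]/(vadd _ _) !(clsD, clsZ) ?scalerDl; auto.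
Qed.
HB.instance Definition _ :=
  GRing.Zmodule_isLmodule.Build R V vscaleA vscale1 vscaleDr vscaleDl.


Let vnorm_cls u : inH u -> vnorm (cls u) = nrm I01 u.
Proof. by move=> hu; rewrite vnormE; exact: (aeq_nrm mI (vrep_inH _) hu (clsK hu)). Qed.

Let vnormD x y : vnorm (x + y) <= vnorm x + vnorm y.
Proof.
elim/elimV: x => u hu; elim/elimV: y => v hv.
rewrite -[_ + _ in X in X <= _]/(vadd _ _) clsD// !vnorm_cls//; last exact: hD.
exact: nrmD.
Qed.
Let vnormZ a x : vnorm (a *: x) = `|a| * vnorm x.
Proof.
elim/elimV: x => u hu; rewrite -[_ *: _]/(vscale _ _) clsZ// !vnorm_cls//.
  exact: nrmZ.
exact: hZ.
Qed.
Let vnorm_eq0 x : vnorm x = 0 -> x = 0.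
Proof.
elim/elimV: x => u hu; rewrite vnorm_cls// => /nrm_eq0 e.
by rewrite -[RHS]/vzero vzeroE; apply: cls_eq => //; exact: e.
Qed.
HB.instance Definition _ := Lmodule_isNormed.Build R V vnormD vnormZ vnorm_eq0.

Lemma cls0 : cls 0 = 0 :> V. Proof. by rewrite -vzeroE. Qed.
Lemma clsDE u v : inH u -> inH v -> cls (u + v) = cls u + cls v.
Proof. by move=> hu hv; rewrite -clsD. Qed.
Lemma clsZE a u : inH u -> cls (a *: u) = a *: cls u.
Proof. by move=> hu; rewrite -clsZ. Qed.
Lemma clsNE u : inH u -> cls (- u) = - cls u.
Proof. by move=> hu; rewrite -clsN. Qed.
Lemma clsBE u v : inH u -> inH v -> cls (u - v) = cls u - cls v.
Proof. by move=> hu hv; rewrite clsDE ?clsNE; auto. Qed.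
Lemma norm_cls u : inH u -> `|cls u| = nrm I01 u.
Proof. exact: vnorm_cls. Qed.
Lemma norm_vrep x : `|x| = nrm I01 (vrep x).
Proof. exact: vnormE. Qed.
Lemma Hnorm_cls u : inH u -> Hnorm u = `|cls u|%:E.
Proof. by move=> hu; rewrite norm_cls// -norm2E. Qed.

(** Each component converges with error [2 * 2^-n], and the square root of 8 is below 4. *)
Lemma Vsp_fast_complete (x_ : nat -> V) :
  (forall n, `|x_ n.+1 - x_ n| <= 2^-1 ^+ n) ->
  exists x, forall n, `|x_ n - x| <= 4 * 2^-1 ^+ n.
Proof.
move=> hx; pose u n := vrep (x_ n).
have hu n : inH (u n) by exact: vrep_inH.
have xE n : x_ n = cls (u n) by rewrite vrepK.
have huB n : nrm I01 (u n.+1 - u n) <= 2^-1 ^+ n.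
  rewrite -norm_cls; last exact: (inL2B mI (hu _) (hu _)).
  by rewrite clsBE// -!xE.
have comp1 w : inH w -> snrm I01 w.1 <= nrm I01 w.
  by move=> hw; rewrite ler_sqrt ?ip2_ge0// /ip2 lerDl ip_ge0.
have comp2 w : inH w -> snrm I01 w.2 <= nrm I01 w.
  by move=> hw; rewrite ler_sqrt ?ip2_ge0// /ip2 lerDr ip_ge0.
have hB n : inH (u n.+1 - u n) by exact: (inL2B mI (hu _) (hu _)).
have [u1 su1 h1] := riesz_fischer mI (fun n => (hu n).1)
  (fun n => le_trans (comp1 _ (hB n)) (huB n)).
have [u2 su2 h2] := riesz_fischer mI (fun n => (hu n).2)
  (fun n => le_trans (comp2 _ (hB n)) (huB n)).
have hl : inH (u1, u2) by split.
exists (cls (u1, u2)) => n; rewrite xE -clsBE// norm_cls; last exact: (inL2B mI (hu _) hl).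
have hn := h1 n; have hn2 := h2 n.
have e0 : 0 <= (2^-1 : R) ^+ n by rewrite exprn_ge0// invr_ge0.
set e := 2^-1 ^+ n in hn hn2 e0 *.
rewrite -ler_sqr ?nnegrE ?nrm_ge0 ?mulr_ge0// nrm_sqr.
rewrite /ip2 -(snrm_sqr I01 (u n - (u1, u2)).1) -(snrm_sqr I01 (u n - (u1, u2)).2).
have k1 := snrm_ge0 I01 (u n - (u1, u2)).1.
have k2 := snrm_ge0 I01 (u n - (u1, u2)).2.
have : snrm I01 (u n - (u1, u2)).1 <= 2 * e by exact: hn.
have : snrm I01 (u n - (u1, u2)).2 <= 2 * e by exact: hn2.
nra.
Qed.

Lemma Vsp_complete (F : set_system V) : ProperFilter F -> cauchy F -> cvg F.
Proof.
move=> FF Fc.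
(* Two such balls share a point, so consecutive centres are at distance at most
   [(1/4 + 1/8) * 2^-n]: the Cauchy filter is reduced to a fast Cauchy sequence. *)
have ex n : exists x, F (ball x (4^-1 * 2^-1 ^+ n)).
  apply: (proj1 (cauchyP F) Fc).
  by rewrite mulr_gt0 ?invr_gt0 ?exprn_gt0 ?invr_gt0.
have [x_ hx_] := choice ex.
have hb n : `|x_ n.+1 - x_ n| <= 2^-1 ^+ n.
  have [z [z1 z2]] := filter_ex (filterI (hx_ n) (hx_ n.+1)).
  move: z1 z2; rewrite -!ball_normE /= => z1 z2.
  have -> : x_ n.+1 - x_ n = (x_ n.+1 - z) - (x_ n - z).
    by rewrite opprB addrA subrK.
  rewrite (le_trans (ler_normB _ _))//.
  have e0 : 0 <= (2^-1 : R) ^+ n by rewrite exprn_ge0// invr_ge0.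
  by move: z1 z2; rewrite exprS; lra.
have [x hx] := Vsp_fast_complete hb.
apply/cvg_ex; exists x; apply/cvgrPdist_lt => e e0.
have [N hN5] : exists N : nat, 5 * 2^-1 ^+ N < e.
  have : geometric 5 (2^-1 : R) @ \oo --> 0.
    by apply: cvg_geometric; rewrite ger0_norm ?invr_ge0// invf_lt1// ltr1n.
  move/cvgrPdist_lt => /(_ _ e0)[N _ /(_ N (leqnn N))]/=.
  rewrite sub0r normrN ger0_norm ?mulr_ge0 ?exprn_ge0 ?invr_ge0// => h.
  by exists N.
apply: filterS (hx_ N) => z; rewrite -ball_normE /= => hz.
have -> : x - z = (x_ N - z) - (x_ N - x) by rewrite opprB [RHS]addrC subrKA.
rewrite (le_lt_trans (ler_normB _ _))//.
have e1 : 0 <= (2^-1 : R) ^+ N by rewrite exprn_ge0// invr_ge0.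
have := hx N; lra.
Qed.

HB.instance Definition _ := Uniform_isComplete.Build V Vsp_complete.

End SpaceOps.
#[global] Hint Resolve vrep_inH : core.

(** * Calculus of vector-valued functions *)

Section RealInduction.
Context {R : realType}.

(** Consider the [x] such that [P] holds on all of [[a, x]]. Their supremum is one of them by the
    limit hypothesis, and cannot lie below [b] by the step hypothesis. *)
Lemma real_induction (P : R -> Prop) (a b : R) : a <= b -> P a ->
  (forall x, a <= x < b -> P x ->
    exists2 d, 0 < d & forall y, x < y < x + d -> y <= b -> P y) ->
  (forall x, a < x <= b -> (forall y, a <= y < x -> P y) -> P x) ->
  P b.
Proof.
move=> ab Pa step lim.
pose A := [set x | a <= x <= b /\ forall y, a <= y <= x -> P y].
have Aa : A a.
  split; first by rewrite lexx ab.
  by move=> y ya; have -> : y = a by apply/le_anti; rewrite andbC.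
have ubA : has_ubound A by exists b => x [/andP[_]].
pose s := sup A.
have as_ : a <= s by exact: (ub_le_sup ubA Aa).
have sb : s <= b by apply: ge_sup; [exists a|move=> x [/andP[_]]].
have below y : a <= y < s -> P y.
  move=> /andP[ay ys]; have [|x [_ hx] yx] := sup_gt _ ys; first by exists a.
  by apply: hx; rewrite ay ltW.
have Ps : P s.
  move: as_; rewrite le_eqVlt => /orP[/eqP<-//|as_].
  by apply: lim => //; rewrite as_.
move: sb; rewrite le_eqVlt => /orP[/eqP<-//|sb].
have [|d d0 hd] := step s _ Ps; first by rewrite as_.
pose z := Num.min b (s + d / 2).
have sz : s < z by rewrite /z lt_min sb ltrDl divr_gt0.
have zd : z < s + d.
  by rewrite /z gt_min ltrD2l ltr_pdivrMr// ltr_pMr// ltr1n orbT.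
have zb : z <= b by rewrite /z ge_min lexx.
suff : z <= s by rewrite leNgt sz.
apply: (ub_le_sup ubA); split; first by rewrite zb (le_trans as_ (ltW sz)).
move=> y /andP[ay yz]; have [ys|] := ltP y s; first by apply: below; rewrite ay.
rewrite le_eqVlt => /orP[/eqP<-//|sy].
by apply: hd; [rewrite sy (le_lt_trans yz)|rewrite (le_trans yz)].
Qed.

(** Takes the place of compactness of [[a, b]]: boundedness, uniform continuity and uniform strong
    continuity along a path are obtained from it. *)
Lemma cousin (Q : R -> R -> Prop) (a b : R) : a <= b ->
  (forall x y z, a <= x -> x <= y -> y <= z -> z <= b ->
     Q x y -> Q y z -> Q x z) ->
  (forall s, a <= s <= b -> exists2 d, 0 < d & forall x y, a <= x -> x <= s ->
     s <= y -> y <= b -> s - d < x -> y < s + d -> Q x y) ->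
  Q a b.
Proof.
move=> ab trans loc; apply: (real_induction (P := Q a) ab).
- have [|d d0 hd] := loc a; first by rewrite lexx.
  by apply: hd => //; rewrite ?ltrDl// gtrBl.
- move=> x /andP[ax xb] Qx.
  have [|d d0 hd] := loc x; first by rewrite ax ltW.
  exists d => // y /andP[xy yd] yb.
  apply: (trans _ x) => //; first exact: ltW.
  by apply: hd => //; rewrite ?gtrBl// ltW.
- move=> x /andP[ax xb] Qy.
  have [|d d0 hd] := loc x; first by rewrite ltW.
  pose y := Num.max a (x - d / 2).
  have yx : y < x by rewrite /y gt_max ax gtrBl divr_gt0.
  have ay : a <= y by rewrite /y le_max lexx.
  apply: (trans _ y) => //; first exact: ltW.
    by apply: Qy; rewrite ay.
  apply: hd => //; rewrite ?ltrDl ?ltW//.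
  by rewrite /y lt_max ltrD2l ltrN2 ltr_pdivrMr// ltr_pMr// ltr1n orbT.
Qed.

End RealInduction.

Section ContOn.
Context {R : realType} {V : normedModType R}.
Implicit Types (a b : R) (f : R -> V).

(** Continuity relative to [[a, b]], hence one-sided at the endpoints and vacuous when [b < a]. The
    vacuous case lets continuity on the half-line be written [forall b, cont_on 0 b f]. *)
Definition cont_on a b f := forall x, a <= x <= b -> forall e, 0 < e ->
  exists2 d, 0 < d & forall y, a <= y <= b -> `|y - x| < d -> `|f y - f x| < e.

Lemma continuous_cont_on a b f : continuous f -> cont_on a b f.
Proof.
move=> cf x _ e e0; have /cvgrPdist_lt/(_ _ e0) := cf x.
move=> /nbhs_ballP[d d0 hd]; exists d => // y _ yx.
rewrite distrC; apply: hd.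
by rewrite -ball_normE /= distrC.
Qed.

Lemma within_cont_on a b f : {within `[a, b], continuous f} -> cont_on a b f.
Proof.
move=> cf x xab e e0.
have := cf x; rewrite /continuous_at.
move=> /cvgrPdist_lt/(_ _ e0).
rewrite /nbhs/= /nbhs_subspace; case: ifPn => [_|]; last first.
  by move=> /negP[]; rewrite inE /= in_itv.
move=> /nbhs_ballP[d d0 hd]; exists d => // y yab yx.
rewrite distrC; apply: hd; last by rewrite /= in_itv.
by rewrite -ball_normE /= distrC.
Qed.

Lemma cont_on_subset a b a' b' f : a <= a' -> b' <= b -> cont_on a b f ->
  cont_on a' b' f.
Proof.
move=> aa bb cf x /andP[h1 h2] e e0.
have [|d d0 hd] := cf x _ _ e0.
  by rewrite (le_trans aa h1) (le_trans h2 bb).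
by exists d => // y /andP[y1 y2]; apply: hd; rewrite (le_trans aa y1) (le_trans y2 bb).
Qed.

Lemma cont_on_bounded a b f : a <= b -> cont_on a b f ->
  exists2 M, 0 < M & forall x, a <= x <= b -> `|f x| <= M.
Proof.
move=> ab cf.
pose Q (x y : R) := exists2 M : R, 0 < M & forall u : R, x <= u <= y -> `|f u| <= M.
apply: (cousin (Q := Q) ab).
- move=> x y z _ _ _ _ [M M0 hM] [M' M'0 hM']; exists (M + M'); first exact: addr_gt0.
  move=> u /andP[xu uz]; have [uy|yu] := leP u y.
    by rewrite (le_trans (hM u _))// ?xu// lerDl ltW.
  by rewrite (le_trans (hM' u _))// ?uz ?(ltW yu)// lerDr ltW.
- move=> s sab; have [d d0 hd] := cf s sab 1 ltr01.
  exists d => // x y ax xs sy yb dx dy; exists (`|f s| + 1); first by rewrite ltr_wpDl.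
  move=> u /andP[xu uy]; rewrite -[f u](subrK (f s)) addrC.
  rewrite (le_trans (ler_normD _ _))// lerD2l ltW// hd//.
    by rewrite (le_trans ax xu) (le_trans uy yb).
  by rewrite ltr_norml; apply/andP; split; lra.
Qed.

Lemma cont_on_unif a b f : a <= b -> cont_on a b f -> forall e, 0 < e ->
  exists2 d, 0 < d & forall x y, a <= x <= b -> a <= y <= b -> `|y - x| < d ->
    `|f y - f x| < e.
Proof.
move=> ab cf e e0.
pose Q (x y : R) := exists2 d : R, 0 < d & forall u v : R, x <= u <= y -> a <= v <= b ->
  `|v - u| < d -> `|f v - f u| < e.
apply: (cousin (Q := Q) ab).
- move=> x y z _ _ _ _ [d d0 hd] [d' d'0 hd']; exists (Num.min d d').
    by rewrite lt_min d0.
  move=> u v /andP[xu uz] vab; rewrite lt_min => /andP[h1 h2].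
  by have [uy|/ltW yu] := leP u y; [apply: hd|apply: hd']; rewrite ?xu ?yu.
- move=> s sab; have e20 : 0 < e / 2 by rewrite divr_gt0.
  have [d d0 hd] := cf s sab _ e20.
  exists (d / 2); first by rewrite divr_gt0.
  move=> x y ax xs sy yb dx dy; exists (d / 2); first by rewrite divr_gt0.
  move=> u v /andP[xu uy] vab; rewrite ltr_norml => /andP[h1 h2].
  have -> : f v - f u = (f v - f s) - (f u - f s) by rewrite opprB subrKA.
  rewrite (le_lt_trans (ler_normB _ _))// [e]splitr ltrD// hd//.
  + by rewrite ltr_norml; apply/andP; split; lra.
  + by rewrite (le_trans ax xu) (le_trans uy yb).
  + by rewrite ltr_norml; apply/andP; split; lra.
Qed.

Lemma cont_onD a b f g : cont_on a b f -> cont_on a b g ->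
  cont_on a b (fun x => f x + g x).
Proof.
move=> cf cg x xab e e0; have e20 : 0 < e / 2 by rewrite divr_gt0.
have [d d0 hd] := cf x xab _ e20; have [d' d'0 hd'] := cg x xab _ e20.
exists (Num.min d d'); first by rewrite lt_min d0.
move=> y yab; rewrite lt_min => /andP[h1 h2].
rewrite opprD addrACA (le_lt_trans (ler_normD _ _))// [e]splitr ltrD//; first exact: hd.
exact: hd'.
Qed.

Lemma cont_on_lip a b f (C : R) :
  (forall x y, a <= x <= b -> a <= y <= b -> `|f y - f x| <= C * `|y - x|) ->
  cont_on a b f.
Proof.
move=> h x xab e e0; have C1 : 0 < `|C| + 1 by rewrite ltr_wpDl.
exists (e / (`|C| + 1)); first by rewrite divr_gt0.
move=> y yab; rewrite ltr_pdivlMr// => yx; rewrite (le_lt_trans (h _ _ xab yab))//.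
apply: le_lt_trans yx; rewrite mulrC ler_wpM2l// (le_trans (ler_norm C))// lerDl//.
Qed.

End ContOn.

Section MeanValue.
Context {R : realType} {V : normedModType R}.
Implicit Types (a b : R) (f : R -> V) (g : R -> R).

(** Only increments to the right are compared, because orbits of a semigroup are differentiated from
    the right. The slack [e * (x - a)] is carried along by real induction and then sent to 0. *)
Lemma dini_mvt a b f g : a <= b -> cont_on a b f -> cont_on (V := R^o) a b g ->
  (forall x, a <= x < b -> forall e, 0 < e -> exists2 d, 0 < d &
     forall y, x < y < x + d -> y <= b ->
       `|f y - f x| <= g y - g x + e * (y - x)) ->
  `|f b - f a| <= g b - g a.
Proof.
move=> ab cf cg h; apply/ler_addgt0Pr => e' e'0.
pose e := e' / (b - a + 1).
have ba1 : 0 < b - a + 1 by rewrite ltr_wpDl// subr_ge0.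
have e0 : 0 < e by rewrite divr_gt0.
suff H : `|f b - f a| <= g b - g a + e * (b - a).
  rewrite (le_trans H)// lerD2l /e mulrAC ler_pdivrMr// ler_wpM2l ?(ltW e'0)//.
  by rewrite lerDl.
apply: (real_induction (P := fun x => `|f x - f a| <= g x - g a + e * (x - a)) ab).
- by rewrite !subrr mulr0 normr0 addr0.
- move=> x xab Px; have [d d0 hd] := h x xab e e0.
  exists d => // y xyd yb; have := hd y xyd yb => hy.
  have -> : f y - f a = (f y - f x) + (f x - f a) by rewrite subrKA.
  by rewrite (le_trans (ler_normD _ _))//; lra.
- move=> x /andP[ax xb] Py; rewrite leNgt; apply/negP => lt.
  set r := `|f x - f a| - (g x - g a + e * (x - a)).
  have r0 : 0 < r by rewrite subr_gt0.
  have xab : a <= x <= b by rewrite ltW.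
  have r30 : 0 < r / 3 by rewrite divr_gt0.
  have [d d0 hd] := cf x xab _ r30; have [d' d'0 hd'] := cg x xab _ r30.
  pose y := Num.max a (x - Num.min d d' / 2).
  have yx : y < x by rewrite /y gt_max ax gtrBl divr_gt0// lt_min d0.
  have ay : a <= y by rewrite /y le_max lexx.
  have yab : a <= y <= b by rewrite ay (le_trans (ltW yx) xb).
  have mn : Num.min d d' <= d by rewrite ge_min lexx.
  have mn' : Num.min d d' <= d' by rewrite ge_min lexx orbT.
  have yd : x - Num.min d d' / 2 <= y by rewrite /y le_max lexx orbT.
  have nyx : `|y - x| < Num.min d d'.
    rewrite ltr0_norm ?subr_lt0//.
    have m0 : 0 < Num.min d d' by rewrite lt_min d0.
    by lra.
  have h1 := hd y yab (lt_le_trans nyx mn).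
  have h2 := hd' y yab (lt_le_trans nyx mn').
  have h3 : `|f y - f a| <= g y - g a + e * (y - a) by apply: Py; rewrite ay.
  have h4 : `|f x - f a| <= `|f y - f a| + `|f y - f x|.
    have -> : f x - f a = (f y - f a) - (f y - f x) by rewrite opprB [RHS]addrC subrKA.
    exact: ler_normB.
  have h5 : g y - g x < r / 3 by apply: le_lt_trans h2; exact: ler_norm.
  have h6 : e * (y - a) <= e * (x - a) by rewrite ler_wpM2l ?(ltW e0)// lerD2r ltW.
  rewrite /r in r0 r30 h1 h5; move: h1 h3 h4 h5 h6; lra.
Qed.

End MeanValue.

Section FastCauchy.
Context {R : realType} {V : completeNormedModType R}.

Lemma geometric_tail_le (n m : nat) :
  \sum_(n <= k < n + m) (2^-1 : R) ^+ k <= 2 * 2^-1 ^+ n.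
Proof.
suff -> : \sum_(n <= k < n + m) (2^-1 : R) ^+ k = 2 * 2^-1 ^+ n - 2 * 2^-1 ^+ (n + m).
  by rewrite gerBl mulr_ge0// exprn_ge0// invr_ge0.
elim: m => [|m IH]; first by rewrite addn0 big_geq// subrr.
by rewrite addnS big_nat_recr ?leq_addr//= IH exprS; lra.
Qed.

Lemma fast_cauchy_cvg (x_ : nat -> V) (C : R) :
  (forall n, `|x_ n.+1 - x_ n| <= C * 2^-1 ^+ n) ->
  exists x, forall n, `|x_ n - x| <= C * (2 * 2^-1 ^+ n).
Proof.
move=> hx.
have C0 : 0 <= C by have := hx 0%N; rewrite expr0 mulr1; exact: le_trans.
have tail n m : `|x_ (n + m)%N - x_ n| <= C * (2 * 2^-1 ^+ n).
  rewrite (le_trans _ (ler_wpM2l C0 (geometric_tail_le n m)))//.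
  rewrite -telescope_sumr ?leq_addr// (le_trans (ler_norm_sum _ _ _))// mulr_sumr.
  by apply: ler_sum => k _.
have cx : cvgn x_.
  suff : cvgn (series (fun n => x_ n.+1 - x_ n)).
    have [c cE] : exists c, c = x_ 0%N by eexists.
    move=> /cvg_ex[l hl]; apply/cvg_ex; exists (l + c).
    rewrite (_ : x_ = (fun n => series (fun n => x_ n.+1 - x_ n) n + c)); last first.
      by apply/funext => n; rewrite /series /= telescope_sumr// cE subrK.
    by apply: cvgD => //; exact: cvg_cst.
  apply: normed_cvg; apply: (series_le_cvg (v_ := geometric C 2^-1)) => /=.
  - by move=> n; exact: normr_ge0.
  - by move=> n; rewrite mulr_ge0// exprn_ge0// invr_ge0.
  - exact: hx.
  - by apply: is_cvg_geometric_series; rewrite ger0_norm ?invr_ge0// invf_lt1// ltr1n.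
exists (limn x_) => n; rewrite distrC.
have : (fun m => `|x_ (n + m)%N - x_ n|) @ \oo --> `|limn x_ - x_ n|.
  apply: cvg_norm; apply: cvgB; last exact: cvg_cst.
  have := cx; rewrite -(cvg_shiftn n) => /=.
  by under eq_fun do rewrite addnC.
by move=> /cvgr_to_le; apply; near=> m; exact: tail.
Unshelve. all: by end_near. Qed.

End FastCauchy.

Lemma ler_small_half {R : realType} (x y C : R) :
  (forall n : nat, x <= y + C * 2^-1 ^+ n) -> x <= y.
Proof.
move=> h; apply/ler_addgt0Pr => e e0.
have C1 : 0 < `|C| + 1 by rewrite ltr_wpDl.
have : geometric 1 (2^-1 : R) @ \oo --> 0.
  by apply: cvg_geometric; rewrite ger0_norm ?invr_ge0// invf_lt1// ltr1n.
move/cvgrPdist_lt => /(_ _ (divr_gt0 e0 C1))[N _ /(_ N (leqnn N))]/=.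
have hN : 0 <= (2^-1 : R) ^+ N by rewrite exprn_ge0// invr_ge0.
rewrite mul1r sub0r normrN ger0_norm// ltr_pdivlMr// => lt.
rewrite (le_trans (h N))// lerD2l (le_trans _ (ltW lt))// mulrC ler_wpM2l//.
by rewrite (le_trans (ler_norm C))// lerDl.
Qed.

(** * Primitives and integrals of continuous vector functions *)

Section Primitive.
Context {R : realType} {V : normedModType R}.
Implicit Types (a b : R) (F P : R -> V).

Definition prim a b F P := forall x, a <= x <= b -> forall e, 0 < e ->
  exists2 d, 0 < d & forall y, a <= y <= b -> `|y - x| < d ->
    `|P y - P x - (y - x) *: F x| <= e * `|y - x|.

Lemma prim_cont a b F P : prim a b F P -> cont_on a b P.
Proof.
move=> h x xab e e0; have [d d0 hd] := h x xab 1 ltr01.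
have C0 : 0 < 1 + `|F x| by rewrite ltr_pwDl.
exists (Num.min d (e / (1 + `|F x|))); first by rewrite lt_min d0 divr_gt0.
move=> y yab; rewrite lt_min => /andP[yd]; rewrite ltr_pdivlMr// => ye.
rewrite -[P y - P x](subrK ((y - x) *: F x)) (le_lt_trans (ler_normD _ _))//.
apply: le_lt_trans ye; rewrite mulrDr normrZ lerD2r mulr1.
by rewrite (le_trans (hd y yab yd))// mul1r.
Qed.

Lemma prim_subset a b a' b' F P : a <= a' -> b' <= b -> prim a b F P ->
  prim a' b' F P.
Proof.
move=> aa bb h x /andP[h1 h2] e e0.
have [|d d0 hd] := h x _ _ e0.
  by rewrite (le_trans aa h1) (le_trans h2 bb).
by exists d => // y /andP[y1 y2]; apply: hd; rewrite (le_trans aa y1) (le_trans y2 bb).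
Qed.

Lemma primD a b F G P Q : prim a b F P -> prim a b G Q ->
  prim a b (fun x => F x + G x) (fun x => P x + Q x).
Proof.
move=> hP hQ x xab e e0; have e20 : 0 < e / 2 by rewrite divr_gt0.
have [d d0 hd] := hP x xab _ e20; have [d' d'0 hd'] := hQ x xab _ e20.
exists (Num.min d d'); first by rewrite lt_min d0.
move=> y yab; rewrite lt_min => /andP[h1 h2].
have -> : P y + Q y - (P x + Q x) - (y - x) *: (F x + G x) =
    (P y - P x - (y - x) *: F x) + (Q y - Q x - (y - x) *: G x).
  by rewrite scalerDr !opprD (addrACA (P y)) [LHS]addrACA.
rewrite (le_trans (ler_normD _ _))// [e]splitr mulrDl lerD//; first exact: hd.
exact: hd'.
Qed.

Lemma primZ a b c F P : prim a b F P ->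
  prim a b (fun x => c *: F x) (fun x => c *: P x).
Proof.
move=> hP x xab e e0; have c0 : 0 < `|c| + 1 by rewrite ltr_wpDl.
have [d d0 hd] := hP x xab _ (divr_gt0 e0 c0).
exists d => // y yab yx; have := hd y yab yx => h.
have -> : c *: P y - c *: P x - (y - x) *: (c *: F x) =
   c *: (P y - P x - (y - x) *: F x) by rewrite !scalerBr !scalerA (mulrC c).
rewrite normrZ (@le_trans _ _ (`|c| * (e / (`|c| + 1) * `|y - x|)))//.
  by rewrite ler_wpM2l.
rewrite mulrA ler_wpM2r// mulrCA ger_pMr// ler_pdivrMr// mul1r lerDl//.
Qed.

Lemma prim_cst a b w : prim a b (fun=> w) (fun x => x *: w).
Proof.
move=> x _ e e0; exists 1 => // y _ _.
by rewrite scalerBl subrr normr0 mulr_ge0// ltW.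
Qed.

Lemma primB a b F G P Q : prim a b F P -> prim a b G Q ->
  prim a b (fun x => F x - G x) (fun x => P x - Q x).
Proof.
move=> hP hQ; have := primD hP (primZ (-1) hQ).
by under eq_fun do rewrite scaleN1r; under [X in prim _ _ _ X]eq_fun do rewrite scaleN1r.
Qed.

Lemma prim_le a b F P (g : R -> R) : a <= b -> prim a b F P ->
  cont_on (V := R^o) a b g ->
  (forall x, a <= x < b -> forall e, 0 < e -> exists2 d, 0 < d &
     forall y, x < y < x + d -> y <= b ->
       `|F x| * (y - x) <= g y - g x + e * (y - x)) ->
  `|P b - P a| <= g b - g a.
Proof.
move=> ab hP cg hg; apply: dini_mvt => //; first exact: prim_cont hP.
move=> x xab e e0; have e20 : 0 < e / 2 by rewrite divr_gt0.
have xab' : a <= x <= b by case/andP: xab => -> /ltW.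
have [d d0 hd] := hP x xab' _ e20; have [d' d'0 hd'] := hg x xab _ e20.
exists (Num.min d d'); first by rewrite lt_min d0.
move=> y /andP[xy ym] yb.
have yab : a <= y <= b by rewrite yb (le_trans _ (ltW xy))//; case/andP: xab.
have yxd : y - x < Num.min d d' by rewrite ltrBlDl.
move: yxd; rewrite lt_min => /andP[yd yd'].
have nyx : `|y - x| = y - x by rewrite gtr0_norm// subr_gt0.
have h1 := hd y yab; rewrite nyx in h1; have {}h1 := h1 yd.
have h2 := hd' y; rewrite xy -ltrBlDl yd' in h2; have {}h2 := h2 isT yb.
rewrite -[P y - P x](subrK ((y - x) *: F x)) (le_trans (ler_normD _ _))//.
rewrite normrZ nyx [_ * `|F x|]mulrC.
by move: h1 h2; lra.
Qed.

Lemma prim_le_cst a b F P C : a <= b -> prim a b F P ->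
  (forall x, a <= x <= b -> `|F x| <= C) -> `|P b - P a| <= C * (b - a).
Proof.
move=> ab hP hF; rewrite mulrBr; apply: (prim_le (g := fun x => C * x) ab hP).
  apply: (cont_on_lip (C := `|C|)) => x y _ _.
  by rewrite -mulrBr normrM.
move=> x /andP[ax xb] e e0; exists 1 => // y /andP[xy _] yb.
rewrite -mulrBr -[leLHS]addr0 lerD//; last by rewrite mulr_ge0 ?(ltW e0)// subr_ge0 ltW.
by rewrite ler_wpM2r ?subr_ge0 ?(ltW xy)// hF// ax ltW.
Qed.

Lemma prim_le_deriv a b F P (g g' : R -> R) : a <= b -> prim a b F P ->
  (forall x, is_derive x (1 : R) g (g' x)) ->
  (forall x, a <= x <= b -> `|F x| <= g' x) -> `|P b - P a| <= g b - g a.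
Proof.
move=> ab hP dg hF.
have cg : continuous g.
  move=> x; apply: differentiable_continuous; apply/derivable1_diffP.
  exact: (@ex_derive _ _ _ _ _ _ _ (dg x)).
apply: (prim_le ab hP); first exact: (continuous_cont_on (V := R^o)).
move=> x /andP[ax xb] e e0.
have := dg x; case=> _.
rewrite -derive1E => gx.
have : derivable g x 1 by exact: (@ex_derive _ _ _ _ _ _ _ (dg x)).
move=> /cvgrPdist_le/(_ e e0); rewrite -/(derive g x 1).
have -> : derive g x 1 = g' x by rewrite -derive1E.
move=> /nbhs_ballP[d /= d0 hd]; exists d => // y /andP[xy yd] yb.
have yx0 : 0 < y - x by rewrite subr_gt0.
have := hd (y - x); rewrite /ball /= sub0r normrN gtr0_norm// ltrBlDl.
move=> /(_ yd); rewrite gt_eqF// => /(_ isT).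
rewrite [(y - x) *: 1]mulr1 subrK => h.
have {}h : (g' x - (y - x)^-1 * (g y - g x)) <= e.
  by apply: le_trans h; exact: ler_norm.
have : g' x * (y - x) <= g y - g x + e * (y - x).
  have : (g' x - (y - x)^-1 * (g y - g x)) * (y - x) <= e * (y - x).
    by rewrite ler_wpM2r// ltW.
  by rewrite mulrBl mulrAC mulVf ?gt_eqF// mul1r lerBlDl.
by apply: le_trans; rewrite ler_wpM2r ?(ltW yx0)// hF// ax ltW.
Qed.

Lemma prim_unique a b F P Q : a <= b -> prim a b F P -> prim a b F Q ->
  P b - P a = Q b - Q a.
Proof.
move=> ab hP hQ; have hPQ := primB hP hQ.
have := prim_le_cst (C := 0) ab hPQ; rewrite mul0r => h.
apply/eqP; rewrite -subr_eq0 -normr_le0.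
have -> : P b - P a - (Q b - Q a) = P b - Q b - (P a - Q a).
  by rewrite !opprD !opprK addrACA.
by apply: h => x _; rewrite subrr normr0.
Qed.

End Primitive.

Section Existence.
Context {R : realType} {V : completeNormedModType R}.
Implicit Types (a b c : R) (F P : R -> V).

(** A primitive up to the error [e] in the right derivative. Prolonging it by an affine piece keeps
    the same [e], so it can be built by real induction; exact primitives are limits of such
    functions. *)
Let eprim e a b F P := cont_on a b P /\
  forall x, a <= x < b -> exists2 d, 0 < d &
    forall y, x < y < x + d -> y <= b ->
      `|P y - P x - (y - x) *: F x| <= e * (y - x).

Let eprim_extend e a c c' F P w : 0 <= e -> a <= c -> c <= c' -> eprim e a c F P ->
  (forall x, c <= x <= c' -> `|w - F x| <= e) -> exists Q, eprim e a c' F Q.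
Proof.
move=> e0 ac cc' [cP hP] hw.
pose Q x := if x <= c then P x else P c + (x - c) *: w.
have QE x : c <= x -> Q x = P c + (x - c) *: w.
  rewrite /Q; case: ifPn => // h1 h2.
  have -> : x = c by apply/le_anti/andP; split.
  by rewrite subrr scale0r addr0.
exists Q; split.
- move=> x /andP[ax xc'] e1 e10; have [xc|cx|xc] := ltgtP x c.
  + have xac : a <= x <= c by rewrite ax ltW.
    have [d d0 hd] := cP x xac e1 e10.
    exists (Num.min d (c - x)); first by rewrite lt_min d0 subr_gt0.
    move=> y /andP[ay yc']; rewrite lt_min => /andP[yd yc].
    have yc2 : y <= c.
      by move: yc; rewrite ltr_norml => /andP[_]; rewrite ltrD2r => /ltW.
    by rewrite /Q yc2 (ltW xc) hd// ay.
  + have w0 : 0 < `|w| + 1 by rewrite ltr_wpDl.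
    exists (Num.min (x - c) (e1 / (`|w| + 1))).
      by rewrite lt_min subr_gt0 cx divr_gt0.
    move=> y /andP[ay yc']; rewrite lt_min => /andP[yc].
    rewrite ltr_pdivlMr// => yd.
    have cy : c <= y.
      by move: yc; rewrite ltr_norml => /andP[+ _]; rewrite opprB ltrD2r => /ltW.
    rewrite !QE ?(ltW cx)// opprD addrACA subrr add0r -scalerBl normrZ.
    rewrite opprB addrA subrK (le_lt_trans _ yd)// ler_wpM2l// lerDl//.
  + have w0 : 0 < `|w| + 1 by rewrite ltr_wpDl.
    have xac : a <= x <= c by rewrite ax xc lexx.
    have [d d0 hd] := cP x xac e1 e10.
    exists (Num.min d (e1 / (`|w| + 1))).
      by rewrite lt_min d0 divr_gt0.
    move=> y /andP[ay yc']; rewrite lt_min => /andP[yd].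
    rewrite ltr_pdivlMr// => yd2.
    have [yc|/ltW cy] := leP y c.
      have xc2 : x <= c by rewrite xc.
      by rewrite /Q yc xc2 hd// ay.
    have cx2 : c <= x by rewrite xc.
    rewrite !QE// opprD addrACA subrr add0r -scalerBl normrZ.
    rewrite opprB addrA subrK (le_lt_trans _ yd2)// ler_wpM2l// lerDl//.
- move=> x /andP[ax xc']; have [xc|cx] := ltP x c.
  + have [|d d0 hd] := hP x; first by rewrite ax.
    exists (Num.min d (c - x)); first by rewrite lt_min d0 subr_gt0.
    move=> y /andP[xy]; rewrite -ltrBlDl lt_min => /andP[yd]; rewrite ltrD2r => yc _.
    by rewrite /Q (ltW yc) (ltW xc) hd ?(ltW yc)// xy -ltrBlDl.
  + exists 1 => // y /andP[xy _] yc'.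
    rewrite !QE ?(le_trans cx (ltW xy))// opprD addrACA subrr add0r -scalerBl.
    rewrite opprB addrA subrK -scalerBr normrZ gtr0_norm ?subr_gt0// mulrC.
    by rewrite ler_wpM2r ?subr_ge0 ?(ltW xy)// hw// cx ltW.
Qed.

Let eprim_exists e a b F : 0 < e -> a <= b -> cont_on a b F ->
  exists P, eprim e a b F P.
Proof.
move=> e0 ab cF; apply: (real_induction (P := fun x => exists P, eprim e a x F P) ab).
- exists (fun=> 0); split => [x _ e1 e10|x /andP[h1 h2]].
    by exists 1 => // y _ _; rewrite subrr normr0.
  by move: (le_lt_trans h1 h2); rewrite ltxx.
- move=> x /andP[ax xb] [P hP].
  have xab : a <= x <= b by rewrite ax ltW.
  have [d d0 hd] := cF x xab e e0; exists d => // y /andP[xy yd] yb.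
  apply: (eprim_extend (w := F x) (ltW e0) ax (ltW xy) hP) => z /andP[xz zy].
  rewrite distrC ltW// hd ?(le_trans ax xz) ?(le_trans zy yb)//.
  by rewrite ger0_norm ?subr_ge0// ltrBlDl (le_lt_trans zy).
- move=> x /andP[ax xb] hy.
  have xab : a <= x <= b by rewrite (ltW ax).
  have [d d0 hd] := cF x xab e e0.
  pose y := Num.max a (x - d / 2).
  have yx : y < x by rewrite /y gt_max ax gtrBl divr_gt0.
  have ay : a <= y by rewrite /y le_max lexx.
  have dy : x - d / 2 <= y by rewrite /y le_max lexx orbT.
  have [|P hP] := hy y; first by rewrite ay.
  apply: (eprim_extend (w := F x) (ltW e0) ay (ltW yx) hP) => z /andP[yz zx].
  rewrite distrC ltW// hd ?(le_trans ay yz) ?(le_trans zx xb)//.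
  by rewrite ler0_norm ?subr_le0//; lra.
Qed.

Let eprim_le e a b x y F P w k : eprim e a b F P -> a <= x -> x <= y -> y <= b ->
  0 <= e -> (forall z, x <= z <= y -> `|F z - w| <= k) ->
  `|P y - P x - (y - x) *: w| <= (e + k) * (y - x).
Proof.
move=> [cP hP] ax xy yb e0 hw.
have -> : P y - P x - (y - x) *: w = (P y - y *: w) - (P x - x *: w).
  by rewrite scalerBl !opprD !opprK addrACA.
rewrite mulrBr; apply: (dini_mvt (f := fun z => P z - z *: w) (g := fun x => (e + k) * x) xy).
- apply: cont_onD; first exact: cont_on_subset cP.
  apply: (cont_on_lip (C := `|w|)) => u v _ _.
  by rewrite -opprD normrN addrC -scaleNr -scalerDl normrZ mulrC addrC distrC.
- apply: (cont_on_lip (C := `|e + k|)) => u v _ _.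
  by rewrite -mulrBr normrM.
- move=> z /andP[xz zy] e1 e10.
  have [|d d0 hd] := hP z; first by rewrite (le_trans ax xz) (lt_le_trans zy yb).
  exists d => // u zu uy.
  have zu0 : 0 < u - z by rewrite subr_gt0; case/andP: zu.
  have -> : P u - u *: w - (P z - z *: w) =
      (P u - P z - (u - z) *: F z) + (u - z) *: (F z - w).
    rewrite scalerBr addrA subrK scalerBl !opprD !opprK addrACA.
    by rewrite -!addrA; congr (_ + _); rewrite addrCA.
  rewrite (le_trans (ler_normD _ _))// normrZ gtr0_norm//.
  have h1 := hd u zu (le_trans uy yb).
  have h2 : (u - z) * `|F z - w| <= (u - z) * k by rewrite ler_wpM2l ?(ltW zu0)// hw// xz ltW.
  have h3 : 0 <= e1 * (u - z) by rewrite mulr_ge0 ?ltW.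
  by move: h1 h2 h3; lra.
Qed.

Lemma prim_exists a b F : a <= b -> cont_on a b F -> exists P, prim a b F P.
Proof.
move=> ab cF.
have ex n : exists P, eprim (2^-1 ^+ n) a b F P.
  by apply: eprim_exists => //; rewrite exprn_gt0// invr_gt0.
have [P_ hP_] := choice ex.
pose Q n x := P_ n x - P_ n a.
have e_ n : 0 <= (2^-1 : R) ^+ n by rewrite exprn_ge0// invr_ge0.
(* The errors [2^-n] and [2^-(n+1)] of two approximate primitives bound the right derivative of
   their difference, so the functions [Q n], normalised at [a], form a fast Cauchy sequence. *)
have hQ n x : a <= x <= b -> `|Q n.+1 x - Q n x| <= (2 * (b - a)) * 2^-1 ^+ n.
  move=> /andP[ax xb].
  have -> : Q n.+1 x - Q n x = (P_ n.+1 x - P_ n x) - (P_ n.+1 a - P_ n a).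
    by rewrite /Q !opprD !opprK addrACA.
  have [c1 h1] := hP_ n; have [c2 h2] := hP_ n.+1.
  apply: (@le_trans _ _ (2 * 2^-1 ^+ n * x - 2 * 2^-1 ^+ n * a)); last first.
    by rewrite -mulrBr mulrAC ler_wpM2r// ler_wpM2l// lerD2r.
  apply: (dini_mvt (f := fun x => P_ n.+1 x - P_ n x) (g := fun x => 2 * 2^-1 ^+ n * x) ax).
  - apply: (cont_on_subset (lexx a) xb); apply: cont_onD => // u uab e e0.
    have [d d0 hd] := c1 u uab e e0; exists d => // v vab uv.
    by rewrite -opprD normrN; apply: hd.
  - apply: (cont_on_lip (C := `|2 * 2^-1 ^+ n|)) => u v _ _.
    by rewrite -mulrBr normrM.
  - move=> z /andP[az zx] e e0.
    have zab : a <= z < b by rewrite az (lt_le_trans zx).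
    have [d d0 hd] := h1 z zab; have [d' d'0 hd'] := h2 z zab.
    exists (Num.min d d'); first by rewrite lt_min d0.
    move=> y /andP[zy]; rewrite -ltrBlDl lt_min => /andP[yd yd'] yx.
    have k1 := hd y; rewrite zy -ltrBlDl yd in k1; have {}k1 := k1 isT (le_trans yx xb).
    have k2 := hd' y; rewrite zy -ltrBlDl yd' in k2; have {}k2 := k2 isT (le_trans yx xb).
    have -> : P_ n.+1 y - P_ n y - (P_ n.+1 z - P_ n z) =
       (P_ n.+1 y - P_ n.+1 z - (y - z) *: F z) - (P_ n y - P_ n z - (y - z) *: F z).
      by linmod R.
    rewrite (le_trans (ler_normB _ _))//.
    have h3 : 0 <= e * (y - z) by rewrite mulr_ge0 ?ltW// subr_gt0.
    have h4 : 0 <= 2^-1 ^+ n * (y - z) by rewrite mulr_ge0 ?subr_ge0 ?(ltW zy).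
    by move: k1 k2 h3 h4; rewrite exprS; lra.
have lim x : exists l, a <= x <= b -> forall n, `|Q n x - l| <= 2 * (b - a) * (2 * 2^-1 ^+ n).
  have [xab|] := boolP (a <= x <= b); last by exists 0.
  by have [l hl] := fast_cauchy_cvg (fun n => hQ n x xab); exists l.
have [P hP] := choice lim.
exists P => x xab e e0; have e20 : 0 < e / 2 by rewrite divr_gt0.
have [d d0 hd] := cF x xab _ e20; exists d => // y yab yx.
(* The interval has one end at [x] and is so short that [F] stays within [e / 2] of [F x] on it. The
   index [n] is arbitrary, and the last term disappears as it grows. *)
have main u v n : a <= u <= b -> a <= v <= b -> u <= v -> (u = x \/ v = x) ->
    `|v - u| < d ->
    `|P v - P u - (v - u) *: F x| <= e / 2 * (v - u) +
       (v - u + 8 * (b - a)) * 2^-1 ^+ n.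
  move=> uab vab uv ux uvd; have hu := hP u uab n; have hv := hP v vab n.
  have h1 : `|P_ n v - P_ n u - (v - u) *: F x| <= (2^-1 ^+ n + e / 2) * (v - u).
    case/andP: uab => au ub; case/andP: vab => av vb.
    apply: (eprim_le (hP_ n)) => // z /andP[uz zv]; rewrite ltW// hd//.
      by rewrite (le_trans au uz) (le_trans zv vb).
    apply: le_lt_trans uvd; rewrite (ger0_norm (_ : 0 <= v - u)) ?subr_ge0//.
    by case: ux => <-; [rewrite ger0_norm ?subr_ge0// lerD2r|rewrite ler0_norm ?subr_le0// opprB lerD2l lerN2].
  have -> : P v - P u - (v - u) *: F x = (P_ n v - P_ n u - (v - u) *: F x) -
      (Q n v - P v) + (Q n u - P u).
    by rewrite /Q; linmod R.
  rewrite (le_trans (ler_normD _ _))// (le_trans (lerD (ler_normB _ _) (lexx _)))//.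
  by move: hu hv h1; lra.
have nyx : `|y - x| = if x <= y then y - x else x - y.
  by case: ifPn => [h|]; [rewrite ger0_norm// subr_ge0|rewrite -ltNge => h; rewrite ltr0_norm ?subr_lt0// opprB].
have [xy|/ltW xy] := leP x y.
  rewrite ger0_norm ?subr_ge0//; apply: (@ler_small_half _ _ _ (y - x + 8 * (b - a))) => n.
  have := main x y n xab yab xy (or_introl erefl) yx.
  have : 0 <= e / 2 * (y - x) by rewrite mulr_ge0 ?subr_ge0 ?(ltW e20).
  by lra.
have -> : P y - P x - (y - x) *: F x = - (P x - P y - (x - y) *: F x) by linmod R.
rewrite normrN ler0_norm ?subr_le0// opprB.
apply: (@ler_small_half _ _ _ (x - y + 8 * (b - a))) => n.
have yx' : `|x - y| < d by rewrite distrC.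
have := main y x n yab xab xy (or_intror erefl) yx'.
have : 0 <= e / 2 * (x - y) by rewrite mulr_ge0 ?subr_ge0 ?(ltW e20).
by lra.
Qed.

End Existence.

Section Vint.
Context {R : realType} {V : completeNormedModType R}.
Implicit Types (a b c : R) (F G P : R -> V).

(** The increment of any primitive; if there is none, the chosen function is 0 and so is the
    integral. *)
Definition Vint F a b : V :=
  let P := xget (fun=> 0) [set P | prim a b F P] in P b - P a.

Lemma VintE F a b P : a <= b -> prim a b F P -> Vint F a b = P b - P a.
Proof.
move=> ab hP; rewrite /Vint; case: xgetP => [Q _ hQ|/(_ P)//].
exact: prim_unique hQ hP.
Qed.

Lemma Vint_prim F a b : cont_on a b F -> prim a b F (Vint F a).
Proof.
move=> cF x xab e e0; have ab : a <= b by case/andP: xab; exact: le_trans.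
have [P hP] := prim_exists ab cF; have [d d0 hd] := hP x xab e e0.
exists d => // y yab yx.
have E t : a <= t <= b -> Vint F a t = P t - P a.
  by move=> /andP[at_ tb]; apply: VintE => //; exact: prim_subset tb hP.
rewrite !E//.
have -> : P y - P a - (P x - P a) = P y - P x by linmod R.
exact: hd.
Qed.

Lemma Vint_xx F a : Vint F a a = 0. Proof. by rewrite /Vint subrr. Qed.

Lemma Vint_cat F a b c : a <= b -> b <= c -> cont_on a c F ->
  Vint F a c = Vint F a b + Vint F b c.
Proof.
move=> ab bc cF; have [P hP] := prim_exists (le_trans ab bc) cF.
rewrite (VintE (le_trans ab bc) hP) (VintE ab (prim_subset (lexx a) bc hP)).
by rewrite (VintE bc (prim_subset ab (lexx c) hP)); linmod R.
Qed.

Lemma eq_Vint F G a b : a <= b -> (forall x, a <= x <= b -> F x = G x) ->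
  Vint F a b = Vint G a b.
Proof.
move=> ab FG; rewrite /Vint.
suff -> : [set P | prim a b F P] = [set P | prim a b G P] by [].
apply/seteqP; split => P hP x xab e e0; have [d d0 hd] := hP x xab e e0;
  by exists d => // y yab yx; have := hd y yab yx; rewrite FG.
Qed.

Lemma VintD F G a b : a <= b -> cont_on a b F -> cont_on a b G ->
  Vint (fun x => F x + G x) a b = Vint F a b + Vint G a b.
Proof.
move=> ab cF cG; rewrite (VintE ab (primD (Vint_prim cF) (Vint_prim cG))).
by rewrite !Vint_xx addr0 subr0.
Qed.

Lemma VintB F G a b : a <= b -> cont_on a b F -> cont_on a b G ->
  Vint (fun x => F x - G x) a b = Vint F a b - Vint G a b.
Proof.
move=> ab cF cG; rewrite (VintE ab (primB (Vint_prim cF) (Vint_prim cG))).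
by rewrite !Vint_xx !subr0.
Qed.

Lemma VintZ F a b (k : R) : a <= b -> cont_on a b F ->
  Vint (fun x => k *: F x) a b = k *: Vint F a b.
Proof.
move=> ab cF; rewrite (VintE ab (primZ k (Vint_prim cF))).
by rewrite !Vint_xx scaler0 !subr0.
Qed.

Lemma Vint_le_cst F a b (C : R) : a <= b -> cont_on a b F ->
  (forall x, a <= x <= b -> `|F x| <= C) -> `|Vint F a b| <= C * (b - a).
Proof.
by move=> ab cF hF; have := prim_le_cst ab (Vint_prim cF) hF; rewrite Vint_xx subr0.
Qed.

Lemma Vint_le_deriv F a b (g g' : R -> R) : a <= b -> cont_on a b F ->
  (forall x, is_derive x (1 : R) g (g' x)) ->
  (forall x, a <= x <= b -> `|F x| <= g' x) -> `|Vint F a b| <= g b - g a.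
Proof.
move=> ab cF dg hF; have := prim_le_deriv ab (Vint_prim cF) dg hF.
by rewrite Vint_xx subr0.
Qed.

Lemma Vint_near F a b w e : a <= b -> cont_on a b F ->
  (forall x, a <= x <= b -> `|F x - w| <= e) ->
  `|Vint F a b - (b - a) *: w| <= e * (b - a).
Proof.
move=> ab cF hF.
have := prim_le_cst ab (primB (Vint_prim cF) (@prim_cst _ _ a b w)) hF.
by rewrite Vint_xx; congr (`|_| <= _); linmod R.
Qed.

Lemma Vint_shift F a b h : a <= b -> cont_on (a + h) (b + h) F ->
  Vint F (a + h) (b + h) = Vint (fun x => F (x + h)) a b.
Proof.
move=> ab cF; rewrite (@VintE _ a b (fun x => Vint F (a + h) (x + h)))//.
  by rewrite Vint_xx subr0.
move=> x xab e e0.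
have [|d d0 hd] := Vint_prim cF (x := x + h) _ e0; first by rewrite !lerD2r.
exists d => // y yab yx; have := hd (y + h).
have -> : y + h - (x + h) = y - x by ring.
by apply => //; rewrite !lerD2r.
Qed.

(** The bridge to [is_Hintegral]. On each cell the tagged value is off by at most [e / (b - a + 1)]
    times the length, by uniform continuity, and these errors add up. *)
Lemma Vint_riemann F a b : a <= b -> cont_on a b F -> forall e, 0 < e ->
  exists2 d, 0 < d & forall (n : nat) (t s : nat -> R), t 0%N = a -> t n = b ->
    (forall i, (i < n)%N -> t i <= s i <= t i.+1 /\ t i.+1 - t i < d) ->
    `|\sum_(i < n) (t i.+1 - t i) *: F (s i) - Vint F a b| <= e.
Proof.
move=> ab cF e e0; have ba1 : 0 < b - a + 1 by rewrite ltr_wpDl// subr_ge0.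
have [d d0 hd] := cont_on_unif ab cF (divr_gt0 e0 ba1).
exists d => // n t s t0 tn hts.
suff H m : (m <= n)%N -> a <= t m /\
    `|\sum_(i < m) (t i.+1 - t i) *: F (s i) - Vint F a (t m)| <=
       e / (b - a + 1) * (t m - a).
  have [_] := H n (leqnn n); rewrite tn => /le_trans; apply.
  by rewrite mulrAC ler_pdivrMr// ler_wpM2l ?(ltW e0)// lerDl.
have tb k0 : (k0 <= n)%N -> t k0 <= b.
  have mono (k : nat) : (k0 + k <= n)%N -> t k0 <= t (k0 + k)%N.
    elim: k => [|k IH]; rewrite ?addn0// addnS => mk.
    have [/andP[h1 h2] _] := hts _ mk.
    exact: le_trans (IH (ltnW mk)) (le_trans h1 h2).
  by move=> mn; have := mono (n - k0)%N; rewrite subnKC// tn; apply.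
elim: m => [|m IH] mn.
  by rewrite t0 lexx big_ord0 Vint_xx subrr normr0 subrr mulr0.
have [am {}IH] := IH (ltnW mn); have [/andP[h1 h2] h3] := hts m mn.
have tm := le_trans h1 h2; split; first exact: le_trans tm.
have bm := tb _ mn.
rewrite big_ord_recr /= (@Vint_cat F a (t m) (t m.+1))//; last exact: cont_on_subset cF.
have -> : \sum_(i < m) (t i.+1 - t i) *: F (s i) + (t m.+1 - t m) *: F (s m) -
   (Vint F a (t m) + Vint F (t m) (t m.+1)) =
   (\sum_(i < m) (t i.+1 - t i) *: F (s i) - Vint F a (t m)) -
   (Vint F (t m) (t m.+1) - (t m.+1 - t m) *: F (s m)) by linmod R.
rewrite (le_trans (ler_normB _ _))//.
have -> : t m.+1 - a = (t m - a) + (t m.+1 - t m) by ring.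
rewrite mulrDr lerD// Vint_near//; first exact: cont_on_subset cF.
move=> x /andP[x1 x2]; rewrite ltW// hd//.
- by rewrite (le_trans am h1) (le_trans h2).
- by rewrite (le_trans am x1) (le_trans x2).
by apply: le_lt_trans h3; rewrite ler_norml; apply/andP; split; lra.
Qed.

End Vint.

Section VintLinear.
Context {R : realType} {V W : completeNormedModType R}.
Variables (T : V -> W) (M : R).
Hypothesis TB : forall x y, T (x - y) = T x - T y.
Hypothesis TZ : forall k x, T (k *: x) = k *: T x.
Hypothesis TM : forall x, `|T x| <= M * `|x|.

Lemma cont_on_lin (F : R -> V) a b : cont_on a b F -> cont_on a b (T \o F).
Proof.
move=> cF x xab e e0; have M1 : 0 < `|M| + 1 by rewrite ltr_wpDl.
have [d d0 hd] := cF x xab _ (divr_gt0 e0 M1).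
exists d => // y yab yx; have := hd y yab yx; rewrite ltr_pdivlMr// => h.
rewrite /= -TB (le_lt_trans (TM _))//; apply: le_lt_trans h.
by rewrite mulrC ler_wpM2l// (le_trans (ler_norm M))// lerDl.
Qed.

Lemma Vint_lin (F : R -> V) a b : a <= b -> cont_on a b F ->
  T (Vint F a b) = Vint (T \o F) a b.
Proof.
move=> ab cF; rewrite (@VintE _ _ _ a b (T \o Vint F a))//.
  rewrite /= Vint_xx; have -> : T 0 = 0 by rewrite -(subrr 0) TB subrr.
  by rewrite subr0.
move=> x xab e e0; have M1 : 0 < `|M| + 1 by rewrite ltr_wpDl.
have [d d0 hd] := Vint_prim cF xab (divr_gt0 e0 M1).
exists d => // y yab yx; have := hd y yab yx => h.
rewrite /= -TZ -!TB (le_trans (TM _))//.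
rewrite (@le_trans _ _ ((`|M| + 1) * (e / (`|M| + 1) * `|y - x|)))//.
  apply: (le_trans _ (ler_wpM2l (ltW M1) h)).
  by rewrite ler_wpM2r// (le_trans (ler_norm M))// lerDl.
by rewrite mulrA mulrCA divff ?gt_eqF// mulr1.
Qed.

End VintLinear.

(** * Polynomial flows and density *)

Section PolyOps.
Context {R : realType}.
Implicit Types (p q w : {poly R}) (a c y : R).

Definition pint p : {poly R} :=
  \poly_(i < (size p).+1) (if i is j.+1 then p`_j / j.+1%:R else 0).
Definition epart p : {poly R} := \poly_(i < size p) (if odd i then 0 else p`_i).
Definition opart p : {poly R} := \poly_(i < size p) (if odd i then p`_i else 0).

Lemma coef_pint p i : (pint p)`_i = if i is j.+1 then p`_j / j.+1%:R else 0.
Proof.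
rewrite coef_poly; case: ltnP => // h; case: i h => // j.
by rewrite ltnS => /(nth_default 0) ->; rewrite mul0r.
Qed.

Lemma coef_epart p i : (epart p)`_i = if odd i then 0 else p`_i.
Proof. by rewrite coef_poly; case: ltnP => // /(nth_default 0) ->; rewrite if_same. Qed.

Lemma coef_opart p i : (opart p)`_i = if odd i then p`_i else 0.
Proof. by rewrite coef_poly; case: ltnP => // /(nth_default 0) ->; rewrite if_same. Qed.

Lemma pintD p q : pint (p + q) = pint p + pint q.
Proof.
by apply/polyP => -[|i]; rewrite coefD !coef_pint ?addr0// coefD mulrDl.
Qed.

Lemma pintZ k p : pint (k *: p) = k *: pint p.
Proof.
by apply/polyP => -[|i]; rewrite coefZ !coef_pint ?mulr0// coefZ mulrA.
Qed.

Lemma epartD p q : epart (p + q) = epart p + epart q.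
Proof. by apply/polyP => i; rewrite coefD !coef_epart coefD; case: odd; rewrite ?addr0. Qed.

Lemma epartZ k p : epart (k *: p) = k *: epart p.
Proof. by apply/polyP => i; rewrite coefZ !coef_epart coefZ; case: odd; rewrite ?mulr0. Qed.

Lemma opartD p q : opart (p + q) = opart p + opart q.
Proof. by apply/polyP => i; rewrite coefD !coef_opart coefD; case: odd; rewrite ?addr0. Qed.

Lemma opartZ k p : opart (k *: p) = k *: opart p.
Proof. by apply/polyP => i; rewrite coefZ !coef_opart coefZ; case: odd; rewrite ?mulr0. Qed.

Lemma epart_opart p : epart p + opart p = p.
Proof.
by apply/polyP => i; rewrite coefD coef_epart coef_opart; case: odd; rewrite ?add0r ?addr0.
Qed.

Lemma horner_epartN p y : (epart p).[- y] = (epart p).[y].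
Proof.
rewrite /epart !horner_poly; apply: eq_bigr => i _; case: (boolP (odd i)) => [|/negPf h].
  by rewrite !mul0r.
by rewrite exprNn -signr_odd h expr0 mul1r.
Qed.

Lemma horner_opartN p y : (opart p).[- y] = - (opart p).[y].
Proof.
rewrite /opart !horner_poly -sumrN; apply: eq_bigr => i _; case: (boolP (odd i)) => [h|_].
  by rewrite exprNn -signr_odd h expr1 mulN1r mulrN.
by rewrite !mul0r oppr0.
Qed.

Lemma horner_epart p y : (epart p).[y] = (p.[y] + p.[- y]) / 2.
Proof.
rewrite -{2 3}(epart_opart p) !hornerD horner_epartN horner_opartN.
lra.
Qed.

Lemma horner_opart p y : (opart p).[y] = (p.[y] - p.[- y]) / 2.
Proof.
rewrite -{2 3}(epart_opart p) !hornerD horner_epartN horner_opartN; lra.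
Qed.

Lemma deriv_pint p : (pint p)^`() = p.
Proof.
apply/polyP => i; rewrite coef_deriv coef_pint -[LHS]mulr_natr.
by rewrite divfK// pnatr_eq0.
Qed.

Lemma pint_deriv p : pint p^`() = p - (p.[0])%:P.
Proof.
apply/polyP => -[|i]; rewrite coefB coefC coef_pint /=.
  by rewrite horner_coef0 subrr.
by rewrite coef_deriv subr0 -[X in X / _]mulr_natr mulfK// pnatr_eq0.
Qed.

Lemma horner_pint0 p : (pint p).[0] = 0.
Proof. by rewrite horner_coef0 coef_pint. Qed.

End PolyOps.

Section Generator.
Context {R : realType}.
Variables (a c : R).
Implicit Types (p q w : {poly R}).

(** Differentiation exchanges odd and even polynomials, so the coupled system for the pair is a
    single transport operator for [w]. Only the integral of the even component, which feeds the odd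
    one, refers to parity. *)
Definition Lp w : {poly R} :=
  w^`() - 'X * w^`() - a *: w + c *: pint (epart w).

Lemma coef_Lp w n : (Lp w)`_n = n.+1%:R * w`_n.+1 - (n%:R + a) * w`_n +
  (if odd n then c * (w`_n.-1 / n%:R) else 0).
Proof.
rewrite /Lp coefD !coefB !coefZ coefXM coef_deriv coef_pint; case: n => [|n].
  by rewrite /= mulr1n; ring.
rewrite /= coef_deriv coef_epart -(mulr_natl w`_n.+2) -(mulr_natl w`_n.+1).
by case: odd => /=; ring.
Qed.

Lemma LpD p q : Lp (p + q) = Lp p + Lp q.
Proof. by apply/polyP => i; rewrite coefD !coef_Lp !coefD; case: odd; ring. Qed.

Lemma LpZ k p : Lp (k *: p) = k *: Lp p.
Proof. by apply/polyP => i; rewrite coefZ !coef_Lp !coefZ; case: odd; ring. Qed.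

(** The integral term raises the degree by one, but only from an even degree to an odd one. Even
    bounds on the size are therefore preserved, which is why all of them have the form [k.*2]. *)
Lemma size_Lp k w : (size w <= k.*2)%N -> (size (Lp w) <= k.*2)%N.
Proof.
move=> hw; apply/leq_sizeP => j hj.
have h1 : w`_j = 0 by apply: nth_default; exact: leq_trans hj.
have h2 : w`_j.+1 = 0 by apply: nth_default; apply: leq_trans (leqW hj).
rewrite coef_Lp h1 h2 !mulr0 subrr add0r; case: ifPn => // oj.
have h3 : w`_j.-1 = 0.
  apply: nth_default; apply: (leq_trans hw).
  move: hj; rewrite leq_eqVlt => /orP[/eqP e|]; first by rewrite -e odd_double in oj.
  by case: j oj h1 h2 => // j _ _ _; rewrite ltnS.
by rewrite h3 mul0r mulr0.
Qed.

Definition flow N (W : R -> {poly R}) :=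
  (forall t, (size (W t) <= N)%N) /\
  forall n t, is_derive t (1 : R) (fun s => (W s)`_n) ((Lp (W t))`_n).

Lemma flowB N W W' : flow N W -> flow N W' -> flow N (fun t => W t - W' t).
Proof.
move=> [s1 d1] [s2 d2]; split => [t|n t].
  by rewrite (leq_trans (size_polyD _ _))// geq_max s1 size_polyN s2.
have -> : (fun s => (W s - W' s)`_n) = (fun s => (W s)`_n - (W' s)`_n).
  by apply/funext => s; rewrite coefB.
have -> : (Lp (W t - W' t))`_n = (Lp (W t))`_n - (Lp (W' t))`_n.
  by rewrite -scaleN1r LpD LpZ coefD coefZ mulN1r.
exact: is_deriveB.
Qed.

Lemma flowZ N k W : flow N W -> flow N (fun t => k *: W t).
Proof.
move=> [s1 d1]; split => [t|n t].
  by rewrite (leq_trans (size_scale_leq _ _)).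
have -> : (fun s => (k *: W s)`_n) = (fun s => k * (W s)`_n).
  by apply/funext => s; rewrite coefZ.
rewrite LpZ coefZ; have := d1 n t => h.
exact: (is_deriveZ k).
Qed.

Lemma flowD N W W' : flow N W -> flow N W' -> flow N (fun t => W t + W' t).
Proof.
move=> h1 h2; have := flowB h1 (flowZ (-1) h2).
by under [X in flow _ X]eq_fun do rewrite scaleN1r opprK.
Qed.

Lemma flow_shift N h W : flow N W -> flow N (fun t => W (t + h)).
Proof.
move=> [s1 d1]; split => // n t.
have d2 := d1 n (t + h).
have d3 : is_derive t (1 : R) (fun s : R => s + h) 1.
  by rewrite -[1 in X in is_derive _ _ _ X]addr0; exact: is_deriveD.
have := is_derive1_comp (f := fun s => (W s)`_n) (g := fun s : R => s + h) (x := t) d2 d3.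
by rewrite mulr1.
Qed.

Section Existence.
Variables (k : nat) (w : {poly R}).
Hypothesis hw : (size w <= k.*2)%N.

(** Bounds [Lp], on polynomials of size at most [k.*2], in the norm given by the largest
    coefficient. *)
Let C := 2 * k.*2%:R + `|a| + `|c| + 1.

Let size_iter j : (size (iter j Lp w) <= k.*2)%N.
Proof. by elim: j => //= j; exact: size_Lp. Qed.

Let C_ge0 : 0 <= C.
Proof. by rewrite !addr_ge0// mulr_ge0. Qed.

Let Lp_bound p B : (size p <= k.*2)%N -> (forall n, `|p`_n| <= B) ->
  forall n, `|(Lp p)`_n| <= C * B.
Proof.
move=> sp hp n; have B0 : 0 <= B := le_trans (normr_ge0 _) (hp 0%N).
have [hn|hn] := ltnP n k.*2; last first.
  by rewrite (nth_default 0 (leq_trans (size_Lp sp) hn)) normr0 mulr_ge0.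
have nk : n.+1%:R <= k.*2%:R :> R by rewrite ler_nat.
have n0 : 0 <= n%:R :> R by [].
rewrite coef_Lp (le_trans (ler_normD _ _))//.
have h1 : `|n.+1%:R * p`_n.+1 - (n%:R + a) * p`_n| <= (2 * k.*2%:R + `|a|) * B.
  rewrite (le_trans (ler_normB _ _))// !normrM.
  have -> : (2 * k.*2%:R + `|a|) * B = k.*2%:R * B + (k.*2%:R + `|a|) * B by ring.
  rewrite lerD//; first by rewrite ler_pM// ger0_norm.
  rewrite ler_pM// (le_trans (ler_normD _ _))// lerD2r ger0_norm//.
  by rewrite (le_trans _ nk)// ler_nat.
have h2 : `|if odd n then c * (p`_n.-1 / n%:R) else 0| <= `|c| * B.
  case: ifPn => [on|_]; last by rewrite normr0 mulr_ge0.
  rewrite normrM ler_wpM2l// normrM normfV (ger0_norm n0).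
  rewrite -[leRHS]mulr1 ler_pM// ?invr_ge0//.
  have n1 : (0 < n)%N by case: n on {hn nk n0 h1}.
  by rewrite invf_le1 ?ltr0n// ler1n.
rewrite (le_trans (lerD h1 h2))// -mulrDl ler_wpM2r//.
by rewrite /C lerDl.
Qed.

Let iter_bound n j : `|(iter j Lp w)`_n| <= C ^+ j * (\sum_(i < size w) `|w`_i|).
Proof.
elim: j n => [|j IH] n /=.
  rewrite expr0 mul1r; have [h|h] := ltnP n (size w); last first.
    by rewrite (nth_default 0 h) normr0 sumr_ge0.
  by rewrite (bigD1 (Ordinal h))//= lerDl sumr_ge0.
by rewrite exprS -mulrA; apply: Lp_bound.
Qed.

(** Taylor coefficients in time of the [n]-th coefficient of [Lp^m exp(t Lp) w]. The parameter [m]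
    is carried because termwise differentiation of the series just raises it by one. *)
Let cf (m n j : nat) : R := (iter (m + j) Lp w)`_n / j`!%:R.

Let cvg_cf m n K : cvgn (pseries (cf m n) K).
Proof.
set B := \sum_(i < size w) `|w`_i|.
apply: normed_cvg.
apply: (series_le_cvg (v_ := fun j => (C ^+ m * B) * exp_coeff (C * `|K|) j)).
- by move=> j /=.
- move=> j; rewrite mulr_ge0// ?mulr_ge0 ?exprn_ge0 ?sumr_ge0//.
  by rewrite mulr_ge0.
- move=> j /=; rewrite /cf normrM normrM normrX normfV (ger0_norm (_ : 0 <= j`!%:R))//.
  rewrite /exp_coeff /= exprMn.
  have -> : C ^+ m * B * (C ^+ j * `|K| ^+ j / j`!%:R) =
     (C ^+ (m + j) * B) / j`!%:R * `|K| ^+ j by rewrite exprD; ring.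
  by rewrite !ler_wpM2r ?exprn_ge0 ?invr_ge0//; exact: iter_bound.
- exact/is_cvg_seriesZ/is_cvg_series_exp_coeff.
Qed.

Let cfS m n : pseries_diffs (cf m n) = cf m.+1 n.
Proof.
apply/funext => j; rewrite /pseries_diffs /cf addnS addSn factS natrM invfM.
by rewrite mulrCA (mulrA j.+1%:R) divff ?mul1r// pnatr_eq0.
Qed.

Let e m n t : R := limn (pseries (cf m n) t).

Let e_deriv m n t : is_derive t (1 : R) (e m n) (e m.+1 n t).
Proof.
have := @pseries_snd_diffs R (cf m n) (`|t| + 1) t (@cvg_cf m n _).
rewrite !cfS; apply; try exact: cvg_cf.
by rewrite [ltRHS]ger0_norm ?addr_ge0// ltrDl.
Qed.

Let e_Lp m n t : e m.+1 n t = n.+1%:R * e m n.+1 t - (n%:R + a) * e m n t +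
  (if odd n then c * (e m n.-1 t / n%:R) else 0).
Proof.
have h1 := @cvg_cf m n.+1 t; have h2 := @cvg_cf m n t; have h3 := @cvg_cf m n.-1 t.
rewrite /e; apply: cvg_lim => //.
pose z := if odd n then c / n%:R else 0.
have -> : (if odd n then c * (limn (pseries (cf m n.-1) t) / n%:R) else 0) =
    z * limn (pseries (cf m n.-1) t) by rewrite /z; case: odd; ring.
have -> : pseries (cf m.+1 n) t = (fun N => n.+1%:R * pseries (cf m n.+1) t N -
    (n%:R + a) * pseries (cf m n) t N + z * pseries (cf m n.-1) t N).
  apply/funext => N; rewrite /pseries /series /= !mulr_sumr -sumrB -big_split /=.
  apply: eq_bigr => j _; rewrite /cf addSn /= coef_Lp /z; case: odd; ring.
apply: cvgD; [apply: cvgB|].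
- by apply: cvgMl_tmp.
- by apply: cvgMl_tmp.
- by apply: cvgMl_tmp.
Qed.

Lemma flow_exists : exists2 W, flow k.*2 W & W 0 = w.
Proof.
have e_out n t : (k.*2 <= n)%N -> e 0 n t = 0.
  move=> hn; rewrite /e; apply: cvg_lim => //.
  have -> : pseries (cf 0 n) t = fun=> 0; last exact: cvg_cst.
  apply/funext => N; rewrite /pseries /series /= big1// => j _.
  by rewrite /cf (nth_default 0 (leq_trans (size_iter _) hn)) !mul0r.
pose W t := \poly_(n < k.*2) e 0 n t.
have WE n t : (W t)`_n = e 0 n t.
  by rewrite coef_poly; case: ltnP => // /e_out ->.
exists W; first split.
- by move=> t; exact: size_poly.
- move=> n t; rewrite (_ : (fun s => (W s)`_n) = e 0 n); last exact/funext.
  by rewrite coef_Lp !WE -e_Lp.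
- apply/polyP => n; rewrite WE /e; apply: cvg_lim => //.
  have E N : pseries (cf 0 n) 0 N.+1 = w`_n.
    rewrite /pseries /series /= big_nat_recl//= big1 ?addr0.
      by rewrite /cf /= expr0 mulr1 fact0 divr1.
    by move=> j _; rewrite exprS mul0r mulr0.
  rewrite -(cvg_shiftS (pseries (cf 0 n) 0)) /=.
  by under eq_fun do rewrite E; exact: cvg_cst.
Qed.

End Existence.

End Generator.

(** * The antiderivative from 0 of a square integrable function *)

Section IntegralFromZero.
Context {R : realType}.
Notation mu := (@lebesgue_measure R).
Notation Io r := (`]0%R, r[%classic : set R).
Implicit Types (u v : R -> R) (r x y : R).

Lemma ipBl (D : set R) u v w : measurable D -> square_integrable D u ->
  square_integrable D v -> square_integrable D w ->
  ip D (fun x => u x - v x) w = ip D u w - ip D v w.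
Proof.
move=> mD su sv sw; rewrite -(mulN1r (ip D v w)) -ipZl// -ipDl//; last exact: sqiZ.
by congr ip; apply/funext => z; rewrite mulN1r.
Qed.

Definition intI u x : R := \int[mu]_(s in `[0, x]) u s.

Lemma mIo r : measurable (Io r). Proof. exact: measurable_itv. Qed.

Lemma mu_Io_lty r : (mu (Io r) < +oo)%E.
Proof. by rewrite lebesgue_measure_itv/=; case: ifPn => _; rewrite ?ltry// -EFinB ltry. Qed.

Lemma mu_Io r : 0 <= r -> mu (Io r) = r%:E.
Proof.
rewrite lebesgue_measure_itv /= lte_fin le_eqVlt => /orP[/eqP <-|->].
  by rewrite ltxx.
by rewrite -EFinB subr0.
Qed.

Lemma sqi_bounded (D : set R) u M : measurable D -> (mu D < +oo)%E ->
  measurable_fun D u -> (forall x, D x -> `|u x| <= M) -> square_integrable D u.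
Proof.
move=> mD fD mu_ hM; split => //.
apply: (@le_lt_trans _ _ (\int[mu]_(x in D) (M ^+ 2)%:E)%E); last first.
  by rewrite integral_cst// lte_mul_pinfty// lee_fin sqr_ge0.
apply: ge0_le_integral => //.
- by move=> x _; rewrite lee_fin sqr_ge0.
- exact: measurable_EFinX2.
- move=> x Dx; rewrite lee_fin -(real_normK (num_real (u x))) ler_sqr ?nnegrE//.
    exact: hM.
  exact: le_trans (hM x Dx).
Qed.

Lemma sqi_horner (D : set R) r (p : {poly R}) : measurable D -> D `<=` `[- r, r] ->
  (mu D < +oo)%E -> square_integrable D (horner p).
Proof.
move=> mD Dr fD.
have cp : cont_on (V := R^o) (- `|r|) `|r| (horner p).
  by apply: (continuous_cont_on (V := R^o)); exact: continuous_horner.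
have [|M M0 hM] := cont_on_bounded _ cp; first by rewrite lerNl (le_trans _ (normr_ge0 r))// oppr_le0.
apply: (sqi_bounded (M := M)) => //.
  by apply: measurable_funTS; apply: continuous_measurable_fun; exact: continuous_horner.
move=> x /Dr /=; rewrite in_itv /= => /andP[h1 h2]; apply: hM.
by rewrite (le_trans h2 (ler_norm r)) andbT (le_trans _ h1)// lerN2 ler_norm.
Qed.

Lemma sqi_horner_Io r (p : {poly R}) : square_integrable (Io r) (horner p).
Proof.
apply: (@sqi_horner _ r); [exact: mIo| |exact: mu_Io_lty].
move=> x /=; rewrite !in_itv /= => /andP[h1 h2]; rewrite (ltW h2) andbT.
by rewrite (le_trans _ (ltW h1))// oppr_le0 (le_trans (ltW h1) (ltW h2)).
Qed.

Definition ind x : R -> R := \1_(`]0, x] : set R).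

Lemma sqi_ind r x : square_integrable (Io r) (ind x).
Proof.
apply: (sqi_bounded (M := 1)); [exact: mIo|exact: mu_Io_lty| |].
  exact: measurable_indic.
by move=> y _; rewrite /ind indicE; case: (_ \in _); rewrite ?normr1 ?normr0.
Qed.

Let sub_Io r x : x < r -> Io r `&` [set` `]0, x]] = [set` `]0, x]].
Proof.
move=> xr; apply/seteqP; split => [y []//|y] /=; rewrite !in_itv /= => /andP[y0 yx].
by rewrite y0 yx (le_lt_trans yx).
Qed.

(** Once the value at a point is an inner product with an indicator, additivity and Hoelder
    continuity are instances of bilinearity and Cauchy-Schwarz. *)
Lemma intI_ip r u x : square_integrable (Io r) u -> x < r ->
  intI u x = ip (Io r) u (ind x).
Proof.
move=> su xr; have h := sqi_mul (mIo r) su (sqi_ind r x).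
have mu1 : measurable_fun [set` `]0, x]] u.
  by rewrite -(sub_Io xr); apply: measurable_funS su.1 => //; exact: subIsetl.
rewrite /intI /Rintegral -integral_itv_obnd_cbnd; last exact/measurable_EFinP.
rewrite -[X in (\int[mu]_(x in X) _)%E](sub_Io xr) /ip /Rintegral; congr fine.
rewrite integral_mkcondr; apply: eq_integral => y _.
by rewrite /ind patchE indicE; case: (_ \in _); rewrite ?mulr1 ?mulr0.
Qed.

Lemma ip_ind r x y : 0 <= x -> x <= y -> y < r ->
  ip (Io r) (fun z => ind y z - ind x z) (fun z => ind y z - ind x z) = y - x.
Proof.
move=> x0 xy yr.
have -> : ip (Io r) (fun z => ind y z - ind x z) (fun z => ind y z - ind x z)
    = \int[mu]_(z in Io r) (\1_(`]x, y] : set R) z).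
  apply: eq_Rintegral => z /set_mem; rewrite /= in_itv /= => /andP[z0 zr].
  rewrite /ind !indicE !mem_setE !in_itv /= z0 /=.
  have [zx|xz] := leP z x; first by rewrite (le_trans zx xy) subrr mulr0.
  by case: leP => _; rewrite subr0 ?mulr1 ?mulr0.
rewrite /Rintegral integral_indic//= (_ : _ `&` _ = [set` `]x, y]]).
  rewrite lebesgue_measure_itv /= lte_fin; move: xy; rewrite le_eqVlt => /orP[/eqP ->|->].
    by rewrite ltxx subrr.
  by rewrite -EFinB.
apply/seteqP; split => [z []//|z] /=; rewrite !in_itv /= => /andP[xz zy].
by rewrite xz zy (le_lt_trans x0 xz) (le_lt_trans zy yr).
Qed.

Lemma intI_le_diff r u x y : square_integrable (Io r) u -> 0 <= x -> x <= y -> y < r ->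
  `|intI u y - intI u x| <= Num.sqrt (y - x) * snrm (Io r) u.
Proof.
move=> su x0 xy yr; have mI := mIo r.
rewrite (intI_ip su yr) (intI_ip su (le_lt_trans xy yr)).
have sB := sqiB mI (sqi_ind r y) (sqi_ind r x).
have -> : ip (Io r) u (ind y) - ip (Io r) u (ind x) =
    ip (Io r) (fun z => ind y z - ind x z) u.
  by rewrite !(ipC _ u) ipBl//; exact: sqi_ind.
have := ip2_cauchy_schwarz mI (sqi_pair sB) (sqi_pair su).
rewrite -!snrmE /ip2 /= (_ : ip (Io r) (fun=> 0) (fun=> 0) = 0) ?addr0; last first.
  by rewrite /ip /Rintegral integral0_eq// => z _; rewrite mul0r.
have -> : snrm (Io r) (fun z => ind y z - ind x z) = Num.sqrt (y - x).
  by rewrite /snrm ip_ind.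
exact.
Qed.

Lemma intI0 u : intI u 0 = 0.
Proof.
by rewrite /intI set_itv1 Rintegral_set1.
Qed.

Lemma intI_le r u x : square_integrable (Io r) u -> 0 <= x -> x < r ->
  `|intI u x| <= Num.sqrt x * snrm (Io r) u.
Proof.
move=> su x0 xr; have := intI_le_diff su (lexx 0) x0 xr.
by rewrite intI0 !subr0.
Qed.

Lemma intI_le_dist r u x y : square_integrable (Io r) u ->
  0 <= x < r -> 0 <= y < r ->
  `|intI u y - intI u x| <= Num.sqrt `|y - x| * snrm (Io r) u.
Proof.
move=> su /andP[x0 xr] /andP[y0 yr]; have [xy|/ltW yx] := leP x y.
  by rewrite (ger0_norm (_ : 0 <= y - x)) ?subr_ge0//; exact: intI_le_diff.
by rewrite distrC (ler0_norm (_ : y - x <= 0)) ?subr_le0// opprB; exact: intI_le_diff.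
Qed.

Lemma intI_cont r u : square_integrable (Io r) u -> {in Io r, continuous (intI u)}.
Proof.
move=> su x /set_mem /= xr0; have := xr0; rewrite in_itv /= => /andP[x0 xr].
apply/cvgrPdist_lt => e e0; have n1 : 0 < snrm (Io r) u + 1.
  by rewrite ltr_wpDl// snrm_ge0.
have en0 : 0 < e / (snrm (Io r) u + 1) by rewrite divr_gt0.
near=> y.
have : y \in `]0, r[ by near: y; apply: near_in_itvoo; rewrite in_itv /= x0 xr.
rewrite in_itv /= => /andP[y0 yr].
rewrite (le_lt_trans (intI_le_dist su _ _))// ?(ltW y0) ?(ltW x0)//.
apply: (@le_lt_trans _ _ (Num.sqrt `|x - y| * (snrm (Io r) u + 1))).
  by rewrite ler_wpM2l ?sqrtr_ge0// lerDl.
rewrite -ltr_pdivlMr//.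
have -> : e / (snrm (Io r) u + 1) = Num.sqrt ((e / (snrm (Io r) u + 1)) ^+ 2).
  by rewrite sqrtr_sqr ger0_norm// ltW.
rewrite ltr_sqrt ?exprn_gt0//.
by near: y; apply/nbhs_ballP; exists ((e / (snrm (Io r) u + 1)) ^+ 2) => //=; exact: exprn_gt0.
Unshelve. all: by end_near. Qed.

Lemma measurable_intI r u : square_integrable (Io r) u -> measurable_fun (Io r) (intI u).
Proof.
by move=> su; apply: open_continuous_measurable_fun; [exact: itv_open|exact: intI_cont].
Qed.

Lemma intI_bound r u x : square_integrable (Io r) u -> 0 <= x < r ->
  `|intI u x| <= Num.sqrt r * snrm (Io r) u.
Proof.
move=> su /andP[x0 xr]; rewrite (le_trans (intI_le su x0 xr))//.
by rewrite ler_wpM2r ?snrm_ge0// ler_sqrt ?(ltW xr)// (le_trans x0 (ltW xr)).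
Qed.

Lemma sqi_intI r u : square_integrable (Io r) u -> square_integrable (Io r) (intI u).
Proof.
move=> su; apply: (sqi_bounded (M := Num.sqrt r * snrm (Io r) u)).
- exact: mIo.
- exact: mu_Io_lty.
- exact: measurable_intI.
- by move=> x /=; rewrite in_itv /= => /andP[/ltW x0 xr]; apply: intI_bound; rewrite ?x0.
Qed.

Lemma snrm_le_bound r u M : 0 <= r -> 0 <= M -> square_integrable (Io r) u ->
  (forall x, 0 < x < r -> `|u x| <= M) -> snrm (Io r) u <= Num.sqrt r * M.
Proof.
move=> r0 M0 su hM; rewrite -ler_sqr ?nnegrE ?mulr_ge0 ?snrm_ge0 ?sqrtr_ge0//.
rewrite snrm_sqr exprMn sqr_sqrtr// -lee_fin -integral_sqrE//.
have -> : (r * M ^+ 2)%:E = (\int[mu]_(x in Io r) (M ^+ 2)%:E)%E.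
  rewrite integral_cst//.
  by rewrite -[X in (_ * X)%E]/(mu (Io r)) mu_Io// mulrC EFinM.
apply: ge0_le_integral => //.
- by move=> x _; rewrite lee_fin sqr_ge0.
- exact: measurable_EFinX2 su.1.
- move=> x /=; rewrite in_itv /= => x0; rewrite lee_fin -(real_normK (num_real (u x))).
  by rewrite ler_sqr ?nnegrE// hM.
Qed.

Lemma snrm_intI r u : 0 <= r -> square_integrable (Io r) u ->
  snrm (Io r) (intI u) <= r * snrm (Io r) u.
Proof.
move=> r0 su; have := snrm_le_bound r0 _ (sqi_intI su) _.
move=> /(_ (Num.sqrt r * snrm (Io r) u)); rewrite mulrA -expr2 sqr_sqrtr//; apply.
  by rewrite mulr_ge0 ?sqrtr_ge0 ?snrm_ge0.
by move=> x /andP[x0 xr]; apply: intI_bound => //; rewrite (ltW x0).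
Qed.

Lemma Rintegral_poly (p : {poly R}) (x y : R) : x <= y ->
  \int[mu]_(s in `[x, y]) p.[s] = (pint p).[y] - (pint p).[x].
Proof.
rewrite le_eqVlt => /orP[/eqP->|xy].
  by rewrite set_itv1 Rintegral_set1 subrr.
rewrite /Rintegral (@continuous_FTC2 _ (horner p) (horner (pint p)))//.
- by apply: continuous_subspaceT; exact: continuous_horner.
- split.
  + by move=> z _; exact: derivable_horner.
  + by apply: cvg_at_right_filter; exact: continuous_horner.
  + by apply: cvg_at_left_filter; exact: continuous_horner.
- by move=> z _; rewrite -derivE deriv_pint.
Qed.

Lemma intI_horner (p : {poly R}) x : 0 <= x -> intI (horner p) x = (pint p).[x].
Proof. by move=> x0; rewrite /intI Rintegral_poly// horner_pint0 subr0. Qed.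

Lemma ip_horner r (p q : {poly R}) : 0 < r ->
  ip (Io r) (horner p) (horner q) = (pint (p * q)).[r].
Proof.
move=> r0; rewrite -intI_horner ?(ltW r0)// /intI /ip.
have i1 := sqi_mul (mIo r) (sqi_horner_Io r p) (sqi_horner_Io r q).
have E : EFin \o (fun x => p.[x] * q.[x]) = EFin \o horner (p * q).
  by apply/funext => z; rewrite /= hornerM.
have sq P : square_integrable [set` `]0, r]] (horner P).
  apply: (@sqi_horner _ r) => //.
    move=> x /=; rewrite !in_itv /= => /andP[h1 ->]; rewrite andbT.
    by rewrite (le_trans _ (ltW h1))// oppr_le0 ltW.
  by rewrite lebesgue_measure_itv/=; case: ifPn => _; rewrite ?ltry// -EFinB ltry.
have i2 := sqi_mul (measurable_itv `]0, r]) (sq p) (sq q).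
rewrite E in i1 i2.
rewrite -Rintegral_itv_obnd_cbnd// -Rintegral_itv_bndo_bndc//.
by apply: eq_Rintegral => z _; rewrite hornerM.
Qed.

End IntegralFromZero.

(** * Uniform polynomial approximation *)

Section Bernstein.
Context {R : realType}.
Implicit Types (x y : R) (F : R -> R).

Let bern n x i : R := ((1 - x) ^+ (n - i) * x ^+ i) *+ 'C(n, i).

(** The generating polynomial of the binomial law. Its value and first two derivatives at 1 give the
    moments needed for the variance. *)
Let genE n x : ((1 - x)%:P + x *: 'X) ^+ n = \sum_(i < n.+1) bern n x i *: 'X^i.
Proof.
rewrite exprDn; apply: eq_bigr => i _.
by rewrite exprZn -polyC_exp -scalerAr mul_polyC scalerA scalerMnl mulrC.
Qed.

Let bern0 n x : \sum_(i < n.+1) bern n x i = 1.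
Proof.
have := congr1 (horner^~ 1) (genE n x).
rewrite hornerE hornerD hornerC hornerZ hornerX mulr1 subrK expr1n => ->.
rewrite horner_sum; apply: eq_bigr => i _.
by rewrite hornerZ hornerXn expr1n mulr1.
Qed.

Let bern1 n x : \sum_(i < n.+1) i%:R * bern n x i = n%:R * x.
Proof.
have := congr1 (fun p => p^`().[1]) (genE n x).
rewrite deriv_exp derivD derivC derivZ derivX add0r -mulr_natl.
rewrite -polyC_natr mul_polyC hornerZ hornerM hornerZ hornerC mulr1 horner_exp.
rewrite hornerD hornerC hornerZ hornerX mulr1 subrK expr1n mulr1 => ->.
rewrite raddf_sum /= horner_sum; apply: eq_bigr => i _.
by rewrite derivZ hornerZ derivXn hornerMn hornerXn expr1n mulrC.
Qed.

Let bern2 n x : \sum_(i < n.+1) (i%:R * (i%:R - 1)) * bern n x i =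
  (n%:R * (n%:R - 1)) * x ^+ 2.
Proof.
have := congr1 (fun p => p^`()^`().[1]) (genE n x).
have nat1 m : m%:R * m.-1%:R = m%:R * (m%:R - 1) :> R.
  by case: m => [|m]; [rewrite !mul0r|rewrite -[in m.+1%:R - 1]natr1 addrK].
rewrite deriv_exp derivD derivC derivZ derivX add0r -scalerAl mul1r derivMn.
rewrite derivZ deriv_exp derivD derivC derivZ derivX add0r hornerMn hornerZ.
rewrite hornerMn hornerM hornerZ hornerC mulr1 horner_exp hornerD hornerC hornerZ.
rewrite hornerX mulr1 subrK expr1n mulr1 => E; rewrite -nat1.
transitivity (x * (x *+ n.-1) *+ n); last by rewrite -(mulr_natr (x * _)) -(mulr_natr x); ring.
rewrite E !raddf_sum /= horner_sum; apply: eq_bigr => i _.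
rewrite !derivZ hornerZ derivXn derivMn derivXn !hornerMn hornerXn expr1n.
by rewrite -mulrnA mulnC natrM nat1 mulrC.
Qed.

Let bern_var n x : \sum_(i < n.+1) (i%:R - n%:R * x) ^+ 2 * bern n x i =
  n%:R * x * (1 - x).
Proof.
transitivity (\sum_(i < n.+1) (i%:R * (i%:R - 1)) * bern n x i +
   (1 - 2 * n%:R * x) * (\sum_(i < n.+1) i%:R * bern n x i) +
   (n%:R * x) ^+ 2 * \sum_(i < n.+1) bern n x i).
  rewrite !mulr_sumr -!big_split /=; apply: eq_bigr => i _; ring.
by rewrite bern0 bern1 bern2; ring.
Qed.

Let bern_ge0 n x i : 0 <= x <= 1 -> 0 <= bern n x i.
Proof.
by move=> /andP[x0 x1]; rewrite mulrn_wge0// mulr_ge0 ?exprn_ge0// subr_ge0.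
Qed.

(** Chebyshev's argument: nodes near [x] contribute at most [e / 2] by uniform continuity, the far
    ones at most [2 * M / (N * d) ^ 2] times the variance [N * x * (1 - x)], which the choice of [n]
    puts below [e / 2]. *)
Lemma weierstrass F : cont_on (V := R^o) 0 1 F -> forall e, 0 < e ->
  exists p : {poly R}, forall x, 0 <= x <= 1 -> `|F x - p.[x]| <= e.
Proof.
move=> cF e e0.
have [M M0 hM] := cont_on_bounded ler01 cF.
have [d d0 hd] := cont_on_unif ler01 cF (divr_gt0 e0 (ltr0n R 2)).
have [n hn] : exists n : nat, (4 * M) / (d ^+ 2 * e) < n.+1%:R.
  by exists (Num.truncn (4 * M / (d ^+ 2 * e))); exact: truncnS_gt.
pose N := n.+1.
have N0 : 0 < N%:R :> R by rewrite ltr0n.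
pose p := \sum_(i < N.+1) F (i%:R / N%:R) *:
  (((1 - 'X) ^+ (N - i) * 'X ^+ i) *+ 'C(N, i)).
exists p => x x01.
have -> : p.[x] = \sum_(i < N.+1) F (i%:R / N%:R) * bern N x i.
  rewrite horner_sum; apply: eq_bigr => i _.
  by rewrite hornerZ hornerMn hornerM !horner_exp hornerD hornerN hornerC hornerX.
have -> : F x = \sum_(i < N.+1) F x * bern N x i by rewrite -mulr_sumr bern0 mulr1.
rewrite -sumrB (le_trans (ler_norm_sum _ _ _))//.
have term (i : 'I_N.+1) : `|F x * bern N x i - F (i%:R / N%:R) * bern N x i| <=
   e / 2 * bern N x i +
   2 * M / (N%:R * d) ^+ 2 * ((i%:R - N%:R * x) ^+ 2 * bern N x i).
  have i01 : 0 <= (i%:R / N%:R : R) <= 1.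
    by rewrite divr_ge0//= ler_pdivrMr// mul1r ler_nat -ltnS.
  rewrite -mulrBl normrM (ger0_norm (bern_ge0 N i x01)) mulrA -mulrDl.
  rewrite ler_wpM2r ?bern_ge0//.
  have [near|far] := ltP `|x - i%:R / N%:R| d.
    rewrite (le_trans (ltW (hd _ _ i01 x01 near)))// lerDl.
    by rewrite mulr_ge0 ?sqr_ge0// divr_ge0 ?sqr_ge0// mulr_ge0// ltW.
  rewrite ler_wpDl ?divr_ge0 ?(ltW e0)//.
  rewrite (@le_trans _ _ (2 * M))//.
    rewrite (le_trans (ler_normB _ _))// mulr2n mulrDl mul1r lerD ?hM//.
  rewrite mulrAC ler_pdivlMr ?exprn_gt0 ?mulr_gt0// ler_wpM2l ?mulr_ge0 ?(ltW M0)//.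
  rewrite -(real_normK (num_real (i%:R - _))) ler_sqr ?nnegrE ?mulr_ge0 ?(ltW d0)//.
  have -> : i%:R - N%:R * x = - (N%:R * (x - i%:R / N%:R)).
    by rewrite mulrBr mulrCA divff ?gt_eqF// mulr1 opprB.
  by rewrite normrN normrM ger0_norm// ler_wpM2l.
rewrite (le_trans (ler_sum _ (fun i _ => term i)))//.
rewrite big_split /= -!mulr_sumr bern0 mulr1 bern_var.
rewrite [leRHS]splitr lerD2l.
have x14 : x * (1 - x) <= 1 by case/andP: x01 => h1 h2; nra.
have -> : 2 * M / (N%:R * d) ^+ 2 * (N%:R * x * (1 - x)) =
    (2 * M / (N%:R * d ^+ 2)) * (x * (1 - x)).
  by field; rewrite !gt_eqF.
apply: (@le_trans _ _ (2 * M / (N%:R * d ^+ 2))).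
  rewrite -[leRHS]mulr1 ler_wpM2l// divr_ge0 ?mulr_ge0 ?(ltW M0) ?(ltW N0) ?(ltW d0)//.
rewrite ler_pdivrMr ?mulr_gt0 ?exprn_gt0//.
move: hn; rewrite ltr_pdivrMr ?mulr_gt0 ?exprn_gt0// -/N => /ltW.
lra.
Qed.

End Bernstein.

(** * Density of polynomial pairs *)

Section Density.
Context {R : realType}.
Notation mu := (@lebesgue_measure R).
Notation I01 := (`]0%R, 1%R[%classic : set R).
Implicit Types (u v : R -> R) (x y : R).

Let mI : measurable I01 := mI01.

Let mu1 : (mu I01 < +oo)%E := mu_Io_lty 1.

Lemma snrm_mono (D : set R) u v : measurable D -> square_integrable D u ->
  square_integrable D v -> (forall x, D x -> `|u x| <= `|v x|) ->
  snrm D u <= snrm D v.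
Proof.
move=> mD su sv uv; rewrite ler_sqrt ?ip_ge0// -lee_fin -!integral_sqrE//.
apply: ge0_le_integral => //.
- by move=> x _; rewrite lee_fin sqr_ge0.
- exact: measurable_EFinX2 su.1.
- exact: measurable_EFinX2 sv.1.
- move=> x Dx; rewrite lee_fin -(real_normK (num_real (u x))).
  by rewrite -(real_normK (num_real (v x))) ler_sqr ?nnegrE// uv.
Qed.

Definition trnc (M x : R) : R := Num.max (- M) (Num.min x M).

Lemma trnc_bound M x : 0 <= M -> `|trnc M x| <= M.
Proof.
move=> M0; rewrite ler_norml /trnc le_max lexx /=.
by rewrite ge_max ge_min lexx orbT andbT lerNl (le_trans _ M0)// oppr_le0.
Qed.

Lemma trnc_id M x : `|x| <= M -> trnc M x = x.
Proof. by rewrite ler_norml /trnc => /andP[h1 h2]; rewrite min_l// max_r. Qed.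

Lemma trnc_lip M x y : `|trnc M x - trnc M y| <= `|x - y|.
Proof.
have mn (a b c : R) : `|Num.min a c - Num.min b c| <= `|a - b|.
  have [ac|ca] := leP a c; have [bc|cb] := leP b c => //.
  - by rewrite !ler0_norm; lra.
  - by rewrite !ger0_norm; lra.
  - by rewrite subrr normr0.
have mx (a b c : R) : `|Num.max c a - Num.max c b| <= `|a - b|.
  have [ac|ca] := leP c a; have [bc|cb] := leP c b => //.
  - by rewrite !ger0_norm; lra.
  - by rewrite !ler0_norm; lra.
  - by rewrite subrr normr0.
exact: le_trans (mx _ _ _) (mn _ _ _).
Qed.

Lemma trnc_cont M : continuous (trnc M).
Proof.
move=> x; apply/cvgrPdist_lt => e e0; near=> y.
apply: le_lt_trans (trnc_lip _ _ _) _.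
by near: y; apply/nbhs_ballP; exists e.
Unshelve. all: by end_near. Qed.

Lemma bounded_dense u e : square_integrable I01 u -> 0 < e ->
  exists2 M, 0 < M & snrm I01 (fun x => u x - trnc M (u x)) <= e.
Proof.
move=> su e0.
have mt M : measurable_fun I01 (fun x => trnc M (u x)).
  by apply: measurableT_comp su.1; apply: continuous_measurable_fun; exact: trnc_cont.
have md M : measurable_fun I01 (fun x => u x - trnc M (u x)).
  exact: measurable_funB su.1 (mt M).
have dle M x : 0 <= M -> `|u x - trnc M (u x)| <= `|u x|.
  move=> M0; have := trnc_lip M (u x) 0; rewrite subr0 (trnc_id (x := 0)) ?normr0// => _.
  have := trnc_lip M (u x) 0; rewrite (trnc_id (x := 0)) ?normr0// !subr0.
  rewrite /trnc; case: (leP (u x) M) => h1; case: (leP (- M)) => h2.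
  - by rewrite subrr normr0.
  - by move=> _; rewrite opprK !ler0_norm; lra.
  - by move=> _; rewrite !ger0_norm; lra.
  - by move=> _; rewrite !ger0_norm; lra.
have ig := sqi_mul mI su su.
have [||||_ _] := @dominated_convergence _ _ R mu I01 mI
   (fun n x => ((u x - trnc n%:R (u x)) ^+ 2)%:E) (cst 0%E) (EFin \o (fun x => u x * u x)) _ _ _ ig _.
- by move=> n; exact: measurable_EFinX2.
- exact: measurable_cst.
- apply/aeW => x _; apply: cvg_near_cst; near=> n.
  rewrite trnc_id ?subrr ?expr0n//; near: n.
  exact: nbhs_infty_ger.
- apply/aeW => x n _ /=; rewrite lee_fin ger0_norm ?sqr_ge0// -expr2.
  rewrite -(real_normK (num_real (u x))) -(real_normK (num_real (_ - _))).
  by rewrite ler_sqr ?nnegrE// dle.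
rewrite integral_cst// mul0e => /fine_cvgP[_ /cvgrPdist_lt].
move=> /(_ (e ^+ 2) (exprn_gt0 _ e0))[N _ /(_ N.+1 (leqnSn N))] /=.
rewrite sub0r normrN => h; exists N.+1%:R; first by rewrite ltr0n.
have sd : square_integrable I01 (fun x => u x - trnc N.+1%:R (u x)).
  split => //; apply: le_lt_trans su.2; apply: ge0_le_integral => //.
  - by move=> x _; rewrite lee_fin sqr_ge0.
  - exact: measurable_EFinX2.
  - exact: measurable_EFinX2 su.1.
  - move=> x _; rewrite lee_fin -(real_normK (num_real (u x))).
    by rewrite -(real_normK (num_real (_ - _))) ler_sqr ?nnegrE// dle.
rewrite -ler_sqr ?nnegrE ?snrm_ge0 ?(ltW e0)// snrm_sqr -lee_fin -integral_sqrE//.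
have := integral_sqrE mI sd; rewrite /integral_sqr => E; move: h; rewrite E /= => h.
by rewrite lee_fin (le_trans (ler_norm _))// ltW.
Unshelve. all: by end_near. Qed.

(** Continuous functions are dense in L^1. After truncation of both functions at height [M],
    [(v - h) ^ 2 <= 2 * M * |v - g|], which turns approximation in L^1 into approximation in L^2. *)
Lemma continuous_dense u e : square_integrable I01 u -> 0 < e ->
  exists g : R -> R, [/\ continuous g, square_integrable I01 g &
     snrm I01 (fun x => u x - g x) <= e].
Proof.
move=> su e0; have e20 : 0 < e / 2 by rewrite divr_gt0.
have [M M0 hM] := bounded_dense su e20.
pose v x := trnc M (u x).
have mv : measurable_fun I01 v.
  by apply: measurableT_comp su.1; apply: continuous_measurable_fun; exact: trnc_cont.
have sv : square_integrable I01 v.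
  by apply: (sqi_bounded (M := M)) => // x _; exact: (trnc_bound _ (ltW M0)).
have iv : mu.-integrable I01 (EFin \o v).
  have := sqi_mul mI sv (sqi_cst 1 mI mu1).
  by congr (is_true (integrable _ _ _)); apply/funext => x /=; rewrite mulr1.
have [g_ [cg ig gl]] := approximation_continuous_integrable mI mu1 iv.
pose h n x := trnc M (g_ n x).
have ch n : continuous (h n).
  move=> x; apply: (@continuous_comp _ _ _ (g_ n) (trnc M) x (cg n x)).
  exact: trnc_cont.
have mh n : measurable_fun I01 (h n).
  by apply: measurable_funTS; exact: continuous_measurable_fun.
have sh n : square_integrable I01 (h n).
  by apply: (sqi_bounded (M := M)) => // x _; exact: (trnc_bound _ (ltW M0)).
have M20 : 0 < 2 * M by rewrite mulr_gt0.
move/fine_cvgP : gl => [_ /cvgrPdist_lt] /(_ (e ^+ 2 / 4 / (2 * M))).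
have e40 : 0 < e ^+ 2 / 4 / (2 * M) by rewrite !divr_gt0// exprn_gt0.
move=> /(_ e40)[N _ /(_ N (leqnn N))] /=; rewrite sub0r normrN => hN.
exists (h N); split => //.
have -> : (fun x => u x - h N x) = (fun x => (u x - v x) + (v x - h N x)).
  by apply/funext => x; rewrite subrKA.
have sB1 := sqiB mI su sv; have sB2 := sqiB mI sv (sh N).
rewrite (le_trans (snrmD mI sB1 sB2))// [e]splitr lerD//.
rewrite -ler_sqr ?nnegrE ?snrm_ge0 ?(ltW e20)// snrm_sqr -lee_fin -integral_sqrE//.
have iB : mu.-integrable I01 (EFin \o (fun x => v x - g_ N x)).
  by have := @integrableB _ _ R mu I01 mI _ _ iv (ig N); apply: eq_integrable.
have iabs : (\int[mu]_(x in I01) `|(v x - g_ N x)%:E|)%E \is a fin_num.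
  by have /integrableP[_ hlt] := iB; rewrite ge0_fin_numE ?integral_ge0.
apply: (@le_trans _ _ (\int[mu]_(x in I01) ((2 * M)%:E * `|(v x - g_ N x)%:E|))%E).
  apply: ge0_le_integral => //.
  - by move=> x _; rewrite lee_fin sqr_ge0.
  - exact: measurable_EFinX2 sB2.1.
  - apply: measurable_funeM; apply: measurableT_comp => //.
    by have /integrableP[] := iB.
  - move=> x _; rewrite -EFinM lee_fin -(real_normK (num_real (_ - _))) expr2.
    have vb : `|v x| <= M by exact: (trnc_bound _ (ltW M0)).
    have vl := trnc_lip M (v x) (g_ N x); rewrite (trnc_id vb) in vl.
    rewrite ler_pM//.
    rewrite (le_trans (ler_normB _ _))// mulr2n mulrDl mul1r.
    by rewrite lerD// trnc_bound// ltW.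
rewrite ge0_integralZl_EFin//; last 2 first.
- by apply: measurableT_comp => //; have /integrableP[] := iB.
- exact: ltW.
rewrite -(fineK iabs) -EFinM lee_fin mulrC -ler_pdivlMr//.
by apply: le_trans (le_trans (ler_norm _) (ltW hN)) _; lra.
Qed.

End Density.

Section Iota.
Context {R : realType}.
Notation I01 := (`]0%R, 1%R[%classic : set R).
Notation V := (Vsp R).
Implicit Types (p q w v : {poly R}) (x : V).

Let mI : measurable I01 := mI01.

Definition iot w : fpair R := (horner (opart w), horner (epart w)).

Lemma iot_inH w : inH (iot w).
Proof. by split; exact: sqi_horner_Io. Qed.

Lemma iotD w v : iot (w + v) = iot w + iot v.
Proof. by congr pair; apply/funext => y; rewrite !fctE /= ?opartD ?epartD hornerD. Qed.

Lemma iotZ k w : iot (k *: w) = k *: iot w.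
Proof. by congr pair; apply/funext => y; rewrite !fctE /= ?opartZ ?epartZ hornerZ. Qed.

Definition iota_ w : V := cls (iot w).

Lemma iota_D w v : iota_ (w + v) = iota_ w + iota_ v.
Proof. by rewrite /iota_ iotD clsDE//; exact: iot_inH. Qed.

Lemma iota_Z k w : iota_ (k *: w) = k *: iota_ w.
Proof. by rewrite /iota_ iotZ clsZE//; exact: iot_inH. Qed.

Lemma iota_B w v : iota_ (w - v) = iota_ w - iota_ v.
Proof. by rewrite -scaleN1r iota_D iota_Z scaleN1r. Qed.

Lemma nrm_le_sum (D : set R) (u : fpair R) : nrm D u <= snrm D u.1 + snrm D u.2.
Proof.
rewrite -ler_sqr ?nnegrE ?nrm_ge0 ?addr_ge0 ?snrm_ge0// nrm_sqr sqrrD /ip2 !snrm_sqr.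
by have := mulr_ge0 (snrm_ge0 D u.1) (snrm_ge0 D u.2); lra.
Qed.

(** Substitute [y = sqrt t]: a polynomial in [t = y ^ 2] is an even polynomial in [y]. *)
Let dense_even (g : R -> R) (e : R) : continuous g -> 0 < e ->
  exists q, forall y : R, 0 <= y <= 1 -> `|g y - q.[y ^+ 2]| <= e.
Proof.
move=> cg e0; have cG : continuous (fun t => g (Num.sqrt t)).
  by move=> t; apply: (@continuous_comp _ _ _ (@Num.sqrt R) g); [exact: sqrt_continuous|exact: cg].
have [q hq] := weierstrass (continuous_cont_on (V := R^o) (a := 0) (b := 1) cG) e0.
exists q => y /andP[y0 y1]; have := hq (y ^+ 2).
rewrite sqrtr_sqr (ger0_norm y0); apply.
by rewrite sqr_ge0/= expr_le1.
Qed.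

(** An odd polynomial is [y] times an even one, so [g] is divided by [y], with the divisor kept
    above [d] to stay continuous. The price is an error on []0, d]] of L^2 norm at most
    [B * sqrt d], and this fixes [d]. *)
Let dense_odd (g : R -> R) (e : R) : continuous g -> square_integrable I01 g -> 0 < e ->
  exists q, snrm I01 (fun y => g y - y * q.[y ^+ 2]) <= e.
Proof.
move=> cg sg e0; have e20 : 0 < e / 2 by rewrite divr_gt0.
have [B B0 hB] := cont_on_bounded ler01 (continuous_cont_on (V := R^o) (a := 0) (b := 1) cg).
pose d : R := Num.min 2^-1 ((e / 2 / B) ^+ 2).
have d0 : 0 < d by rewrite lt_min invr_gt0 exprn_gt0 ?divr_gt0//= ltr0n.
have d1 : d < 1 by rewrite gt_min invf_lt1 ?ltr1n.
pose G (y : R) : R := g y / Num.max y d.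
have mx0 y : 0 < Num.max y d by rewrite lt_max d0 orbT.
have cG : continuous G.
  have cm : continuous (fun y : R => Num.max y d : R).
    move=> {}y; apply/cvgrPdist_lt => e' e'0; near=> z.
    apply: (@le_lt_trans _ _ `|y - z|); last by near: z; apply/nbhs_ballP; exists e'.
    have [yd|dy] := leP y d; have [zd|dz] := leP z d => //.
    - by rewrite subrr normr0.
    - by rewrite !ler0_norm; lra.
    - by rewrite !ger0_norm; lra.
  move=> y; apply: cvgM; first exact: cg.
  by apply: cvgV; [rewrite gt_eqF|exact: cm].
have [q hq] := dense_even cG e20; exists q.
have sy (p : {poly R}) : square_integrable I01 (horner p) by exact: sqi_horner_Io.
have sGq : square_integrable I01 (fun y => y * q.[y ^+ 2]).
  have := sy ('X * (q \Po 'X^2)); congr (square_integrable _ _).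
  by apply/funext => y; rewrite hornerM hornerX horner_comp hornerXn.
have cyG : continuous (fun y : R => (y * G y : R)).
  by move=> y; apply: cvgM; [exact: cvg_id|exact: cG].
have syG : square_integrable I01 (fun y => y * G y).
  apply: (sqi_bounded (M := B)) => //; first exact: mu_Io_lty.
    by apply: measurable_funTS; exact: continuous_measurable_fun.
  move=> y /=; rewrite in_itv /= => /andP[y0 y1].
  rewrite /G mulrCA normrM -[leRHS]mulr1 ler_pM// ?hB ?(ltW y0) ?(ltW y1)//.
  rewrite ger0_norm ?divr_ge0 ?(ltW y0) ?(ltW (mx0 y))//.
  by rewrite ler_pdivrMr// mul1r le_max lexx.
have sB1 := sqiB mI sg syG; have sB2 := sqiB mI syG sGq.
have -> : (fun y => g y - y * q.[y ^+ 2]) =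
   (fun y => (g y - y * G y) + (y * G y - y * q.[y ^+ 2])).
  by apply/funext => y; rewrite subrKA.
rewrite (le_trans (snrmD mI sB1 sB2))// [e]splitr lerD//; last first.
  have := snrm_le_bound (@ler01 R) (ltW e20) sB2; rewrite sqrtr1 mul1r; apply.
  move=> y /andP[y0 y1]; rewrite -mulrBr normrM ger0_norm ?(ltW y0)//.
  rewrite -[leRHS]mul1r ler_pM ?(ltW y0) ?(ltW y1)//.
  by apply: hq; rewrite (ltW y0) (ltW y1).
have sind := sqi_ind 1 d.
apply: (@le_trans _ _ (snrm I01 (fun y => B * ind d y))).
  apply: snrm_mono => //; first exact: sqiZ.
  move=> y /=; rewrite in_itv /= => /andP[y0 y1].
  rewrite /ind indicE mem_setE in_itv /= y0 /=; have [yd|dy] := leP y d.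
    rewrite mulr1 (ger0_norm (ltW B0)) /G max_r// (_ : g y - _ = g y * (1 - y / d)); last by ring.
    rewrite normrM -[leRHS]mulr1 ler_pM ?hB ?(ltW y0) ?(ltW y1)//.
    rewrite ger0_norm ?subr_ge0 ?ler_pdivrMr ?mul1r// lerBlDr lerDl divr_ge0 ?(ltW y0)//.
    exact: ltW.
  rewrite mulr0 normr0 /G max_l ?(ltW dy)// mulrCA divff ?gt_eqF// mulr1 subrr.
  by rewrite normr0.
rewrite snrmZ// ger0_norm ?(ltW B0)//.
have -> : snrm I01 (ind d) = Num.sqrt d.
  have indE : (fun z => ind d z - ind 0 z) = ind d.
    apply/funext => z; rewrite /ind [X in _ - X]indicE mem_setE in_itv /=.
    by case: ltP => // z0; rewrite ?leNgt ?z0 ?subr0// subr0.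
  have E := ip_ind (lexx 0) (ltW d0) d1; rewrite subr0 indE in E.
  by rewrite /snrm E.
rewrite -ler_pdivlMl// mulrC.
have -> : e / 2 / B = Num.sqrt ((e / 2 / B) ^+ 2).
  by rewrite sqrtr_sqr ger0_norm// divr_ge0 ?ltW.
by rewrite ler_sqrt ?sqr_ge0// ge_min lexx orbT.
Unshelve. all: by end_near. Qed.

Lemma dense_iota x e : 0 < e -> exists w, `|x - iota_ w| <= e.
Proof.
move=> e0; pose u := vrep x; have hu : inH u := vrep_inH x.
have e40 : 0 < e / 4 by rewrite divr_gt0.
have [g1 [cg1 sg1 h1]] := continuous_dense hu.1 e40.
have [g2 [cg2 sg2 h2]] := continuous_dense hu.2 e40.
have [q1 hq1] := dense_odd cg1 sg1 e40.
have [q2 hq2] := dense_even cg2 e40.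
pose w := (q2 \Po 'X^2) + 'X * (q1 \Po 'X^2).
have wE y : w.[y] = q2.[y ^+ 2] + y * q1.[y ^+ 2].
  by rewrite /w hornerD hornerM !horner_comp !hornerXn hornerX.
have oE : horner (opart w) = (fun y => y * q1.[y ^+ 2]).
  apply/funext => y; rewrite horner_opart !wE sqrrN; by field.
have eE : horner (epart w) = (fun y => q2.[y ^+ 2]).
  apply/funext => y; rewrite horner_epart !wE sqrrN; by field.
have hw := iot_inH w.
exists w; rewrite -(vrepK x) -/u /iota_ -clsBE// norm_cls; last exact: (inL2B mI hu hw).
rewrite (le_trans (nrm_le_sum _ _))//.
have so : square_integrable I01 (horner (opart w)) by exact: sqi_horner_Io.
have se : square_integrable I01 (horner (epart w)) by exact: sqi_horner_Io.
have tri (u0 g0 p0 : R -> R) : square_integrable I01 u0 -> square_integrable I01 g0 ->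
    square_integrable I01 p0 -> snrm I01 (fun y => u0 y - p0 y) <=
    snrm I01 (fun y => u0 y - g0 y) + snrm I01 (fun y => g0 y - p0 y).
  move=> s1 s2 s3; have := snrmD mI (sqiB mI s1 s2) (sqiB mI s2 s3).
  by congr (snrm _ _ <= _); apply/funext => y; rewrite subrKA.
have k1 : snrm I01 (u - iot w).1 <= e / 4 + e / 4.
  apply: (le_trans (tri _ g1 _ hu.1 sg1 so)); apply: lerD => //.
  by rewrite oE.
have k2 : snrm I01 (u - iot w).2 <= e / 4 + e / 4.
  apply: (le_trans (tri _ g2 _ hu.2 sg2 se)); apply: lerD => //.
  have := snrm_le_bound (@ler01 R) (ltW e40) (sqiB mI sg2 se).
  rewrite sqrtr1 mul1r; apply => y /andP[y0 y1]; rewrite eE.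
  by apply: hq2; rewrite (ltW y0) (ltW y1).
by move: k1 k2; lra.
Qed.

End Iota.

Section Calculus.
Context {R : realType}.
Implicit Types (f g : R -> R) (x : R).

Lemma deriv1_ext f g x df dg : (forall s, f s = g s) -> df = dg ->
  is_derive x (1 : R) f df -> is_derive x (1 : R) g dg.
Proof. by move=> /funext -> ->. Qed.

Lemma deriv1M f g x df dg : is_derive x (1 : R) f df -> is_derive x (1 : R) g dg ->
  is_derive x (1 : R) (fun s => f s * g s) (df * g x + f x * dg).
Proof.
move=> h1 h2; have -> : df * g x + f x * dg = f x *: dg + g x *: df.
  by rewrite [RHS]addrC [g x *: df]mulrC.
exact: is_deriveM.
Qed.

Lemma deriv1Z k f x df : is_derive x (1 : R) f df ->
  is_derive x (1 : R) (fun s => k * f s) (k * df).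
Proof. by move=> h; exact: (is_deriveZ k h). Qed.

Lemma deriv1D f g x df dg : is_derive x (1 : R) f df -> is_derive x (1 : R) g dg ->
  is_derive x (1 : R) (fun s => f s + g s) (df + dg).
Proof. by move=> h1 h2; exact: is_deriveD. Qed.

Lemma deriv1_cst (k x : R) : is_derive x (1 : R) (fun=> k) (0 : R).
Proof. exact: is_derive_cst. Qed.

Lemma deriv1_sum n (h : 'I_n -> R -> R) (dh : 'I_n -> R) x :
  (forall i, is_derive x (1 : R) (h i) (dh i)) ->
  is_derive x (1 : R) (fun s => \sum_(i < n) h i s) (\sum_(i < n) dh i).
Proof.
move=> H; have := is_derive_sum H; congr (is_derive _ _ _ _).
by apply/funext => s; rewrite fct_sumE.
Qed.

Lemma deriv1_comp f g x df dg : is_derive (g x) (1 : R) f df ->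
  is_derive x (1 : R) g dg -> is_derive x (1 : R) (fun s => f (g s)) (df * dg).
Proof. by move=> h1 h2; exact: (is_derive1_comp h1 h2). Qed.

Lemma deriv1_lin k l x : is_derive x (1 : R) (fun s => k * s + l) k.
Proof.
have := deriv1D (deriv1Z k (is_derive_id x (1 : R))) (deriv1_cst l x).
by rewrite mulr1 addr0.
Qed.

Lemma deriv1_expR k x : is_derive x (1 : R) (fun s => expR (k * s)) (k * expR (k * x)).
Proof.
have := deriv1_comp (g := fun s => k * s + 0) (is_derive_expR _) (deriv1_lin k 0 x).
rewrite addr0 mulrC; congr (is_derive _ _ _ _).
by apply/funext => s; rewrite addr0.
Qed.

Lemma deriv1_cont f df x : is_derive x (1 : R) f df -> {for x, continuous f}.
Proof.
move=> h; apply: differentiable_continuous; apply/derivable1_diffP.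
exact: (@ex_derive _ _ _ _ _ _ _ h).
Qed.

Lemma deriv1_mono f f' (a b : R) : a <= b ->
  (forall x, a <= x <= b -> is_derive x (1 : R) f (f' x)) ->
  (forall x, a < x < b -> 0 <= f' x) -> f a <= f b.
Proof.
rewrite le_eqVlt => /orP[/eqP->//|ab] df f0.
have [||z zab e] := @MVT R f f' a b ab.
- by move=> x; rewrite in_itv /= => /andP[h1 h2]; apply: df; rewrite !ltW.
- apply: continuous_in_subspaceT => x /set_mem /=; rewrite in_itv /= => h.
  exact: deriv1_cont (df x h).
rewrite -subr_ge0 e mulr_ge0 ?subr_ge0 ?(ltW ab)//.
by apply: f0; move: zab; rewrite in_itv.
Qed.

Lemma deriv1_eq0 f (a b : R) : a <= b ->
  (forall x, a <= x <= b -> is_derive x (1 : R) f 0) -> f a = f b.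
Proof.
move=> ab df; apply/le_anti/andP; split.
  exact: (deriv1_mono (f' := fun=> 0) ab df).
rewrite -lerN2; apply: (deriv1_mono (f := fun x => - f x) (f' := fun=> 0) ab) => // x xab.
have := deriv1Z (-1) (df x xab); rewrite mulr0; congr (is_derive _ _ _ _).
by apply/funext => s; rewrite mulN1r.
Qed.

End Calculus.

(** * The energy estimate for the polynomial flow *)

Section Energy.
Context {R : realType}.
Variables (a c : R).
Hypothesis (a0 : 0 <= a) (c0 : 0 <= c).
Notation I01 := (`]0%R, 1%R[%classic : set R).
Implicit Types (p q w v : {poly R}).

Let mI : measurable I01 := mI01.

Definition pip w v : R := ip2 I01 (iot w) (iot v).

Lemma pipE w v : pip w v = (pint (opart w * opart v + epart w * epart v)).[1].
Proof. by rewrite /pip /ip2 /= !ip_horner// pintD hornerD. Qed.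

Lemma pipC w v : pip w v = pip v w.
Proof. by rewrite /pip ip2C. Qed.

Lemma pipDl w w' v : pip (w + w') v = pip w v + pip w' v.
Proof. by rewrite /pip iotD ip2Dl//; exact: iot_inH. Qed.

Lemma pipZl k w v : pip (k *: w) v = k * pip w v.
Proof. by rewrite /pip iotZ ip2Zl//; exact: iot_inH. Qed.

Lemma pip_ge0 w : 0 <= pip w w. Proof. exact: ip2_ge0. Qed.

Lemma norm_iota w : `|iota_ w| = Num.sqrt (pip w w).
Proof. by rewrite norm_cls//; exact: iot_inH. Qed.

Lemma opart_Lp w : opart (Lp a c w) =
  (epart w)^`() - 'X * (opart w)^`() - a *: opart w + c *: pint (epart w).
Proof.
apply/polyP => n; rewrite coef_opart coef_Lp coefD !coefB !coefZ coefXM !coef_deriv.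
rewrite coef_pint; case: n => [|n] /=.
  by rewrite !coef_opart !coef_epart /= mul0rn; ring.
rewrite !coef_epart !coef_opart /=.
by case: odd => /=; rewrite ?mul0rn -?(mulr_natl w`_n.+2) -?(mulr_natl w`_n.+1); ring.
Qed.

Lemma epart_Lp w : epart (Lp a c w) =
  (opart w)^`() - 'X * (epart w)^`() - a *: epart w.
Proof.
apply/polyP => n; rewrite coef_epart coef_Lp !coefB !coefZ coefXM !coef_deriv.
case: n => [|n] /=.
  by rewrite !coef_opart !coef_epart /=; ring.
rewrite !coef_epart !coef_opart /=.
by case: odd => /=; rewrite ?mul0rn -?(mulr_natl w`_n.+2) -?(mulr_natl w`_n.+1); ring.
Qed.

Lemma pint_sqr_le p : (pint (pint p * pint p)).[1] <= (pint (p * p)).[1].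
Proof.
have sp : square_integrable I01 (horner p) by exact: sqi_horner_Io.
have spp : square_integrable I01 (horner (pint p)) by exact: sqi_horner_Io.
have := snrm_intI (@ler01 R) sp; rewrite mul1r.
have -> : snrm I01 (intI (horner p)) = snrm I01 (horner (pint p)).
  congr Num.sqrt; apply: eq_Rintegral => y /set_mem /=; rewrite in_itv /= => /andP[y0 _].
  by rewrite intI_horner// ltW.
by rewrite /snrm ler_sqrt ?ip_ge0// !ip_horner.
Qed.

(** Up to terms of order zero the integrand is the derivative of [e * o - x (o ^ 2 + e ^ 2) / 2].
    This vanishes at 0 because [o] is odd, and equals [- (e - o) ^ 2 / 2] at 1: energy can only
    leave through the boundary of the lightcone. The integral term costs at most [c], since
    integration from 0 is a contraction of L^2. *)
Lemma energy_poly w : pip (Lp a c w) w <= (1 + c) * pip w w.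
Proof.
rewrite !pipE opart_Lp epart_Lp; set o := opart w; set e := epart w.
set U := pint e.
have -> : (e^`() - 'X * o^`() - a *: o + c *: U) * o +
    (o^`() - 'X * e^`() - a *: e) * e =
    ((e * o) - 2^-1 *: ('X * (o * o + e * e)))^`() +
    (2^-1 - a) *: (o * o + e * e) + c *: (U * o).
  rewrite derivB derivM derivZ derivM derivX derivD !derivM -!mul_polyC.
  have -> : (2^-1 - a)%:P = (2^-1)%:P - a%:P :> {poly R} by rewrite polyCB.
  have h : (2^-1)%:P + (2^-1)%:P = 1 :> {poly R}.
    by rewrite -polyCD -polyC1; congr polyC; field.
  have -> : 'X * o^`() = ((2^-1)%:P + (2^-1)%:P) * ('X * o^`()) by rewrite h mul1r.
  have -> : 'X * e^`() = ((2^-1)%:P + (2^-1)%:P) * ('X * e^`()) by rewrite h mul1r.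
  ring.
rewrite !pintD !hornerD pint_deriv !pintZ !hornerZ hornerD hornerN hornerC.
set F := e * o - _.
have F1 : F.[1] <= 0.
  have -> : F.[1] = - (2^-1 * (e.[1] - o.[1]) ^+ 2).
    by rewrite /F !(hornerD, hornerN, hornerM, hornerZ, hornerX); field.
  by rewrite oppr_le0 mulr_ge0 ?sqr_ge0// invr_ge0.
have F0 : F.[0] = 0.
  rewrite /F !(hornerD, hornerN, hornerM, hornerZ, hornerX); suff -> : o.[0] = 0 by ring.
  by rewrite horner_opart oppr0 subrr mul0r.
set T := (pint (o * o + e * e)).[1].
have TE : T = (pint (o * o)).[1] + (pint (e * e)).[1] by rewrite /T pintD hornerD.
have psq p : 0 <= (pint (p * p)).[1] by rewrite -ip_horner// ip_ge0.
have Uo : (pint (U * o)).[1] <= T.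
  have := psq (U - o).
  have -> : (U - o) * (U - o) = U * U + o * o + (-2%:R) *: (U * o).
    by rewrite -mul_polyC polyCN polyC_natr; ring.
  rewrite !pintD !hornerD pintZ hornerZ => h.
  have := pint_sqr_le e; rewrite -/U; have := psq U; have := psq o; have := psq e.
  rewrite TE; lra.
have T0 : 0 <= T by rewrite TE addr_ge0.
have h1 : c * (pint (U * o)).[1] <= c * T by rewrite ler_wpM2l.
have h2 : 0 <= a * T by rewrite mulr_ge0.
rewrite F0 subr0 -TE; move: F1 h1 h2 T0; lra.
Qed.

Lemma flow_pip k W W' t : flow a c k.*2 W -> flow a c k.*2 W' ->
  is_derive t (1 : R) (fun s => pip (W s) (W' s))
    (pip (Lp a c (W t)) (W' t) + pip (W t) (Lp a c (W' t))).
Proof.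
set N := k.*2; move=> [sW dW] [sW' dW'].
pose be (i j : nat) := pip 'X^i 'X^j.
have polE p : (size p <= N)%N -> p = \sum_(i < N) p`_i *: 'X^i.
  move=> sp; rewrite -[LHS](coefK p) poly_def.
  rewrite (big_ord_widen N (fun i => p`_i *: 'X^i) sp) big_mkcond /=.
  apply: eq_bigr => i _; case: ifPn => //; rewrite -leqNgt => h.
  by rewrite (nth_default 0 h) scale0r.
have pip_suml (F : 'I_N -> {poly R}) v : pip (\sum_i F i) v = \sum_i pip (F i) v.
  elim/big_rec2: _ => [|i y1 y2 _ <-]; last by rewrite pipDl.
  by rewrite -(scale0r 0) pipZl mul0r.
have pipS p q : (size p <= N)%N -> (size q <= N)%N ->
    pip p q = \sum_(i < N) \sum_(j < N) p`_i * q`_j * be i j.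
  move=> sp sq; rewrite {1}(polE p sp) pip_suml; apply: eq_bigr => i _.
  rewrite pipZl pipC {1}(polE q sq) pip_suml mulr_sumr; apply: eq_bigr => j _.
  by rewrite pipZl pipC mulrA.
have sL s : (size (Lp a c (W s)) <= N)%N by exact: size_Lp.
have sL' s : (size (Lp a c (W' s)) <= N)%N by exact: size_Lp.
rewrite (pipS _ _ (sL t) (sW' t)) (pipS _ _ (sW t) (sL' t)).
have -> : (fun s => pip (W s) (W' s)) =
    (fun s => \sum_(i < N) \sum_(j < N) be i j * ((W s)`_i * (W' s)`_j)).
  apply/funext => s; rewrite pipS//; apply: eq_bigr => i _.
  by apply: eq_bigr => j _; rewrite mulrC.
rewrite -big_split /=; apply: deriv1_sum => i.
rewrite -big_split /=; apply: deriv1_sum => j.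
rewrite -mulrDl mulrC; apply: deriv1Z; exact: deriv1M.
Qed.

Lemma flow_growth k W t : flow a c k.*2 W -> 0 <= t ->
  `|iota_ (W t)| <= expR ((1 + c) * t) * `|iota_ (W 0)|.
Proof.
move=> fW t0; pose phi s := pip (W s) (W s).
(* With this exponent [exp(m s) * phi s] is nonincreasing. *)
pose m := - (2 * (1 + c)).
have dphi s : is_derive s (1 : R) (fun r => - (expR (m * r) * phi r))
    (- (m * expR (m * s) * phi s + expR (m * s) * (2 * pip (Lp a c (W s)) (W s)))).
  have h := deriv1M (deriv1_expR m s) (flow_pip s fW fW).
  apply: deriv1_ext (deriv1Z (-1) h) => [r|]; first by rewrite mulN1r.
  by rewrite (pipC (W s) (Lp _ _ _)) /phi; ring.
have := deriv1_mono t0 (fun s _ => dphi s) _; rewrite mulr0 expR0 mul1r lerN2.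
have -> : (forall x, 0 < x < t -> 0 <= - (m * expR (m * x) * phi x +
    expR (m * x) * (2 * pip (Lp a c (W x)) (W x)))) <-> True.
  split => // _ s _; rewrite oppr_ge0.
  have -> : m * expR (m * s) * phi s + expR (m * s) * (2 * pip (Lp a c (W s)) (W s)) =
    expR (m * s) * 2 * (pip (Lp a c (W s)) (W s) - (1 + c) * phi s) by rewrite /m; ring.
  rewrite mulr_ge0_le0 ?mulr_ge0 ?expR_ge0// subr_le0; exact: energy_poly.
move=> /(_ Logic.I) h.
rewrite !norm_iota -[expR _]ger0_norm ?expR_ge0// -sqrtr_sqr -sqrtrM ?sqr_ge0//.
rewrite ler_sqrt ?mulr_ge0 ?sqr_ge0 ?pip_ge0//.
have -> : expR ((1 + c) * t) ^+ 2 = (expR (m * t))^-1.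
  by rewrite -expRN -expRM_natl /m; congr expR; ring.
by rewrite ler_pdivlMl ?expR_gt0.
Qed.

End Energy.

(** * Semigroups and their generators *)

Section AbstractSemigroup.
Context {R : realType} {V : completeNormedModType R}.
Implicit Types (S : R -> V -> V) (x y z : V) (t s T : R).

(** The bound is required locally uniformly in time. The semigroups of the notion of solution are
    bounded at each time separately; for them it comes from the uniform boundedness principle in
    [sg_local_bound]. *)
Record semigroupV S : Prop := {
  sgV_add : forall t x y, 0 <= t -> S t (x + y) = S t x + S t y;
  sgV_scale : forall t k x, 0 <= t -> S t (k *: x) = k *: S t x;
  sgV_bound : forall T, exists2 K, 0 < K &
    forall t x, 0 <= t <= T -> `|S t x| <= K * `|x|;
  sgV_0 : forall x, S 0 x = x;
  sgV_D : forall s t x, 0 <= s -> 0 <= t -> S (s + t) x = S s (S t x);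
  sgV_cont0 : forall x e, 0 < e -> exists2 d, 0 < d &
    forall h, 0 < h < d -> `|S h x - x| <= e }.

Definition genV S x y := forall e, 0 < e -> exists2 d, 0 < d &
  forall h, 0 < h < d -> `|S h x - x - h *: y| <= e * h.

Section Theory.
Variable S : R -> V -> V.
Hypothesis hS : semigroupV S.

Lemma sgV_sub t x y : 0 <= t -> S t (x - y) = S t x - S t y.
Proof.
by move=> t0; rewrite -(scaleN1r y) (sgV_add hS)// (sgV_scale hS)// scaleN1r.
Qed.

Lemma sgV_cont T x : cont_on 0 T (S^~ x).
Proof.
move=> t /andP[t0 tT] e e0; have [K K0 hK] := sgV_bound hS T.
have [d d0 hd] := sgV_cont0 hS x (divr_gt0 e0 (mulr_gt0 (ltr0n R 2) K0)).
have K0' : 0 <= K := ltW K0.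
have main u v : 0 <= u -> u < v -> v <= T -> v - u < d -> `|S v x - S u x| < e.
  move=> u0 uv vT vud; have -> : S v x = S u (S (v - u) x).
    by rewrite -(sgV_D hS) ?subr_ge0 ?(ltW uv)// addrC subrK.
  rewrite -sgV_sub// (le_lt_trans (hK _ _ _))//.
    by rewrite u0 (le_trans (ltW uv) vT).
  rewrite (@le_lt_trans _ _ (K * (e / (2 * K))))//.
    by rewrite ler_wpM2l// hd// subr_gt0 uv.
  have -> : K * (e / (2 * K)) = e / 2 by field; rewrite gt_eqF.
  by rewrite ltr_pdivrMr// ltr_pMr// ltr1n.
exists d => // s /andP[s0 sT]; rewrite ltr_norml => /andP[h1 h2].
have [st|ts|->] := ltgtP s t; last by rewrite subrr normr0.
  by rewrite distrC main//; lra.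
by rewrite main.
Qed.

Lemma cont_on_sgV a b t (f : R -> V) : b <= t -> cont_on a b f ->
  cont_on a b (fun s => S (t - s) (f s)).
Proof.
move=> bt cf s sab e e0; have /andP[as_ sb] := sab.
have [K K0 hK] := sgV_bound hS (t - a).
have e20 : 0 < e / 2 by rewrite divr_gt0.
have [d d0 hd] := cf s sab _ (divr_gt0 e20 K0).
have ts : 0 <= t - s <= t - a by lra.
have [d' d'0 hd'] := sgV_cont (f s) ts e20.
exists (Num.min d d'); first by rewrite lt_min d0.
move=> u /andP[au ub]; rewrite lt_min => /andP[ud ud'].
have tu : 0 <= t - u <= t - a by lra.
have -> : S (t - u) (f u) - S (t - s) (f s) =
    (S (t - u) (f u - f s)) + (S (t - u) (f s) - S (t - s) (f s)).
  by rewrite sgV_sub ?subrKA//; case/andP: tu.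
rewrite (le_lt_trans (ler_normD _ _))// [e]splitr ltrD//.
  rewrite (le_lt_trans (hK _ _ tu))// mulrC -ltr_pdivlMr// hd//.
  by rewrite au.
apply: hd' => //; have -> : t - u - (t - s) = s - u by ring.
by rewrite distrC.
Qed.

Lemma gen_orbit x y t : 0 <= t -> genV S x y -> genV S (S t x) (S t y).
Proof.
move=> t0 g e e0; have [K K0 hK] := sgV_bound hS t.
have [d d0 hd] := g _ (divr_gt0 e0 K0); exists d => // h h0.
have hh : 0 <= h by case/andP: h0 => /ltW.
have -> : S h (S t x) - S t x - h *: S t y = S t (S h x - x - h *: y).
  by rewrite !sgV_sub// (sgV_scale hS)// -!(sgV_D hS)// (addrC t).
rewrite (le_trans (hK _ _ _))// ?t0 ?lexx//.
by have := ler_wpM2l (ltW K0) (hd h h0); rewrite mulrA mulrCA divff ?mulr1// gt_eqF.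
Qed.

(** With its converse [int_gen] this replaces the generator by an integral equation, in which limits
    and linear combinations can be taken directly. The orbit and the integral have the same right
    derivative, so their difference is constant. *)
Lemma gen_int x y t : 0 <= t -> genV S x y -> S t x = x + Vint (S^~ y) 0 t.
Proof.
move=> t0 g; have cy := sgV_cont (T := t) y.
have Py := Vint_prim cy.
have := dini_mvt (f := fun s => S s x - Vint (S^~ y) 0 s) (g := fun=> 0) t0.
rewrite Vint_xx (sgV_0 hS) !subr0 => H.
have : `|S t x - Vint (S^~ y) 0 t - x| <= 0; last first.
 
  rewrite normr_le0 subr_eq0 => /eqP E.
  by rewrite -[X in _ = X + _]E subrK.
apply: H.
- apply: cont_onD; first exact: sgV_cont.
  move=> s hs e e0; have [d d0 hd] := prim_cont Py hs e0.
  by exists d => // u hu us; rewrite -opprD normrN; exact: hd.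
- by move=> s _ e e0; exists 1 => // u _ _; rewrite subrr normr0.
- move=> s /andP[s0 st] e e0; have e20 : 0 < e / 2 by rewrite divr_gt0.
  have [d d0 hd] := gen_orbit s0 g e20.
  have [|d' d'0 hd'] := Py s _ _ e20; first by rewrite s0 ltW.
  exists (Num.min d d'); first by rewrite lt_min d0.
  move=> u /andP[su]; rewrite -ltrBlDl lt_min => /andP[ud ud'] ut.
  have us0 : 0 < u - s by rewrite subr_gt0.
  have h1 : `|S u x - S s x - (u - s) *: S s y| <= e / 2 * (u - s).
    have := hd (u - s); rewrite us0 ud -(sgV_D hS) ?(ltW us0)// subrK; exact.
  have h2 := hd' u; rewrite (le_trans s0 (ltW su)) ut gtr0_norm// in h2.
  have {}h2 := h2 isT ud'.
  have -> : S u x - Vint (S^~ y) 0 u - (S s x - Vint (S^~ y) 0 s) =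
     (S u x - S s x - (u - s) *: S s y) -
     (Vint (S^~ y) 0 u - Vint (S^~ y) 0 s - (u - s) *: S s y) by linmod R.
  rewrite (le_trans (ler_normB _ _))//; move: h1 h2; lra.
Qed.

Lemma int_gen x y : (forall t, 0 <= t -> S t x = x + Vint (S^~ y) 0 t) -> genV S x y.
Proof.
move=> H e e0; have [d d0 hd] := sgV_cont0 hS y e0.
exists d => // h /andP[h0 hd_]; rewrite (H _ (ltW h0)) [x + _]addrC addrK.
have := @Vint_near _ _ (S^~ y) 0 h y e (ltW h0) (sgV_cont (T := h) y).
rewrite subr0; apply => s /andP[s0 sh].
move: s0; rewrite le_eqVlt => /orP[/eqP <-|s0]; first by rewrite (sgV_0 hS) subrr normr0 ltW.
by apply: hd; rewrite s0 (le_lt_trans sh).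
Qed.

(** Both sides of the integral equation depend continuously on the pair [(x, y)]. *)
Lemma gen_closed x y : (forall e, 0 < e -> exists x' y', [/\ genV S x' y',
   `|x - x'| <= e & `|y - y'| <= e]) -> genV S x y.
Proof.
move=> H; apply: int_gen => t t0; have [K K0 hK] := sgV_bound hS t.
apply/eqP; rewrite -subr_eq0 -normr_le0; apply/ler_addgt0Pr => e e0; rewrite add0r.
have C0 : 0 < K + 1 + K * t by rewrite ltr_wpDr ?addr_gt0// mulr_ge0// ltW.
have [x' [y' [g hx hy]]] := H _ (divr_gt0 e0 C0).
have E := gen_int t0 g.
have -> : S t x - (x + Vint (S^~ y) 0 t) =
    S t (x - x') - (x - x') - Vint (fun s => S s (y - y')) 0 t.
  rewrite sgV_sub// E.
  have -> : Vint (fun s => S s (y - y')) 0 t = Vint (S^~ y) 0 t - Vint (S^~ y') 0 t.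
    rewrite -VintB//; [|exact: sgV_cont|exact: sgV_cont].
    by apply: eq_Vint => // s /andP[s0 _]; rewrite sgV_sub.
  by linmod R.
rewrite (le_trans (ler_normB _ _))// (le_trans (lerD (ler_normB _ _) (lexx _)))//.
have h1 : `|S t (x - x')| <= K * (e / (K + 1 + K * t)).
  by rewrite (le_trans (hK _ _ _)) ?t0 ?lexx// ler_wpM2l// ltW.
have h2 : `|Vint (fun s => S s (y - y')) 0 t| <= K * (e / (K + 1 + K * t)) * (t - 0).
  apply: Vint_le_cst => //; first exact: sgV_cont.
  by move=> s hs; rewrite (le_trans (hK _ _ hs))// ler_wpM2l// ltW.
rewrite subr0 in h2.
rewrite (le_trans (lerD (lerD h1 hx) h2))// le_eqVlt; apply/orP; left; apply/eqP.
by field; rewrite gt_eqF.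
Qed.

Lemma gen_lin k x y x' y' : genV S x y -> genV S x' y' ->
  genV S (k *: x + x') (k *: y + y').
Proof.
move=> g g'; apply: int_gen => t t0.
rewrite (sgV_add hS)// (sgV_scale hS)// (gen_int t0 g) (gen_int t0 g').
have c1 := sgV_cont (T := t) y; have c2 := sgV_cont (T := t) y'.
have -> : Vint (S^~ (k *: y + y')) 0 t = k *: Vint (S^~ y) 0 t + Vint (S^~ y') 0 t.
  have <- : Vint (fun s => k *: S s y) 0 t = k *: Vint (S^~ y) 0 t by rewrite VintZ.
  rewrite -VintD//.
    by apply: eq_Vint => // s /andP[s0 _]; rewrite (sgV_add hS)// (sgV_scale hS).
  have := prim_cont (primZ k (Vint_prim c1)) => _ s hs e e0.
  have k1 : 0 < `|k| + 1 by rewrite ltr_wpDl.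
  have [d d0 hd] := c1 s hs _ (divr_gt0 e0 k1); exists d => // u hu us.
  have := hd u hu us; rewrite ltr_pdivlMr// => h.
  rewrite -scalerBr normrZ (le_lt_trans _ h)// mulrC ler_wpM2l// lerDl//.
by linmod R.
Qed.

(** Start from [(1 + h lam) x = S h x - (S h x - x - h y) + h (lam x - y)], bound [S h x] by the
    growth hypothesis, multiply by [1 - M h <= exp(- M h)] and divide by [h]. *)
Lemma gen_resolvent (M lam : R) x y : 0 <= M -> 0 <= lam ->
  (forall h, 0 <= h -> `|S h x| <= expR (M * h) * `|x|) ->
  genV S x y -> (lam - M) * `|x| <= `|lam *: x - y|.
Proof.
move=> M0 l0 B g; apply/ler_addgt0Pr => e e0.
have e20 : 0 < e / 2 by rewrite divr_gt0.
have [d d0 hd] := g _ e20.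
(* For [h] below [Num.min e 1 / Q] this makes [M h < 1] and [h M lam |x| <= e / 2], which takes care
   of the term of second order in [h]. *)
pose Q := 2 * (M * lam * `|x| + M + 1).
have Q0 : 0 < Q by rewrite mulr_gt0// ltr_wpDl// addr_ge0// !mulr_ge0.
have q0 : 0 < Num.min e 1 / Q by rewrite divr_gt0// lt_min e0 ltr01.
pose h := Num.min d (Num.min e 1 / Q) / 2.
have h0 : 0 < h by rewrite divr_gt0// lt_min d0.
have : h < Num.min d (Num.min e 1 / Q).
  by rewrite /h ltr_pdivrMr// ltr_pMr ?ltr1n// lt_min d0.
rewrite lt_min ltr_pdivlMr// lt_min => /and3P[hd1 hQe hQ1].
have := hd h; rewrite h0 hd1 => /(_ isT) E.
have h0' := ltW h0.
have hMx : 0 <= h * (M * lam * `|x|) by apply: mulr_ge0 => //; rewrite !mulr_ge0.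
have hM : 0 <= h * M by rewrite mulr_ge0.
have Mh : M * h < 1 by move: hQ1; rewrite /Q; lra.
set z := lam *: x - y.
have E1 : (1 + h * lam) * `|x| <= `|S h x| + e / 2 * h + h * `|z|.
  have -> : (1 + h * lam) * `|x| = `|(1 + h * lam) *: x|.
    by rewrite normrZ gtr0_norm// ltr_pwDl// mulr_ge0// ltW.
  have -> : (1 + h * lam) *: x = S h x - (S h x - x - h *: y) + h *: z.
    by rewrite /z; linmod R.
  rewrite (le_trans (ler_normD _ _))// normrZ (gtr0_norm h0) lerD2r.
  by rewrite (le_trans (ler_normB _ _))// lerD.
have E2 : expR (M * h) * (1 - M * h) <= 1.
  have := expR_ge1Dx (- (M * h)); rewrite expRN => E2.
  by rewrite mulrC -ler_pdivlMr ?expR_gt0// div1r.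
have E3 := B h (ltW h0).
have Mh1 : 0 <= 1 - M * h by rewrite subr_ge0 ltW.
have E4 : (1 - M * h) * `|S h x| <= `|x|.
  rewrite (le_trans (ler_wpM2l Mh1 E3))// mulrA ler_piMl// mulrC.
  by [].
have E5 := ler_wpM2l Mh1 E1.
have E6 : 0 <= M * h * (e / 2 * h + h * `|z|).
  by rewrite mulr_ge0// ?addr_ge0// mulr_ge0// ltW.
rewrite -(ler_pM2l h0).
have E7 : h * (h * (M * lam * `|x|)) <= h * (e / 2).
  rewrite ler_wpM2l ?(ltW h0)//; move: hQe; rewrite /Q; lra.
move: E4 E5 E6 E7; rewrite -/z; lra.
Qed.

End Theory.

(** For [x'] in the domain of the first generator, [S2 (t - s) (S1 s x')] has right derivative 0 in
    [s], so its values at 0 and [t] agree. Boundedness and density of the domain extend this to all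
    vectors. *)
Lemma sgV_unique S1 S2 : semigroupV S1 -> semigroupV S2 ->
  (forall x y, genV S1 x y -> genV S2 x y) ->
  (forall x e, 0 < e -> exists x' y', genV S1 x' y' /\ `|x - x'| <= e) ->
  forall t x, 0 <= t -> S1 t x = S2 t x.
Proof.
move=> h1 h2 g12 dn t x t0.
have dom x' y' : genV S1 x' y' -> S1 t x' = S2 t x'.
  move=> g; have := dini_mvt (f := fun s => S2 (t - s) (S1 s x')) (g := fun=> 0) t0.
  rewrite !subr0 subrr (sgV_0 h1) (sgV_0 h2) => H.
  suff : `|S1 t x' - S2 t x'| <= 0 by rewrite normr_le0 subr_eq0 => /eqP.
  apply: H.
  - by apply: cont_on_sgV => //; exact: sgV_cont.
  - by move=> s _ e e0; exists 1 => // u _ _; rewrite subrr normr0.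
  - move=> s /andP[s0 st] e e0; have [K K0 hK] := sgV_bound h2 t.
    have k0 : 0 < e / (2 * K) by rewrite divr_gt0// mulr_gt0.
    have G1 := gen_orbit h1 s0 g; have G2 := g12 _ _ G1.
    have [d d0 hd] := G1 _ k0; have [d' d'0 hd'] := G2 _ k0.
    exists (Num.min d d'); first by rewrite lt_min d0.
    move=> u /andP[su]; rewrite -ltrBlDl lt_min => /andP[ud ud'] ut.
    have us0 : 0 < u - s by rewrite subr_gt0.
    have -> : S1 u x' = S1 (u - s) (S1 s x').
      by rewrite -(sgV_D h1) ?(ltW us0)// subrK.
    have -> : S2 (t - s) (S1 s x') = S2 (t - u) (S2 (u - s) (S1 s x')).
      rewrite -(sgV_D h2) ?subr_ge0 ?(ltW us0)//; last exact: ltW.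
      by congr (S2 _ _); ring.
    rewrite -(sgV_sub h2) ?subr_ge0//.
    have tu : 0 <= t - u <= t by lra.
    rewrite add0r (le_trans (hK _ _ tu))//.
    have := hd (u - s); rewrite us0 => /(_ ud) a1.
    have := hd' (u - s); rewrite us0 => /(_ ud') a2.
    set z := S1 s x' in a1 a2 *; set z' := S1 s y' in a1 a2.
    have -> : S1 (u - s) z - S2 (u - s) z = (S1 (u - s) z - z - (u - s) *: z') -
       (S2 (u - s) z - z - (u - s) *: z') by linmod R.
    have := le_trans (ler_normB _ _) (lerD a1 a2) => a3.
    have := ler_wpM2l (ltW K0) a3.
    have -> : K * (e / (2 * K) * (u - s) + e / (2 * K) * (u - s)) = e * (u - s).
      by field; rewrite gt_eqF.
    exact.
apply/eqP; rewrite -subr_eq0 -normr_le0; apply/ler_addgt0Pr => e e0; rewrite add0r.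
have [K K0 hK] := sgV_bound h1 t; have [K' K'0 hK'] := sgV_bound h2 t.
have C0 : 0 < K + K' by rewrite addr_gt0.
have [x' [y' [g xx]]] := dn x _ (divr_gt0 e0 C0).
have E := dom _ _ g; have tt : 0 <= t <= t by rewrite t0 lexx.
have -> : S1 t x - S2 t x = S1 t (x - x') - S2 t (x - x').
  by rewrite (sgV_sub h1)// (sgV_sub h2)// E; linmod R.
rewrite (le_trans (ler_normB _ _))// (le_trans (lerD (hK _ _ tt) (hK' _ _ tt)))//.
by rewrite -mulrDl mulrC -ler_pdivlMr.
Qed.

(** If no bound held on any [[0, d]], there would be times [q n <= 1 / (n + 1)] with operators of
    norm above [n + 1], while strong continuity at 0 bounds them on each vector: this contradicts
    Banach-Steinhaus. The semigroup law extends a bound on [[0, d]] to [[0, T]]. *)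
Lemma sg_local_bound S :
  (forall t k x y, 0 <= t -> S t (k *: x + y) = k *: S t x + S t y) ->
  (forall t, 0 <= t -> exists M : R, forall x, `|S t x| <= M * `|x|) ->
  (forall x, S 0 x = x) ->
  (forall s t x, 0 <= s -> 0 <= t -> S (s + t) x = S s (S t x)) ->
  (forall x e, 0 < e -> exists2 d, 0 < d & forall h, 0 < h < d -> `|S h x - x| <= e) ->
  forall T, exists2 K, 0 < K & forall t x, 0 <= t <= T -> `|S t x| <= K * `|x|.
Proof.
move=> Sl Sb S0 SD Sc.
have SZ t k x : 0 <= t -> S t (k *: x) = k *: S t x.
  move=> t0; have Z0 : S t 0 = 0.
    have := Sl t (-1) 0 0 t0; rewrite scaler0 addr0 => {1}->.
    by rewrite scaleN1r addNr.
  by rewrite -[k *: x]addr0 Sl// Z0 addr0.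
have [d d0 [K K1 hK]] : exists2 d, 0 < d & exists2 K, 1 <= K &
    forall t x, 0 <= t <= d -> `|S t x| <= K * `|x|.
  apply: contrapT => H.
  have ex (n : nat) : exists q : R * V, [/\ 0 <= q.1, q.1 <= n.+1%:R^-1 &
      ~ `|S q.1 q.2| <= n.+1%:R * `|q.2| ].
    apply: contrapT => H2; apply: H; exists (n.+1%:R^-1) => //.
    exists n.+1%:R; first by rewrite ler1n.
    move=> t x /andP[t0 tn]; apply: contrapT => H3; apply: H2.
    by exists (t, x).
  have [q hq] := choice ex.
  pose F : set (V -> V) := [set S (q n).1 | n in setT].
  have UB : uniform_bounded F.
    apply: Banach_Steinhauss.
    - move=> f [n _ <-]; have [q0 _ _] := hq n; split.
        move=> r; have [M hM] := Sb _ q0; exists (`|M| * `|r|) => x xr.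
        rewrite (le_trans (hM x))// (le_trans (ler_norm _))// normrM normr_id.
        by rewrite ler_wpM2l// (le_trans xr (ler_norm _)).
      by move=> k x y; rewrite Sl.
    - move=> x; have [d d0 hd] := Sc x 1 ltr01.
      pose N := Num.truncn d^-1.
      have [M_ hM_] : exists M_ : nat -> R, forall n, `|S (q n).1 x| <= M_ n.
        by exists (fun n => `|S (q n).1 x|).
      exists (`|x| + 1 + \sum_(n < N.+1) `|M_ n|) => f [n _ <-].
      have S0' : 0 <= \sum_(n < N.+1) `|M_ n| by apply: sumr_ge0.
      have [nN|Nn] := ltnP n N.+1.
        rewrite (le_trans (hM_ n))// (le_trans (ler_norm _))//.
        rewrite (bigD1 (Ordinal nN))//= addrCA lerDl addr_ge0// ?addr_ge0//.
        exact: sumr_ge0.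
      have [q0 qn _] := hq n.
      rewrite -[S (q n).1 x](subrK x) (le_trans (ler_normD _ _))//.
      suff : `|S (q n).1 x - x| <= 1 by lra.
      move: q0; rewrite le_eqVlt => /orP[/eqP <-|q0]; first by rewrite S0 subrr normr0.
      apply: hd; rewrite q0 (le_lt_trans qn)// invf_plt ?posrE//.
      have := truncnS_gt d^-1; rewrite -/N => /lt_le_trans; apply.
      by rewrite ler_nat ltnW.
  have [M hM] := UB 1.
  pose n := Num.truncn `|M|.
  have [q0 _] := hq n; apply.
  have [->|x0] := eqVneq (q n).2 0; first by rewrite -(scale0r (0 : V)) SZ// scale0r normr0 mulr_ge0.
  have nx : 0 < `|(q n).2| by rewrite normr_gt0.
  have := hM _ (ex_intro2 _ _ n I erefl) (`|(q n).2|^-1 *: (q n).2).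
  rewrite normrZ ger0_norm ?invr_ge0// mulVf ?gt_eqF// lexx => /(_ isT).
  rewrite SZ// normrZ ger0_norm ?invr_ge0// mulrC ler_pdivrMr// => /le_trans; apply.
  rewrite ler_wpM2r// (le_trans (ler_norm _))// ltW//.
  exact: truncnS_gt.
move=> T; pose n := Num.truncn (T / d).
exists (K ^+ n.+1); first by rewrite exprn_gt0// (lt_le_trans ltr01).
have main (m : nat) t x : 0 <= t <= m%:R * d -> `|S t x| <= K ^+ m * `|x|.
  elim: m t x => [|m IH] t x.
    by rewrite mul0r -eq_le => /eqP <-; rewrite S0 expr0 mul1r.
  rewrite -natr1 mulrDl mul1r => /andP[t0 tm].
  have K0 : 0 <= K by rewrite (le_trans ler01).
  have [td|td] := leP t d.
    rewrite (le_trans (hK _ _ _)) ?t0// exprS mulrAC ler_peMr ?mulr_ge0//.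
    by rewrite exprn_ege1.
  have -> : t = d + (t - d) by ring.
  rewrite SD ?subr_ge0 ?(ltW td) ?(ltW d0)// (le_trans (hK _ _ _))//.
    by rewrite lexx ltW.
  rewrite exprS -mulrA ler_wpM2l// IH// subr_ge0 (ltW td)/=; lra.
move=> t x /andP[t0 tT]; apply: main; rewrite t0 (le_trans tT)//.
rewrite -ler_pdivrMr// ltW//; exact: truncnS_gt.
Qed.

End AbstractSemigroup.

Section Scalar.
Context {R : realType} {V : completeNormedModType R}.

Lemma deriv1_eps (f : R -> R) (x df e : R) : is_derive x (1 : R) f df -> 0 < e ->
  exists2 d : R, 0 < d & forall y, `|y - x| < d ->
    `|f y - f x - (y - x) * df| <= e * `|y - x|.
Proof.
move=> hf e0; have [hd hE] := hf.
have : h^-1 *: (f (h *: (1 : R) + x) - f x) @[h --> 0^'] --> df by rewrite -hE.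
move=> /cvgrPdist_le /(_ e e0) [d /= d0 hd0].
exists d => // y yx; have [->|xy] := eqVneq y x; first by rewrite !subrr mul0r subr0 normr0 mulr0.
have yx0 : y - x != 0 by rewrite subr_eq0.
have := hd0 (y - x); rewrite /ball_ /= distrC subr0 => /(_ yx yx0).
rewrite /GRing.scale /= mulr1 subrK => h.
have n0 : 0 < `|y - x| by rewrite normr_gt0.
have -> : f y - f x - (y - x) * df = - (df - (y - x)^-1 * (f y - f x)) * (y - x) by field.
by rewrite normrM normrN ler_wpM2r.
Qed.

Lemma prim_scal (f f' : R -> R) (v : V) a b :
  (forall x, is_derive x (1 : R) f (f' x)) ->
  prim a b (fun t => f' t *: v) (fun t => f t *: v).
Proof.
move=> hf x _ e e0; have v1 : 0 < `|v| + 1 by rewrite ltr_wpDl.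
have [d d0 hd] := deriv1_eps (hf x) (divr_gt0 e0 v1).
exists d => // y _ yx; have := hd y yx => h.
have -> : f y *: v - f x *: v - (y - x) *: (f' x *: v) =
  (f y - f x - (y - x) * f' x) *: v by linmod R.
rewrite normrZ (le_trans (ler_wpM2r _ h))// mulrAC ler_wpM2r//.
by rewrite -mulrA ler_piMr ?(ltW e0)// mulrC ler_pdivrMr// mul1r lerDl.
Qed.

Lemma prim_sum n (F P : 'I_n -> R -> V) a b : (forall i, prim a b (F i) (P i)) ->
  prim a b (fun t => \sum_(i < n) F i t) (fun t => \sum_(i < n) P i t).
Proof.
elim: n F P => [|n IH] F P h.
  by move=> x _ e e0; exists 1 => // y _ _; rewrite !big_ord0 scaler0 !subrr normr0 mulr_ge0// ltW.
have E (G : 'I_n.+1 -> R -> V) : (fun t => \sum_(i < n.+1) G i t) =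
    fun t => \sum_(i < n) G (widen_ord (leqnSn n) i) t + G ord_max t.
  by apply/funext => t; rewrite big_ord_recr.
by rewrite !E; apply: primD; [apply: IH => i|]; exact: h.
Qed.

End Scalar.

(** * The semigroup of the polynomial flows *)

Section Concrete.
Context {R : realType}.
Variables (a c : R).
Hypotheses (a0 : 0 <= a) (c0 : 0 <= c).
Notation V := (Vsp R).
Implicit Types (x y z : V) (w : {poly R}) (t s : R).
Let M := 1 + c.

Let expM_gt0 t : 0 < expR (M * t). Proof. exact: expR_gt0. Qed.

Lemma flow_le N N' W : (N <= N')%N -> flow a c N W -> flow a c N' W.
Proof. by move=> h [s d]; split => // t; exact: leq_trans h. Qed.

Lemma flow_dist k k' W W' t : flow a c k.*2 W -> flow a c k'.*2 W' -> 0 <= t ->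
  `|iota_ (W t) - iota_ (W' t)| <= expR (M * t) * `|iota_ (W 0) - iota_ (W' 0)|.
Proof.
move=> h h' t0; have le1 : (k.*2 <= (maxn k k').*2)%N by rewrite leq_double leq_maxl.
have le2 : (k'.*2 <= (maxn k k').*2)%N by rewrite leq_double leq_maxr.
have := flow_growth a0 c0 (flowB (flow_le le1 h) (flow_le le2 h')) t0.
by rewrite !iota_B.
Qed.

(** The closure of the graph of the polynomial time-[t] map. Working with a relation avoids fixing
    approximating sequences; the growth estimate makes it single-valued. *)
Definition is_S t x y := forall e, 0 < e -> exists k W, [/\ flow a c k.*2 W,
  `|x - iota_ (W 0)| <= e & `|y - iota_ (W t)| <= e].

Lemma is_S_ex t x : 0 <= t -> exists y, is_S t x y.
Proof.
move=> t0.
have pn (n : nat) : 0 < (2^-1 : R) ^+ n by rewrite exprn_gt0// invr_gt0.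
have ex (n : nat) : exists q : nat * (R -> {poly R}), flow a c q.1.*2 q.2 /\
    `|x - iota_ (q.2 0)| <= 2^-1 ^+ n.
  have [w hw] := dense_iota x (pn n).
  have [|W hW W0] := @flow_exists R a c (size w) w; first by rewrite -addnn leq_addr.
  by exists (size w, W); rewrite /= W0.
have [q hq] := choice ex.
have C0 : 0 < 2 * expR (M * t) by rewrite mulr_gt0.
have step n : `|iota_ ((q n.+1).2 t) - iota_ ((q n).2 t)| <= (2 * expR (M * t)) * 2^-1 ^+ n.
  have [f1 h1] := hq n.+1; have [f2 h2] := hq n.
  rewrite (le_trans (flow_dist f1 f2 t0))// mulrAC mulrC ler_wpM2r ?(ltW (expM_gt0 t))//.
  have -> : iota_ ((q n.+1).2 0) - iota_ ((q n).2 0) =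
    (x - iota_ ((q n).2 0)) - (x - iota_ ((q n.+1).2 0)) by linmod R.
  apply: (le_trans (ler_normB _ _)); rewrite exprS in h1.
  have := pn n; move: h1 h2; lra.
have [y hy] := fast_cauchy_cvg step; exists y => e e0.
have C1 : 0 < 4 * expR (M * t) + 1 by rewrite addr_gt0// mulr_gt0.
have [n hn] : exists n, 2^-1 ^+ n <= e / (4 * expR (M * t) + 1).
  apply: contrapT => H; suff : e / (4 * expR (M * t) + 1) <= 0 by rewrite leNgt divr_gt0.
  apply: (@ler_small_half _ _ _ 1) => n; rewrite add0r mul1r.
  by have [//|/ltW h] := leP (e / (4 * expR (M * t) + 1)) (2^-1 ^+ n); case: H; exists n.
rewrite ler_pdivlMr// in hn.
have [f1 h1] := hq n; exists (q n).1, (q n).2; split => //.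
  rewrite (le_trans h1)// (le_trans _ hn)// ler_peMr ?(ltW (pn n))//.
  by rewrite lerDr mulr_ge0// ltW.
rewrite distrC (le_trans (hy n))//; have := pn n; move: hn; lra.
Qed.

Lemma is_S_lip t x y x' y' : 0 <= t -> is_S t x y -> is_S t x' y' ->
  `|y - y'| <= expR (M * t) * `|x - x'|.
Proof.
move=> t0 h h'; apply/ler_addgt0Pr => e e0.
have C0 : 0 < 2 + 2 * expR (M * t) by rewrite addr_gt0// mulr_gt0.
have e1 := divr_gt0 e0 C0; set e' := e / _ in e1.
have [k [W [f hx hy]]] := h _ e1; have [k' [W' [f' hx' hy']]] := h' _ e1.
have -> : y - y' = (y - iota_ (W t)) - (y' - iota_ (W' t)) +
  (iota_ (W t) - iota_ (W' t)) by linmod R.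
have A1 : `|iota_ (W 0) - iota_ (W' 0)| <= `|x - x'| + e' + e'.
  have -> : iota_ (W 0) - iota_ (W' 0) = (x - x') - (x - iota_ (W 0)) +
    (x' - iota_ (W' 0)) by linmod R.
  by rewrite (le_trans (ler_normD _ _))// lerD// (le_trans (ler_normB _ _))// lerD.
have := le_trans (flow_dist f f' t0) (ler_wpM2l (ltW (expM_gt0 t)) A1) => A2.
rewrite (le_trans (ler_normD _ _))//.
have A3 := le_trans (ler_normB _ _) (lerD hy hy').
have E : e = e' * (2 + 2 * expR (M * t)) by rewrite /e' divfK// gt_eqF.
clearbody e'; by rewrite E; move: A2 A3; lra.
Qed.

Lemma is_S_uniq t x y y' : 0 <= t -> is_S t x y -> is_S t x y' -> y = y'.
Proof.
move=> t0 h h'; have := is_S_lip t0 h h'; rewrite subrr normr0 mulr0.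
by rewrite normr_le0 subr_eq0 => /eqP.
Qed.

(** Negative times are read as 0, which makes [St] total. *)
Definition St t x : V := xget 0 [set y | is_S (Num.max t 0) x y].

Lemma StP t x : 0 <= t -> is_S t x (St t x).
Proof.
move=> t0; rewrite /St (max_l t0); have [y hy] := is_S_ex x t0.
by case: xgetP => [z _ //|/(_ y)].
Qed.

Lemma St_eq t x y : 0 <= t -> is_S t x y -> St t x = y.
Proof. by move=> t0; apply: is_S_uniq => //; exact: StP. Qed.

Lemma St_flow k W t : flow a c k.*2 W -> 0 <= t -> St t (iota_ (W 0)) = iota_ (W t).
Proof.
move=> f t0; apply: St_eq => // e e0; exists k, W; rewrite !subrr normr0.
by split => //; exact: ltW.
Qed.

Let St_lin t k x y : 0 <= t -> St t (k *: x + y) = k *: St t x + St t y.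
Proof.
move=> t0; apply: St_eq => // e e0.
have C0 : 0 < `|k| + 1 by rewrite ltr_wpDl.
have e1 := divr_gt0 e0 C0.
have [k1 [W [f hx hy]]] := StP x t0 e1; have [k2 [W' [f' hx' hy']]] := StP y t0 e1.
have le1 : (k1.*2 <= (maxn k1 k2).*2)%N by rewrite leq_double leq_maxl.
have le2 : (k2.*2 <= (maxn k1 k2).*2)%N by rewrite leq_double leq_maxr.
have F := flowD (flowZ k (flow_le le1 f)) (flow_le le2 f').
have main (u v p q : V) : `|u - p| <= e / (`|k| + 1) -> `|v - q| <= e / (`|k| + 1) ->
    `|k *: u + v - (k *: p + q)| <= e.
  move=> h1 h2; have -> : k *: u + v - (k *: p + q) = k *: (u - p) + (v - q) by linmod R.
  rewrite (le_trans (ler_normD _ _))// normrZ.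
  have := ler_wpM2l (normr_ge0 k) h1 => h3.
  rewrite (le_trans (lerD h3 h2))// le_eqVlt; apply/orP; left; apply/eqP.
  by field; rewrite gt_eqF.
by exists (maxn k1 k2), (fun t => k *: W t + W' t); split => //=; rewrite iota_D iota_Z main.
Qed.

Lemma St0 x : St 0 x = x.
Proof.
apply: St_eq => // e e0; have [w hw] := dense_iota x e0.
have [|W hW W0] := @flow_exists R a c (size w) w; first by rewrite -addnn leq_addr.
by exists (size w), W; rewrite W0.
Qed.

Let StZ0 t : 0 <= t -> St t 0 = 0.
Proof.
move=> t0; have := St_lin (-1) 0 0 t0; rewrite scaler0 addr0 => {1}->.
by rewrite scaleN1r addNr.
Qed.

Lemma St_growth t x : 0 <= t -> `|St t x| <= expR (M * t) * `|x|.
Proof.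
move=> t0; have := is_S_lip t0 (StP x t0) (StP 0 t0).
by rewrite StZ0// !subr0.
Qed.

Let St_D s t x : 0 <= s -> 0 <= t -> St (s + t) x = St s (St t x).
Proof.
move=> s0 t0; apply: St_eq; first exact: addr_ge0.
move=> e e0; have e1 : 0 < e / expR (M * s) by rewrite divr_gt0.
have [|k [W [f h1 h2]]] := StP x t0 (e := Num.min e (e / expR (M * s))).
  by rewrite lt_min e0.
move: h1 h2; rewrite !le_min => /andP[h1 _] /andP[_ h2].
exists k, W; split => //; rewrite addrC.
have F := flow_shift t f.
have := is_S_lip s0 (StP (St t x) s0) (StP (iota_ (W t)) s0).
have := St_flow F s0; rewrite add0r addrC => -> /le_trans; apply.
by rewrite mulrC -ler_pdivlMr.
Qed.

Lemma iota_sum w N : (size w <= N)%N -> iota_ w = \sum_(i < N) w`_i *: iota_ 'X^i.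
Proof.
move=> sw; have {1}-> : w = \sum_(i < N) w`_i *: 'X^i.
  rewrite -poly_def.
  by apply/polyP => i; rewrite coef_poly; case: ltnP => // h; rewrite nth_default// (leq_trans sw).
have i0 : iota_ 0 = 0 :> V by rewrite -(scale0r (0 : {poly R})) iota_Z scale0r.
elim: N {sw} => [|N IH]; first by rewrite !big_ord0.
by rewrite big_ord_recr [RHS]big_ord_recr /= -IH -iota_Z -iota_D.
Qed.

Lemma flow_prim k W S T : flow a c k.*2 W ->
  prim S T (fun t => iota_ (Lp a c (W t))) (fun t => iota_ (W t)).
Proof.
move=> [s d].
have -> : (fun t => iota_ (W t)) = fun t => \sum_(i < k.*2) (W t)`_i *: iota_ 'X^i.
  by apply/funext => t; apply: iota_sum.
have -> : (fun t => iota_ (Lp a c (W t))) =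
    fun t => \sum_(i < k.*2) (Lp a c (W t))`_i *: iota_ 'X^i.
  by apply/funext => t; apply: iota_sum; apply: size_Lp.
apply: prim_sum => i; exact: prim_scal.
Qed.

Let flow_near k W e : flow a c k.*2 W -> 0 < e -> exists2 d, 0 < d &
  forall h, 0 < h < d -> `|iota_ (W h) - iota_ (W 0) - h *: iota_ (Lp a c (W 0))| <= e * h.
Proof.
move=> f e0; have [|d d0 hd] := @flow_prim k W 0 1 f 0 _ e e0; first by rewrite lexx ler01.
exists (Num.min d 1); first by rewrite lt_min d0 ltr01.
move=> h /andP[h0]; rewrite lt_min => /andP[hd1 h1].
have := hd h; rewrite subr0 gtr0_norm// (ltW h0) (ltW h1); exact.
Qed.

Lemma St_sg : semigroupV St.
Proof.
split.
- by move=> t x y t0; rewrite -{1}[x]scale1r St_lin// scale1r.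
- by move=> t k x t0; rewrite -[k *: x]addr0 St_lin// StZ0// addr0.
- move=> T; exists (expR (M * T)) => // t x /andP[t0 tT].
  rewrite (le_trans (St_growth _ t0))// ler_wpM2r// ler_expR ler_wpM2l//.
  by rewrite addr_ge0.
- exact: St0.
- exact: St_D.
(* Three errors are added: the distance to a polynomial, the same amplified by at most [exp M] up to
   time 1, and the displacement of the polynomial orbit. *)
- move=> x e e0; have C0 : 0 < 2 + expR M by rewrite addr_gt0 ?expR_gt0.
  have [w hw] := dense_iota x (divr_gt0 e0 C0).
  have [|W hW W0] := @flow_exists R a c (size w) w; first by rewrite -addnn leq_addr.
  have [d d0 hd] := flow_near hW ltr01; rewrite W0 in hd.
  have L1 : 0 < 1 + `|iota_ (Lp a c w)| by rewrite ltr_pwDl.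
  have e2 := divr_gt0 (divr_gt0 e0 C0) L1.
  exists (Num.min (Num.min d 1) (e / (2 + expR M) / (1 + `|iota_ (Lp a c w)|))).
    by rewrite !lt_min d0 ltr01 e2.
  move=> h /andP[h0]; rewrite !lt_min => /andP[/andP[hd1 h1] h2].
  rewrite ltr_pdivlMr// in h2.
  have A1 : `|iota_ (W h) - iota_ w| <= e / (2 + expR M).
    rewrite (le_trans _ (ltW h2))// -[X in `|X|](subrK (h *: iota_ (Lp a c w))).
    rewrite (le_trans (ler_normD _ _))// mulrDr mulr1 lerD//.
      by have := hd h; rewrite h0 hd1 mul1r; apply.
    by rewrite normrZ gtr0_norm.
  have E : St h (iota_ w) = iota_ (W h) by rewrite -W0 (St_flow hW)// ltW.
  have A2 : `|St h x - iota_ (W h)| <= expR M * (e / (2 + expR M)).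
    rewrite -E (le_trans (is_S_lip (ltW h0) (StP _ (ltW h0)) (StP _ (ltW h0))))//.
    rewrite ler_pM ?expR_ge0// ler_expR -[leRHS]mulr1 ler_wpM2l ?(ltW h1)//.
    by rewrite addr_ge0.
  have -> : St h x - x = (St h x - iota_ (W h)) + (iota_ (W h) - iota_ w) - (x - iota_ w) by linmod R.
  rewrite (le_trans (ler_normB _ _))// (le_trans (lerD (ler_normD _ _) (lexx _)))//.
  rewrite (le_trans (lerD (lerD A2 A1) hw))// le_eqVlt; apply/orP; left; apply/eqP.
  by field; rewrite gt_eqF.
Qed.

Lemma St_gen w : genV St (iota_ w) (iota_ (Lp a c w)).
Proof.
move=> e e0.
have [|W hW W0] := @flow_exists R a c (size w) w; first by rewrite -addnn leq_addr.
have [d d0 hd] := flow_near hW e0; exists d; first exact: d0.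
move=> h hh; have h0 : 0 <= h by case/andP: hh => /ltW.
by have := hd h hh; rewrite -(St_flow hW h0) W0.
Qed.

End Concrete.

(** * Continuously differentiable pairs *)

Section C1.
Context {R : realType}.
Notation mu := (@lebesgue_measure R).
Notation I01 := (`]0%R, 1%R[%classic : set R).
Implicit Types (f g : R -> R).

Lemma eq_sqi (D : set R) f g : measurable D -> (forall x, D x -> f x = g x) ->
  square_integrable D f -> square_integrable D g.
Proof.
move=> mD fg sf; apply: (ae_eq_sqi mD sf); last exact/aeW.
by apply: eq_measurable_fun sf.1 => x /set_mem /fg.
Qed.

Lemma cont_sqi f : {within `[0, 1], continuous f} -> square_integrable I01 f.
Proof.
move=> cf; have [M M0 hM] := cont_on_bounded ler01 (within_cont_on cf).
apply: (sqi_bounded (M := M) (@mI01 R) (mu_Io_lty 1)).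
  apply: (@measurable_funS _ _ _ _ (`[0, 1]%classic : set R)) => //; first exact: subset_itv_oo_cc.
  exact: subspace_continuous_measurable_fun.
by move=> x /=; rewrite in_itv /= => /andP[/ltW x0 /ltW x1]; rewrite hM// x0.
Qed.

Lemma C1_on_derive1 f (df : R -> R) : (forall x : R, 0 < x < 1 -> is_derive x (1 : R) f (df x)) ->
  forall x, I01 x -> df x = derive1 f x.
Proof.
by move=> h x /=; rewrite in_itv /= => /h h'; rewrite derive1E derive_val.
Qed.

(** The energy identity for the functions on which [L0t] is defined: [g] is the derivative of the
    boundary term [G], and [G 1 - G 0 = - (f1 1 - f2 1) ^ 2 / 2]. *)
Lemma C1_on_ip f1 f2 : C1_on 0 1 f1 -> C1_on 0 1 f2 -> f1 0 = 0 ->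
  ip I01 (fun x => derive1 f2 x - x * derive1 f1 x) f1 +
  ip I01 (fun x => derive1 f1 x - x * derive1 f2 x) f2 <=
  2^-1 * (ip I01 f1 f1 + ip I01 f2 f2).
Proof.
move=> [c1 [d1 cd1 h1]] [c2 [d2 cd2 h2]] f10.
have cid : {within `[0, 1], continuous (fun x : R => x)}.
  by apply: continuous_subspaceT => x; exact: cvg_id.
pose g (x : R) : R := (d2 x - x * d1 x) * f1 x + (d1 x - x * d2 x) * f2 x
   - 2^-1 * (f1 x * f1 x + f2 x * f2 x).
pose G (x : R) : R := f1 x * f2 x - 2^-1 * x * (f1 x * f1 x + f2 x * f2 x).
have cg : {within `[0, 1], continuous g}.
  move=> x; apply: cvgB; last first.
    apply: cvgM; first exact: cvg_cst.
    by apply: cvgD; apply: cvgM; [exact: c1|exact: c1|exact: c2|exact: c2].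
  apply: cvgD; apply: cvgM; try exact: c1; try exact: c2.
    by apply: cvgB; [exact: cd2|apply: cvgM; [exact: cid|exact: cd1]].
  by apply: cvgB; [exact: cd1|apply: cvgM; [exact: cid|exact: cd2]].
have cG : {within `[0, 1], continuous G}.
  move=> x; apply: cvgB; first by apply: cvgM; [exact: c1|exact: c2].
  apply: cvgM; first by apply: cvgM; [exact: cvg_cst|exact: cid].
  by apply: cvgD; apply: cvgM; [exact: c1|exact: c1|exact: c2|exact: c2].
have dG (x : R) : 0 < x < 1 -> is_derive x (1 : R) G (g x).
  move=> x01; have a1 := h1 x x01; have a2 := h2 x x01.
  have := deriv1D (deriv1M a1 a2) (deriv1Z (- 2^-1) (deriv1M (is_derive_id x (1 : R))
    (deriv1D (deriv1M a1 a1) (deriv1M a2 a2)))).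
  apply: deriv1_ext => [s|]; rewrite /G /g; lra.
have FTC : \int[mu]_(x in `[0, 1]) g x = G 1 - G 0.
  rewrite /Rintegral (@continuous_FTC2 _ g G)//.
    have [_ l r] := (continuous_within_itvP _ (@ltr01 R)).1 cG.
    split => // x; rewrite in_itv /= => /dG h; exact: (@ex_derive _ _ _ _ _ _ _ h).
  by move=> x; rewrite in_itv /= => /dG h; rewrite derive1E derive_val.
have mI : measurable I01 := @mI01 R.
have s1 := cont_sqi c1; have s2 := cont_sqi c2.
have sx (f df : R -> R) : {within `[0, 1], continuous f} -> {within `[0, 1], continuous df} ->
    square_integrable I01 (fun x => f x - x * df x).
  move=> cf cdf; apply: cont_sqi => x; apply: cvgB; first exact: cf.
  by apply: cvgM; [exact: cid|exact: cdf].
have E (f k dk dl l : R -> R) : (forall x : R, 0 < x < 1 -> is_derive x (1 : R) k (dk x)) ->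
    (forall x : R, 0 < x < 1 -> is_derive x (1 : R) l (dl x)) ->
    ip I01 (fun x => derive1 k x - x * derive1 l x) f = ip I01 (fun x => dk x - x * dl x) f.
  move=> hk hl; apply: eq_Rintegral => x /set_mem xI.
  by rewrite (C1_on_derive1 hk xI) (C1_on_derive1 hl xI).
rewrite (E _ _ _ _ _ h2 h1) (E _ _ _ _ _ h1 h2) -subr_le0.
have i1 := sqi_mul mI (sx _ _ cd2 cd1) s1; have i2 := sqi_mul mI (sx _ _ cd1 cd2) s2.
have i3 := sqi_mul mI s1 s1; have i4 := sqi_mul mI s2 s2.
have i5 := @int_scale R I01 2^-1 _ mI (int_add mI i3 i4).
have -> : ip I01 (fun x => d2 x - x * d1 x) f1 + ip I01 (fun x => d1 x - x * d2 x) f2 -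
    2^-1 * (ip I01 f1 f1 + ip I01 f2 f2) = \int[mu]_(x in I01) g x.
  rewrite /ip -(@RintegralD _ _ R mu I01 _ _ mI i1 i2) -(@RintegralD _ _ R mu I01 _ _ mI i3 i4).
  rewrite -(@RintegralZl _ _ R mu I01 _ _ mI (int_add mI i3 i4)).
  by rewrite -(@RintegralB _ _ R mu I01 _ _ mI (int_add mI i1 i2) i5).
have -> : \int[mu]_(x in I01) g x = \int[mu]_(x in `[0, 1]) g x.
  rewrite /Rintegral; congr fine; apply/esym; apply: integral_itv_bndoo.
  exact: (measurableT_comp (@EFin_measurable R setT) (cont_sqi cg).1).
rewrite FTC /G f10; have := sqr_ge0 (f1 1 - f2 1); lra.
Qed.

End C1.

(** * The generator is the closure of the given operator *)

Section GeneratorGraph.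
Context {R : realType}.
Variable p : R.
Hypothesis p1 : 1 < p.
Notation mu := (@lebesgue_measure R).
Notation I01 := (`]0%R, 1%R[%classic : set R).
Notation V := (Vsp R).
Implicit Types (u v : fpair R) (q : {poly R}).

Definition pa : R := 2 / (p - 1).
Definition pc : R := p * kappa0 p.
Notation Sg := (St pa pc).
Notation lp := (Lp pa pc).

Lemma pa_gt0 : 0 < pa. Proof. by rewrite divr_gt0// subr_gt0. Qed.
(** In terms of [a = pa], [p = (a + 2) / a] and [kappa0 = a (a + 1)]. *)
Lemma pcE : pc = (pa + 1) * (pa + 2).
Proof. by rewrite /pc /kappa0 /pa; field; rewrite gt_eqF// subr_gt0. Qed.
Lemma pc_gt0 : 0 < pc.
Proof. by have := pa_gt0 => a0; rewrite pcE mulr_gt0// addr_gt0. Qed.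

Let a0 : 0 <= pa := ltW pa_gt0.
Let c0 : 0 <= pc := ltW pc_gt0.
Let mI : measurable I01 := @mI01 R.

Lemma Lprime_inH u : inH u -> inH (Lprime p u).
Proof.
move=> [_ h2]; split; last exact: sqi0.
exact: (@sqiZ R I01 pc _ mI (sqi_intI h2)).
Qed.

Lemma nrm_Lprime u : inH u -> nrm I01 (Lprime p u) <= pc * nrm I01 u.
Proof.
move=> [h1 h2]; have -> : nrm I01 (Lprime p u) = snrm I01 (fun x => pc * intI u.2 x).
  by rewrite snrmE.
rewrite snrmZ//; last exact: sqi_intI.
rewrite ger0_norm// ler_wpM2l// (le_trans (snrm_intI ler01 h2))// mul1r.
rewrite -ler_sqr ?nnegrE ?nrm_ge0 ?snrm_ge0// nrm_sqr snrm_sqr /ip2.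
by rewrite lerDr ip_ge0.
Qed.

Lemma LprimeB u v : inH u -> inH v ->
  aeq I01 (Lprime p u - Lprime p v) (Lprime p (u - v)).
Proof.
move=> [_ u2] [_ v2]; split; apply/aeW => x /=; last by rewrite !fctE /= subrr.
rewrite in_itv /= => /andP[x0 x1]; rewrite !fctE /=.
have := intI_ip (sqiB mI u2 v2) x1; rewrite ipBl//; last exact: sqi_ind.
by rewrite -(intI_ip u2 x1) -(intI_ip v2 x1) /intI => ->; rewrite mulrBr.
Qed.

Lemma cls_Lprime_dist u v : inH u -> inH v ->
  `|cls (Lprime p u) - cls (Lprime p v)| <= pc * `|cls u - cls v|.
Proof.
move=> hu hv; have hB := inL2B mI hu hv.
have l1 := Lprime_inH hu; have l2 := Lprime_inH hv.
rewrite -(clsBE l1 l2) -(clsBE hu hv) (norm_cls hB) (norm_cls (inL2B mI l1 l2)).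
rewrite (aeq_nrm mI (inL2B mI l1 l2) (Lprime_inH hB) (LprimeB hu hv)).
exact: nrm_Lprime.
Qed.

Lemma Hnorm_cvg (T : Type) (F : set_system T) (FF : Filter F) (f : T -> fpair R) :
  (\forall t \near F, inH (f t)) ->
  (Hnorm (f t) @[t --> F] --> 0%E) <->
  (forall e, 0 < e -> \forall t \near F, `|cls (f t)| <= e).
Proof.
move=> hf; split.
  move=> /fine_cvgP[_ /cvgrPdist_le h] e e0; have := h e e0.
  move: hf; apply: filterS2 => t ht /=; rewrite Hnorm_cls//= sub0r normrN.
  by rewrite ger0_norm.
move=> h; apply/fine_cvgP; split.
  by move: hf; apply: filterS => t ht; rewrite Hnorm_cls.
apply/cvgrPdist_le => e e0; have := h e e0.
move: hf; apply: filterS2 => t ht /=; rewrite Hnorm_cls//= sub0r normrN.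
by rewrite ger0_norm.
Qed.

Lemma dom_inH u : dom_L0t u -> inH u.
Proof. by move=> [[c1 _] [c2 _] _]; split; exact: cont_sqi. Qed.

Lemma L0t_inH u : dom_L0t u -> inH (L0t p u).
Proof.
move=> [[c1 [d1 cd1 h1]] [c2 [d2 cd2 h2]] _].
have cid : {within `[0, 1], continuous (fun x : R => x)}.
  by apply: continuous_subspaceT => x; exact: cvg_id.
have cc (f g h : R -> R) : {within `[0, 1], continuous f} -> {within `[0, 1], continuous g} ->
   {within `[0, 1], continuous h} -> 
   square_integrable I01 (fun x : R => f x - x * g x - 2 / (p - 1) * h x : R).
  move=> cf cg ch; apply: cont_sqi => x; apply: cvgB.
    by apply: cvgB; [exact: cf|apply: cvgM; [exact: cid|exact: cg]].
  by apply: cvgM; [exact: cvg_cst|exact: ch].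
split.
  apply: (eq_sqi mI _ (cc _ _ _ cd2 cd1 c1)) => x xI /=.
  by rewrite (C1_on_derive1 h1 xI) (C1_on_derive1 h2 xI).
apply: (eq_sqi mI _ (cc _ _ _ cd1 cd2 c2)) => x xI /=.
by rewrite (C1_on_derive1 h1 xI) (C1_on_derive1 h2 xI).
Qed.

Lemma C1_sqi_comb (f g : R -> R) : C1_on (0 : R) 1 f -> C1_on 0 1 g ->
  square_integrable I01 (fun x => derive1 f x - x * derive1 g x).
Proof.
move=> [c1 [d1 cd1 h1]] [c2 [d2 cd2 h2]].
have cid : {within `[0, 1], continuous (fun x : R => x)}.
  by apply: continuous_subspaceT => x; exact: cvg_id.
have s : square_integrable I01 (fun x : R => d1 x - x * d2 x : R).
  apply: cont_sqi => x; apply: cvgB; first exact: cd1.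
  by apply: cvgM; [exact: cid|exact: cd2].
apply: (eq_sqi mI _ s) => x xI /=.
by rewrite (C1_on_derive1 h1 xI) (C1_on_derive1 h2 xI).
Qed.

(** The counterpart of [gen_resolvent] for the differential operator on its original domain; being
    an inequality between continuous quantities, it survives the passage to the closure. *)
Lemma dissip_dom u (lam : R) : dom_L0t u -> 0 <= lam ->
  (lam - (1 + pc)) * `|cls u| <= `|lam *: cls u - (cls (L0t p u) + cls (Lprime p u))|.
Proof.
move=> du l0; have hu := dom_inH du; have h0 := L0t_inH du; have hp := Lprime_inH hu.
have hs : inH (L0t p u + Lprime p u) by exact: (inL2D mI).
have hz : inH (lam *: u) by exact: (inL2Z).
have E : ip2 I01 (L0t p u + Lprime p u) u <= (1 + pc) * ip2 I01 u u.
  rewrite ip2Dl// mulrDl lerD//.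
    case: du => d1 d2 u0; have := C1_on_ip d1 d2 u0.
    have s1 := C1_sqi_comb d2 d1; have s2 := C1_sqi_comb d1 d2.
    case: hu => hu1 hu2.
    have B (F g : R -> R) : square_integrable I01 F -> square_integrable I01 g ->
        ip I01 (fun x => F x - pa * g x) g = ip I01 F g - pa * ip I01 g g.
      by move=> sF sg; rewrite (ipBl mI sF (sqiZ pa mI sg) sg) ipZl.
    rewrite mul1r; move: (B _ _ s1 hu1) (B _ _ s2 hu2); rewrite /ip2 /L0t /= => -> ->.
    have := ip_ge0 I01 u.1; have := ip_ge0 I01 u.2.
    move=> a1 a2; have := mulr_ge0 a0 a1; have := mulr_ge0 a0 a2; lra.
  apply: (le_trans (ler_norm _)); apply: (le_trans (ip2_cauchy_schwarz mI hp hu)).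
  by rewrite -nrm_sqr expr2 mulrA ler_wpM2r ?nrm_ge0// nrm_Lprime.
rewrite -clsDE// -clsZE// -clsBE// !norm_cls//; last exact: (inL2B mI).
have := nrm_ge0 I01 u; rewrite le_eqVlt => /orP[/eqP <-|n0].
  by rewrite mulr0 nrm_ge0.
rewrite -(ler_pM2r n0) -mulrA -expr2 nrm_sqr.
have := ip2_cauchy_schwarz mI (inL2B mI hz hs) hu => /(le_trans (ler_norm _)); apply: le_trans.
have -> : ip2 I01 (lam *: u - (L0t p u + Lprime p u)) u =
    lam * ip2 I01 u u - ip2 I01 (L0t p u + Lprime p u) u.
  rewrite -scaleN1r (ip2Dl mI hz (inL2Z (-1) mI hs) hu).
  by rewrite (ip2Zl lam mI hu hu) (ip2Zl (-1) mI hs hu); ring.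
lra.
Qed.

(** The closure of the graph of [Lp] on polynomials, the middle term between the generator of [St]
    and [L_graph]. *)
Definition app (x y : V) := forall e, 0 < e ->
  exists w, `|x - iota_ w| <= e /\ `|y - iota_ (lp w)| <= e.

Lemma app_gen (x y : V) : app x y -> genV Sg x y.
Proof.
move=> h; apply: (gen_closed (St_sg a0 c0)) => e e0; have [w [h1 h2]] := h e e0.
exists (iota_ w), (iota_ (lp w)); split => //; exact: St_gen.
Qed.

(** In the degrees [2 k] and [2 k + 1] the equation is a 2 by 2 system of determinant [A * B - pc],
    positive because [A] and [B] are at least [lam >= 2 + pc]. Solving it for the two top
    coefficients leaves a right-hand side of size smaller by two. *)
Lemma Lp_surj (lam : R) k q : 2 + pc <= lam -> (size q <= k.*2)%N ->
  exists2 w : {poly R}, (size w <= k.*2)%N & lam *: w - lp w = q.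
Proof.
move=> hl; elim: k q => [|k IH] q.
  rewrite leqn0 size_poly_eq0 => /eqP ->; exists 0; first by rewrite size_poly0.
  have Z : lp (0 : {poly R}) = 0 by have := LpZ pa pc 0 (0 : {poly R}); rewrite !scale0r.
  by rewrite scaler0 sub0r Z oppr0.
move=> sq; pose n : R := k.*2%:R; have n0 : 0 <= n by [].
pose A := lam + n + pa; pose B := lam + n + 1 + pa.
have c00 := c0; have a00 := a0.
have D0 : 0 < A * B - pc by rewrite /A /B; nra.
pose al := (q`_k.*2 * B + (n + 1) * q`_k.*2.+1) / (A * B - pc).
pose be := (q`_k.*2.+1 * A + pc * q`_k.*2 / (n + 1)) / (A * B - pc).
pose w1 := al *: 'X^(k.*2) + be *: 'X^(k.*2.+1).
have w1E i : w1`_i = al * (i == k.*2)%:R + be * (i == k.*2.+1)%:R.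
  by rewrite coefD !coefZ !coefXn.
pose q' := q - (lam *: w1 - lp w1).
have sw1 : (size w1 <= k.+1.*2)%N.
  apply/leq_sizeP => j; rewrite doubleS => hj; rewrite w1E.
  by rewrite !gtn_eqF ?mulr0 ?addr0// (leq_trans _ hj).
have sq' : (size q' <= k.*2)%N.
  apply/leq_sizeP => j hj; rewrite /q' coefB [X in _ - X]coefB coefZ coef_Lp.
  have n1 : n + 1 != 0 by rewrite gt_eqF// ltr_wpDl.
  have e1 : (k.*2.+1 == k.*2) = false by lia.
  have e2 : (k.*2 == k.*2.+1) = false by lia.
  have e3 : (k.*2.+2 == k.*2) = false by lia.
  have e4 : (k.*2.+2 == k.*2.+1) = false by lia.
  have [->|jn] := eqVneq j k.*2.
    rewrite !w1E odd_double e1 e2 !eqxx.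
    rewrite (_ : true%:R = 1 :> R)// (_ : false%:R = 0 :> R)// -[k.*2.+1%:R]natr1 -/n /al /be; move: D0; rewrite /A /B => D0; field.
    by rewrite n1 gt_eqF//; move: D0; lra.
  have [->|jn1] := eqVneq j k.*2.+1.
    rewrite !w1E oddS odd_double succnK e1 e2 e3 e4 !eqxx [~~ false]/=.
    rewrite (_ : true%:R = 1 :> R)// (_ : false%:R = 0 :> R)// -[k.*2.+1%:R]natr1 -/n /al /be; move: D0; rewrite /A /B => D0; field.
    by rewrite n1 gt_eqF//; move: D0; lra.
  have hj2 : (k.*2.+2 <= j)%N.
    by rewrite ltn_neqAle eq_sym jn1 ltn_neqAle eq_sym jn.
  have z1 i : (k.*2.+2 <= i)%N -> w1`_i = 0.
    by move=> hi; rewrite nth_default// (leq_trans sw1)// doubleS.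
  rewrite (z1 j)// (z1 j.+1); last exact: leqW.
  have -> : q`_j = 0 by rewrite nth_default// (leq_trans sq)// doubleS.
  have [oj|_] := boolP (odd j); last by ring.
  have -> : w1`_j.-1 = 0.
    apply: z1; rewrite ltnNge; apply/negP => h.
    have E : j = k.*2.+2 by lia.
    by move: oj; rewrite E /= odd_double.
  by rewrite mul0r; ring.
have [w2 sw2 E] := IH q' sq'; exists (w1 + w2).
  rewrite (leq_trans (size_polyD _ _))// geq_max sw1/= (leq_trans sw2)//.
  by rewrite leq_double.
rewrite LpD scalerDr opprD addrACA E /q' addrC subrK.
by [].
Qed.

(** The least value allowed in [Lp_surj]; the constant [lam - (1 + pc)] of the resolvent estimates
    is then 1. *)
Let lam : R := 2 + pc.

Let dense_range (x : V) (e : R) : 0 < e -> exists w, `|x - (lam *: iota_ w - iota_ (lp w))| <= e.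
Proof.
move=> e0; have [q hq] := dense_iota x e0.
have [||w _ E] := @Lp_surj lam (size q) q => //; first by rewrite -addnn leq_addr.
by exists w; rewrite -iota_Z -iota_B E.
Qed.

(* A relation whose resolvent estimate holds against polynomials lies in the
   closure of their graph, because [lam - Lp] is onto. *)
Lemma app_crit (x y : V) :
  (forall w, (lam - (1 + pc)) * `|x - iota_ w| <=
    `|lam *: (x - iota_ w) - (y - iota_ (lp w))|) -> app x y.
Proof.
move=> H e e0; have l0 : 0 < lam + 1 by rewrite /lam; have := c0; lra.
have [w hw] := dense_range (lam *: x - y) (divr_gt0 e0 l0); exists w.
have := H w; rewrite (_ : lam - (1 + pc) = 1) ?mul1r; last by rewrite /lam; ring.
have E : lam *: (x - iota_ w) - (y - iota_ (lp w)) =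
  lam *: x - y - (lam *: iota_ w - iota_ (lp w)) by linmod R.
rewrite E => /le_trans /(_ hw) h1; split.
  by rewrite (le_trans h1)// ler_pdivrMr// ler_peMr ?(ltW e0)// /lam; have := c0; lra.
have -> : y - iota_ (lp w) = lam *: (x - iota_ w) -
   (lam *: x - y - (lam *: iota_ w - iota_ (lp w))) by linmod R.
rewrite (le_trans (ler_normB _ _))// normrZ ger0_norm; last by rewrite /lam; have := c0; lra.
have := ler_wpM2l (_ : 0 <= lam) h1 => h2.
rewrite (le_trans (lerD (h2 _) hw)); [|by rewrite /lam; have := c0; lra|].
  by [].
rewrite le_eqVlt; apply/orP; left; apply/eqP; field; rewrite gt_eqF//.
Qed.

Lemma gen_app (x y : V) : genV Sg x y -> app x y.
Proof.
move=> g; apply: app_crit => w; have hS := St_sg a0 c0.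
have M0 : 0 <= 1 + pc by rewrite addr_ge0.
have l0 : 0 <= lam by rewrite /lam addr_ge0.
have := @gen_resolvent _ _ Sg (1 + pc) lam (x - iota_ w) (y - iota_ (lp w)) M0 l0.
apply.
  by move=> h h0; exact: St_growth.
have := gen_lin hS (-1) (St_gen a0 c0 w) g.
by rewrite !scaleN1r (addrC _ x) (addrC _ y).
Qed.

Lemma iot_dom (w : {poly R}) : dom_L0t (iot w).
Proof.
have h q : C1_on (0 : R) 1 (horner q).
  split; first by apply: continuous_subspaceT => x; exact: continuous_horner.
  exists (horner q^`()) => [|x _]; last exact: is_derive_poly.
  by apply: continuous_subspaceT => x; exact: continuous_horner.
by split; [exact: h|exact: h|rewrite /= horner_opart oppr0 subrr mul0r].
Qed.

Lemma iot_Lp (w : {poly R}) : Heq (iot (lp w)) (L0t p (iot w) + Lprime p (iot w)).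
Proof.
have dE (q : {poly R}) x : derive1 (horner q) x = (q^`()).[x].
  by rewrite derive1E; have h := is_derive_poly q x; rewrite derive_val.
split; apply/aeW => x /=; rewrite in_itv /= => /andP[x0 x1]; rewrite !fctE /=.
  rewrite !dE opart_Lp !(hornerD, hornerN, hornerM, hornerX, hornerZ).
  by rewrite -(intI_horner (epart w) (ltW x0)).
by rewrite !dE epart_Lp !(hornerD, hornerN, hornerM, hornerX, hornerZ) addr0.
Qed.

Lemma iota_Lp (w : {poly R}) : iota_ (lp w) = cls (L0t p (iot w)) + cls (Lprime p (iot w)).
Proof.
have h1 := L0t_inH (iot_dom w); have h2 := Lprime_inH (iot_inH w).
rewrite -clsDE//; apply: cls_eq => //; [exact: iot_inH|exact: inL2D|exact: iot_Lp].
Qed.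

Lemma C1_onB (f g : R -> R) : C1_on (0 : R) 1 f -> C1_on 0 1 g ->
  C1_on 0 1 (fun x => f x - g x) /\
  {in I01, derive1 (fun x => f x - g x) =1 (fun x => derive1 f x - derive1 g x)}.
Proof.
move=> [c1 [d1 cd1 h1]] [c2 [d2 cd2 h2]].
have dB (x : R) : 0 < x < 1 -> is_derive x (1 : R) (fun x => f x - g x) (d1 x - d2 x).
  move=> x01; have := deriv1D (h1 x x01) (deriv1Z (-1) (h2 x x01)).
  by apply: deriv1_ext => [s|]; rewrite mulN1r.
split.
  split; first by move=> x; apply: cvgB; [exact: c1|exact: c2].
  exists (fun x => d1 x - d2 x) => //.
  by move=> x; apply: cvgB; [exact: cd1|exact: cd2].
move=> x /set_mem xI; rewrite -(C1_on_derive1 dB xI).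
by rewrite (C1_on_derive1 h1 xI) (C1_on_derive1 h2 xI).
Qed.

Lemma dom_L0tB u v : dom_L0t u -> dom_L0t v ->
  dom_L0t (u - v) /\ Heq (L0t p (u - v)) (L0t p u - L0t p v).
Proof.
move=> [u1 u2 u0] [v1 v2 v0]; have [B1 E1] := C1_onB u1 v1; have [B2 E2] := C1_onB u2 v2.
split; first by split => //; change (u.1 0 - v.1 0 = 0); rewrite u0 v0 subrr.
pose k : R := 2 / (p - 1).
split; apply/aeW => x xI; have k1 := E1 x (mem_set xI); have k2 := E2 x (mem_set xI).
  change (derive1 (fun x => u.2 x - v.2 x) x - x * derive1 (fun x => u.1 x - v.1 x) x -
    k * (u.1 x - v.1 x) = (derive1 u.2 x - x * derive1 u.1 x - k * u.1 x) -
    (derive1 v.2 x - x * derive1 v.1 x - k * v.1 x)).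
  by rewrite k1 k2; ring.
change (derive1 (fun x => u.1 x - v.1 x) x - x * derive1 (fun x => u.2 x - v.2 x) x -
  k * (u.2 x - v.2 x) = (derive1 u.1 x - x * derive1 u.2 x - k * u.2 x) -
  (derive1 v.1 x - x * derive1 v.2 x - k * v.2 x)).
by rewrite k1 k2; ring.
Qed.

Lemma app_L u v : inH u -> inH v -> app (cls u) (cls v) -> L_graph p u v.
Proof.
move=> hu hv h; have hp := Lprime_inH hu; have hB := inL2B mI hv hp.
have pn (n : nat) : 0 < (2^-1 : R) ^+ n by rewrite exprn_gt0// invr_gt0.
have [w hw] := choice (fun n => h _ (pn n)).
have C0 : 0 < 1 + pc by rewrite ltr_pwDl.
have small (f : nat -> R) (C : R) : 0 < C -> (forall n, f n <= C * 2^-1 ^+ n) ->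
    forall e, 0 < e -> \forall n \near \oo, f n <= e.
  move=> C1 hf e e0; have : geometric C (2^-1 : R) @ \oo --> 0.
    by apply: cvg_geometric; rewrite ger0_norm ?invr_ge0// invf_lt1// ltr1n.
  move=> /cvgrPdist_le /(_ _ e0); apply: filterS => n /=.
  rewrite sub0r normrN => /(le_trans (ler_norm _)); exact: le_trans.
split => //; exists (fun n => iot (w n)); split.
- by move=> n; exact: iot_dom.
- apply/Hnorm_cvg; first by near=> n; exact: (inL2B mI (iot_inH _) hu).
  apply: (small _ 1) => // n; rewrite mul1r clsBE//; last exact: iot_inH.
  by rewrite distrC; case: (hw n).
- have h0 n := L0t_inH (iot_dom (w n)).
  apply/Hnorm_cvg; first by near=> n; exact: (inL2B mI (h0 _) hB).
  apply: (small _ (1 + pc)) => // n; have [k1 k2] := hw n.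
  rewrite !clsBE//.
  have -> : cls (L0t p (iot (w n))) - (cls v - cls (Lprime p u)) =
     - (cls v - iota_ (lp (w n))) + (cls (Lprime p u) - cls (Lprime p (iot (w n)))).
    by rewrite iota_Lp; linmod R.
  rewrite (le_trans (ler_normD _ _))// normrN mulrDl mul1r lerD//.
  rewrite (le_trans (cls_Lprime_dist hu (iot_inH _)))// ler_wpM2l//.
Unshelve. all: by end_near. Qed.

Lemma L_app u v : L_graph p u v -> [/\ inH u, inH v & app (cls u) (cls v)].
Proof.
move=> [hu hB [U [dU]]]; have hp := Lprime_inH hu.
have hv : inH v by have := inL2D mI hB hp; rewrite subrK.
have hU n := dom_inH (dU n); have h0 n := L0t_inH (dU n).
move=> /Hnorm_cvg c1 /Hnorm_cvg c2; split => //; apply: app_crit => w.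
have {}c1 := c1 (nearW _ (fun n => inL2B mI (hU n) hu)).
have {}c2 := c2 (nearW _ (fun n => inL2B mI (h0 n) hB)).
apply/ler_addgt0Pr => e e0.
have C0 : 0 < 1 + lam + 1 + pc by rewrite /lam; have := c0; lra.
have e1 := divr_gt0 e0 C0; set e' := e / _ in e1.
have [n [k1 k2]] : exists n, `|cls (U n - u)| <= e' /\ `|cls (L0t p (U n) - (v - Lprime p u))| <= e'.
  have := filterI (c1 _ _ e1) (c2 _ _ e1) => -[N _ /(_ N (leqnn N))] [? ?]; by exists N.
rewrite clsBE// in k1; rewrite !clsBE// in k2.
have [dd De] := dom_L0tB (dU n) (iot_dom w).
have iw := iot_inH w; have hw := L0t_inH (iot_dom w).
have l0 : 0 <= lam by rewrite /lam addr_ge0.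
have := dissip_dom dd l0.
have -> : cls (L0t p (U n - iot w)) = cls (L0t p (U n)) - cls (L0t p (iot w)).
  by rewrite -clsBE//; exact: (cls_eq (L0t_inH dd) (inL2B mI (h0 n) hw) De).
have -> : cls (Lprime p (U n - iot w)) = cls (Lprime p (U n)) - cls (Lprime p (iot w)).
  have pU := Lprime_inH (hU n); have pw := Lprime_inH iw.
  rewrite -clsBE//; have hUw := inL2B mI (hU n) iw.
  exact: (cls_eq (Lprime_inH hUw) (inL2B mI pU pw) (aeq_sym (LprimeB (hU n) iw))).
rewrite clsBE// => D.
have k3 := le_trans (cls_Lprime_dist (hU n) hu) (ler_wpM2l c0 k1).
have -> : (lam - (1 + pc)) = 1 by rewrite /lam; ring.
move: D; rewrite (_ : lam - (1 + pc) = 1) ?mul1r; last by rewrite /lam; ring.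
move=> D.
set A := cls (U n) - cls u in k1; set B := cls (L0t p (U n)) - _ in k2.
set C := cls (Lprime p (U n)) - _ in k3.
have E1 : cls u - iota_ w = cls (U n) - cls (iot w) - A by rewrite /A /iota_; linmod R.
have E2 : lam *: (cls (U n) - cls (iot w)) - (cls (L0t p (U n)) - cls (L0t p (iot w))
    + (cls (Lprime p (U n)) - cls (Lprime p (iot w)))) =
    lam *: (cls u - iota_ w) - (cls v - iota_ (lp w)) + (lam *: A - B - C).
  by rewrite iota_Lp /A /B /C /iota_; linmod R.
rewrite E1 (le_trans (ler_normB _ _))//.
rewrite E2 in D; have D2 := le_trans D (ler_normD _ _).
have D3 : `|lam *: A - B - C| <= lam * e' + e' + pc * e'.
  rewrite (le_trans (ler_normB _ _))// lerD// (le_trans (ler_normB _ _))// lerD//.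
  by rewrite normrZ ger0_norm// ler_wpM2l.
have E3 : e = e' * (1 + lam + 1 + pc) by rewrite /e' divfK// gt_eqF.
rewrite -E1 E3; move: D2 D3 k1; lra.
Qed.

(** Both relations equal [app]. It lies in the generator because the latter is closed, and in
    [L_graph] because polynomial pairs are in the domain and [Lprime] is bounded. Conversely, both
    satisfy the resolvent estimate against polynomials, and [app_crit] puts them in [app]. *)
Theorem gen_L_graph u v : inH u -> inH v ->
  (L_graph p u v <-> genV Sg (cls u) (cls v)).
Proof.
move=> hu hv; split; first by move=> /L_app[_ _ /app_gen].
by move=> /gen_app; exact: app_L.
Qed.

End GeneratorGraph.

(** * Semigroups and integrals on functions and on classes *)

Section Transfer.
Context {R : realType}.
Variable p : R.
Hypothesis p1 : 1 < p.
Notation I01 := (`]0%R, 1%R[%classic : set R).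
Notation V := (Vsp R).
Notation Sg := (St (pa p) (pc p)).
Implicit Types (u v : fpair R).

Let a0 : 0 <= pa p := ltW (pa_gt0 p1).
Let c0 : 0 <= pc p := ltW (pc_gt0 p1).
Let mI : measurable I01 := @mI01 R.

Lemma gen_cvg (S : R -> fpair R -> fpair R) u v : (forall h, 0 <= h -> inH (S h u)) ->
  inH u -> inH v ->
  (Hnorm (h^-1 *: (S h u - u) - v)%R @[h --> 0^'+] --> 0%E) <->
  (forall e : R, 0 < e -> exists2 d : R, 0 < d & forall h, 0 < h < d ->
    `|cls (S h u) - cls u - h *: cls v| <= e * h).
Proof.
move=> hS hu hv.
have E (h : R) : 0 < h -> `|cls (h^-1 *: (S h u - u) - v)| =
    h^-1 * `|cls (S h u) - cls u - h *: cls v|.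
  move=> h0; have hs := hS h (ltW h0); have hb := inL2B mI hs hu.
  rewrite clsBE//; last exact: (inL2Z (h^-1) mI hb).
  rewrite clsZE// clsBE//.
  have -> : h^-1 *: (cls (S h u) - cls u) - cls v =
     h^-1 *: (cls (S h u) - cls u - h *: cls v).
    by rewrite [RHS]scalerBr scalerA mulVf ?gt_eqF// scale1r.
  by rewrite normrZ gtr0_norm// invr_gt0.
have inh : \forall h \near 0^'+, inH (h^-1 *: (S h u - u) - v).
  near=> h; have h0 : 0 < h by near: h; exact: nbhs_right_gt.
  exact: (inL2B mI (inL2Z (h^-1) mI (inL2B mI (hS h (ltW h0)) hu)) hv).
have H := @Hnorm_cvg R _ (0^'+) _ (fun h => h^-1 *: (S h u - u) - v) inh.
split.
  move=> /H {}H e e0; have := H _ e0 => -[d /= d0 hd]; exists d => // h /andP[h0 hd1].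
  have := hd h; rewrite /ball_ /= sub0r normrN gtr0_norm// => /(_ hd1 h0).
  by rewrite E// mulrC ler_pdivrMr.
move=> h; apply/H => e e0; have [d d0 hd] := h e e0.
near=> z; have z0 : 0 < z by near: z; exact: nbhs_right_gt.
rewrite E// mulrC ler_pdivrMr// hd// z0/=.
by near: z; exact: nbhs_right_lt.
Unshelve. all: by end_near. Qed.

Lemma sg_cont_cvg (S : R -> fpair R -> fpair R) u : (forall h, 0 <= h -> inH (S h u)) ->
  inH u ->
  (Hnorm (S h u - u)%R @[h --> 0^'+] --> 0%E) <->
  (forall e : R, 0 < e -> exists2 d : R, 0 < d & forall h, 0 < h < d ->
    `|cls (S h u) - cls u| <= e).
Proof.
move=> hS hu.
have inh : \forall h \near 0^'+, inH (S h u - u).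
  near=> h; have h0 : 0 < h by near: h; exact: nbhs_right_gt.
  exact: (inL2B mI (hS h (ltW h0)) hu).
have H := @Hnorm_cvg R _ (0^'+) _ (fun h => S h u - u) inh.
split.
  move=> /H {}H e e0; have := H _ e0 => -[d /= d0 hd]; exists d => // h /andP[h0 hd1].
  have := hd h; rewrite /ball_ /= sub0r normrN gtr0_norm// => /(_ hd1 h0).
  by rewrite clsBE//; exact: hS (ltW h0).
move=> h; apply/H => e e0; have [d d0 hd] := h e e0.
near=> z; have z0 : 0 < z by near: z; exact: nbhs_right_gt.
rewrite clsBE//; last exact: hS (ltW z0).
apply: hd; rewrite z0/=.
by near: z; exact: nbhs_right_lt.
Unshelve. all: by end_near. Qed.

Section Uniqueness.
Variable S1 : R -> fpair R -> fpair R.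
Hypothesis hS1 : C0_semigroup S1.
Hypothesis gS1 : forall u v, generator S1 u v <-> L_graph p u v.

Let st t u : 0 <= t -> inH u -> inH (S1 t u).
Proof. by move=> t0 hu; exact: (sg_stable hS1). Qed.

Let lin t k u v : 0 <= t -> inH u -> inH v ->
  cls (S1 t (k *: u + v)) = k *: cls (S1 t u) + cls (S1 t v).
Proof.
move=> t0 hu hv; have hk := inL2Z k mI hu; have hkv := inL2D mI hk hv.
have sk := inL2Z k mI (st t0 hu).
rewrite -clsZE; last exact: st. rewrite -clsDE//; last exact: st.
apply: cls_eq; [exact: st|exact: (inL2D mI sk (st t0 hv))|exact: (sg_linear hS1)].
Qed.

Let bnd t : 0 <= t -> exists M : R, forall u, inH u -> `|cls (S1 t u)| <= M * `|cls u|.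
Proof.
move=> t0; have [M hM] := sg_bounded hS1 t0; exists M => u hu.
have := hM u hu; rewrite (Hnorm_cls hu) (Hnorm_cls (st t0 hu)).
by rewrite -EFinM lee_fin.
Qed.

(** The given maps act on functions. Linearity and boundedness, applied to the difference, show that
    they respect classes. *)
Let ext t u v : 0 <= t -> inH u -> inH v -> cls u = cls v -> cls (S1 t u) = cls (S1 t v).
Proof.
move=> t0 hu hv E; have [M hM] := bnd t0.
have hd : inH (-1 *: u + v) by exact: (inL2D mI (inL2Z (-1) mI hu) hv).
have := hM _ hd; rewrite lin// (clsDE (inL2Z (-1) mI hu) hv).
rewrite clsZE// E !scaleN1r addNr normr0 mulr0 normr_le0 addrC subr_eq0.
by move=> /eqP ->.
Qed.

Let SV t (x : V) : V := cls (S1 t (vrep x)).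

Let SV_cls t u : 0 <= t -> inH u -> SV t (cls u) = cls (S1 t u).
Proof. move=> t0 hu; apply: (ext t0 (vrep_inH _) hu); exact: vrepK. Qed.

Let SV_cont x e : 0 < e -> exists2 d, 0 < d & forall h, 0 < h < d -> `|SV h x - x| <= e.
Proof.
move=> e0; have hx := vrep_inH x.
have [H _] := @sg_cont_cvg S1 (vrep x) (fun h h0 => st h0 hx) hx.
by have := H (sg_continuous hS1 hx) e e0; rewrite vrepK.
Qed.

Let SV_sg : semigroupV SV.
Proof.
have SVl t k x y : 0 <= t -> SV t (k *: x + y) = k *: SV t x + SV t y.
  move=> t0; have hx := vrep_inH x; have hy := vrep_inH y; rewrite -lin// -[LHS]/(SV _ _).
  rewrite -{1}(vrepK x) -{1}(vrepK y) -clsZE// -clsDE//; last exact: (inL2Z k mI hx).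
  by rewrite SV_cls//; exact: (inL2D mI (inL2Z k mI hx) hy).
have SV0 x : SV 0 x = x.
  rewrite -{2}(vrepK x); apply: cls_eq; [exact: st (vrep_inH x)|exact: vrep_inH|].
  by apply: (sg_0 hS1); exact: vrep_inH.
have SVD s t x : 0 <= s -> 0 <= t -> SV (s + t) x = SV s (SV t x).
  move=> s0 t0; have hx := vrep_inH x; have h1 := st t0 hx.
  rewrite {3}/SV SV_cls//; apply: cls_eq; [exact: st (addr_ge0 s0 t0) hx|exact: st|].
  exact: (sg_add hS1).
have Z t : 0 <= t -> SV t 0 = 0.
  move=> t0; have := SVl t (-1) 0 0 t0; rewrite scaler0 addr0 => {1}->.
  by rewrite scaleN1r addNr.
split => //.
- by move=> t x y t0; rewrite -{1}[x]scale1r SVl// scale1r.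
- by move=> t k x t0; rewrite -[k *: x]addr0 SVl// Z// addr0.
apply: sg_local_bound => // t t0; have [M hM] := bnd t0; exists M => x.
by have := hM _ (vrep_inH x); rewrite vrepK.
Qed.

(** The semigroup is existentially quantified inside [mild_solution], so two solutions may come with
    two different ones. This identifies each of them with [St] on classes. *)
Lemma C0_semigroup_unique t u : 0 <= t -> inH u -> cls (S1 t u) = Sg t (cls u).
Proof.
move=> t0 hu; rewrite -SV_cls//.
have g x y : genV Sg x y -> genV SV x y.
  move=> h; have hx := vrep_inH x; have hy := vrep_inH y.
  rewrite -(vrepK x) -(vrepK y) in h; have /gS1[_ _] := (gen_L_graph p1 hx hy).2 h.
  by move=> /(@gen_cvg S1 _ _ (fun h h0 => st h0 hx) hx hy); rewrite !vrepK.
symmetry; apply: (sgV_unique (St_sg a0 c0) SV_sg g _ _ t0).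
move=> x e e0; have [w hw] := dense_iota x e0.
exists (iota_ w), (iota_ (Lp (pa p) (pc p) w)); split; [exact: St_gen|exact: hw].
Qed.

End Uniqueness.

Definition S0 t u : fpair R := vrep (Sg t (cls u)).

Lemma S0_cls t u : cls (S0 t u) = Sg t (cls u). Proof. exact: vrepK. Qed.

Lemma S0_C0 : C0_semigroup S0.
Proof.
have hS := St_sg a0 c0; have hi t u : inH (S0 t u) := vrep_inH _.
split.
- by move=> t u _ _; exact: hi.
- move=> t k u v t0 hu hv; have hk := inL2Z k mI hu.
  have hk' := inL2Z k mI (hi t u).
  apply: cls_inj; [exact: hi|exact: (inL2D mI hk' (hi t v))|].
  rewrite [RHS]clsDE// ?clsZE// !S0_cls clsDE// clsZE// (sgV_add hS)// (sgV_scale hS)//.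
- move=> t t0; exists (expR ((1 + pc p) * t)) => u hu.
  by rewrite !Hnorm_cls// S0_cls -EFinM lee_fin St_growth.
- move=> u hu; apply: (cls_inj (hi _ _) hu); rewrite S0_cls; exact: (sgV_0 hS).
- move=> s t u s0 t0 hu; apply: (cls_inj (hi _ _) (hi _ _)).
  rewrite !S0_cls; exact: (sgV_D hS _ s0 t0).
- move=> u hu; apply/(sg_cont_cvg (fun h _ => hi h u) hu) => e e0.
  have [d d0 hd] := sgV_cont0 hS (cls u) e0; exists d => // h hh.
  by rewrite S0_cls; exact: hd.
Qed.

Lemma S0_generator u v : generator S0 u v <-> L_graph p u v.
Proof.
have hi t w : inH (S0 t w) := vrep_inH _.
split.
  move=> [hu hv /(gen_cvg (fun h _ => hi h u) hu hv) h].
  apply/(gen_L_graph p1 hu hv) => e e0; have [d d0 hd] := h e e0; exists d => // z /hd.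
  by rewrite S0_cls.
move=> hL; have [hu hv _] := L_app p1 hL; split => //.
apply/(gen_cvg (fun h _ => hi h u) hu hv) => e e0.
have [d d0 hd] := (gen_L_graph p1 hu hv).1 hL e e0; exists d => // z /hd.
by rewrite S0_cls.
Qed.

Lemma cls_sum n (k : 'I_n -> R) (u : 'I_n -> fpair R) : (forall i, inH (u i)) ->
  inH (\sum_(i < n) k i *: u i) /\
  cls (\sum_(i < n) k i *: u i) = \sum_(i < n) k i *: cls (u i).
Proof.
elim: n k u => [|n IH] k u hu.
  by rewrite !big_ord0; split; [exact: inL20|exact: cls0].
have [h E] := IH (fun i => k (widen_ord (leqnSn n) i)) (fun i => u (widen_ord (leqnSn n) i))
  (fun i => hu _).
rewrite !big_ord_recr /=; have hk := inL2Z (k ord_max) mI (hu ord_max).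
by split; [exact: (inL2D mI h hk)|rewrite clsDE// clsZE// E].
Qed.

(* The quantifier over partitions is not vacuous: uniform ones are arbitrarily
   fine, so a Riemann integral is unique. *)
Lemma uniform_partition (a b d : R) : a <= b -> 0 < d ->
  exists (n : nat) (t : nat -> R), [/\ t 0%N = a, t n = b &
    forall i, (i < n)%N -> t i <= t i.+1 /\ t i.+1 - t i < d].
Proof.
move=> ab d0; pose n := Num.truncn ((b - a) / d).
have n0 : 0 < n.+1%:R :> R by [].
exists n.+1, (fun i => a + i%:R * ((b - a) / n.+1%:R)); split.
- by rewrite mul0r addr0.
- by rewrite mulrC divfK ?gt_eqF// addrC subrK.
move=> i _; have -> : a + i.+1%:R * ((b - a) / n.+1%:R) =
    a + i%:R * ((b - a) / n.+1%:R) + (b - a) / n.+1%:R by rewrite -natr1; ring.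
rewrite lerDl divr_ge0 ?subr_ge0//; split => //.
rewrite addrC addKr ltr_pdivrMr// mulrC -ltr_pdivrMr//; exact: truncnS_gt.
Qed.

Lemma partition_mono (t : nat -> R) n : (forall i, (i < n)%N -> t i <= t i.+1) ->
  forall i j, (i <= j <= n)%N -> t i <= t j.
Proof.
move=> h i; elim=> [|j IH] /andP[ij jn]; first by move: ij; rewrite leqn0 => /eqP ->.
move: ij; rewrite leq_eqVlt => /orP[/eqP ->//|ij].
by rewrite (le_trans (IH _)) ?h// -ltnS ij/= ltnW.
Qed.

Lemma is_HintegralP (F : R -> fpair R) (FV : R -> V) (a b : R) v : a <= b ->
  (forall s, a <= s <= b -> inH (F s) /\ cls (F s) = FV s) -> cont_on a b FV -> inH v ->
  (is_Hintegral F a b v <-> cls v = Vint FV a b).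
Proof.
move=> ab hF cF hv.
have key n (t s : nat -> R) : t 0%N = a -> t n = b ->
   (forall i, (i < n)%N -> t i <= s i <= t i.+1) ->
   inH (\sum_(i < n) (t i.+1 - t i) *: F (s i) - v) /\
   cls (\sum_(i < n) (t i.+1 - t i) *: F (s i) - v) =
   \sum_(i < n) (t i.+1 - t i) *: FV (s i) - cls v.
  move=> t0 tn hts.
  have mono := @partition_mono t n (fun i hi => let: conj x y := andP (hts i hi) in le_trans x y).
  have hs (i : 'I_n) : a <= s i <= b.
    have /andP[h1 h2] := hts i (ltn_ord i); rewrite -t0 -tn.
    rewrite (le_trans _ h1) ?(le_trans h2)// mono//; last by rewrite leq0n ltnW.
    by rewrite leqnn andbT ltn_ord.
  have [h E] := @cls_sum n (fun i => t i.+1 - t i) (fun i => F (s i)) (fun i => (hF _ (hs i)).1).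
  split; first exact: (inL2B mI h hv).
  rewrite clsBE// E; congr (_ - _); apply: eq_bigr => i _.
  by rewrite (hF _ (hs i)).2.
split; last first.
  move=> Ev e e0; have e20 : 0 < e / 2 by rewrite divr_gt0.
  have [d d0 hd] := Vint_riemann ab cF e20; exists d => // n t s t0 tn hts.
  have [h E] := key n t s t0 tn (fun i hi => (hts i hi).1).
  rewrite Hnorm_cls// E Ev lte_fin (le_lt_trans (hd n t s t0 tn hts))//.
  by rewrite ltr_pdivrMr// ltr_pMr// ltr1n.
move=> H; apply/eqP; rewrite -subr_eq0 -normr_le0; apply/ler_addgt0Pr => e e0; rewrite add0r.
have e20 : 0 < e / 2 by rewrite divr_gt0.
have [d d0 hd] := H _ e20; have [d' d'0 hd'] := Vint_riemann ab cF e20.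
have [n [t [t0 tn ht]]] : exists (n : nat) (t : nat -> R), [/\ t 0%N = a, t n = b &
    forall i, (i < n)%N -> t i <= t i.+1 /\ t i.+1 - t i < Num.min d d'].
  by apply: uniform_partition => //; rewrite lt_min d0.
have A1 i : (i < n)%N -> t i <= t i <= t i.+1 /\ t i.+1 - t i < d.
  by move=> /ht[-> ]; rewrite lexx lt_min => /andP[].
have A2 i : (i < n)%N -> t i <= t i <= t i.+1 /\ t i.+1 - t i < d'.
  by move=> /ht[-> ]; rewrite lexx lt_min => /andP[].
have [h E] := key n t t t0 tn (fun i hi => (A1 i hi).1).
have := hd n t t t0 tn A1; rewrite Hnorm_cls// E lte_fin => /ltW k1.
have := hd' n t t t0 tn A2; move: k1; set s := \sum_(i < n) _ => k1 k2.
have -> : cls v - Vint FV a b = (s - Vint FV a b) - (s - cls v) by linmod R.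
by rewrite (le_trans (ler_normB _ _))// [leRHS]splitr lerD.
Qed.

End Transfer.

(** * Decay away from the unstable direction *)

Section PolyParity.
Context {R : realType}.
Implicit Types (q w : {poly R}).

Lemma opart_pint_epart q : opart (pint (epart q)) = pint (epart q).
Proof.
apply/polyP => -[|i]; rewrite coef_opart coef_pint //= coef_epart.
by case: (odd i); rewrite /= ?mul0r.
Qed.

Lemma epart_pint_epart q : epart (pint (epart q)) = 0.
Proof.
apply/polyP => -[|i]; rewrite coef_epart coef_pint coef0 //= coef_epart.
by case: (odd i); rewrite /= ?mul0r.
Qed.

Lemma epart_pint_opart q : epart (pint (opart q)) = pint (opart q).
Proof.
apply/polyP => -[|i]; rewrite coef_epart coef_pint //= coef_opart.
by case: (odd i); rewrite /= ?mul0r.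
Qed.

Lemma opart_pint_opart q : opart (pint (opart q)) = 0.
Proof.
apply/polyP => -[|i]; rewrite coef_opart coef_pint coef0 //= coef_opart.
by case: (odd i); rewrite /= ?mul0r.
Qed.

Lemma opartK q : opart (opart q) = opart q.
Proof. by apply/polyP => i; rewrite !coef_opart; case: odd. Qed.

Lemma pint_Xderiv q : pint ('X * q^`()) = 'X * q - pint q.
Proof.
apply/polyP => -[|i]; rewrite coefB coefXM !coef_pint /= ?subrr//.
rewrite coefXM coef_deriv; case: i => [|i] /=.
  by rewrite mul0r divr1 subrr.
rewrite -mulr_natr; have h : i.+2%:R != 0 :> R by rewrite pnatr_eq0.
by move: h; rewrite -[i.+2%:R]natr1 => h; field.
Qed.

Lemma horner_opart0 q : (opart q).[0] = 0.
Proof. by rewrite horner_coef0 coef_opart. Qed.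

Lemma size_pint q : (size (pint q) <= (size q).+1)%N.
Proof. exact: size_poly. Qed.

Lemma pint_mono q (r s : R) : r <= s -> (forall x, r < x < s -> 0 <= q.[x]) ->
  (pint q).[r] <= (pint q).[s].
Proof.
move=> rs h; apply: (deriv1_mono rs (f' := horner q)) => // x _.
by have := is_derive_poly (pint q) x; rewrite deriv_pint.
Qed.

(** Expand the integral of [(q - t) ^ 2] over [[r, s]], with [t] the mean value of [q] there. *)
Lemma pint_cauchy_schwarz q (r s : R) : -1 <= r -> r <= s -> s <= 1 ->
  `|(pint q).[s] - (pint q).[r]| <=
  Num.sqrt (s - r) * Num.sqrt ((pint (q * q)).[1] - (pint (q * q)).[-1]).
Proof.
move=> r1 rs s1; have sr0 : 0 <= s - r by rewrite subr_ge0.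
set J := (pint q).[s] - (pint q).[r].
set Q := (pint (q * q)).[1] - (pint (q * q)).[-1].
have sq x : 0 <= (q * q).[x] by rewrite hornerM -expr2 sqr_ge0.
have Q1 : (pint (q * q)).[s] - (pint (q * q)).[r] <= Q.
  by rewrite /Q lerB//; apply: pint_mono => // x _; exact: sq.
suff : J ^+ 2 <= (s - r) * Q.
  move=> h; rewrite -sqrtrM// -sqrtr_sqr ler_sqrt// mulr_ge0//.
  apply: le_trans Q1; rewrite subr_ge0; apply: pint_mono => // x _; exact: sq.
move: sr0; rewrite le_eqVlt => /orP[/eqP E|sr0].
  have rs' : r = s by lra.
  by rewrite /J rs' !subrr expr2 !mul0r.
pose t := J / (s - r).
have key : 0 <= (pint ((q - t%:P) * (q - t%:P))).[s] - (pint ((q - t%:P) * (q - t%:P))).[r].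
  by rewrite subr_ge0; apply: pint_mono => // x _; rewrite hornerM -expr2 sqr_ge0.
have E : (q - t%:P) * (q - t%:P) = q * q + (- (t + t)) *: q + (t * t)%:P.
  by rewrite -mul_polyC polyCN polyCD polyCM; ring.
have pC (k x : R) : (pint k%:P).[x] = k * x.
  have -> : pint k%:P = k *: 'X.
    apply/polyP => -[|[|i]]; rewrite coef_pint coefZ coefX ?coefC /= ?mulr0 ?mul0r//.
    by rewrite divr1 mulr1.
  by rewrite hornerZ hornerX.
rewrite E !pintD !pintZ !hornerD !hornerZ !pC in key.
have key2 : 0 <= Q - J ^+ 2 / (s - r).
  have : t ^+ 2 * (s - r) = J ^+ 2 / (s - r) by rewrite /t; field; rewrite gt_eqF.
  have : t * J = J ^+ 2 / (s - r) by rewrite /t; field; rewrite gt_eqF.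
  move: key Q1; rewrite /J; lra.
by rewrite subr_ge0 ler_pdivrMr// mulrC in key2.
Qed.

(** The sum of the squares of the odd and even parts is the even part of the square. So the norm of
    the pair is, up to a factor, the L^2 norm of the polynomial on [[-1, 1]], the natural domain of
    the transport equation. *)
Lemma pip_sym q : 2 * pip q q = (pint (q * q)).[1] - (pint (q * q)).[-1].
Proof.
have h (r : {poly R}) (x : R) : is_derive x (1 : R) (fun y : R => (pint r).[y]) r.[x].
  by have := is_derive_poly (pint r) x; rewrite deriv_pint.
have hN (r : {poly R}) (x : R) : is_derive x (1 : R) (fun y : R => (pint r).[- y]) (- r.[- x]).
  have := deriv1_comp (g := fun y => -1 * y + 0) (h r (-1 * x + 0)) (deriv1_lin (-1) 0 x).
  apply: deriv1_ext => [y|]; rewrite ?mulN1r ?addr0//.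
  by rewrite mulrN1.
pose s := opart q * opart q + epart q * epart q.
have := deriv1_eq0 (f := fun y => 2 * (pint s).[y] - ((pint (q * q)).[y] - (pint (q * q)).[- y]))
  (@ler01 R).
rewrite !oppr0 !horner_pint0 !subr0 mulr0 pipE -/s => H.
suff E : forall x : R, 0 <= x <= 1 -> is_derive x (1 : R) (fun y : R =>
    2 * (pint s).[y] - ((pint (q * q)).[y] - (pint (q * q)).[- y])) 0.
  by have := H E; lra.
move=> x _.
have := deriv1D (deriv1Z 2 (h s x)) (deriv1Z (-1) (deriv1D (h (q * q) x) (deriv1Z (-1) (hN (q * q) x)))).
apply: deriv1_ext => [y|]; first by rewrite !mulN1r.
rewrite /s hornerD !hornerM !horner_opart !horner_epart; lra.
Qed.

End PolyParity.

(** * Reduction to a transport equation *)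

Section Characteristics.
Context {R : realType}.
Variable a : R.
Hypothesis a0 : 0 < a.
Let nu : R := a + 1.
Let c : R := (a + 1) * (a + 2).
Let c' : R := a * (a + 1).
Notation lp := (Lp a c).
Implicit Types (w q : {poly R}).

(** A linear functional of a polynomial of bounded size is a fixed combination of its coefficients,
    so it can be differentiated along the flow coefficient by coefficient. *)
Lemma flow_lin N W (phi : {poly R} -> R) t : flow a c N W ->
  (forall t, (size (lp (W t)) <= N)%N) ->
  (forall p q, phi (p + q) = phi p + phi q) -> (forall k p, phi (k *: p) = k * phi p) ->
  is_derive t (1 : R) (fun s => phi (W s)) (phi (lp (W t))).
Proof.
move=> [sW dW] sL pD pZ.
have p0 : phi 0 = 0 by rewrite -(scale0r (0 : {poly R})) pZ mul0r.
have E w : (size w <= N)%N -> phi w = \sum_(i < N) w`_i * phi 'X^i.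
  move=> sw; have {1}-> : w = \sum_(i < N) w`_i *: 'X^i.
    rewrite -poly_def; apply/polyP => i; rewrite coef_poly; case: ltnP => // h.
    by rewrite nth_default// (leq_trans sw).
  rewrite (big_morph phi pD p0); apply: eq_bigr => i _; exact: pZ.
have := @deriv1_sum R N (fun i s => phi 'X^i * (W s)`_i) (fun i => phi 'X^i * (lp (W t))`_i) t
  (fun i => deriv1Z (phi 'X^i) (dW i t)).
apply: deriv1_ext => [s|]; rewrite E//; apply: eq_bigr => i _; exact: mulrC.
Qed.

(** The constant [nu = a + 1] is dictated by the eigenvector [1 + nu x]: [XP] vanishes on it and
    [BP] maps it to the constant -1. At the same time the factor of the integral term drops from
    [(a + 1) (a + 2)] to [a (a + 1)], the value that the contraction argument can afford. *)
Definition XP w : {poly R} := - opart w + nu *: pint (epart w).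
Definition BP w : {poly R} := - w + nu *: pint (epart w) - nu *: pint (XP w).

Lemma XPD p q : XP (p + q) = XP p + XP q.
Proof. by rewrite /XP opartD epartD pintD scalerDr opprD addrACA. Qed.
Lemma XPZ k q : XP (k *: q) = k *: XP q.
Proof. by rewrite /XP opartZ epartZ pintZ scalerDr scalerN !scalerA (mulrC k). Qed.
Lemma BPD p q : BP (p + q) = BP p + BP q.
Proof. by rewrite /BP XPD epartD !pintD !scalerDr; ring. Qed.
Lemma BPZ k q : BP (k *: q) = k *: BP q.
Proof. by rewrite /BP XPZ epartZ !pintZ -!mul_polyC; ring. Qed.

Lemma opart_XP w : opart (XP w) = XP w.
Proof.
by rewrite /XP -scaleN1r opartD !opartZ opartK opart_pint_epart.
Qed.

Lemma opart_BP w : opart (BP w) = XP w.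
Proof.
have hx := opart_XP w; have -> : BP w = -1 *: w + nu *: pint (epart w) + (- nu) *: pint (opart (XP w)).
  by rewrite hx scaleN1r scaleNr.
transitivity (-1 *: opart w + nu *: pint (epart w)); last by rewrite scaleN1r.
move: (XP w) hx => x hx.
by rewrite !opartD !opartZ opart_pint_opart opart_pint_epart scaler0 addr0.
Qed.

Lemma epart_BP w : epart (BP w) = - epart w - nu *: pint (XP w).
Proof.
have hx := opart_XP w; have -> : BP w = -1 *: w + nu *: pint (epart w) + (- nu) *: pint (opart (XP w)).
  by rewrite hx scaleN1r scaleNr.
move: (XP w) hx => x hx.
rewrite !epartD !epartZ epart_pint_opart epart_pint_epart scaler0 addr0 hx.
by rewrite scaleN1r scaleNr.
Qed.

Lemma size_XP w : (size (XP w) <= (size w).+1)%N.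
Proof.
rewrite (leq_trans (size_polyD _ _))// geq_max size_polyN; apply/andP; split.
  by rewrite (leq_trans (size_poly _ _)).
rewrite (leq_trans (size_scale_leq _ _))// (leq_trans (size_pint _))// ltnS.
exact: size_poly.
Qed.

Lemma size_BP w : (size (BP w) <= (size w).+2)%N.
Proof.
rewrite (leq_trans (size_polyD _ _))// geq_max size_polyN; apply/andP; split; last first.
  rewrite (leq_trans (size_scale_leq _ _))// (leq_trans (size_pint _))// ltnS.
  exact: size_XP.
rewrite (leq_trans (size_polyD _ _))// geq_max size_polyN; apply/andP; split.
  by rewrite (leq_trans (leqnSn _)).
rewrite (leq_trans (size_scale_leq _ _))// (leq_trans (size_pint _))// ltnS.
by rewrite (leq_trans (size_poly _ _)).
Qed.

(* In the variable [BP w] the generator becomes a transport operator plus the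
   smoothing term [c' pint (XP w)], up to a constant. *)
Lemma BP_Lp w : BP (lp w) = (1 - 'X) * (BP w)^`() - a *: BP w +
  c' *: pint (XP w) + (- nu * (epart w).[0])%:P.
Proof.
set o := opart w; set e := epart w; set U := pint e.
have wE : w = e + o by rewrite epart_opart.
have dU : U^`() = e by rewrite deriv_pint.
have o0 : (o.[0])%:P = 0 :> {poly R} by rewrite horner_opart0.
have eL : epart (lp w) = o^`() - 'X * e^`() - a *: e by rewrite epart_Lp.
have oL : opart (lp w) = e^`() - 'X * o^`() - a *: o + c *: U by rewrite opart_Lp.
have pXe : pint ('X * e) = 'X * U - pint U by rewrite -{1}dU pint_Xderiv.
have pN q : pint (- q) = - pint q by rewrite -scaleN1r pintZ scaleN1r.
have UL : pint (epart (lp w)) = o - 'X * e + U - a *: U.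
  rewrite eL !pintD !pN pintZ pint_deriv pint_Xderiv o0 -/U; ring.
have XL : XP (lp w) = - (e^`() - 'X * o^`() - a *: o + c *: U) +
    nu *: (o - 'X * e + U - a *: U) by rewrite /XP oL UL.
have PXL : pint (XP (lp w)) = - (e - (e.[0])%:P - ('X * o - pint o) - a *: pint o + c *: pint U) +
    nu *: (pint o - ('X * U - pint U) + pint U - a *: pint U).
  rewrite XL; do !rewrite ?pintD ?pN ?pintZ ?pint_deriv ?pint_Xderiv ?pXe.
  by [].
have PX : pint (XP w) = - pint o + nu *: pint U by rewrite /XP pintD pN pintZ.
have lpE : lp w = (o^`() - 'X * e^`() - a *: e) + (e^`() - 'X * o^`() - a *: o + c *: U).
  by rewrite -eL -oL epart_opart.
have dB : (BP w)^`() = - (e^`() + o^`()) + nu *: e - nu *: XP w.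
  by rewrite /BP derivB derivD derivN !derivZ !deriv_pint {1}wE derivD.
have XE : XP w = - o + nu *: U by [].
have BE : BP w = - (e + o) + nu *: U - nu *: (- pint o + nu *: pint U).
  by rewrite /BP PX -wE.
have c2 : c = (a + 1) * (a + 1 + 1) by rewrite /c; ring.
rewrite [LHS]/BP UL PXL lpE dB BE PX XE c2 /c' /nu.
move: o e U (pint o) (pint U) {wE dU o0 eL oL pXe UL XL PXL PX lpE dB XE BE} => o e U PO PU.
rewrite -!mul_polyC !(polyCM, polyCN, polyCD, polyC1); ring.
Qed.

Lemma XP_half w (y : R) : (XP w).[y] = ((BP w).[y] - (BP w).[- y]) / 2.
Proof. by rewrite -opart_BP horner_opart. Qed.

Lemma pint_XPN w (y : R) : (pint (XP w)).[- y] = (pint (XP w)).[y].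
Proof. by rewrite -opart_XP -epart_pint_opart horner_epartN. Qed.

Section Flow.
Variables (k : nat) (W : R -> {poly R}).
Hypothesis fW : flow a c k.*2 W.

Let sL t : (size (lp (W t)) <= k.*2)%N. Proof. by apply: size_Lp; case: fW. Qed.

(** The point [1 - (1 - y) exp(- (tau - s))] runs along the characteristic that reaches [y] at time
    [tau]. The last term does not depend on [y], so it cancels between two characteristics. *)
Lemma BP_char_deriv (tau y s : R) :
  is_derive s (1 : R)
   (fun s => expR (- a * (tau - s)) * (BP (W s)).[1 - (1 - y) * expR (- (tau - s))])
   (expR (- a * (tau - s)) *
     (c' * (pint (XP (W s))).[1 - (1 - y) * expR (- (tau - s))] - nu * (epart (W s)).[0])).
Proof.
pose M := k.*2.+2; pose eta s := 1 - (1 - y) * expR (- (tau - s)).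
have sB t : (size (BP (W t)) <= M)%N.
  by rewrite (leq_trans (size_BP _))// !ltnS; case: fW.
have sBL t : (size (BP (lp (W t))) <= M)%N.
  by rewrite (leq_trans (size_BP _))// !ltnS.
have dexp (l : R) : is_derive s (1 : R) (fun s => expR (l * (tau - s))) (- l * expR (l * (tau - s))).
  have := deriv1_comp (f := expR) (g := fun s => - l * s + l * tau) (is_derive_expR _) (deriv1_lin (- l) (l * tau) s).
  apply: deriv1_ext => [z|]; first by congr expR; ring.
  by rewrite mulrC; congr (_ * expR _); ring.
have deta : is_derive s (1 : R) eta (- (1 - eta s)).
  have := deriv1D (deriv1_cst 1 s) (deriv1Z (- (1 - y)) (dexp (-1))).
  apply: deriv1_ext => [z|]; rewrite /eta !mulN1r; ring.
have dpow i : is_derive s (1 : R) (fun s => eta s ^+ i) (i%:R * eta s ^+ i.-1 * (- (1 - eta s))).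
  elim: i => [|i IH]; first by under eq_fun do rewrite expr0; rewrite mul0r mul0r; exact: deriv1_cst.
  have := deriv1M deta IH; apply: deriv1_ext => [z|]; first by rewrite exprS.
  case: i {IH} => [|i]; first by rewrite !expr0; ring.
  by rewrite [in RHS]/= !exprS -[i.+2%:R]natr1; rewrite /= ; ring.
have dsum := @deriv1_sum R M (fun i s => (BP (W s))`_i * eta s ^+ i) _ s
  (fun i => deriv1M (@flow_lin _ W (fun w => (BP w)`_i) s fW sL
     (fun p q => etrans (congr1 (fun r : {poly R} => r`_i) (BPD p q)) (coefD _ _ _))
     (fun k p => etrans (congr1 (fun r : {poly R} => r`_i) (BPZ k p)) (coefZ _ _ _))) (dpow i)).
have hE (q : {poly R}) x : (size q <= M)%N -> q.[x] = \sum_(i < M) q`_i * x ^+ i.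
  by move=> sq; rewrite (horner_coef_wide _ sq).
have db : is_derive s (1 : R) (fun s => (BP (W s)).[eta s])
   (- a * (BP (W s)).[eta s] + (c' * (pint (XP (W s))).[eta s] - nu * (epart (W s)).[0])).
  move: dsum; apply: deriv1_ext => [z|]; first by rewrite hE.
  rewrite big_split /= -hE//.
  have -> : \sum_(i < M) (BP (W s))`_i * (i%:R * eta s ^+ i.-1 * - (1 - eta s)) =
      (BP (W s))^`().[eta s] * - (1 - eta s).
    have sd : (size (BP (W s))^`() <= M.-1)%N.
      by rewrite (leq_trans (size_poly _ _))// -!subn1 leq_sub2r.
    rewrite (horner_coef_wide _ sd) mulr_suml big_ord_recl /= !mul0r mulr0 add0r.
    apply: eq_bigr => i _; rewrite /bump leq0n add1n add0n coef_deriv -[_ *+ _]mulr_natr.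
    by ring.
  rewrite BP_Lp !(hornerD, hornerN, hornerM, hornerC, hornerX, hornerZ).
  by ring.
have := deriv1M (dexp (- a)) db; apply: deriv1_ext => [z|]; first by [].
by rewrite -/(eta s); ring.
Qed.

End Flow.

End Characteristics.

Section ScalarLemmas.
Context {R : realType}.

Lemma deriv1_le (f f' g g' : R -> R) (a b : R) : a <= b ->
  (forall x, a <= x <= b -> is_derive x (1 : R) f (f' x)) ->
  (forall x, a <= x <= b -> is_derive x (1 : R) g (g' x)) ->
  (forall x, a < x < b -> `|f' x| <= g' x) -> `|f b - f a| <= g b - g a.
Proof.
move=> ab df dg h.
have h1 := deriv1_mono ab (fun x xab => deriv1D (dg x xab) (df x xab)).
have h2 := deriv1_mono ab (fun x xab => deriv1D (dg x xab) (deriv1Z (-1) (df x xab))).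
have {}h1 : g a + f a <= g b + f b.
  by apply: h1 => x /h; rewrite ler_norml => /andP[]; lra.
have {}h2 : g a + -1 * f a <= g b + -1 * f b.
  by apply: h2 => x /h; rewrite ler_norml => /andP[]; lra.
by rewrite ler_norml; apply/andP; split; lra.
Qed.

Lemma sqrt_expR (x : R) : Num.sqrt (expR x) = expR (x / 2).
Proof.
have -> : expR x = expR (x / 2) ^+ 2 by rewrite expr2 -expRD -splitr.
by rewrite sqrtr_sqr ger0_norm// expR_ge0.
Qed.

Lemma deriv1_expRh (l tau s : R) :
  is_derive s (1 : R) (fun s => expR (l * (tau - s))) (- l * expR (l * (tau - s))).
Proof.
have := deriv1_comp (f := expR) (g := fun s => - l * s + l * tau) (is_derive_expR _)
  (deriv1_lin (- l) (l * tau) s).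
apply: deriv1_ext => [z|]; first by congr expR; ring.
by rewrite mulrC; congr (_ * expR _); ring.
Qed.

Lemma deriv1_horner_lin (q : {poly R}) (k l s : R) :
  is_derive s (1 : R) (fun s => q.[k * s + l]) (k * q^`().[k * s + l]).
Proof.
have := deriv1_comp (f := horner q) (g := fun s => k * s + l) (is_derive_poly _ _) (deriv1_lin k l s).
by apply: deriv1_ext => [z //|]; rewrite mulrC.
Qed.

Lemma horner_bound (q : {poly R}) (x : R) : `|x| <= 1 -> `|q.[x]| <= \sum_(i < size q) `|q`_i|.
Proof.
move=> x1; rewrite horner_coef (le_trans (ler_norm_sum _ _ _))//.
apply: ler_sum => i _; rewrite normrM ler_piMr// normrX exprn_ile1//.
Qed.

End ScalarLemmas.

(** * The weighted estimate along characteristics *)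

Section Decay.
Context {R : realType}.
Variables (a mu : R).
Hypotheses (a0 : 0 < a) (mu1 : -1 < mu) (mua : 2^-1 - a <= mu).
Let nu : R := a + 1.
Let c : R := (a + 1) * (a + 2).
Let c' : R := a * (a + 1).
(** The damping [exp(- a (tau - s))], the contraction of lengths by [exp(- (tau - s))] and the
    factor [exp(mu s)] of the solution combine to [exp(mu tau) exp(- q (tau - s))]. *)
Let q : R := a + 1 + mu.
Let th : R := c' / (q * (q + 1)).
(** This value gives [c' / q + th * A = A * (1 + th) / 2]: the contraction factor of the weighted
    norm is the mean of [th] and 1. *)
Let A : R := 2 * c' / (q * (1 - th)).

Let q0 : 0 < q. Proof. by move: a0 mu1; rewrite /q; lra. Qed.
Let qq0 : 0 < q * (q + 1). Proof. by rewrite mulr_gt0// addr_gt0. Qed.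
Let c'0 : 0 < c'. Proof. by rewrite mulr_gt0// addr_gt0. Qed.
Let nu0 : 0 < nu. Proof. by rewrite addr_gt0. Qed.
Let th0 : 0 < th. Proof. by rewrite divr_gt0. Qed.
Let th1 : th < 1.
Proof. by rewrite ltr_pdivrMr// mul1r; move: a0 mu1; rewrite /c' /q; nra. Qed.
Let A0 : 0 < A.
Proof. by rewrite divr_gt0// mulr_gt0// subr_gt0. Qed.

Section Flow.
Variables (k : nat) (W : R -> {poly R}).
Hypothesis fW : flow a c k.*2 W.
Let sL t : (size (Lp a c (W t)) <= k.*2)%N. Proof. by apply: size_Lp; case: fW. Qed.
Let b0 : {poly R} := BP a (W 0).
Let B0 := pint b0.
(** The L^2 norm on [[-1, 1]] of the transformed data, the only quantity by which they are
    measured. *)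
Let N : R := Num.sqrt ((pint (b0 * b0)).[1] - (pint (b0 * b0)).[-1]).
Let N0 : 0 <= N. Proof. exact: sqrtr_ge0. Qed.

(** The odd part of the freely transported data. It is controlled only in L^2, so pointwise
    estimates are made for its antiderivative [Xf] in [y]; the sup norm is applied to the remainder
    [x2]. *)
Let xf (s y : R) : R := expR (- a * s) / 2 *
  (b0.[1 - (1 - y) * expR (- s)] - b0.[1 - (1 + y) * expR (- s)]).
Let Xf (s y : R) : R := expR ((1 - a) * s) / 2 *
  (B0.[1 - (1 - y) * expR (- s)] + B0.[1 - (1 + y) * expR (- s)]).
Let x2 (s y : R) : R := (XP a (W s)).[y] - xf s y.
Let Z (s y : R) : R := (pint (XP a (W s))).[y].

Let kap_bound (s : R) : 0 <= s -> 0 < expR (- s) <= 1.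
Proof. by move=> s0; rewrite expR_gt0 /= -expR0 ler_expR oppr_le0. Qed.

Let Xf_deriv (s y : R) : is_derive y (1 : R) (Xf s) (xf s y).
Proof.
set K := expR (- s); have d1 := deriv1_horner_lin B0 K (1 - K) y.
have d2 := deriv1_horner_lin B0 (- K) (1 - K) y.
have := deriv1Z (expR ((1 - a) * s) / 2) (deriv1D d1 d2).
apply: deriv1_ext => [z|]; rewrite /Xf /xf -/K.
  by congr (_ * (_.[_] + _.[_])); ring.
have -> : expR (- a * s) = expR ((1 - a) * s) * K by rewrite -expRD; congr expR; ring.
rewrite /B0 deriv_pint.
have -> : K * y + (1 - K) = 1 - (1 - y) * K by ring.
have -> : - K * y + (1 - K) = 1 - (1 + y) * K by ring.
by ring.
Qed.

Let Xf_diff (s r t : R) : 0 <= s -> 0 <= r -> r <= t -> t <= 1 ->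
  `|Xf s t - Xf s r| <= expR ((2^-1 - a) * s) * Num.sqrt (t - r) * N.
Proof.
move=> s0 r0 rt t1; have /andP[k0 k1] := kap_bound s0.
rewrite /Xf; set K := expR (- s) in k0 k1 *.
have rs0 : 0 <= t - r by rewrite subr_ge0.
have sq : Num.sqrt ((t - r) * K) = Num.sqrt (t - r) * expR (- s / 2).
  by rewrite sqrtrM// sqrt_expR.
have h1 : `|B0.[1 - (1 - t) * K] - B0.[1 - (1 - r) * K]| <= Num.sqrt ((t - r) * K) * N.
  have -> : (t - r) * K = 1 - (1 - t) * K - (1 - (1 - r) * K) by ring.
  by apply: pint_cauchy_schwarz; nra.
have h2 : `|B0.[1 - (1 + t) * K] - B0.[1 - (1 + r) * K]| <= Num.sqrt ((t - r) * K) * N.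
  rewrite distrC; have -> : (t - r) * K = 1 - (1 + r) * K - (1 - (1 + t) * K) by ring.
  by apply: pint_cauchy_schwarz; nra.
rewrite -mulrBr normrM ger0_norm ?divr_ge0 ?expR_ge0//.
have -> : expR ((2^-1 - a) * s) = expR ((1 - a) * s) * expR (- s / 2).
  by rewrite -expRD; congr expR; field.
have -> : B0.[1 - (1 - t) * K] + B0.[1 - (1 + t) * K] - (B0.[1 - (1 - r) * K] + B0.[1 - (1 + r) * K])
  = (B0.[1 - (1 - t) * K] - B0.[1 - (1 - r) * K]) +
    (B0.[1 - (1 + t) * K] - B0.[1 - (1 + r) * K]) by ring.
have E0 : 0 <= expR ((1 - a) * s) / 2 by rewrite divr_ge0 ?expR_ge0.
have := ler_wpM2l E0 (le_trans (ler_normD _ _) (lerD h1 h2)).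
rewrite sq; lra.
Qed.

Section Weighted.
Variables (T m : R).
Hypothesis m0 : 0 <= m.
Hypothesis P : forall s y : R, 0 <= s <= T -> 0 <= y <= 1 ->
  `|x2 s y| <= m * (1 + A * y) * expR (mu * s).

Let Z_diff (s r t : R) : 0 <= s <= T -> 0 <= r -> r <= t -> t <= 1 ->
  `|Z s t - Z s r| <= expR ((2^-1 - a) * s) * Num.sqrt (t - r) * N +
    m * expR (mu * s) * ((t - r) + A / 2 * (t ^+ 2 - r ^+ 2)).
Proof.
move=> sT r0 rt t1; have s0 : 0 <= s by case/andP: sT.
have dZ (y : R) : is_derive y (1 : R) (fun y : R => Z s y - Xf s y) (x2 s y).
  have := is_derive_poly (pint (XP a (W s))) y; rewrite deriv_pint => h.
  have := deriv1D h (deriv1Z (-1) (Xf_deriv s y)).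
  by apply: deriv1_ext => [z|]; rewrite mulN1r.
have dH (y : R) : is_derive y (1 : R) (fun y : R => m * expR (mu * s) * (y + A / 2 * (y * y)))
    (m * (1 + A * y) * expR (mu * s)).
  have i := is_derive_id y (1 : R).
  have := deriv1Z (m * expR (mu * s)) (deriv1D i (deriv1Z (A / 2) (deriv1M i i))).
  by apply: deriv1_ext => [z //|]; field.
have H := deriv1_le rt (fun y _ => dZ y) (fun y _ => dH y).
have {}H : `|Z s t - Xf s t - (Z s r - Xf s r)| <=
    m * expR (mu * s) * (t + A / 2 * (t * t)) - m * expR (mu * s) * (r + A / 2 * (r * r)).
  apply: H => y /andP[ry yt]; apply: P => //.
  by rewrite (le_trans r0 (ltW ry)) (le_trans (ltW yt) t1).
have X := Xf_diff s0 r0 rt t1.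
have -> : Z s t - Z s r = (Xf s t - Xf s r) + (Z s t - Xf s t - (Z s r - Xf s r)) by ring.
rewrite (le_trans (ler_normD _ _))//; move: X H; lra.
Qed.

Let Z_abs (s y : R) : Z s `|y| = Z s y.
Proof. by rewrite /Z; have [//|y0] := ger0P y; rewrite pint_XPN. Qed.

Let Z_diff_sym (s u v d : R) : 0 <= s <= T -> `|u| <= 1 -> `|v| <= 1 -> `|u - v| <= d ->
  `|Z s u - Z s v| <= expR ((2^-1 - a) * s) * Num.sqrt d * N +
    m * expR (mu * s) * ((1 + A) * d).
Proof.
move=> sT u1 v1 uvd; rewrite -(Z_abs s u) -(Z_abs s v).
have d1 : `|u| - `|v| <= d by rewrite (le_trans _ uvd)// lerB_dist.
have d2 : `|v| - `|u| <= d by rewrite (le_trans _ uvd)// distrC lerB_dist.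
have main r t : 0 <= r -> r <= t -> t <= 1 -> t - r <= d ->
    `|Z s t - Z s r| <= expR ((2^-1 - a) * s) * Num.sqrt d * N +
    m * expR (mu * s) * ((1 + A) * d).
  move=> r0 rt t1 trd; apply: (le_trans (Z_diff sT r0 rt t1)); apply: lerD.
    by rewrite ler_wpM2r// ler_wpM2l ?expR_ge0// ler_sqrt// (le_trans _ trd)// subr_ge0.
  rewrite ler_wpM2l ?mulr_ge0 ?expR_ge0// mulrDl mul1r lerD//.
  have : t ^+ 2 - r ^+ 2 <= 2 * d by nra.
  by have := A0; nra.
have [uv|vu] := leP `|u| `|v|; first by rewrite distrC main.
by rewrite main// ltW.
Qed.

(** By oddness the antiderivative is compared at two points whose absolute values differ by at most
    [2 y K], with [K = exp(- (tau - s))]: hence a factor [y]. The part [A y] of the weight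
    integrates to a square, and the difference of squares is [4 y K (1 - K)]. Its factor [1 - K]
    replaces [1 / q] by [1 / q - 1 / (q + 1)], so that the contraction factor tends to [th < 1] for
    large [A]. *)
Let step (tau y : R) : 0 <= tau <= T -> 0 <= y <= 1 ->
  `|x2 tau y| <= expR (mu * tau) * (1 + A * y) * (c' * N + m * ((1 + th) / 2)).
Proof.
move=> /andP[t0 tT] /andP[y0 y1].
pose f (s : R) : R := 2^-1 * (expR (- a * (tau - s)) * (BP a (W s)).[1 - (1 - y) * expR (- (tau - s))]
  + -1 * (expR (- a * (tau - s)) * (BP a (W s)).[1 - (1 - (- y)) * expR (- (tau - s))])).
pose f' (s : R) : R := 2^-1 * (expR (- a * (tau - s)) * c' *
   (Z s (1 - (1 - y) * expR (- (tau - s))) - Z s (1 - (1 + y) * expR (- (tau - s))))).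
pose C1 := c' * N * expR ((2^-1 - a) * tau); pose C2 := m * c' * y * expR (mu * tau).
(* A majorant with an explicit derivative: comparing derivatives takes the place of integrating in
   time. *)
pose g (s : R) : R := C1 * expR (-1 * (tau - s)) + C2 * ((1 + A) / q * expR (- q * (tau - s)) +
   - A / (q + 1) * expR (- (q + 1) * (tau - s))).
pose g' (s : R) : R := C1 * expR (-1 * (tau - s)) + C2 * ((1 + A) * expR (- q * (tau - s)) +
   - A * expR (- (q + 1) * (tau - s))).
have df (s : R) : is_derive s (1 : R) f (f' s).
  have h1 := BP_char_deriv fW tau y s; have h2 := BP_char_deriv fW tau (- y) s.
  have := deriv1Z 2^-1 (deriv1D h1 (deriv1Z (-1) h2)).
  apply: deriv1_ext => [z //|]; rewrite /f' opprK /Z /c'; ring.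
have dg (s : R) : is_derive s (1 : R) g (g' s).
  have h := deriv1D (deriv1Z C1 (deriv1_expRh (-1) tau s)) (deriv1Z C2
    (deriv1D (deriv1Z ((1 + A) / q) (deriv1_expRh (- q) tau s))
       (deriv1Z (- A / (q + 1)) (deriv1_expRh (- (q + 1)) tau s)))).
  apply: deriv1_ext h => [z //|]; rewrite /g'; field.
  by rewrite !gt_eqF//; have := q0; lra.
have H : `|f tau - f 0| <= g tau - g 0.
  apply: (deriv1_le t0 (fun s _ => df s) (fun s _ => dg s)) => s /andP[s0 st].
  have h0 : 0 <= tau - s by lra.
  have sT : 0 <= s <= T by lra.
  rewrite /f' /g'; have /andP[k0 k1] := kap_bound h0.
  set K := expR (- (tau - s)) in k0 k1 *.
  set u := 1 - (1 - y) * K; set v := 1 - (1 + y) * K.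
  have v2 : `|v| ^+ 2 = v ^+ 2 by rewrite real_normK ?num_real.
  have vu : `|v| <= u by rewrite /u /v ler_norml; apply/andP; split; nra.
  have u1 : u <= 1 by rewrite /u; nra.
  have Zd := Z_diff sT (normr_ge0 v) vu u1; rewrite Z_abs in Zd.
  have uv : u - `|v| <= 2 * y * K.
    by have := ler_norm v; rewrite /u /v; lra.
  have sqb : Num.sqrt (u - `|v|) <= 2 * expR (- (tau - s) / 2).
    rewrite -sqrt_expR -/K; have -> : 2 * Num.sqrt K = Num.sqrt (4 * K).
      rewrite sqrtrM// (_ : 4 = 2 ^+ 2); last by ring.
      by rewrite sqrtr_sqr ger0_norm.
    by rewrite ler_sqrt ?mulr_ge0 ?(ltW k0)//; nra.
  have uv2 : u ^+ 2 - `|v| ^+ 2 = 4 * y * K * (1 - K) by rewrite v2 /u /v; ring.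
  rewrite uv2 in Zd.
  have E1 : expR (- a * (tau - s)) * (expR ((2^-1 - a) * s) * expR (- (tau - s) / 2)) =
     expR ((2^-1 - a) * tau) * expR (-1 * (tau - s)).
    by rewrite -!expRD; congr expR; field.
  have E2 : expR (- a * (tau - s)) * (expR (mu * s) * K) = expR (mu * tau) * expR (- q * (tau - s)).
    by rewrite /K -!expRD; congr expR; rewrite /q; ring.
  have E3 : expR (- (q + 1) * (tau - s)) = expR (- q * (tau - s)) * K.
    by rewrite /K -expRD; congr expR; ring.
  have Ea : 0 <= expR (- a * (tau - s)) * c' by rewrite mulr_ge0 ?expR_ge0// ltW.
  rewrite normrM (ger0_norm (_ : 0 <= 2^-1 :> R)) ?invr_ge0// normrM (ger0_norm Ea).
  have Z2 : `|Z s u - Z s v| <= expR ((2^-1 - a) * s) * (2 * expR (- (tau - s) / 2)) * N +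
     m * expR (mu * s) * (2 * y * K + A / 2 * (4 * y * K * (1 - K))).
    apply: (le_trans Zd); apply: lerD.
      by rewrite ler_wpM2r// ler_wpM2l ?expR_ge0.
    by rewrite ler_wpM2l ?mulr_ge0 ?expR_ge0// lerD2r.
  have := ler_wpM2l (_ : 0 <= (2^-1 : R)) (ler_wpM2l Ea Z2).
  rewrite invr_ge0 => /(_ (ltW _)) Z3; apply: (le_trans (Z3 _)); first by [].
  rewrite le_eqVlt; apply/orP; left; apply/eqP.
  transitivity (c' * N * (expR (- a * (tau - s)) * (expR ((2^-1 - a) * s) * expR (- (tau - s) / 2))) +
     m * c' * y * (expR (- a * (tau - s)) * (expR (mu * s) * K)) * (1 + A - A * K)).
    by field.
  by rewrite E1 E2 E3 /C1 /C2; ring.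
have fT : f tau = (XP a (W tau)).[y].
  rewrite /f subrr oppr0 mulr0 expR0 !mul1r !mulr1 XP_half.
  by rewrite mulrC mulN1r; congr ((_.[_] - _.[_]) / 2); ring.
have f0 : f 0 = xf tau y.
  by rewrite /f /xf subr0 -/b0 opprK; field.
have -> : x2 tau y = f tau - f 0 by rewrite fT f0.
apply: (le_trans H).
have qq : g tau - g 0 <= C1 + C2 * (c'^-1 * (c' / q + th * A)).
  rewrite /g subrr !mulr0 expR0 !mulr1 subr0.
  have K1 : 0 < expR (-1 * tau) by exact: expR_gt0.
  have K2 : 0 < expR (- q * tau) by exact: expR_gt0.
  have K3 : expR (- (q + 1) * tau) <= expR (- q * tau).
    by rewrite ler_expR ler_wpM2r//; lra.
  have C10 : 0 <= C1 by rewrite !mulr_ge0 ?expR_ge0// ltW.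
  have C20 : 0 <= C2 by rewrite !mulr_ge0 ?expR_ge0// ltW.
  have -> : c'^-1 * (c' / q + th * A) = (1 + A) / q + - A / (q + 1).
    rewrite /th; field; have := q0; have := c'0 => c1 q1.
    by rewrite !gt_eqF//; lra.
  have B1 : A / (q + 1) * expR (- (q + 1) * tau) <= (1 + A) / q * expR (- q * tau).
    have q10 : 0 < q + 1 by move: q0; lra.
    apply: ler_pM => //; first exact: divr_ge0 (ltW A0) (ltW q10).
    rewrite ler_pdivrMr// mulrAC ler_pdivlMr//.
    by move: (ltW A0) (ltW q0) (mulr_gt0 A0 q0); lra.
  have := mulr_ge0 C10 (ltW K1); move: (subr_ge0 (A / (q + 1) * expR (- (q + 1) * tau)) ((1 + A) / q * expR (- q * tau))).
  rewrite B1 => B2; have := mulr_ge0 C20 B2; lra.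
apply: (le_trans qq).
have -> : c' / q + th * A = A * ((1 + th) / 2).
  rewrite /A; field; rewrite !gt_eqF//; first by have := th1; lra.
have E : expR ((2^-1 - a) * tau) <= expR (mu * tau) by rewrite ler_expR ler_wpM2r.
have C1b : C1 <= c' * N * expR (mu * tau) by rewrite ler_wpM2l// mulr_ge0// ltW.
have -> : C2 * (c'^-1 * (A * ((1 + th) / 2))) = expR (mu * tau) * (A * y) * (m * ((1 + th) / 2)).
  by rewrite /C2; field; rewrite gt_eqF.
have Em := expR_ge0 (mu * tau).
have cN : 0 <= c' * N by rewrite mulr_ge0// ltW.
have Ay : 0 <= A * y by rewrite mulr_ge0// ltW.
have mt : 0 <= m * ((1 + th) / 2) by rewrite mulr_ge0// divr_ge0// addr_ge0// ltW.
have := mulr_ge0 Em mt; have := mulr_ge0 Em (mulr_ge0 Ay cN); move: C1b; lra.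
Qed.

Lemma weighted_step (s y : R) : 0 <= s <= T -> 0 <= y <= 1 ->
  `|x2 s y| <= expR (mu * s) * (1 + A * y) * (c' * N + m * ((1 + th) / 2)).
Proof. exact: step. Qed.

(** Subtracting the value at 0 removes the unknown constant in the equation for [b]. The integral
    term is then bounded outright by the weighted bound on the odd part, so no absorption takes
    place here. *)
Lemma BP_spread (tau y : R) : 0 <= tau <= T -> `|y| <= 1 ->
  `|((BP a (W tau)).[y] - expR (- a * tau) * b0.[1 - (1 - y) * expR (- tau)]) -
    ((BP a (W tau)).[0] - expR (- a * tau) * b0.[1 - expR (- tau)])| <=
  (c' * N + m * c' * (1 + A) / q) * expR (mu * tau).
Proof.
move=> /andP[t0 tT] y1; have /andP[yl yu] : -1 <= y <= 1 by rewrite -ler_norml.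
pose f (s : R) : R := expR (- a * (tau - s)) * (BP a (W s)).[1 - (1 - y) * expR (- (tau - s))]
  + -1 * (expR (- a * (tau - s)) * (BP a (W s)).[1 - (1 - 0) * expR (- (tau - s))]).
pose f' (s : R) : R := expR (- a * (tau - s)) * c' *
   (Z s (1 - (1 - y) * expR (- (tau - s))) - Z s (1 - (1 - 0) * expR (- (tau - s)))).
pose C1 := c' * N * expR ((2^-1 - a) * tau); pose C2 := m * c' * (1 + A) * expR (mu * tau).
pose g (s : R) : R := C1 * expR (-1 * (tau - s)) + C2 / q * expR (- q * (tau - s)).
pose g' (s : R) : R := C1 * expR (-1 * (tau - s)) + C2 * expR (- q * (tau - s)).
have df (s : R) : is_derive s (1 : R) f (f' s).
  have h1 := BP_char_deriv fW tau y s; have h2 := BP_char_deriv fW tau 0 s.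
  have := deriv1D h1 (deriv1Z (-1) h2).
  by apply: deriv1_ext => [z //|]; rewrite /f' /Z /c'; ring.
have dg (s : R) : is_derive s (1 : R) g (g' s).
  have h := deriv1D (deriv1Z C1 (deriv1_expRh (-1) tau s))
    (deriv1Z (C2 / q) (deriv1_expRh (- q) tau s)).
  by apply: deriv1_ext h => [z //|]; rewrite /g'; field; rewrite gt_eqF.
have C10 : 0 <= C1 by rewrite !mulr_ge0 ?expR_ge0// ltW.
have C20 : 0 <= C2 by rewrite !mulr_ge0 ?expR_ge0 ?addr_ge0// ltW.
have H : `|f tau - f 0| <= g tau - g 0.
  apply: (deriv1_le t0 (fun s _ => df s) (fun s _ => dg s)) => s /andP[s0 st].
  have h0 : 0 <= tau - s by lra.
  have sT : 0 <= s <= T by lra.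
  rewrite /f' /g'; have /andP[k0 k1] := kap_bound h0.
  set K := expR (- (tau - s)) in k0 k1 *.
  have u1 : `|1 - (1 - y) * K| <= 1 by rewrite ler_norml; apply/andP; split; nra.
  have v1 : `|1 - (1 - 0) * K| <= 1 by rewrite ler_norml; apply/andP; split; nra.
  have uv : `|1 - (1 - y) * K - (1 - (1 - 0) * K)| <= K.
    have -> : 1 - (1 - y) * K - (1 - (1 - 0) * K) = y * K by ring.
    by rewrite normrM (gtr0_norm k0) ler_piMl// ltW.
  have Zd := Z_diff_sym sT u1 v1 uv; rewrite sqrt_expR in Zd.
  have E1 : expR (- a * (tau - s)) * (expR ((2^-1 - a) * s) * expR (- (tau - s) / 2)) =
     expR ((2^-1 - a) * tau) * expR (-1 * (tau - s)).
    by rewrite -!expRD; congr expR; field.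
  have E2 : expR (- a * (tau - s)) * (expR (mu * s) * K) = expR (mu * tau) * expR (- q * (tau - s)).
    by rewrite /K -!expRD; congr expR; rewrite /q; ring.
  have Ea : 0 <= expR (- a * (tau - s)) * c' by rewrite mulr_ge0 ?expR_ge0// ltW.
  rewrite normrM (ger0_norm Ea).
  apply: (le_trans (ler_wpM2l Ea Zd)).
  rewrite le_eqVlt; apply/orP; left; apply/eqP.
  transitivity (c' * N * (expR (- a * (tau - s)) * (expR ((2^-1 - a) * s) * expR (- (tau - s) / 2))) +
     m * c' * (1 + A) * (expR (- a * (tau - s)) * (expR (mu * s) * K))).
    by ring.
  by rewrite E1 E2 /C1 /C2; ring.
have fE : f tau - f 0 = ((BP a (W tau)).[y] - expR (- a * tau) * b0.[1 - (1 - y) * expR (- tau)]) -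
    ((BP a (W tau)).[0] - expR (- a * tau) * b0.[1 - expR (- tau)]).
  have fT : f tau = (BP a (W tau)).[y] - (BP a (W tau)).[0].
    rewrite /f subrr oppr0 mulr0 expR0 !mul1r !mulr1 mulN1r.
    by congr (_.[_] - _.[_]); ring.
  have f0 : f 0 = expR (- a * tau) * b0.[1 - (1 - y) * expR (- tau)] -
      expR (- a * tau) * b0.[1 - expR (- tau)].
    by rewrite /f !subr0 mulN1r -/b0 mul1r.
  by rewrite fT f0; ring.
rewrite -fE (le_trans H)// /g subrr !mulr0 expR0 !mulr1 subr0.
have K1 : 0 < expR (-1 * tau) by exact: expR_gt0.
have K2 : 0 < expR (- q * tau) by exact: expR_gt0.
have E : expR ((2^-1 - a) * tau) <= expR (mu * tau) by rewrite ler_expR ler_wpM2r.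
have C1b : C1 <= c' * N * expR (mu * tau) by rewrite ler_wpM2l// mulr_ge0// ltW.
have := mulr_ge0 C10 (ltW K1).
have := mulr_ge0 (divr_ge0 C20 (ltW q0)) (ltW K2).
have -> : (c' * N + m * c' * (1 + A) / q) * expR (mu * tau) = c' * N * expR (mu * tau) + C2 / q.
  by rewrite /C2; field; rewrite gt_eqF.
move: C1b; lra.
Qed.

End Weighted.

(** A qualitative bound, which makes the supremum in [x2_bound] finite so that it can be
    absorbed. *)
Let x2_locally_bounded (T : R) : 0 <= T -> exists M : R, forall s y : R, 0 <= s <= T -> 0 <= y <= 1 ->
  `|x2 s y| <= M.
Proof.
move=> T0.
have coefb (i : nat) : exists M : R, forall s, 0 <= s <= T -> `|(XP a (W s))`_i| <= M.
  have d s := @flow_lin _ a _ W (fun w => (XP a w)`_i) s fW sL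
     (fun p q => etrans (congr1 (fun r : {poly R} => r`_i) (XPD a p q)) (coefD _ _ _))
     (fun k p => etrans (congr1 (fun r : {poly R} => r`_i) (XPZ a k p)) (coefZ _ _ _)).
  have cc : continuous (fun s => (XP a (W s))`_i) by move=> s; exact: deriv1_cont (d s).
  have [M _ hM] := cont_on_bounded T0 (continuous_cont_on (V := R^o) (a := 0) (b := T) cc).
  by exists M.
have [M_ hM] := choice coefb.
pose BB := \sum_(i < size b0) `|b0`_i|.
exists (\sum_(i < k.*2.+1) M_ i + BB) => s y sT /andP[y0 y1].
have s0 : 0 <= s by case/andP: sT.
rewrite (le_trans (ler_normB _ _))// lerD//.
  have sz : (size (XP a (W s)) <= k.*2.+1)%N.
    by rewrite (leq_trans (size_XP _ _))// ltnS; case: fW.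
  rewrite (horner_coef_wide _ sz) (le_trans (ler_norm_sum _ _ _))//.
  apply: ler_sum => i _; rewrite normrM (le_trans _ (hM i s sT))// ler_piMr// normrX.
  by rewrite exprn_ile1// ger0_norm.
have /andP[k0 k1] := kap_bound s0; rewrite /xf; set K := expR (- s) in k0 k1 *.
have b1 : `|b0.[1 - (1 - y) * K]| <= BB by apply: horner_bound; rewrite ler_norml; apply/andP; split; nra.
have b2 : `|b0.[1 - (1 + y) * K]| <= BB by apply: horner_bound; rewrite ler_norml; apply/andP; split; nra.
have E1 : expR (- a * s) <= 1 by rewrite -expR0 ler_expR mulNr oppr_le0 mulr_ge0// ltW.
have E0 := expR_ge0 (- a * s).
rewrite normrM ger0_norm ?divr_ge0//.
have b3 := le_trans (ler_normB _ _) (lerD b1 b2).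
have BB0 : 0 <= BB by apply: sumr_ge0.
have := ler_wpM2l (_ : 0 <= expR (- a * s) / 2) b3; rewrite divr_ge0// => /(_ isT).
have := ler_wpM2r BB0 E1; lra.
Qed.

Let K0 : R := 2 * c' / (1 - th).

(** The best constant [m] on [[0, s]] satisfies [m <= c' * N + m * (1 + th) / 2], that is,
    [m <= K0 * N], independently of [s]. *)
Lemma x2_bound (s y : R) : 0 <= s -> 0 <= y <= 1 ->
  `|x2 s y| <= (K0 * N) * (1 + A * y) * expR (mu * s).
Proof.
move=> s0 y01; pose S : set R := [set v | exists t z : R, [/\ 0 <= t <= s, 0 <= z <= 1 &
  v = `|x2 t z| / (expR (mu * t) * (1 + A * z))]].
have [M hM] := x2_locally_bounded s0.
have w0 (t z : R) : 0 <= z -> 0 < expR (mu * t) * (1 + A * z).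
  by move=> z0; rewrite mulr_gt0 ?expR_gt0// ltr_pwDl// mulr_ge0// ltW.
have M0 : 0 <= M by apply: le_trans (hM s y _ y01); rewrite ?s0 ?lexx.
have ubS : has_ubound S.
  exists (M * expR (`|mu| * s)) => v [t [z [ts z01 ->]]].
  have /andP[t0 ts'] := ts; have /andP[z0 z1] := z01.
  rewrite ler_pdivrMr ?w0// (le_trans (hM t z ts z01))// -mulrA ler_peMr//.
  rewrite mulrA -expRD -[leLHS]mulr1 ler_pM//; last by rewrite lerDl mulr_ge0// ltW.
  rewrite -expR0 ler_expR.
  have : - (`|mu| * t) <= mu * t by rewrite -mulNr ler_wpM2r// lerNl -normrN ler_norm.
  have : `|mu| * t <= `|mu| * s by rewrite ler_wpM2l.
  lra.
have S0 : S !=set0 by exists (`|x2 s y| / (expR (mu * s) * (1 + A * y))), s, y; rewrite s0 lexx.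
pose m := sup S.
have Pm t z : 0 <= t <= s -> 0 <= z <= 1 -> `|x2 t z| <= m * (1 + A * z) * expR (mu * t).
  move=> ts z01; have /andP[z0 _] := z01.
  rewrite -mulrA (mulrC (1 + _)) -ler_pdivrMr ?w0//.
  by apply: (ub_le_sup ubS); exists t, z.
have m0 : 0 <= m.
  have [v Sv] := S0; apply: le_trans (ub_le_sup ubS Sv); case: Sv => t [z [_ /andP[z0 _] ->]].
  by rewrite divr_ge0// ltW// w0.
have mle : m <= c' * N + m * ((1 + th) / 2).
  apply: ge_sup => // v [t [z [ts z01 ->]]]; have /andP[z0 _] := z01.
  rewrite ler_pdivrMr ?w0// mulrC; exact: (weighted_step m0 Pm ts z01).
have mK : m <= K0 * N.
  have d0 : 0 < 1 - th by rewrite subr_gt0.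
  by rewrite /K0 mulrAC ler_pdivlMr//; lra.
apply: (le_trans (Pm s y _ y01)); first by rewrite s0 lexx.
have /andP[y0 _] := y01.
rewrite ler_wpM2r ?expR_ge0// ler_wpM2r// addr_ge0// mulr_ge0//; exact: ltW A0.
Qed.

Definition spread_cst : R := c' + K0 * c' * (1 + A) / q.

Lemma spread_cst_ge0 : 0 <= spread_cst.
Proof.
have K00 : 0 < K0 by rewrite divr_gt0 ?mulr_gt0// subr_gt0.
rewrite /spread_cst addr_ge0 ?(ltW c'0)// divr_ge0 ?(ltW q0)//.
exact: (mulr_ge0 (mulr_ge0 (ltW K00) (ltW c'0)) (addr_ge0 ler01 (ltW A0))).
Qed.

Lemma BP_decay (tau : R) : 0 <= tau -> exists D : R, forall y, `|y| <= 1 ->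
  `|(BP a (W tau)).[y] - D - expR (- a * tau) * b0.[1 - (1 - y) * expR (- tau)]| <=
  spread_cst * N * expR (mu * tau).
Proof.
move=> t0; exists ((BP a (W tau)).[0] - expR (- a * tau) * b0.[1 - expR (- tau)]) => y y1.
have K00 : 0 < K0 by rewrite divr_gt0 ?mulr_gt0// subr_gt0.
have KN : 0 <= K0 * N by rewrite mulr_ge0// ltW.
have := @BP_spread tau (K0 * N) KN _ tau y _ y1.
rewrite t0 lexx => /(_ _ isT) H.
rewrite [X in `|X| <= _](_ : _ = ((BP a (W tau)).[y] - expR (- a * tau) * b0.[1 - (1 - y) * expR (- tau)]) -
    ((BP a (W tau)).[0] - expR (- a * tau) * b0.[1 - expR (- tau)])); last by ring.
have -> : spread_cst * N * expR (mu * tau) =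
   (c' * N + K0 * N * c' * (1 + A) / q) * expR (mu * tau) by rewrite /spread_cst; ring.
by apply: H => s z /andP[s0 _] z01; exact: x2_bound.
Qed.

End Flow.

End Decay.

(** * The coefficient along the unstable eigenvector *)

Section SpectralSplit.
Context {R : realType} {V : completeNormedModType R}.
Variables (S : R -> V -> V) (ev : V) (mu C : R) (mfun : V -> R).
Hypothesis hS : semigroupV S.
Hypothesis ev0 : 0 < `|ev|.
Hypothesis mu0 : mu <= 0.
Hypothesis C0 : 0 <= C.
Hypothesis St_evec : forall t, 0 <= t -> S t ev = expR t *: ev.
Hypothesis hC : forall (x : V) (t : R), 0 <= t -> exists D : R,
  `|S t x - D *: ev| <= C * expR (mu * t) * `|x|.
Hypothesis mfun_lin : forall k x y, mfun (k *: x + y) = k * mfun x + mfun y.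
Hypothesis mfun_bound : forall x, `|mfun x| <= `|ev|^-1 * `|x|.
Hypothesis mfun_ev : mfun ev = 1.

(* [ell] is the spectral projection coefficient: the limit of
   [exp (- n) * m (S n x)] for any bounded [m] with [m ev = 1]. *)
Lemma spectral_split : exists (ell : V -> R) (C : R), [/\ 0 < C,
  forall k x y, ell (k *: x + y) = k * ell x + ell y,
  forall x, `|ell x| <= C * `|x|, ell ev = 1 &
  forall x t, 0 <= t -> `|S t x - (expR t * ell x) *: ev| <= C * expR (mu * t) * `|x|].
Proof.
have [K K0 hK] := sgV_bound hS 1.
pose Me : R := `|ev|^-1; have Me0 : 0 < Me by rewrite invr_gt0.
pose f (x : V) (t : R) : R := expR (- t) * mfun (S t x).
pose M2 : R := Me * (1 + K) * C.
have M20 : 0 <= M2 by apply: mulr_ge0 => //; apply: mulr_ge0; [exact: ltW|apply: addr_ge0 => //; exact: ltW].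
have mB x y : mfun (x - y) = mfun x - mfun y.
  by rewrite -scaleN1r addrC mfun_lin; ring.
have mZ k : mfun (k *: ev) = k.
  have m00 : mfun 0 = 0 by have := mB 0 0; rewrite !subrr.
  by rewrite -[k *: ev]addr0 mfun_lin mfun_ev m00; ring.
(* The component along [ev] is multiplied by [exp s] and so cancels in [f x]. What remains is the
   decaying part, of size [exp(mu t)], against the factor [exp(- t)]. *)
have step x t s : 0 <= t -> 0 <= s <= 1 -> `|f x (t + s) - f x t| <= M2 * `|x| * expR ((mu - 1) * t).
  move=> t0 s01; have /andP[s0 s1] := s01; have [D hD] := hC x t0.
  set r := S t x - D *: ev in hD.
  have E1 : S t x = D *: ev + r by rewrite /r; linmod R.
  have E2 : S (t + s) x = (expR s * D) *: ev + S s r.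
    rewrite addrC (sgV_D hS)// E1 (sgV_add hS)// (sgV_scale hS)// St_evec// scalerA.
    by rewrite (mulrC D).
  have -> : f x (t + s) - f x t = expR (- t) * (expR (- s) * mfun (S s r) - mfun r).
    have A1 : mfun (S (t + s) x) = expR s * D + mfun (S s r).
      by rewrite E2 mfun_lin mfun_ev; ring.
    have A2 : mfun (S t x) = D + mfun r by rewrite E1 mfun_lin mfun_ev; ring.
    rewrite /f A1 A2 opprD expRD.
    have : expR (- s) * expR s = 1 by rewrite -expRD addNr expR0.
    move=> e1; rewrite !mulrDr; have -> : expR (- t) * expR (- s) * (expR s * D) = expR (- t) * (expR (- s) * expR s) * D by ring.
    by rewrite e1; ring.
  rewrite normrM (ger0_norm (expR_ge0 _)).
  have r0 := normr_ge0 r.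
  have b1 : `|expR (- s) * mfun (S s r)| <= Me * K * `|r|.
    rewrite normrM (ger0_norm (expR_ge0 _)) -[leRHS]mul1r ler_pM ?expR_ge0//.
      by rewrite -expR0 ler_expR oppr_le0.
    rewrite (le_trans (mfun_bound _))// -mulrA ler_wpM2l ?(ltW Me0)//; exact: hK.
  have b2 : `|expR (- s) * mfun (S s r) - mfun r| <= Me * (1 + K) * `|r|.
    by rewrite (le_trans (ler_normB _ _))//; have := mfun_bound r; rewrite -/Me; lra.
  have MK : 0 <= Me * (1 + K) by rewrite mulr_ge0 ?addr_ge0 ?ltW.
  have b3 := le_trans b2 (ler_wpM2l MK hD).
  have -> : M2 * `|x| * expR ((mu - 1) * t) = expR (- t) * (Me * (1 + K) * (C * expR (mu * t) * `|x|)).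
    by rewrite /M2 (_ : (mu - 1) * t = - t + mu * t) ?expRD; ring.
  by rewrite ler_wpM2l ?expR_ge0.
have e2 : expR (mu - 1) <= (2^-1 : R).
  rewrite -[leLHS]invrK -expRN lef_pV2 ?posrE ?expR_gt0//.
  have := expR_ge1Dx (- (mu - 1)); move: mu0; lra.
have geo n : expR ((mu - 1) * n%:R) <= 2^-1 ^+ n.
  by rewrite mulrC expRM_natl; apply: lerXn2r; rewrite ?nnegrE ?expR_ge0.
have sumb x t n : 0 <= t -> `|f x (t + n%:R) - f x t| <= 2 * M2 * `|x| * expR ((mu - 1) * t).
  move=> t0; pose B : R := M2 * `|x| * expR ((mu - 1) * t).
  have B0 : 0 <= B by apply: mulr_ge0; [apply: mulr_ge0|exact: expR_ge0].
  have : `|f x (t + n%:R) - f x t| <= B * (2 - 2 * 2^-1 ^+ n).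
    elim: n => [|n IH]; first by rewrite addr0 subrr normr0 expr0 mulr1 subrr mulr0.
    have := step x (t + n%:R) 1; rewrite addr_ge0// ler01 lexx => /(_ isT isT) h1.
    have -> : t + n.+1%:R = t + n%:R + 1 by rewrite -natr1 addrA.
    have -> : f x (t + n%:R + 1) - f x t = (f x (t + n%:R + 1) - f x (t + n%:R)) + (f x (t + n%:R) - f x t) by ring.
    rewrite (le_trans (ler_normD _ _))//.
    have h2 : M2 * `|x| * expR ((mu - 1) * (t + n%:R)) <= B * 2^-1 ^+ n.
      rewrite mulrDr expRD mulrA -/B ler_wpM2l//; exact: geo.
    rewrite exprS; move: h1 h2 IH; lra.
  move=> /le_trans; apply; rewrite /B.
  have : 0 <= (2^-1 : R) ^+ n by rewrite exprn_ge0// invr_ge0.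
  by have := B0; rewrite /B => b0 h; have := mulr_ge0 b0 h; lra.
have lim x : exists l : R, forall n : nat, `|f x n%:R - l| <= M2 * `|x| * (2 * 2^-1 ^+ n).
  apply: (@fast_cauchy_cvg R R^o (fun n => f x n%:R)) => n.
  have := step x n%:R 1 (ler0n _ _); rewrite ler01 lexx natr1 => /(_ isT) /le_trans; apply.
  exact: (ler_wpM2l (mulr_ge0 M20 (normr_ge0 x)) (geo n)).
have [ell hell] := choice lim.
(* A real time is linked to the integer sequence by going from [t] to [t + n] in unit steps and then
   down to the integer [N] just below. *)
have main x t : 0 <= t -> `|f x t - ell x| <= 3 * M2 * `|x| * expR ((mu - 1) * t).
  move=> t0.
  have B0 : 0 <= M2 * `|x| by rewrite mulr_ge0.
  apply: (@ler_small_half _ _ _ (3 * (M2 * `|x|))) => n.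
  pose T := Num.truncn t; have /andP[T1 T2] := truncn_itv t0; rewrite -/T in T1 T2.
  pose N := (T + n)%N.
  have NE : N%:R = T%:R + n%:R :> R by rewrite /N natrD.
  have h1 := sumb x t n t0.
  have ts : 0 <= t - T%:R <= 1 by rewrite -[T.+1%:R]natr1 in T2; lra.
  have h2 := step x N%:R (t - T%:R) (ler0n _ _) ts.
  have h3 := hell x N.
  have E : N%:R + (t - T%:R) = t + n%:R by rewrite NE; ring.
  rewrite E in h2.
  have g1 := geo N.
  have g2 : (2^-1 : R) ^+ N <= 2^-1 ^+ n.
    by rewrite /N exprD ler_piMl ?exprn_ge0 ?invr_ge0// exprn_ile1 ?invr_ge0// invf_le1// ler1n.
  have -> : f x t - ell x = - (f x (t + n%:R) - f x t) + (f x (t + n%:R) - f x N%:R) +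
     (f x N%:R - ell x) by ring.
  rewrite (le_trans (ler_normD _ _))// (le_trans (lerD (ler_normD _ _) (lexx _)))// normrN.
  have k1 := ler_wpM2l B0 (le_trans g1 g2); have k2 := ler_wpM2l B0 g2.
  have k3 := mulr_ge0 B0 (expR_ge0 ((mu - 1) * t)).
  move: h1 h2 h3 k1 k2 k3; lra.
pose Cf := Me + 3 * M2 + (C + (Me * C + 3 * M2) * `|ev|) + 1.
have MC0 : 0 <= Me * C by rewrite mulr_ge0// ltW.
have MM0 : 0 <= (Me * C + 3 * M2) * `|ev| by rewrite mulr_ge0// addr_ge0// mulr_ge0.
have Cf1 : Me + 3 * M2 <= Cf by move: C0; rewrite /Cf; lra.
have Cf2 : C + (Me * C + 3 * M2) * `|ev| <= Cf by have := ltW Me0; rewrite /Cf; lra.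
exists ell, Cf; split.
- by move: C0 (ltW Me0); rewrite /Cf; lra.
- move=> k x y; apply/eqP; rewrite -subr_eq0 -normr_le0.
  pose Q := M2 * `|k *: x + y| * 2 + `|k| * (M2 * `|x| * 2) + M2 * `|y| * 2.
  apply: (@ler_small_half _ _ _ Q) => n; rewrite add0r.
  have h1 := hell (k *: x + y) n; have h2 := hell x n; have h3 := hell y n.
  have E : f (k *: x + y) n%:R = k * f x n%:R + f y n%:R.
    by rewrite /f (sgV_add hS)// (sgV_scale hS)// mfun_lin; ring.
  have -> : ell (k *: x + y) - (k * ell x + ell y) =
    - (f (k *: x + y) n%:R - ell (k *: x + y)) + k * (f x n%:R - ell x) + (f y n%:R - ell y).
    by rewrite E; ring.
  rewrite (le_trans (ler_normD _ _))// (le_trans (lerD (ler_normD _ _) (lexx _)))// normrN normrM.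
  have := ler_wpM2l (normr_ge0 k) h2; rewrite /Q; move: h1 h3; lra.
- move=> x; have := main x 0 (lexx _); rewrite mulr0 expR0 mulr1 /f oppr0 expR0 mul1r (sgV_0 hS) => h.
  have -> : ell x = mfun x - (mfun x - ell x) by ring.
  rewrite (le_trans (ler_normB _ _))//; have := mfun_bound x; rewrite -/Me.
  have := ler_wpM2r (normr_ge0 x) Cf1; move: h; lra.
- apply/eqP; rewrite -subr_eq0 -normr_le0.
  apply: (@ler_small_half _ _ _ (M2 * `|ev| * 2)) => n; rewrite add0r.
  have E : f ev n%:R = 1 by rewrite /f St_evec// mZ -expRD addNr expR0.
  by have := hell ev n; rewrite E distrC; lra.
- move=> x t t0; have [D hD] := hC x t0; set r := S t x - D *: ev in hD.
  have Em := expR_ge0 (mu * t).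
  have E1 : S t x = D *: ev + r by rewrite /r; linmod R.
  have A2 : mfun (S t x) = D + mfun r by rewrite E1 mfun_lin mfun_ev; ring.
  have h := main x t t0.
  have h2 : `|expR t * (f x t - ell x)| <= 3 * M2 * `|x| * expR (mu * t).
    rewrite normrM (ger0_norm (expR_ge0 _)).
    have := ler_wpM2l (expR_ge0 t) h => /le_trans; apply.
    by rewrite (_ : (mu - 1) * t = - t + mu * t) ?expRD ?expRN; [rewrite le_eqVlt; apply/orP; left; apply/eqP; field; rewrite gt_eqF ?expR_gt0|ring].
  have -> : S t x - (expR t * ell x) *: ev = r + (expR t * (f x t - ell x) - mfun r) *: ev.
    have -> : expR t * (f x t - ell x) - mfun r = D - expR t * ell x.
      rewrite mulrBr /f mulrA -expRD subrr expR0 mul1r A2; ring.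
    by rewrite E1; linmod R.
  rewrite (le_trans (ler_normD _ _))// normrZ.
  have h3 := le_trans (mfun_bound r) (ler_wpM2l (ltW Me0) hD); rewrite -/Me in h3.
  have h4 := le_trans (ler_normB _ _) (lerD h2 h3).
  have h5 := ler_wpM2r (normr_ge0 ev) h4.
  have h6 := ler_wpM2r (mulr_ge0 Em (normr_ge0 x)) Cf2.
  move: h5 h6 hD; lra.
Qed.

End SpectralSplit.

Section PolyNorm.
Context {R : realType}.
Notation I01 := (`]0%R, 1%R[%classic : set R).
Implicit Types (w q : {poly R}).
Let mI : measurable I01 := @mI01 R.

Definition n01 q : R := snrm I01 (horner q).

Let sq q : square_integrable I01 (horner q). Proof. exact: sqi_horner_Io. Qed.

Lemma n01D p q : n01 (p + q) <= n01 p + n01 q.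
Proof.
have := snrmD mI (sq p) (sq q); congr (snrm _ _ <= _).
by apply/funext => y; rewrite hornerD.
Qed.

Lemma n01Z k q : n01 (k *: q) = `|k| * n01 q.
Proof.
rewrite -(snrmZ k mI (sq q)) /n01; congr snrm.
by apply/funext => y; rewrite hornerZ.
Qed.

Lemma n01_ge0 q : 0 <= n01 q. Proof. exact: snrm_ge0. Qed.

Lemma n01_pint q : n01 (pint q) <= n01 q.
Proof.
rewrite -ler_sqr ?nnegrE ?n01_ge0// /n01 !snrm_sqr !ip_horner//; exact: pint_sqr_le.
Qed.

Lemma n01_bound q B : 0 <= B -> (forall y, 0 < y < 1 -> `|q.[y]| <= B) -> n01 q <= B.
Proof.
by move=> B0 h; have := snrm_le_bound ler01 B0 (sq q) h; rewrite sqrtr1 mul1r.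
Qed.

Lemma norm_iota_sqr w : `|iota_ w| ^+ 2 = n01 (opart w) ^+ 2 + n01 (epart w) ^+ 2.
Proof. by rewrite norm_cls; [rewrite nrm_sqr /n01 !snrm_sqr|exact: iot_inH]. Qed.

Lemma n01_opart w : n01 (opart w) <= `|iota_ w|.
Proof. by rewrite -ler_sqr ?nnegrE ?n01_ge0// norm_iota_sqr lerDl sqr_ge0. Qed.

Lemma n01_epart w : n01 (epart w) <= `|iota_ w|.
Proof. by rewrite -ler_sqr ?nnegrE ?n01_ge0// norm_iota_sqr lerDr sqr_ge0. Qed.

Lemma norm_iota_le w : `|iota_ w| <= n01 (opart w) + n01 (epart w).
Proof. by rewrite norm_cls; [exact: nrm_le_sum|exact: iot_inH]. Qed.

End PolyNorm.

Section PolyDecay.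
Context {R : realType}.
Variables (a mu : R).
Hypotheses (a0 : 0 < a) (mu1 : -1 < mu) (mua : 2^-1 - a <= mu).
Let nu : R := a + 1.
Let c : R := (a + 1) * (a + 2).
Notation I01 := (`]0%R, 1%R[%classic : set R).
Notation V := (Vsp R).
Let nu0 : 0 < nu. Proof. by rewrite addr_gt0. Qed.
Let c0 : 0 < c. Proof. by rewrite mulr_gt0// addr_gt0. Qed.

Definition evec : {poly R} := 1 + nu *: 'X.

Lemma opart_evec : opart evec = nu *: 'X.
Proof.
apply/polyP => -[|[|i]]; rewrite coef_opart coefZ coefX coefD coef1 coefZ coefX /=; try ring.
by case: odd; ring.
Qed.

Lemma epart_evec : epart evec = 1.
Proof.
apply/polyP => -[|[|i]]; rewrite coef_epart coef1 coefD coef1 coefZ coefX /=; try ring.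
by case: odd; ring.
Qed.

Let opartC (k : R) : opart k%:P = 0.
Proof. by apply/polyP => -[|i]; rewrite coef_opart coefC coef0 //=; case: odd. Qed.

Let epartC (k : R) : epart k%:P = k%:P.
Proof. by apply/polyP => -[|i]; rewrite coef_epart coefC //=; case: odd. Qed.

Let pint1 : pint (1 : {poly R}) = 'X.
Proof.
apply/polyP => -[|[|i]]; rewrite coef_pint ?coef1 coefX /= ?mul0r//.
by rewrite divr1.
Qed.

Let hsub (p q : {poly R}) (k y : R) : (p - k%:P - q).[y] = p.[y] - k - q.[y].
Proof. by rewrite !hornerD !hornerN hornerC. Qed.

Let epD3 (p q : {poly R}) (k : R) : epart (p + q + k%:P) = epart p + epart q + k%:P.
Proof. by rewrite !epartD epartC. Qed.

Let opD3 (p q : {poly R}) (k : R) : opart (p + q + k%:P) = opart p + opart q.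
Proof. by rewrite !opartD opartC addr0. Qed.

(* The transported part contracts by [exp ((1/2 - a) tau)]: the dilation
   [y -> 1 - (1 - y) exp (- tau)] maps [-1, 1] into itself. *)
Lemma free_norm (b0 : {poly R}) (tau : R) : 0 <= tau ->
  `|iota_ (expR (- a * tau) *: (b0 \Po (expR (- tau) *: 'X + (1 - expR (- tau))%:P)))| <=
  expR ((2^-1 - a) * tau) * Num.sqrt ((pint (b0 * b0)).[1] - (pint (b0 * b0)).[-1]).
Proof.
move=> t0; set K := expR (- tau); set E := expR (- a * tau).
have k0 : 0 < K by exact: expR_gt0.
have k1 : K <= 1 by rewrite -expR0 ler_expR oppr_le0.
set f := E *: _; set Q := (pint (b0 * b0)).[1] - (pint (b0 * b0)).[-1].
have fE (y : R) : f.[y] = E * b0.[K * y + (1 - K)].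
  by rewrite hornerZ horner_comp hornerD hornerZ hornerX hornerC.
have dF (y : R) : is_derive y (1 : R) (fun y : R => (pint (f * f)).[y]) (f * f).[y].
  by have := is_derive_poly (pint (f * f)) y; rewrite deriv_pint.
have dG (y : R) : is_derive y (1 : R) (fun y : R => (pint (b0 * b0)).[K * y + (1 - K)])
   (K * (b0 * b0).[K * y + (1 - K)]).
  by have := deriv1_horner_lin (pint (b0 * b0)) K (1 - K) y; rewrite deriv_pint.
have K0 : K != 0 by rewrite gt_eqF.
have H := @deriv1_eq0 R (fun y : R => (pint (f * f)).[y] +
   - (E ^+ 2 / K) * (pint (b0 * b0)).[K * y + (1 - K)]) (-1) 1.
have {}H : (pint (f * f)).[-1] + - (E ^+ 2 / K) * (pint (b0 * b0)).[K * -1 + (1 - K)] =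
   (pint (f * f)).[1] + - (E ^+ 2 / K) * (pint (b0 * b0)).[K * 1 + (1 - K)].
  apply: H => [|y _]; first by lra.
  have := deriv1D (dF y) (deriv1Z (- (E ^+ 2 / K)) (dG y)).
  by apply: deriv1_ext => [z //|]; rewrite !hornerM !fE; field.
have E1 : K * 1 + (1 - K) = 1 by ring.
rewrite E1 in H.
have mono : (pint (b0 * b0)).[-1] <= (pint (b0 * b0)).[K * -1 + (1 - K)].
  apply: pint_mono => [|x _]; first by lra.
  by rewrite hornerM -expr2 sqr_ge0.
have mono2 : (pint (b0 * b0)).[K * -1 + (1 - K)] <= (pint (b0 * b0)).[1].
  apply: pint_mono => [|x _]; first by lra.
  by rewrite hornerM -expr2 sqr_ge0.
have EK : E ^+ 2 / K = expR ((2^-1 - a) * tau) ^+ 2.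
  by rewrite !expr2 /K -expRN -!expRD; congr expR; lra.
have s := pip_sym f; have p0 := pip_ge0 f.
have le : pip f f <= expR ((2^-1 - a) * tau) ^+ 2 * Q.
  have A0 : 0 <= E ^+ 2 / K by rewrite divr_ge0 ?sqr_ge0 ?(ltW k0).
  have := ler_wpM2l A0 mono; rewrite -EK /Q.
  have : 0 <= pip f f by []; move: s H; lra.
have Q0 : 0 <= Q by rewrite /Q; lra.
rewrite norm_iota (le_trans (_ : _ <= Num.sqrt (expR ((2^-1 - a) * tau) ^+ 2 * Q)))//.
  by rewrite ler_sqrt// mulr_ge0// sqr_ge0.
by rewrite sqrtrM ?sqr_ge0// sqrtr_sqr ger0_norm ?expR_ge0.
Qed.

(** Inverts the change of unknown. In [b = be + f + D] the term [be] is small in the sup norm and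
    [f] in L^2. The formulas for [XP] and for the even part of [BP] recover both parts of [w] up to
    the multiple [- D] of the eigenvector, which is what a constant in [b] stands for. Integration
    is bounded on L^2, so only constants depending on [nu] are lost. *)
Lemma flow_decay : exists2 C : R, 0 <= C & forall k W, flow a c k.*2 W ->
  forall tau : R, 0 <= tau -> exists D : R,
    `|iota_ (W tau) - D *: iota_ evec| <= C * expR (mu * tau) * `|iota_ (W 0)|.
Proof.
have sp0 := spread_cst_ge0 a0 mu1; set sp := spread_cst a mu in sp0.
pose C1 := 2 + nu + nu * (1 + nu); pose C2 := 2 * ((1 + nu) + (1 + nu * (1 + nu))).
have C10 : 0 <= C1 by move: (ltW nu0) => n0; rewrite /C1; have := mulr_ge0 n0 n0; lra.
have C20 : 0 <= C2 by move: (ltW nu0) => n0; rewrite /C2; have := mulr_ge0 n0 n0; lra.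
exists (C1 * (2 * (sp + 1)) * C2); first by apply: mulr_ge0 => //; apply: mulr_ge0 => //; apply: mulr_ge0 => //; exact: addr_ge0.
move=> k W fW tau t0; have [D hD] := BP_decay a0 mu1 mua fW t0.
set b0 := BP a (W 0) in hD; set N := Num.sqrt _ in hD.
have N0 : 0 <= N by exact: sqrtr_ge0.
pose f : {poly R} := expR (- a * tau) *: (b0 \Po (expR (- tau) *: 'X + (1 - expR (- tau))%:P)).
have fE (y : R) : f.[y] = expR (- a * tau) * b0.[1 - (1 - y) * expR (- tau)].
  rewrite /f; move: (b0) => b; rewrite hornerZ horner_comp hornerD hornerZ hornerX hornerC.
  by congr (_ * _.[_]); ring.
pose be := BP a (W tau) - D%:P - f.
have Em : 0 < expR (mu * tau) by exact: expR_gt0.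
pose K := sp * N * expR (mu * tau).
have K0 : 0 <= K by rewrite !mulr_ge0// ltW.
have bb (y : R) : `|y| <= 1 -> `|be.[y]| <= K.
  by move=> /hD; rewrite /be hsub fE.
have half (y : R) : 0 < y < 1 -> `|be.[y]| <= K /\ `|be.[- y]| <= K.
  move=> /andP[y0 y1]; have hy : `|y| <= 1 by rewrite ger0_norm ltW.
  by split; apply: bb; rewrite ?normrN.
have no : n01 (opart be) <= K.
  apply: n01_bound => // y /half[h1 h2]; rewrite horner_opart normrM.
  rewrite [`|2^-1|]ger0_norm// ler_pdivrMr//; have := ler_normB be.[y] be.[- y]; lra.
have ne : n01 (epart be) <= K.
  apply: n01_bound => // y /half[h1 h2]; rewrite horner_epart normrM.
  rewrite [`|2^-1|]ger0_norm// ler_pdivrMr//; have := ler_normD be.[y] be.[- y]; lra.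
have ff : `|iota_ f| <= N * expR (mu * tau).
  apply: (le_trans (free_norm b0 t0)); rewrite mulrC ler_wpM2l//.
  by rewrite ler_expR ler_wpM2r.
have fo := le_trans (n01_opart f) ff; have fe := le_trans (n01_epart f) ff.
pose L := K + N * expR (mu * tau).
have bE : BP a (W tau) = be + f + D%:P by rewrite /be; ring.
set w := W tau in bE; set x := XP a w.
have xE : x = opart be + opart f.
  by rewrite /x -opart_BP bE opD3.
have nx : n01 x <= L by rewrite xE (le_trans (n01D _ _))// lerD.
have eE : epart w + D%:P = -1 *: (epart be + epart f) + (- nu) *: pint x.
  have := epart_BP a w; rewrite bE epD3 -/x -/nu => E.
  have -> : epart be + epart f = - epart w - nu *: pint x - D%:P by rewrite -E; ring.
  by rewrite scaleN1r scaleNr; ring.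
have ned : n01 (epart w + D%:P) <= (1 + nu) * L.
  rewrite eE (le_trans (n01D _ _))// !n01Z normrN1 mul1r normrN (gtr0_norm nu0).
  have q1 : n01 (epart be + epart f) <= L by rewrite (le_trans (n01D _ _))// lerD.
  have q2 := ler_wpM2l (ltW nu0) (le_trans (n01_pint x) nx); lra.
have oE : opart w + D *: (nu *: 'X) = nu *: pint (epart w + D%:P) + -1 *: x.
  have pC : pint D%:P = D *: 'X by rewrite -[D%:P]mulr1 mul_polyC pintZ pint1.
  rewrite pintD pC scaleN1r /x /XP -/nu scalerDr !scalerA (mulrC D).
  by ring.
have nod : n01 (opart w + D *: (nu *: 'X)) <= (nu * (1 + nu) + 1) * L.
  rewrite oE (le_trans (n01D _ _))// !n01Z normrN1 mul1r (gtr0_norm nu0).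
  have q2 := ler_wpM2l (ltW nu0) (le_trans (n01_pint _) ned); lra.
have x0 : n01 (XP a (W 0)) <= (1 + nu) * `|iota_ (W 0)|.
  rewrite /XP -scaleN1r (le_trans (n01D _ _))// !n01Z normrN1 mul1r (gtr0_norm nu0).
  have q1 := n01_opart (W 0).
  have q2 := ler_wpM2l (ltW nu0) (le_trans (n01_pint _) (n01_epart (W 0))); lra.
have e0 : n01 (epart b0) <= (1 + nu * (1 + nu)) * `|iota_ (W 0)|.
  rewrite epart_BP -[- epart _]scaleN1r -scaleNr (le_trans (n01D _ _))// !n01Z normrN1 mul1r normrN (gtr0_norm nu0).
  have q1 := n01_epart (W 0).
  have q2 := ler_wpM2l (ltW nu0) (le_trans (n01_pint _) x0); lra.
have NN : N <= C2 * `|iota_ (W 0)|.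
  have : N ^+ 2 = 2 * `|iota_ b0| ^+ 2.
    have n1 : `|iota_ b0| ^+ 2 = pip b0 b0 by rewrite norm_iota sqr_sqrtr// pip_ge0.
    rewrite n1 pip_sym; apply: sqr_sqrtr; rewrite -pip_sym mulr_ge0//; exact: pip_ge0.
  move=> N2; have : N <= 2 * `|iota_ b0|.
    rewrite -ler_sqr ?nnegrE// ?mulr_ge0// N2 exprMn.
    by have := sqr_ge0 `|iota_ b0|; lra.
  move=> /le_trans; apply; rewrite /C2 -mulrA ler_wpM2l//.
  rewrite (le_trans (norm_iota_le _))// mulrDl lerD// opart_BP//.
exists (- D); rewrite -iota_Z -iota_B.
have Lb : L <= 2 * (sp + 1) * expR (mu * tau) * N.
  by rewrite /L /K; have := mulr_ge0 N0 (ltW Em); have := mulr_ge0 sp0 (mulr_ge0 N0 (ltW Em)); lra.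
have dE : w - - D *: evec = w + D *: evec by rewrite scaleNr opprK.
have dO : opart (w + D *: evec) = opart w + D *: (nu *: 'X).
  by rewrite opartD opartZ opart_evec.
have dEp : epart (w + D *: evec) = epart w + D%:P.
  by rewrite epartD epartZ epart_evec -mul_polyC mulr1.
rewrite dE (le_trans (norm_iota_le _))// dO dEp (le_trans (lerD nod ned))//.
have -> : (nu * (1 + nu) + 1) * L + (1 + nu) * L = C1 * L by rewrite /C1; ring.
have P0 : 0 <= 2 * (sp + 1) * expR (mu * tau).
  by apply: mulr_ge0 (ltW Em); apply: mulr_ge0 => //; exact: addr_ge0.
have := ler_wpM2l C10 (le_trans Lb (ler_wpM2l P0 NN)); move/le_trans; apply.
by rewrite le_eqVlt; apply/orP; left; apply/eqP; ring.
Qed.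

Notation S := (St a c).
Notation ev := (iota_ evec : V).
Let a0' : 0 <= a := ltW a0.
Let c0' : 0 <= c := ltW c0.
Let hS := St_sg a0' c0'.

Lemma St_evec (t : R) : 0 <= t -> S t ev = expR t *: ev.
Proof.
move=> t0; have Le : Lp a c evec = evec.
  apply/polyP => n; rewrite coef_Lp !coefD !coef1 !coefZ !coefX /c /nu.
  by case: n => [|[|[|[|n]]]] /=; try (by ring); try (by field); case: odd => /=; ring.
have f : flow a c 1.*2 (fun t => expR t *: evec).
  split => [s|n s].
    rewrite (leq_trans (size_scale_leq _ _))// /evec (leq_trans (size_polyD _ _))// geq_max.
    by rewrite size_poly1 /= (leq_trans (size_scale_leq _ _))// size_polyX.
  rewrite LpZ Le; have := deriv1Z (evec`_n) (deriv1_expR 1 s).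
  by apply: deriv1_ext => [z|]; rewrite coefZ ?mul1r mulrC.
by have := St_flow a0' c0' f t0; rewrite expR0 scale1r iota_Z.
Qed.

Lemma St_decay : exists2 C : R, 0 <= C & forall (x : V) (t : R), 0 <= t -> exists D : R,
  `|S t x - D *: ev| <= C * expR (mu * t) * `|x|.
Proof.
have [C C0 hC] := flow_decay; exists (C + 1); first exact: addr_ge0.
move=> x t t0; have [->|x0] := eqVneq x 0.
  exists 0; have Z : S t 0 = 0 by have := sgV_scale hS 0 0 t0; rewrite !scale0r.
  by rewrite Z scale0r subr0 normr0 mulr0.
have nx : 0 < `|x| by rewrite normr_gt0.
have Em : 0 < expR (mu * t) by exact: expR_gt0.
have EM : 0 < expR ((1 + c) * t) by exact: expR_gt0.
(* Chosen so that replacing [x] by a polynomial costs exactly [exp(mu t) * |x|], which accounts for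
   the constant [C + 1]. *)
pose B := expR ((1 + c) * t) + C * expR (mu * t).
have B0 : 0 < B by rewrite ltr_pwDl// mulr_ge0// ltW.
have [w hw] := dense_iota x (divr_gt0 (mulr_gt0 Em nx) B0).
set d := _ / B in hw; have dB : d * B = expR (mu * t) * `|x| by rewrite /d divfK// gt_eqF.
have [|W fW W0] := @flow_exists R a c (size w) w; first by rewrite -addnn leq_addr.
have [D hD] := hC _ _ fW t t0; exists D.
rewrite -(St_flow a0' c0' fW t0) W0 in hD.
have -> : S t x - D *: ev = S t (x - iota_ w) + (S t (iota_ w) - D *: ev).
  by rewrite (sgV_sub hS)//; linmod R.
rewrite (le_trans (ler_normD _ _))//.
have h1 := le_trans (St_growth a0' c0' (x - iota_ w) t0) (ler_wpM2l (ltW EM) hw).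
have h2 : `|iota_ w| <= `|x| + d.
  have -> : iota_ w = x - (x - iota_ w) by linmod R.
  by rewrite (le_trans (ler_normB _ _))// lerD.
have CE : 0 <= C * expR (mu * t) by rewrite mulr_ge0// ltW.
have h3 := le_trans hD (ler_wpM2l CE h2).
rewrite (le_trans (lerD h1 h3))//; move: dB; rewrite /B; lra.
Qed.

Let ip2_ext (u u' v : fpair R) : inH u -> inH u' -> inH v -> Heq u u' ->
  ip2 I01 u v = ip2 I01 u' v.
Proof.
move=> [u1 u2] [u1' u2'] [v1 v2] [e1 e2]; have mI := @mI01 R.
rewrite /ip2 (ae_eq_ip mI u1.1 u1'.1 v1.1 v1.1 e1 (ae_eq_refl _ _ _)).
by rewrite (ae_eq_ip mI u2.1 u2'.1 v2.1 v2.1 e2 (ae_eq_refl _ _ _)).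
Qed.

Let ev0 : 0 < `|ev|.
Proof.
apply: lt_le_trans (n01_epart evec); rewrite epart_evec /n01 /snrm sqrtr_gt0.
by rewrite ip_horner// mulr1 pint1 hornerX ltr01.
Qed.

Let mfun_ex : exists m : V -> R, [/\ forall k x y, m (k *: x + y) = k * m x + m y,
  forall x, `|m x| <= `|ev|^-1 * `|x| & m ev = 1].
Proof.
have mI := @mI01 R; have he := iot_inH evec.
exists (fun x => ip2 I01 (vrep x) (iot evec) / `|ev| ^+ 2); split.
- move=> k x y; have hx := vrep_inH x; have hy := vrep_inH y; have hk := inL2Z k mI hx.
  have hkx := inL2D mI hk hy.
  have E : Heq (vrep (k *: x + y)) (k *: vrep x + vrep y).
    apply: (cls_inj (vrep_inH _) hkx).
    by rewrite vrepK (clsDE hk hy) (clsZE k hx) !vrepK.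
  rewrite (ip2_ext (vrep_inH _) hkx he E) (ip2Dl mI hk hy he) (ip2Zl k mI hx he).
  by rewrite mulrDl mulrA.
- move=> x; have := ip2_cauchy_schwarz mI (vrep_inH x) he.
  rewrite -norm_vrep -(norm_cls he) -/(iota_ evec) => h.
  rewrite normrM normfV (ger0_norm (sqr_ge0 _)) ler_pdivrMr ?exprn_gt0//.
  by rewrite (le_trans h)// le_eqVlt; apply/orP; left; apply/eqP; field; rewrite gt_eqF.
- rewrite (ip2_ext (vrep_inH _) he he (clsK he)).
  by rewrite -nrm_sqr -(norm_cls he) divff// expf_neq0// gt_eqF.
Qed.

Lemma St_split : mu <= 0 -> exists (ell : V -> R) (C : R), [/\ 0 < C,
  forall k x y, ell (k *: x + y) = k * ell x + ell y,
  forall x, `|ell x| <= C * `|x|, ell ev = 1 &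
  forall x t, 0 <= t -> `|S t x - (expR t * ell x) *: ev| <= C * expR (mu * t) * `|x|].
Proof.
move=> mu0; have [m [m1 m2 m3]] := mfun_ex; have [C C0 hC] := St_decay.
exact: (spectral_split hS ev0 mu0 C0 (fun t t0 => St_evec t0) hC m1 m2 m3).
Qed.

End PolyDecay.

(** * The nonlinearity *)

Section Hardy.
Context {R : realType}.
Notation mu := (@lebesgue_measure R).
Notation I01 := (`]0%R, 1%R[%classic : set R).
Notation V := (Vsp R).
Implicit Types (f g u w : R -> R).
Let mI : measurable I01 := @mI01 R.

Lemma sqi_dom f g (K : R) : measurable_fun I01 f -> square_integrable I01 g -> 0 <= K ->
  (forall x, I01 x -> `|f x| <= K * `|g x|) ->
  square_integrable I01 f /\ snrm I01 f <= K * snrm I01 g.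
Proof.
move=> mf sg K0 h; have sKg := sqiZ K mI sg.
have le x : I01 x -> `|f x| <= `|K * g x| by move=> /h; rewrite normrM ger0_norm.
have sf : square_integrable I01 f.
  split => //; apply: le_lt_trans sKg.2; apply: ge0_le_integral => //.
  - by move=> x _; rewrite lee_fin sqr_ge0.
  - exact: measurable_EFinX2.
  - exact: measurable_EFinX2 sKg.1.
  - move=> x /le; rewrite lee_fin -[f x ^+ 2]real_normK ?num_real// -[(K * g x) ^+ 2]real_normK ?num_real//.
    by move=> hx; rewrite ler_sqr ?nnegrE.
split => //; rewrite -(ger0_norm K0) -(snrmZ K mI sg).
exact: snrm_mono.
Qed.

Lemma dense_poly w (e : R) : square_integrable I01 w -> 0 < e ->
  exists q : {poly R}, snrm I01 (fun x => w x - q.[x]) <= e.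
Proof.
move=> sw e0; have hu : inH ((fun=> 0, w) : fpair R) by split => //; exact: sqi0.
have [q hq] := dense_iota (cls ((fun=> 0, w) : fpair R)) e0; exists (epart q).
have hi := iot_inH q; have hB := inL2B mI hu hi.
move: hq; rewrite /iota_ -clsBE// norm_cls//; apply: le_trans.
rewrite -ler_sqr ?nnegrE ?nrm_ge0 ?snrm_ge0// nrm_sqr snrm_sqr /ip2.
by rewrite lerDr ip_ge0.
Qed.

Let ip00 : ip I01 (fun=> 0) (fun=> 0) = 0.
Proof.
have h := ipZl 0 mI (sqi0 I01) (sqi0 I01); rewrite mul0r in h.
by rewrite h mul0r.
Qed.

Definition avg u (x : R) : R := x^-1 * intI u x.

(* Integrating [(y X ^ 2)' = 2 X q - X ^ 2] for [X = avg q]. *)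
Let hardy_poly (q : {poly R}) : exists X : {poly R},
  (forall x, 0 < x -> X.[x] = avg (horner q) x) /\ n01 X <= 2 * n01 q.
Proof.
pose X : {poly R} := \poly_(i < size q) (q`_i / i.+1%:R).
have XE : 'X * X = pint q.
  apply/polyP => -[|i]; rewrite coefXM coef_pint //= coef_poly.
  by case: ltnP => // /(nth_default 0) ->; rewrite mul0r.
exists X; split.
  move=> x x0; rewrite /avg (intI_horner _ (ltW x0)) -XE hornerM hornerX mulrA mulVf ?mul1r//.
  by rewrite gt_eqF.
have dX : X + 'X * X^`() = q by have := congr1 deriv XE; rewrite deriv_pint derivM derivX mul1r.
have key : (pint (X * X)).[1] = 2 * (pint (X * q)).[1] - X.[1] ^+ 2.
  have : pint (('X * (X * X))^`()) = 'X * (X * X) - (('X * (X * X)).[0])%:P by exact: pint_deriv.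
  have -> : ('X * (X * X))^`() = 2 *: (X * q) - X * X.
    by rewrite !derivM derivX -dX -mul_polyC (_ : 2%:P = 1 + 1) ?polyCD//; ring.
  rewrite hornerM hornerX mul0r subr0 -scaleN1r pintD !pintZ => /(congr1 (fun r : {poly R} => r.[1])).
  by rewrite !(hornerD, hornerZ, hornerM, hornerX); lra.
have cs : (pint (X * q)).[1] <= n01 X * n01 q.
  have sX := sqi_horner_Io 1 X; have sq := sqi_horner_Io 1 q.
  rewrite -(ip_horner X q ltr01).
  have := ip2_cauchy_schwarz mI (sqi_pair sX) (sqi_pair sq).
  rewrite -!snrmE => /(le_trans (ler_norm _)); rewrite /ip2 /=.
  by rewrite ip00 addr0.
have n2 : n01 X ^+ 2 = (pint (X * X)).[1] by rewrite /n01 snrm_sqr ip_horner.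
have := n01_ge0 X; rewrite le_eqVlt => /orP[/eqP <-|X0].
  by rewrite mulr_ge0// n01_ge0.
rewrite -(ler_pM2r X0) -expr2 n2 key.
by have := sqr_ge0 X.[1]; move: cs; lra.
Qed.

Lemma measurable_avg u : square_integrable I01 u -> measurable_fun I01 (avg u).
Proof.
move=> su; apply: measurable_funM; last exact: measurable_intI.
apply: open_continuous_measurable_fun; first exact: interval_open.
move=> x; rewrite inE /= in_itv /= => /andP[x0 _].
by apply: cvgV; [rewrite gt_eqF|exact: cvg_id].
Qed.

Let avgB u w : square_integrable I01 u -> square_integrable I01 w -> forall x, I01 x ->
  intI (fun x => u x - w x) x = intI u x - intI w x.
Proof.
move=> su sw x; rewrite /= in_itv /= => /andP[_ x1].
rewrite (intI_ip (sqiB mI su sw) x1) (intI_ip su x1) (intI_ip sw x1) ipBl//; exact: sqi_ind.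
Qed.

Let mulx_meas f : measurable_fun I01 f -> measurable_fun I01 (fun x => x * f x).
Proof. by move=> mf; apply: measurable_funM. Qed.

Let mulx_le f x : I01 x -> `|x * f x| <= 1 * `|f x|.
Proof.
rewrite /= in_itv /= => /andP[x0 x1]; rewrite normrM ler_wpM2r//.
by rewrite ger0_norm ltW.
Qed.

(** Along polynomials tending to [u], the averages form a Cauchy sequence by the inequality for
    polynomials. Their limit [g] satisfies [x * g x = intI u x] almost everywhere, since both sides
    are limits in L^2, and so [g] is [avg u]. *)
Lemma hardy u : square_integrable I01 u ->
  square_integrable I01 (avg u) /\ snrm I01 (avg u) <= 2 * snrm I01 u.
Proof.
move=> su.
have sum_le (x : R) : 0 < x / 4 -> 2 * x + x / 4 <= 3 * x by lra.
have pn (n : nat) : 0 < (2^-1 : R) ^+ n / 4 by rewrite divr_gt0// exprn_gt0// invr_gt0.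
have [q hq] := choice (fun n => dense_poly su (pn n)).
have [X hX] := choice (fun n => hardy_poly (q n)).
have sq n := sqi_horner_Io 1 (q n).
have XB n m : exists2 Y : {poly R}, (forall x, 0 < x < 1 -> Y.[x] = (X n).[x] - (X m).[x]) &
    n01 Y <= 2 * n01 (q n - q m).
  have [Y [Y1 Y2]] := hardy_poly (q n - q m); exists Y => // x x01.
  have /andP[x0 _] := x01.
  rewrite Y1// (hX n).1// (hX m).1// /avg -mulrBr; congr (_ * _).
  have xI : I01 x by rewrite /= in_itv.
  rewrite -(avgB (sq n) (sq m) xI); congr intI.
  by apply/funext => z; rewrite hornerD hornerN.
have qd n : snrm I01 (fun x => (X n.+1).[x] - (X n).[x]) <= 2^-1 ^+ n.
  have [Y Y1 Y2] := XB n.+1 n.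
  have -> : snrm I01 (fun x => (X n.+1).[x] - (X n).[x]) = n01 Y.
    rewrite /n01 /snrm /ip; congr Num.sqrt; apply: eq_Rintegral => x /set_mem.
    by rewrite /= in_itv /= => /Y1 ->.
  apply: (le_trans Y2).
  have -> : n01 (q n.+1 - q n) = snrm I01 (fun x => (u x - (q n).[x]) - (u x - (q n.+1).[x])).
    by congr snrm; apply/funext => x; rewrite hornerD hornerN; ring.
  have := snrmB mI (sqiB mI su (sq n)) (sqiB mI su (sq n.+1)).
  have := hq n; have := hq n.+1; rewrite exprS; have := pn n; lra.
have [g sg hg] := riesz_fischer mI (fun n => sqi_horner_Io 1 (X n)) qd.
have sxg : square_integrable I01 (fun x => x * g x).
  have [s _] // := sqi_dom (mulx_meas sg.1) sg ler01 (mulx_le g).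
have sI := sqi_intI su.
have z0 : snrm I01 (fun x => x * g x - intI u x) = 0.
  apply/eqP; rewrite eq_le snrm_ge0 andbT; apply: (@ler_small_half _ _ _ 3) => n; rewrite add0r.
  have s1 := sqiB mI (sqi_horner_Io 1 (X n)) sg.
  have s2 := sqi_intI (sqiB mI su (sq n)).
  have [s3 n3] := sqi_dom (mulx_meas s1.1) s1 ler01 (mulx_le _).
  have n2 := snrm_intI ler01 (sqiB mI su (sq n)).
  have E : snrm I01 (fun x => x * g x - intI u x) = snrm I01 (fun x =>
     - 1 * (x * ((X n).[x] - g x)) - intI (fun x => u x - (q n).[x]) x).
    rewrite /snrm /ip; congr Num.sqrt; apply: eq_Rintegral => x /set_mem xI.
    have x0 : 0 < x by move: xI; rewrite /= in_itv /= => /andP[].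
    rewrite (avgB su (sq n) xI).
    have -> : intI (horner (q n)) x = x * (X n).[x].
      by rewrite (hX n).1// /avg mulrA divff ?mul1r// gt_eqF.
    by congr (_ * _); ring.
  rewrite E; apply: (le_trans (snrmB mI (sqiZ (-1) mI s3) s2)).
  rewrite (snrmZ (-1) mI s3) normrN1.
  rewrite !mul1r in n2 n3 *; apply: le_trans (sum_le _ (pn n)).
  exact: lerD (le_trans n3 (hg n)) (le_trans n2 (hq n)).
have ae := ip_eq0 mI (sqiB mI sxg sI) _.
have {}ae : ae_eq mu I01 (fun x => x * g x - intI u x) (fun=> 0).
  by apply: ae; rewrite -snrm_sqr z0 expr2 mul0r.
have gE : ae_eq mu I01 g (avg u).
  apply: filterS ae => x hx xI; have x0 : 0 < x by move: xI; rewrite /= in_itv /= => /andP[].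
  have := hx xI; move/eqP; rewrite subr_eq0 => /eqP E.
  by rewrite /avg -E mulrA mulVf ?mul1r// gt_eqF.
have sa := ae_eq_sqi mI sg (measurable_avg su) gE; split => //.
have -> : snrm I01 (avg u) = snrm I01 g.
  by rewrite /snrm (ae_eq_ip mI sa.1 sg.1 sa.1 sg.1) //; exact: ae_eq_sym.
apply: (@ler_small_half _ _ _ 3) => n.
have sX := sqi_horner_Io 1 (X n).
have -> : snrm I01 g = snrm I01 (fun x => (X n).[x] - ((X n).[x] - g x)).
  by congr snrm; apply/funext => x; ring.
apply: (le_trans (snrmB mI sX (sqiB mI sX sg))).
have h1 := (hX n).2.
have h2 : n01 (q n) <= snrm I01 u + 2^-1 ^+ n / 4.
  rewrite /n01; have -> : horner (q n) = (fun x => u x - (u x - (q n).[x])).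
    by apply/funext => x; ring.
  by rewrite (le_trans (snrmB mI su (sqiB mI su (sq n))))// lerD.
by have := hg n; have := pn n; move: h1 h2; rewrite /n01; lra.
Qed.

End Hardy.

(** * Pointwise estimates for the power *)

Section PowerNonlinearity.
Context {R : realType}.
Variable p : R.
Hypothesis hp : 1 < p <= 3.
Implicit Types (x y z : R).
Let q : R := p - 1.
Let q0 : 0 < q. Proof. by rewrite subr_gt0; case/andP: hp. Qed.
Let q2 : q <= 2. Proof. by case/andP: hp => _; rewrite /q; lra. Qed.
Let k0 : R := kappa0 p.
Let kap : R := k0 `^ q^-1.
Let k0_gt0 : 0 < k0.
Proof. by rewrite /k0 /kappa0 divr_gt0 ?exprn_gt0// mulr_gt0//; case/andP: hp; lra. Qed.
Let kap0 : 0 < kap. Proof. exact: powR_gt0. Qed.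
Let kapq : kap `^ q = k0.
Proof. by rewrite /kap -powRrM mulVf ?gt_eqF// powRr1// ltW. Qed.
Let kapp : k0 `^ (p / q) = k0 * kap.
Proof.
have -> : p / q = 1 + q^-1 by rewrite /q; field; move: q0; rewrite /q => /gt_eqF ->.
rewrite powRD ?powRr1 ?ltW//; apply/implyP => _; exact: lt0r_neq0.
Qed.

(** The power minus its first-order Taylor polynomial at the constant profile; [nonlin x rho] is
    [rho * npow x]. *)
Definition npow x : R := `|kap + x| `^ q * (kap + x) - p * k0 * x - k0 `^ (p / q).

Lemma npow0 : npow 0 = 0.
Proof. by rewrite /npow addr0 gtr0_norm// kapq kapp mulr0 subr0 subrr. Qed.

(** At 0, where the absolute value is not differentiable, the difference quotient is [|h|^q], which
    tends to 0 because [q > 0]. *)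
Let gpow_deriv z : is_derive z (1 : R) (fun z : R => `|z| `^ q * z) (p * `|z| `^ q).
Proof.
have pos (t : R) : 0 < t -> is_derive t (1 : R) (fun z : R => z `^ q * z) (p * t `^ q).
  move=> t0; have := deriv1M (is_derive1_powR q t0) (is_derive_id t (1 : R)).
  apply: deriv1_ext => //.
  have -> : t `^ q = t `^ (q - 1) * t.
    by rewrite -{3}(powRr1 (ltW t0)) -powRD ?subrK//; apply/implyP => _; exact: lt0r_neq0.
  by rewrite /q; ring.
have [z0|z0|->] := ltgtP z 0.
- have nz : 0 < - z by rewrite oppr_gt0.
  have h : is_derive z (1 : R) (fun s : R => -1 * ((-1 * s + 0) `^ q * (-1 * s + 0))) (p * `|z| `^ q).
    have := deriv1Z (-1) (deriv1_comp (f := fun z : R => z `^ q * z) (g := fun s => -1 * s + 0) (pos _ _) (deriv1_lin (-1) 0 z)).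
    rewrite mulN1r addr0 => /(_ nz); apply: deriv1_ext => //.
    by rewrite ltr0_norm//; ring.
  apply: near_eq_is_derive h.
  near=> s; have s0 : s < 0 by near: s; exact: lt_nbhsl.
  by rewrite ltr0_norm// !mulN1r !addr0; ring.
- have := pos _ z0; rewrite gtr0_norm//; apply: near_eq_is_derive.
  near=> s; have s0 : 0 < s by near: s; exact: lt_nbhsr.
  by rewrite gtr0_norm.
rewrite normr0 powR0 ?gt_eqF// mulr0.
suff h : h^-1 *: ((fun z : R => `|z| `^ q * z) (h *: (1 : R) + 0) - (fun z : R => `|z| `^ q * z) 0) @[h --> 0^'] --> (0 : R).
  by apply: DeriveDef; [apply/cvg_ex; exists 0|exact: cvg_lim h].
apply/cvgrPdist_le => e e0; near=> h.
have hn : h != 0 by near: h; exact: nbhs_dnbhs_neq.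
rewrite /= mulr0 subr0 addr0 sub0r normrN /GRing.scale /= mulr1 mulrCA mulVf// mulr1.
rewrite ger0_norm ?powR_ge0//.
have he : `|h| <= e `^ q^-1.
  near: h; apply: dnbhs0_le; exact: powR_gt0.
have -> : e = (e `^ q^-1) `^ q by rewrite -powRrM mulVf ?gt_eqF// powRr1// ltW.
by apply: (ge0_ler_powR (ltW q0)); rewrite ?nnegrE ?powR_ge0.
Unshelve. all: by end_near. Qed.

Let npow_deriv x : is_derive x (1 : R) npow (p * (`|kap + x| `^ q - k0)).
Proof.
have h1 := deriv1_comp (f := fun z : R => `|z| `^ q * z) (g := fun s => 1 * s + kap)
  (gpow_deriv _) (deriv1_lin 1 kap x).
have := deriv1D h1 (deriv1_lin (- (p * k0)) (- k0 `^ (p / q)) x).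
apply: deriv1_ext => [s|]; first by rewrite /npow mul1r (addrC s); ring.
by rewrite mul1r (addrC x); ring.
Qed.

(** As [0 < q <= 2], the power [t^q] lies between 1 and [t ^ 2]. Here [p <= 3] bounds the derivative
    of the nonlinearity by a quadratic expression. *)
Let pow_dist t : 0 <= t -> `|t `^ q - 1| <= 2 * `|t - 1| + (t - 1) ^+ 2.
Proof.
move=> t0; have [t1|t1] := leP 1 t.
  have h : t `^ q <= t ^+ 2 by rewrite -powR_mulrn//; apply: ler_powR.
  have h' : 1 <= t `^ q by rewrite -[leLHS](@powRr0 _ t); apply: ler_powR => //; exact: ltW.
  by rewrite !ger0_norm ?subr_ge0//; move: h; lra.
have h : t ^+ 2 <= t `^ q.
  move: t0; rewrite le_eqVlt => /orP[/eqP <-|t0]; first by rewrite expr2 mul0r powR_ge0.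
  rewrite -(powR_mulrn 2 (ltW t0)); apply: (@ger_powR _ t); last exact: q2.
  by rewrite t0 ltW.
have h' : t `^ q <= 1.
  by have := @ge0_ler_powR R q (ltW q0) t 1; rewrite powR1 !nnegrE => /(_ t0 ler01 (ltW t1)).
rewrite (ler0_norm (_ : t `^ q - 1 <= 0)) ?subr_le0// ltr0_norm ?subr_lt0//.
by have := sqr_ge0 (t - 1); move: h; nra.
Qed.

(** Obtained by applying [pow_dist] to [t = |kap + x| / kap], for which [|t - 1| <= |x| / kap]. *)
Definition npow_cst : R := p * k0 * (2 / kap + (kap ^+ 2)^-1).

Lemma npow_cst_gt0 : 0 < npow_cst.
Proof.
have p0 : 0 < p by case/andP: hp; lra.
apply: mulr_gt0; first exact: mulr_gt0.
by apply: addr_gt0; [exact: divr_gt0|rewrite invr_gt0; exact: exprn_gt0].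
Qed.

Let npow_deriv_le x : `|p * (`|kap + x| `^ q - k0)| <= npow_cst * (`|x| + x ^+ 2).
Proof.
have p0 : 0 < p by case/andP: hp; lra.
pose t := `|kap + x| / kap; have t0 : 0 <= t by rewrite divr_ge0// ltW.
have td : `|t - 1| <= `|x| / kap.
  have -> : t - 1 = (`|kap + x| - kap) / kap by rewrite /t; field; rewrite gt_eqF.
  rewrite normrM (gtr0_norm (_ : 0 < kap^-1)) ?invr_gt0// ler_wpM2r ?invr_ge0 ?(ltW kap0)//.
  rewrite -{2}(gtr0_norm kap0) (le_trans (ler_dist_dist _ _))//.
  by rewrite addrAC subrr add0r.
have -> : p * (`|kap + x| `^ q - k0) = p * k0 * (t `^ q - 1).
  have -> : `|kap + x| = kap * t by rewrite /t; field; rewrite gt_eqF.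
  by rewrite powRM ?(ltW kap0)// kapq; ring.
rewrite normrM (gtr0_norm (mulr_gt0 p0 k0_gt0)) /npow_cst -[leRHS]mulrA.
apply: ler_wpM2l; first exact: ltW (mulr_gt0 p0 k0_gt0).
apply: (le_trans (pow_dist t0)).
have td2 : (t - 1) ^+ 2 <= x ^+ 2 / kap ^+ 2.
  rewrite -real_normK ?num_real// -[x ^+ 2]real_normK ?num_real// -expr_div_n ler_sqr ?nnegrE//.
  by rewrite divr_ge0// ltW.
have k1 : 0 <= kap^-1 by rewrite invr_ge0 ltW.
have k2 : 0 <= (kap ^+ 2)^-1 by rewrite invr_ge0 exprn_ge0// ltW.
have := mulr_ge0 k1 (sqr_ge0 x); have := mulr_ge0 k2 (normr_ge0 x).
move: td td2; lra.
Qed.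

Lemma npow_lip x y m : `|x| <= m -> `|y| <= m ->
  `|npow x - npow y| <= npow_cst * `|x - y| * (m + m ^+ 2).
Proof.
wlog yx : x y / y <= x.
  move=> H xm ym; have [/H|/ltW/H] := leP y x; first exact.
  by rewrite distrC [`|y - x|]distrC; apply.
move=> xm ym.
have dg z : is_derive z (1 : R) (fun z => (npow_cst * (m + m ^+ 2)) * z + 0) (npow_cst * (m + m ^+ 2)).
  exact: deriv1_lin.
have H := deriv1_le yx (fun z _ => npow_deriv z) (fun z _ => dg z).
rewrite (ger0_norm (_ : 0 <= x - y)) ?subr_ge0//.
have -> : npow_cst * (x - y) * (m + m ^+ 2) =
  npow_cst * (m + m ^+ 2) * x + 0 - (npow_cst * (m + m ^+ 2) * y + 0) by ring.
apply: H => z /andP[yz zx]; apply: (le_trans (npow_deriv_le z)).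
rewrite ler_wpM2l ?(ltW npow_cst_gt0)//.
have zm : `|z| <= m.
  move: xm ym; rewrite !ler_norml => /andP[_ xm] /andP[ym _].
  by rewrite (le_trans ym (ltW yz)) (le_trans (ltW zx) xm).
rewrite lerD// -real_normK ?num_real// ler_sqr ?nnegrE//.
exact: le_trans zm.
Qed.

Lemma measurable_npow : measurable_fun setT npow.
Proof.
have c : continuous npow by move=> x; exact: deriv1_cont (npow_deriv x).
exact: continuous_measurable_fun.
Qed.

End PowerNonlinearity.

Section NonlinearOperator.
Context {R : realType}.
Variable p : R.
Hypothesis hp : 1 < p <= 3.
Notation I01 := (`]0%R, 1%R[%classic : set R).
Notation V := (Vsp R).
Implicit Types (u v : fpair R).
Let mI : measurable I01 := @mI01 R.
Let C1 := npow_cst p.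
Let C10 : 0 < C1 := npow_cst_gt0 hp.

Let nonlinN1 u (x : R) : (nonlinN p u).1 x = x * npow p (avg u.2 x).
Proof. by []. Qed.

Let nrm_snrm2 u : snrm I01 u.2 <= nrm I01 u.
Proof.
rewrite -ler_sqr ?nnegrE ?nrm_ge0 ?snrm_ge0// nrm_sqr snrm_sqr /ip2.
by rewrite lerDr ip_ge0.
Qed.

(** The antiderivative is at most [sqrt x] times the norm, so the weight [x] carried by the
    nonlinearity absorbs even the square of an average. One factor, the average of the difference,
    is left for Hardy's inequality. *)
Let avg_bound u x : inH u -> I01 x -> x * `|avg u.2 x| <= nrm I01 u /\
  x * avg u.2 x ^+ 2 <= nrm I01 u ^+ 2.
Proof.
move=> [_ hu] /=; rewrite in_itv /= => /andP[x0 x1].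
have h := intI_le hu (ltW x0) x1; have n := nrm_snrm2 u; have n0 := snrm_ge0 I01 u.2.
have s1 : Num.sqrt x <= 1 by rewrite -sqrtr1 ler_sqrt// ltW.
rewrite /avg normrM normfV (gtr0_norm x0) mulrA divff ?mul1r ?gt_eqF//; split.
  by rewrite (le_trans h)// -[leRHS]mul1r ler_pM.
have -> : x * (x^-1 * intI u.2 x) ^+ 2 = intI u.2 x ^+ 2 / x by field; rewrite gt_eqF.
rewrite ler_pdivrMr// -real_normK ?num_real//.
apply: (@le_trans _ _ ((Num.sqrt x * snrm I01 u.2) ^+ 2)).
  by rewrite ler_sqr ?nnegrE ?mulr_ge0.
rewrite exprMn sqr_sqrtr ?(ltW x0)// mulrC ler_wpM2r ?(ltW x0)//.
by rewrite ler_sqr ?nnegrE ?nrm_ge0.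
Qed.

Let G u v : R := nrm I01 u + nrm I01 v + nrm I01 u ^+ 2 + nrm I01 v ^+ 2.
Let G0 u v : 0 <= G u v.
Proof. by rewrite !addr_ge0 ?nrm_ge0 ?sqr_ge0. Qed.

Let avg_sub u v x : inH u -> inH v -> I01 x ->
  avg (u - v).2 x = avg u.2 x - avg v.2 x.
Proof.
move=> [_ hu] [_ hv] xI; rewrite /avg -mulrBr; congr (_ * _).
move: xI; rewrite /= in_itv /= => /andP[_ x1].
rewrite (intI_ip hu x1) (intI_ip hv x1) -(ipBl mI hu hv (sqi_ind 1 x)).
exact: (intI_ip (sqiB mI hu hv) x1).
Qed.

Let nonlin_pt u v x : inH u -> inH v -> I01 x ->
  `|(nonlinN p u).1 x - (nonlinN p v).1 x| <= (C1 * G u v) * `|avg (u - v).2 x|.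
Proof.
move=> hu hv xI; have x0 : 0 < x by move: xI; rewrite /= in_itv /= => /andP[].
rewrite !nonlinN1 -mulrBr normrM (gtr0_norm x0) (avg_sub hu hv xI).
have [a1 a2] := avg_bound hu xI; have [b1 b2] := avg_bound hv xI.
set X := avg u.2 x in a1 a2 *; set Y := avg v.2 x in b1 b2 *.
pose m := Num.max `|X| `|Y|.
have Xm : `|X| <= m by rewrite le_max lexx.
have Ym : `|Y| <= m by rewrite le_max lexx orbT.
have h := npow_lip hp Xm Ym.
have xm : x * (m + m ^+ 2) <= G u v.
  have n1 := nrm_ge0 I01 u; have n2 := nrm_ge0 I01 v.
  have n3 := sqr_ge0 (nrm I01 u); have n4 := sqr_ge0 (nrm I01 v).
  rewrite /m /G; case: (leP `|X| `|Y|) => _; rewrite mulrDr real_normK ?num_real//; lra.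
have := ler_wpM2l (ltW x0) h => /le_trans; apply.
have := ler_wpM2l (mulr_ge0 (ltW C10) (normr_ge0 (X - Y))) xm.
by congr (_ <= _); rewrite /C1; ring.
Qed.

Lemma nonlinN_meas u : inH u -> measurable_fun I01 (nonlinN p u).1.
Proof.
move=> hu; apply: measurable_funM => //.
exact: (measurableT_comp (measurable_npow hp) (measurable_avg hu.2)).
Qed.

Lemma nonlinN0 : nonlinN p (0 : fpair R) = 0.
Proof.
congr pair; apply/funext => x; rewrite /= /nonlin.
have -> : \int[lebesgue_measure]_(s in `[0, x]) (0 : fpair R).2 s = 0 :> R.
  by rewrite /Rintegral integral0.
rewrite mulr0; have -> : (0 : R -> R) x = 0 by [].
by have := npow0 hp; rewrite /npow => ->; rewrite mulr0.
Qed.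

Lemma nonlinN_inH u : inH u -> inH (nonlinN p u).
Proof.
move=> hu; split; last exact: sqi0.
have h0 : inH (0 : fpair R) by exact: inL20.
have huB := inL2B mI hu h0.
have [sa _] := hardy huB.2.
have pt x : I01 x -> `|(nonlinN p u).1 x| <= (C1 * G u 0) * `|avg (u - 0).2 x|.
  move=> xI; have := nonlin_pt hu h0 xI; rewrite nonlinN0.
  by have -> : (0 : fpair R).1 x = 0 by []; rewrite subr0.
by have [] := sqi_dom (nonlinN_meas hu) sa (mulr_ge0 (ltW C10) (G0 u 0)) pt.
Qed.

Lemma nonlinN_lip u v : inH u -> inH v ->
  `|cls (nonlinN p u) - cls (nonlinN p v)| <= 2 * C1 * `|cls u - cls v| *
   (`|cls u| + `|cls v| + `|cls u| ^+ 2 + `|cls v| ^+ 2).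
Proof.
move=> hu hv; have nu := nonlinN_inH hu; have nv := nonlinN_inH hv.
have huv := inL2B mI hu hv; have [sa na] := hardy huv.2.
have nB := inL2B mI nu nv.
rewrite -!clsBE// !norm_cls// -/(G u v).
have [_ h] := sqi_dom nB.1.1 sa (mulr_ge0 (ltW C10) (G0 u v)) (fun x xI => nonlin_pt hu hv xI).
have -> : nrm I01 (nonlinN p u - nonlinN p v) = snrm I01 (nonlinN p u - nonlinN p v).1.
  rewrite snrmE; congr nrm; congr pair.
  by apply/funext => x; rewrite /= fctE /= subrr.
apply: (le_trans h).
have := ler_wpM2l (mulr_ge0 (ltW C10) (G0 u v)) (le_trans na (ler_wpM2l (ler0n R 2) (nrm_snrm2 (u - v)))).
move=> /le_trans; apply; rewrite le_eqVlt; apply/orP; left; apply/eqP; ring.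
Qed.

Definition NV (x : V) : V := cls (nonlinN p (vrep x)).

Lemma NV_cls u : inH u -> cls (nonlinN p u) = NV (cls u).
Proof.
move=> hu; apply/eqP; rewrite -subr_eq0 -normr_le0.
apply: (le_trans (nonlinN_lip hu (vrep_inH _))); rewrite vrepK subrr normr0.
by rewrite mulr0 mul0r.
Qed.

Lemma NV_lip (x y : V) : `|NV x - NV y| <= 2 * C1 * `|x - y| *
   (`|x| + `|y| + `|x| ^+ 2 + `|y| ^+ 2).
Proof. by have := nonlinN_lip (vrep_inH x) (vrep_inH y); rewrite !vrepK. Qed.

Lemma NV0 : NV 0 = 0.
Proof.
by rewrite -cls0 -NV_cls; [rewrite nonlinN0|exact: inL20].
Qed.

End NonlinearOperator.

(** * Lyapunov-Perron fixed points *)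

Section ScalarCont.
Context {R : realType} {V : normedModType R}.

Lemma cont_on_scal (k : R -> R) (f : R -> V) a b : cont_on (V := R^o) a b k ->
  cont_on a b f ->
  cont_on a b (fun t => k t *: f t).
Proof.
move=> ck cf t tab e e0.
have f1 : 0 < `|f t| + 1 by rewrite ltr_wpDl.
have k1 : 0 < `|k t| + 1 by rewrite ltr_wpDl.
have e2 : 0 < e / 2 by rewrite divr_gt0.
have m0 : 0 < Num.min 1 (e / 2 / (`|f t| + 1)) by rewrite lt_min ltr01 divr_gt0.
have [d d0 hd] := ck t tab _ m0; have [d' d'0 hd'] := cf t tab _ (divr_gt0 e2 k1).
exists (Num.min d d'); first by rewrite lt_min d0.
move=> s sab; rewrite lt_min => /andP[sd sd'].
have := hd s sab sd; rewrite lt_min => /andP[h1 h2]; have h3 := hd' s sab sd'.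
have -> : k s *: f s - k t *: f t = k s *: (f s - f t) + (k s - k t) *: f t by linmod R.
rewrite (le_lt_trans (ler_normD _ _))// !normrZ.
have ks : `|k s| <= `|k t| + 1.
  rewrite -[k s](subrK (k t)) addrC (le_trans (ler_normD _ _))// lerD2l.
  exact: ltW h1.
have h4 : `|k s| * `|f s - f t| <= e / 2.
  rewrite ltr_pdivlMr// in h3; apply: le_trans (ltW h3).
  by rewrite mulrC ler_wpM2l.
have h5 : `|k s - k t| * `|f t| < e / 2.
  move: h2; rewrite ltr_pdivlMr// => h2; apply: le_lt_trans h2.
  by rewrite ler_wpM2l// lerDl.
by move: h4 h5; lra.
Qed.

Lemma cont_on_ext (f g : R -> V) a b : (forall t, a <= t <= b -> f t = g t) ->
  cont_on a b f -> cont_on a b g.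
Proof.
move=> fg cf t tab e e0; have [d d0 hd] := cf t tab e e0; exists d => // s sab.
by rewrite -!fg//; exact: hd.
Qed.

Lemma cont_on_cst (x : V) a b : cont_on a b (fun=> x).
Proof. by move=> t _ e e0; exists 1 => // s _ _; rewrite subrr normr0. Qed.

Lemma cont_on_opp (f : R -> V) a b : cont_on a b f -> cont_on a b (fun t => - f t).
Proof.
move=> cf t tab e e0; have [d d0 hd] := cf t tab e e0; exists d => // s sab sd.
by rewrite -opprD normrN; exact: hd.
Qed.

Lemma cont_onB (f g : R -> V) a b : cont_on a b f -> cont_on a b g ->
  cont_on a b (fun t => f t - g t).
Proof. by move=> cf cg; apply: cont_onD => //; exact: cont_on_opp. Qed.

End ScalarCont.

(** * The Duhamel integral *)

Section Convolution.
Context {R : realType} {V : completeNormedModType R}.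
Variable S : R -> V -> V.
Hypothesis hS : semigroupV S.
Implicit Types (g : R -> V).

(** Strong continuity at 0 is uniform on the compact image of a continuous path. *)
Lemma sgV_unif a b g : a <= b -> cont_on a b g -> forall e, 0 < e -> exists2 d, 0 < d &
  forall h s, 0 < h < d -> a <= s <= b -> `|S h (g s) - g s| <= e.
Proof.
move=> ab cg e e0; have [K K0 hK] := sgV_bound hS 1.
pose Q (x y : R) := exists2 d, 0 < d & forall h s, 0 < h < d -> x <= s <= y ->
  `|S h (g s) - g s| <= e.
apply: (cousin (Q := Q) ab).
- move=> x y z _ xy yz _ [d d0 hd] [d' d'0 hd']; exists (Num.min d d'); first by rewrite lt_min d0.
  move=> h s /andP[h0]; rewrite lt_min => /andP[h1 h2] /andP[xs sz].
  by have [sy|/ltW ys] := leP s y; [apply: hd|apply: hd']; rewrite ?h0 ?xs ?ys.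
move=> s sab; have K1 : 0 < K + 2 by rewrite addr_gt0.
have e1 := divr_gt0 e0 K1.
have [d d0 hd] := cg s sab _ e1; have [d' d'0 hd'] := sgV_cont0 hS (g s) e1.
exists d => // x y ax xs sy yb dx dy; exists (Num.min d' 1); first by rewrite lt_min d'0 ltr01.
move=> h r /andP[h0]; rewrite lt_min => /andP[h1 h2] /andP[xr ry].
have rd : `|g r - g s| < e / (K + 2).
  by apply: hd; [rewrite (le_trans ax xr) (le_trans ry yb)|rewrite ltr_norml; apply/andP; split; lra].
have -> : S h (g r) - g r = S h (g r - g s) + (S h (g s) - g s) - (g r - g s).
  by rewrite (sgV_sub hS) ?ltW//; linmod R.
have k1 : `|S h (g r - g s)| <= K * (e / (K + 2)).
  by rewrite (le_trans (hK _ _ _)) ?(ltW h0) ?(ltW h2)// ler_wpM2l ?ltW.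
have k2 : `|S h (g s) - g s| <= e / (K + 2) by apply: hd'; rewrite h0.
rewrite (le_trans (ler_normB _ _))// (le_trans (lerD (ler_normD _ _) (lexx _)))//.
rewrite (le_trans (lerD (lerD k1 k2) (ltW rd)))// le_eqVlt; apply/orP; left; apply/eqP.
by field; rewrite gt_eqF.
Qed.

Definition duhamel g (t : R) : V := Vint (fun s => S (t - s) (g s)) 0 t.

Let cS g b t : b <= t -> cont_on 0 b g -> cont_on 0 b (fun s => S (t - s) (g s)).
Proof. by move=> bt cg; exact: cont_on_sgV. Qed.

Lemma duhamelB g1 g2 t : 0 <= t -> cont_on 0 t g1 -> cont_on 0 t g2 ->
  duhamel (fun s => g1 s - g2 s) t = duhamel g1 t - duhamel g2 t.
Proof.
move=> t0 c1 c2; rewrite /duhamel -VintB//; [|exact: cS|exact: cS].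
by apply: eq_Vint => // s /andP[_ st]; rewrite (sgV_sub hS)// subr_ge0.
Qed.

Lemma duhamel_split g s t : 0 <= s -> s <= t -> cont_on 0 t g ->
  duhamel g t = S (t - s) (duhamel g s) + Vint (fun r => S (t - r) (g r)) s t.
Proof.
move=> s0 st cg; rewrite /duhamel (Vint_cat s0 st); last exact: cS.
congr (_ + _); have [K K0 hK] := sgV_bound hS (t - s).
have ts : 0 <= t - s by rewrite subr_ge0.
have cs : cont_on 0 s g by exact: (cont_on_subset (lexx _) st).
rewrite (Vint_lin (T := S (t - s)) (M := K)) //.
- apply: eq_Vint => // r /andP[_ rs] /=.
  by rewrite -(sgV_D hS) ?subr_ge0// subrKA.
- by move=> x y; rewrite (sgV_sub hS).
- by move=> k x; rewrite (sgV_scale hS).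
- by move=> x; apply: hK; rewrite ts lexx.
- exact: cS.
Qed.

(** For [s < t] the increment is the Duhamel integral at [s] of [S (t - s) (g r) - g r], small by
    uniform strong continuity along [g], plus an integral over [[s, t]]. *)
Lemma duhamel_cont g b : 0 <= b -> cont_on 0 b g -> cont_on 0 b (duhamel g).
Proof.
move=> b0 cg.
have [K K0 hK] := sgV_bound hS b; have [B B0 hB] := cont_on_bounded b0 cg.
have unif e : 0 < e -> exists2 d, 0 < d & forall s t, 0 <= s -> s < t -> t <= b -> t - s < d ->
    `|duhamel g t - duhamel g s| < e.
  move=> e0; pose q := e / (2 * (K * b + K * B + 1)).
  have C0 : 0 < 2 * (K * b + K * B + 1).
    by rewrite mulr_gt0// ltr_wpDl// addr_ge0// mulr_ge0// ltW.
  have q0 : 0 < q by rewrite divr_gt0.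
  have [d d0 hd] := sgV_unif b0 cg q0.
  exists (Num.min d q); first by rewrite lt_min d0.
  move=> s t s0 st tb; rewrite lt_min => /andP[std stq].
  have h0 : 0 < t - s by rewrite subr_gt0.
  have ct : cont_on 0 t g by exact: (cont_on_subset (lexx _) tb).
  have sb : s <= b by rewrite (le_trans (ltW st)).
  have cs : cont_on 0 s g by exact: (cont_on_subset (lexx _) sb).
  have cgh : cont_on 0 s (fun r => S (t - s) (g r)).
    have [K' K'0 hK'] := sgV_bound hS (t - s).
    by apply: (cont_on_lin (T := S (t - s)) (M := K')) => //; [move=> x y; rewrite (sgV_sub hS) ?ltW|move=> x; apply: hK'; rewrite ltW/=].
  have -> : duhamel g t - duhamel g s = duhamel (fun r => S (t - s) (g r) - g r) s +
       Vint (fun r => S (t - r) (g r)) s t.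
    rewrite (duhamelB s0 cgh cs) (duhamel_split s0 (ltW st) ct).
    have -> : S (t - s) (duhamel g s) = duhamel (fun r => S (t - s) (g r)) s.
      have [K' K'0 hK'] := sgV_bound hS (t - s).
      rewrite /duhamel (Vint_lin (T := S (t - s)) (M := K')) //.
      - apply: eq_Vint => // r /andP[r0 rs] /=.
        by rewrite -!(sgV_D hS) ?subr_ge0 ?(ltW st)// addrC.
      - by move=> x y; rewrite (sgV_sub hS) ?ltW.
      - by move=> k x; rewrite (sgV_scale hS) ?ltW.
      - by move=> x; apply: hK'; rewrite ltW/=.
      - exact: cS.
    by linmod R.
  have k1 : `|duhamel (fun r => S (t - s) (g r) - g r) s| <= K * q * (s - 0).
    apply: Vint_le_cst => //; first by apply: cS => //; exact: cont_onB.
    move=> r /andP[r0 rs]; rewrite (le_trans (hK _ _ _))//; first by lra.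
    rewrite ler_wpM2l ?(ltW K0)// hd ?h0 ?std//; lra.
  have k2 : `|Vint (fun r => S (t - r) (g r)) s t| <= K * B * (t - s).
    apply: Vint_le_cst; first exact: ltW.
      exact: (cont_on_subset s0 (lexx _) (cS (lexx _) ct)).
    move=> r /andP[sr rt]; rewrite (le_trans (hK _ _ _))//; first by lra.
    by rewrite ler_wpM2l ?(ltW K0)// hB//; lra.
  rewrite (le_lt_trans (ler_normD _ _))// (le_lt_trans (lerD k1 k2))//.
  have E : e = q * (2 * (K * b + K * B + 1)) by rewrite /q divfK// gt_eqF.
  have a1 : K * q * (s - 0) <= K * q * b.
    by rewrite subr0; apply: ler_wpM2l sb; exact: mulr_ge0 (ltW K0) (ltW q0).
  have a2 : K * B * (t - s) <= K * B * q.
    by rewrite ler_wpM2l ?mulr_ge0 ?(ltW K0) ?(ltW B0)// ltW.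
  have KB : 0 <= q * (K * b) := mulr_ge0 (ltW q0) (mulr_ge0 (ltW K0) b0).
  have KB' : 0 <= q * (K * B) := mulr_ge0 (ltW q0) (mulr_ge0 (ltW K0) (ltW B0)).
  by rewrite E; move: a1 a2 KB KB' q0; lra.
move=> s /andP[s0 sb] e e0; have [d d0 hd] := unif e e0; exists d => // t /andP[t0 tb].
rewrite ltr_norml => /andP[h1 h2].
have [ts|st|->] := ltgtP t s; last by rewrite subrr normr0.
  by rewrite distrC hd//; lra.
by rewrite hd.
Qed.

End Convolution.

(** * Improper integrals through their tails *)

Section Tail.
Context {R : realType}.
Implicit Types (f : R -> R).

(** Stands for [l] being the integral of [f] over the half-line. Each exponential bound on [f]
    beyond [t] yields one on the remainder, the only form in which the improper integral is used. *)
Definition is_tail f (l : R) := forall t M', 0 <= t -> 0 <= M' ->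
  (forall s, t <= s -> `|f s| <= M' * expR (- s)) ->
  `|l - Vint (V := R^o) f 0 t| <= M' * expR (- t).

Let dexp (M s : R) : is_derive s (1 : R) (fun s => - M * expR (-1 * s)) (M * expR (- s)).
Proof.
have := deriv1Z (- M) (deriv1_expR (-1) s).
by apply: deriv1_ext => [z //|]; rewrite !mulN1r; ring.
Qed.

Let expn_half (n : nat) : expR (- n%:R) <= 2^-1 ^+ n :> R.
Proof.
have e2 : expR (-1) <= 2^-1 :> R.
  by rewrite expRN lef_pV2 ?posrE ?expR_gt0//; have := expR_ge1Dx (1 : R); lra.
by rewrite -[n%:R]mulr1 -mulrN expRM_natl; apply: lerXn2r; rewrite ?nnegrE ?expR_ge0.
Qed.

Let piece f (M a b : R) : (forall b, cont_on (V := R^o) 0 b f) -> 0 <= a -> a <= b ->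
  (forall s, a <= s -> `|f s| <= M * expR (- s)) ->
  `|Vint (V := R^o) f 0 b - Vint (V := R^o) f 0 a| <= M * expR (- a) - M * expR (- b).
Proof.
move=> cf a0 ab hf; rewrite (Vint_cat (b := a))// addrAC subrr add0r.
have := @Vint_le_deriv R R^o f a b _ _ ab (cont_on_subset a0 (lexx _) (cf b)) (dexp M).
by rewrite !mulN1r => /(_ _)/le_trans; apply => [x /andP[ax _]|]; [exact: hf|lra].
Qed.

Lemma tail_ex f (M : R) : 0 <= M -> (forall b, cont_on (V := R^o) 0 b f) ->
  (forall s, 0 <= s -> `|f s| <= M * expR (- s)) -> exists l, is_tail f l.
Proof.
move=> M0 cf hf.
have [n|l hl] := @fast_cauchy_cvg R R^o (fun n => Vint (V := R^o) f 0 n%:R) M.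
  have h := @piece f M n%:R n.+1%:R cf (ler0n _ _) _ (fun s hs => hf s (le_trans (ler0n _ n) hs)).
  rewrite (le_trans (h _)) ?ler_nat// (@le_trans _ _ (M * expR (- n%:R)))//.
    by rewrite gerBl mulr_ge0 ?expR_ge0.
  by rewrite ler_wpM2l.
exists l => t M' t0 M'0 hM'; apply: (@ler_small_half _ _ _ (2 * M)) => n.
pose N := ((Num.truncn t).+1 + n)%N.
have tN : t <= N%:R by rewrite /N natrD (le_trans (ltW (truncnS_gt t)))// lerDl.
have h1 := piece cf t0 tN hM'.
have h2 := hl N.
have h3 : (2^-1 : R) ^+ N <= 2^-1 ^+ n.
  by rewrite /N exprD ler_piMl ?exprn_ge0 ?invr_ge0// exprn_ile1 ?invr_ge0// invf_le1// ler1n.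
have key (z x y : R) : z - y = (x - y) - (x - z) by ring.
rewrite (key l (Vint (V := R^o) f 0 N%:R)).
rewrite (le_trans (ler_normB _ _))//.
have := ler_wpM2l M0 h3; have := mulr_ge0 M'0 (expR_ge0 (- N%:R)).
have h2' : `|Vint (V := R^o) f 0 N%:R - l| <= M * (2 * 2^-1 ^+ N) by exact: h2.
by move: h1 h2'; lra.
Qed.

(** The three remainders at time [n] are of size [exp(- n)], so additivity passes from finite
    integrals to the limits. *)
Lemma is_tailB f1 f2 l1 l2 l (M : R) : 0 <= M -> (forall b, cont_on (V := R^o) 0 b f1) ->
  (forall b, cont_on (V := R^o) 0 b f2) ->
  (forall s, 0 <= s -> `|f1 s| <= M * expR (- s)) ->
  (forall s, 0 <= s -> `|f2 s| <= M * expR (- s)) ->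
  is_tail f1 l1 -> is_tail f2 l2 -> is_tail (fun s => f1 s - f2 s) l -> l = l1 - l2.
Proof.
move=> M0 c1 c2 h1 h2 t1 t2 t12; apply/eqP; rewrite -subr_eq0 -normr_le0.
apply: (@ler_small_half _ _ _ (4 * M)) => n; rewrite add0r.
have n0 : 0 <= n%:R :> R by [].
have a1 := t1 n%:R M n0 M0 (fun s ns => h1 s (le_trans n0 ns)).
have a2 := t2 n%:R M n0 M0 (fun s ns => h2 s (le_trans n0 ns)).
have M20 : 0 <= 2 * M by rewrite mulr_ge0.
have h12 s : n%:R <= s -> `|f1 s - f2 s| <= 2 * M * expR (- s).
  move=> ns; rewrite (le_trans (ler_normB _ _))//.
  have := h1 s (le_trans n0 ns); have := h2 s (le_trans n0 ns); lra.
have a3 := t12 n%:R (2 * M) n0 M20 h12.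
have E := @VintB R R^o f1 f2 0 n%:R n0 (c1 _) (c2 _).
rewrite E in a3; set x := Vint f1 0 n%:R in a1 a3; set y := Vint f2 0 n%:R in a2 a3.
have key (z z1 z2 p q : R) : z - (z1 - z2) = (z - (p - q)) - (z1 - p) + (z2 - q) by ring.
rewrite (key l l1 l2 x y).
rewrite (le_trans (ler_normD _ _))// (le_trans (lerD (ler_normB _ _) (lexx _)))//.
have := ler_wpM2l M0 (expn_half n); move: a1 a2 a3; lra.
Qed.

End Tail.

(** * The decaying fixed point and its obstruction *)

Section LyapunovPerron.
Context {R : realType} {V : completeNormedModType R}.
Variables (S : R -> V -> V) (ev : V) (ell : V -> R) (mu C K : R) (N : V -> V).
Hypothesis hS : semigroupV S.
Hypotheses (mu0 : mu < 0) (C0 : 0 < C) (K0 : 0 < K).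
Hypothesis ell_lin : forall k x y, ell (k *: x + y) = k * ell x + ell y.
Hypothesis ell_bound : forall x, `|ell x| <= C * `|x|.
Hypothesis split : forall x t, 0 <= t ->
  `|S t x - (expR t * ell x) *: ev| <= C * expR (mu * t) * `|x|.
Hypothesis N0 : N 0 = 0.
Hypothesis N_lip : forall x y,
  `|N x - N y| <= K * `|x - y| * (`|x| + `|y| + `|x| ^+ 2 + `|y| ^+ 2).
Implicit Types (g Phi Psi : R -> V) (u v x y : V) (r Q d t s b : R).

Let ellB x y : ell (x - y) = ell x - ell y.
Proof. by rewrite -scaleN1r addrC ell_lin; ring. Qed.

Let ellZ k x : ell (k *: x) = k * ell x.
Proof.
have z : ell 0 = 0 by have := ellB 0 0; rewrite !subrr.
by rewrite -[k *: x]addr0 ell_lin z addr0.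
Qed.

Let fl g s : R := expR (- s) * ell (g s).
Let tl g : R := xget 0 [set l | is_tail (fl g) l].

(** The doubled rate is that of a quadratic expression in functions decaying like [exp(mu s)]. *)
Definition gok Q g := (forall b, cont_on 0 b g) /\
  forall s, 0 <= s -> `|g s| <= Q * expR (2 * mu * s).

Let emu1 t : 0 <= t -> expR (2 * mu * t) <= expR (mu * t) /\ expR (mu * t) <= 1.
Proof.
move=> t0; split; last by rewrite -expR0 ler_expR; have := mu0; nra.
by rewrite ler_expR; have := mu0; nra.
Qed.

Let fl_cont Q g : gok Q g -> forall b, cont_on (V := R^o) 0 b (fl g).
Proof.
move=> [cg _] b.
have ce : continuous (fun s : R => expR (- s)).
  by move=> s; have := deriv1_expR (-1) s; under eq_fun do rewrite mulN1r; exact: deriv1_cont.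
have cs := cont_on_scal (@continuous_cont_on R R^o _ _ _ ce) (cg b).
have h := @cont_on_lin R V R^o ell C ellB ell_bound _ 0 b cs.
by apply: cont_on_ext h => s _; rewrite /= ellZ.
Qed.

Let fl_bound Q g t s : 0 <= Q -> gok Q g -> 0 <= t -> t <= s ->
  `|fl g s| <= C * Q * expR (mu * t) * expR (- s).
Proof.
move=> Q0 [_ hg] t0 ts; have s0 := le_trans t0 ts.
rewrite /fl normrM (ger0_norm (expR_ge0 _)) mulrC ler_wpM2r ?expR_ge0//.
have [e1 e2] := emu1 s0; have h1 := ell_bound (g s); have h2 := hg s s0.
have e3 : expR (mu * s) <= expR (mu * t) by rewrite ler_expR; have := mu0; nra.
rewrite (le_trans h1)// -mulrA ler_wpM2l ?(ltW C0)// (le_trans h2)// ler_wpM2l//.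
exact: le_trans e3.
Qed.

Let tlP Q g : 0 <= Q -> gok Q g -> is_tail (fl g) (tl g).
Proof.
move=> Q0 hg; have M0 : 0 <= C * Q := mulr_ge0 (ltW C0) Q0.
have [|l hl] := tail_ex M0 (fl_cont hg).
  by move=> s s0; have := fl_bound Q0 hg (lexx 0) s0; rewrite mulr0 expR0 mulr1.
by rewrite /tl; case: xgetP => [x _ //|/(_ l)].
Qed.

(** Here [tl g] is the integral of [exp(- s) * ell (g s)] over the half-line. Subtracting its
    multiple of [ev] amounts to integrating the stable part from 0 to [t] and the unstable part from
    infinity to [t], which removes the growth of the Duhamel integral. *)
Definition Lop g t : V := duhamel S g t - (expR t * tl g) *: ev.

Let Lop_tail Q g t : 0 <= Q -> gok Q g -> 0 <= t ->
  `|tl g - Vint (V := R^o) (fl g) 0 t| <= C * Q * expR (mu * t) * expR (- t).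
Proof.
move=> Q0 hg t0; apply: (tlP Q0 hg) => //.
  exact: mulr_ge0 (mulr_ge0 (ltW C0) Q0) (expR_ge0 _).
by move=> s ts; exact: fl_bound.
Qed.

Lemma tl_bound Q g : 0 <= Q -> gok Q g -> `|tl g| <= C * Q.
Proof.
move=> Q0 hg; have := Lop_tail Q0 hg (lexx 0).
by rewrite Vint_xx subr0 mulr0 oppr0 expR0 !mulr1.
Qed.

(** The first term comes from integrating [exp(mu (t - s)) exp(2 mu s)] over [[0, t]], which gives
    at most [exp(mu t) / - mu]; the second is the tail in the direction [ev]. *)
Let C2 : R := C / - mu + C * `|ev|.
Let C20 : 0 < C2.
Proof. by rewrite ltr_wpDr ?mulr_ge0 ?divr_gt0 ?oppr_gt0// ltW. Qed.

Lemma Lop_bound Q g t : 0 <= Q -> gok Q g -> 0 <= t ->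
  `|Lop g t| <= Q * C2 * expR (mu * t).
Proof.
move=> Q0 hg t0; have [cg bg] := hg.
have key (x y w : R) : x <= C * Q / - mu * w -> y * `|ev| <= C * Q * w * `|ev| ->
    x + y * `|ev| <= Q * C2 * w.
  by rewrite /C2; lra.
pose F s : V := S (t - s) (g s) - (expR (t - s) * ell (g s)) *: ev.
have cS : cont_on 0 t (fun s => S (t - s) (g s)) by exact: cont_on_sgV.
have ce : cont_on 0 t (fun s => (expR (t - s) * ell (g s)) *: ev).
  have h := @cont_on_lin R R^o V (fun k : R^o => (expR t * k) *: ev) (expR t * `|ev|) _ _ _ 0 t (fl_cont hg (b := t)).
  apply: (cont_on_ext _ (h _ _)).
  - by move=> s _; rewrite /= /fl mulrA -expRD.
  - by move=> x y; rewrite -scalerBl; congr (_ *: _); exact: mulrBr.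
  - by move=> x; rewrite normrZ normrM (ger0_norm (expR_ge0 _)) mulrAC.
have E : duhamel S g t - (expR t * Vint (V := R^o) (fl g) 0 t) *: ev = Vint F 0 t.
  rewrite /F VintB//; congr (_ - _).
  have h := @Vint_lin R R^o V (fun k : R^o => (expR t * k) *: ev) (expR t * `|ev|) _ _ _ (fl g) 0 t t0 (fl_cont hg (b := t)).
  apply: (etrans (h _ _ _)); last by apply: eq_Vint => // s _; rewrite /= /fl mulrA -expRD.
  - by move=> x y; rewrite -scalerBl; congr (_ *: _); exact: mulrBr.
  - by move=> k x; rewrite scalerA; congr (_ *: _); rewrite /GRing.scale /=; ring.
  - by move=> x; rewrite normrZ normrM (ger0_norm (expR_ge0 _)) mulrAC.
have Em := expR_ge0 (mu * t).
have k1 : `|Vint F 0 t| <= C * Q / - mu * expR (mu * t).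
  pose A := C * Q * expR (mu * t).
  have A0 : 0 <= A by rewrite /A !mulr_ge0 ?(ltW C0).
  have dA s : is_derive s (1 : R) (fun s => A / mu * expR (mu * s)) (A * expR (mu * s)).
    have := deriv1Z (A / mu) (deriv1_expR mu s); apply: deriv1_ext => //.
    by field; rewrite lt_eqF.
  have := @Vint_le_deriv R V F 0 t _ _ t0 (cont_onB cS ce) dA.
  move=> H; have {}H : `|Vint F 0 t| <= A / mu * expR (mu * t) - A / mu * expR (mu * 0).
    apply: H => s /andP[s0 st]; have ts : 0 <= t - s by rewrite subr_ge0.
    apply: (le_trans (split (g s) ts)).
    apply: (le_trans (ler_wpM2l (mulr_ge0 (ltW C0) (expR_ge0 _)) (bg s s0))).
    rewrite le_eqVlt; apply/orP; left; apply/eqP.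
    have -> : 2 * mu * s = mu * s + mu * s by ring.
    have -> : mu * (t - s) = mu * t - mu * s by ring.
    by rewrite /A !expRD expRN; field; rewrite gt_eqF ?expR_gt0.
  apply: (le_trans H); rewrite mulr0 expR0 mulr1.
  have -> : A / mu = - (A / - mu) by field; rewrite lt_eqF.
  have A1 : 0 <= A / - mu by rewrite divr_ge0// oppr_ge0 ltW.
  have -> : C * Q / - mu * expR (mu * t) = A / - mu by rewrite /A; field; rewrite lt_eqF.
  by have := mulr_ge0 A1 Em; lra.
have k2 := Lop_tail Q0 hg t0.
have -> : Lop g t = Vint F 0 t - (expR t * (tl g - Vint (V := R^o) (fl g) 0 t)) *: ev.
  have key2 (z w : R) (x : V) : x - (expR t * z) *: ev =
      (x - (expR t * w) *: ev) - (expR t * (z - w)) *: ev.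
    by rewrite mulrBr; linmod R.
  by rewrite -E; exact: key2.
rewrite (le_trans (ler_normB _ _))// normrZ normrM (ger0_norm (expR_ge0 _)).
have k3 : expR t * `|tl g - Vint (V := R^o) (fl g) 0 t| <= C * Q * expR (mu * t).
  have := ler_wpM2l (expR_ge0 t) k2 => /le_trans; apply.
  rewrite le_eqVlt; apply/orP; left; apply/eqP.
  by rewrite expRN; field; rewrite gt_eqF ?expR_gt0.
exact: key k1 (ler_wpM2r (normr_ge0 ev) k3).
Qed.

Lemma tlB Q g1 g2 : 0 <= Q -> gok Q g1 -> gok Q g2 ->
  gok (2 * Q) (fun s => g1 s - g2 s) /\ tl (fun s => g1 s - g2 s) = tl g1 - tl g2.
Proof.
move=> Q0 h1 h2.
have h : gok (2 * Q) (fun s => g1 s - g2 s).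
  split; first by move=> b; apply: cont_onB; [exact: h1.1|exact: h2.1].
  move=> s s0; rewrite (le_trans (ler_normB _ _))//.
  have := h1.2 s s0; have := h2.2 s s0; lra.
split => //; have M0 : 0 <= C * Q := mulr_ge0 (ltW C0) Q0.
have Q20 : 0 <= 2 * Q by rewrite mulr_ge0.
apply: (is_tailB M0 (fl_cont h1) (fl_cont h2) _ _ (tlP Q0 h1) (tlP Q0 h2)).
- by move=> s s0; have := fl_bound Q0 h1 (lexx 0) s0; rewrite mulr0 expR0 mulr1.
- by move=> s s0; have := fl_bound Q0 h2 (lexx 0) s0; rewrite mulr0 expR0 mulr1.
have := tlP Q20 h; congr is_tail.
by apply/funext => s; rewrite /fl ellB mulrBr.
Qed.

Lemma LopB Q g1 g2 t : 0 <= Q -> gok Q g1 -> gok Q g2 -> 0 <= t ->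
  Lop g1 t - Lop g2 t = Lop (fun s => g1 s - g2 s) t.
Proof.
move=> Q0 h1 h2 t0; have [_ E] := tlB Q0 h1 h2.
by rewrite /Lop E (duhamelB hS t0 (h1.1 t) (h2.1 t)) mulrBr; linmod R.
Qed.

Let cont_ev (k : R) b : cont_on 0 b (fun t => (expR t * k) *: ev).
Proof.
have ce : continuous (fun s : R => expR s).
  by move=> s; have := deriv1_expR 1 s; under eq_fun do rewrite mul1r; exact: deriv1_cont.
have c1 : cont_on 0 b (fun _ : R => k *: ev) by exact: cont_on_cst.
have h := cont_on_scal (@continuous_cont_on R R^o _ _ _ ce) c1.
by apply: cont_on_ext h => t _; rewrite /= scalerA.
Qed.

Lemma Lop_cont Q g b : 0 <= b -> gok Q g -> cont_on 0 b (Lop g).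
Proof.
by move=> b0 [cg _]; apply: cont_onB; [exact: duhamel_cont|exact: cont_ev].
Qed.

Definition adm r Phi := (forall b, cont_on 0 b Phi) /\
  forall t, 0 <= t -> `|Phi t| <= r * expR (mu * t).

Let sqr_emu s : expR (2 * mu * s) = expR (mu * s) ^+ 2.
Proof. by rewrite expr2 -expRD; congr expR; ring. Qed.

(** As [r <= 1], the squares in the Lipschitz bound are also at most [r exp(mu s)], and the four
    terms add up to [4 r exp(mu s)]. Multiplied by [d exp(mu s)] this has the doubled rate. *)
Lemma N_diff r d Phi Psi : 0 <= r <= 1 -> 0 <= d -> adm r Phi -> adm r Psi ->
  (forall t, 0 <= t -> `|Phi t - Psi t| <= d * expR (mu * t)) ->
  gok (4 * K * r * d) (fun s => N (Phi s) - N (Psi s)).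
Proof.
move=> /andP[r0 r1] d0 h1 h2 hd.
have K0' := ltW K0.
have cN Phi' : adm r Phi' -> forall b, cont_on 0 b (fun s => N (Phi' s)).
  move=> [ch bh] b t tb e e0; have e1 := divr_gt0 e0 (mulr_gt0 (ltr0n R 4) K0).
  have [d' d'0 hd'] := ch b t tb _ e1; exists d' => // s sb sd.
  have le1 z : 0 <= z -> `|Phi' z| <= 1.
    move=> z0; have [_ e2] := emu1 z0; rewrite (le_trans (bh z z0))//.
    by rewrite -[leRHS]mulr1 ler_pM ?expR_ge0.
  have b1 := le1 s (proj1 (andP sb)); have b2 := le1 t (proj1 (andP tb)).
  have := hd' s sb sd; rewrite ltr_pdivlMr ?mulr_gt0// => h3.
  apply: le_lt_trans h3; apply: (le_trans (N_lip _ _)).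
  have b3 : `|Phi' s| + `|Phi' t| + `|Phi' s| ^+ 2 + `|Phi' t| ^+ 2 <= 4.
    have := normr_ge0 (Phi' s); have := normr_ge0 (Phi' t); nra.
  have := ler_wpM2l (mulr_ge0 K0' (normr_ge0 (Phi' s - Phi' t))) b3; lra.
split; first by move=> b; apply: cont_onB; exact: cN.
move=> s s0; have [_ e2] := emu1 s0; have E0 := expR_ge0 (mu * s).
have p1 := h1.2 s s0; have p2 := h2.2 s s0; have p3 := hd s s0.
apply: (le_trans (N_lip _ _)); rewrite sqr_emu.
set m := expR (mu * s) in p1 p2 p3 e2 E0 *.
have rm : r * m <= 1 by nra.
have rm0 : 0 <= r * m by rewrite mulr_ge0.
have q1 : `|Phi s| ^+ 2 <= r * m.
  have := normr_ge0 (Phi s); nra.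
have q2 : `|Psi s| ^+ 2 <= r * m.
  have := normr_ge0 (Psi s); nra.
have q3 : `|Phi s| + `|Psi s| + `|Phi s| ^+ 2 + `|Psi s| ^+ 2 <= 4 * (r * m) by lra.
have q4 := ler_wpM2l K0' p3.
have q0 : 0 <= `|Phi s| + `|Psi s| + `|Phi s| ^+ 2 + `|Psi s| ^+ 2.
  by rewrite !addr_ge0 ?sqr_ge0.
have := ler_pM (mulr_ge0 K0' (normr_ge0 _)) q0 q4 q3 => /le_trans; apply.
by rewrite le_eqVlt; apply/orP; left; apply/eqP; ring.
Qed.

Let adm0 r : 0 <= r -> adm r (fun=> 0).
Proof.
move=> r0; split; first by move=> b; exact: cont_on_cst.
by move=> t _; rewrite normr0 mulr_ge0 ?expR_ge0.
Qed.

Lemma N_gok r Phi : 0 <= r <= 1 -> adm r Phi -> gok (4 * K * r * r) (fun s => N (Phi s)).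
Proof.
move=> r01 h; have /andP[r0 _] := r01.
have := @N_diff r r Phi (fun=> 0) r01 r0 h (adm0 r0) _.
move=> H; have {}H : gok (4 * K * r * r) (fun s => N (Phi s) - N 0).
  by apply: H => t t0; rewrite subr0; exact: h.2.
by have -> : (fun s => N (Phi s)) = (fun s => N (Phi s) - N 0) by apply/funext => s; rewrite N0 subr0.
Qed.

Definition KLP u Phi t : V := S t u - (expR t * ell u) *: ev + Lop (fun s => N (Phi s)) t.

(** For [r <= r0] one has [4 * K * r * C2 <= 1 / 2]: with [2 * C * |u| <= r], the map [KLP u]
    preserves the ball of radius [r] and halves distances in it. *)
Definition r0 : R := Num.min 1 (8 * K * C2)^-1.
Let r0_gt0 : 0 < r0.
Proof. by rewrite lt_min ltr01 invr_gt0 !mulr_gt0. Qed.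

Let r0_small r : 0 <= r <= r0 -> r <= 1 /\ 8 * K * C2 * r <= 1.
Proof.
rewrite le_min => /and3P[r0' r1 r2]; split => //.
have P : 0 < 8 * K * C2 by rewrite !mulr_gt0.
by rewrite mulrC -ler_pdivlMr// div1r.
Qed.

Lemma KLP_adm r u Phi : 0 <= r <= r0 -> 2 * C * `|u| <= r -> adm r Phi -> adm r (KLP u Phi).
Proof.
move=> rr0 ur h; have /andP[r0' _] := rr0; have [r1 r2] := r0_small rr0.
have r01 : 0 <= r <= 1 by rewrite r0'.
have g := N_gok r01 h; have Q0 : 0 <= 4 * K * r * r by rewrite !mulr_ge0 ?(ltW K0).
split.
  move=> b; have [b0|b0] := leP 0 b; last first.
    by move=> t /andP[t0 tb]; move: (le_lt_trans (le_trans t0 tb) b0); rewrite ltxx.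
  apply: cont_onD; last exact: Lop_cont g.
  by apply: cont_onB; [exact: sgV_cont|exact: cont_ev].
move=> t t0; rewrite (le_trans (ler_normD _ _))//.
have h1 := split u t0; have h2 := Lop_bound Q0 g t0; have E := expR_ge0 (mu * t).
have h3 : C * `|u| <= r / 2 by lra.
have h4 : 4 * K * r * r * C2 <= r / 2.
  have := ler_wpM2r r0' r2; lra.
have := ler_wpM2r E h3; have := ler_wpM2r E h4; move: h1 h2; lra.
Qed.

Lemma KLP_diff r d u v Phi Psi t : 0 <= r <= r0 -> 0 <= d -> adm r Phi -> adm r Psi ->
  (forall t, 0 <= t -> `|Phi t - Psi t| <= d * expR (mu * t)) -> 0 <= t ->
  `|KLP u Phi t - KLP v Psi t| <= (C * `|u - v| + d / 2) * expR (mu * t).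
Proof.
move=> rr0 d0 h1 h2 hd t0; have /andP[r0' _] := rr0; have [r1 r2] := r0_small rr0.
have r01 : 0 <= r <= 1 by rewrite r0'.
have g1 := N_gok r01 h1; have g2 := N_gok r01 h2; have g := N_diff r01 d0 h1 h2 hd.
have Q0 : 0 <= 4 * K * r * r by rewrite !mulr_ge0 ?(ltW K0).
have Qd0 : 0 <= 4 * K * r * d by rewrite !mulr_ge0 ?(ltW K0).
have k1 := split (u - v) t0; have k2 := Lop_bound Qd0 g t0; rewrite -(LopB Q0 g1 g2 t0) in k2.
have -> : KLP u Phi t - KLP v Psi t = (S t (u - v) - (expR t * ell (u - v)) *: ev) +
   (Lop (fun s => N (Phi s)) t - Lop (fun s => N (Psi s)) t).
  by rewrite /KLP (sgV_sub hS)// ellB mulrBr; linmod R.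
rewrite (le_trans (ler_normD _ _))//.
have E := expR_ge0 (mu * t).
have h4 : 4 * K * r * d * C2 <= d / 2 by have := ler_wpM2r d0 r2; lra.
have := ler_wpM2r E h4; move: k1 k2; lra.
Qed.

Definition delta0 : R := r0 / (2 * C).

Let picard u n : R -> V := iter n (KLP u) (fun=> 0).

(** Banach's iteration written out, in the ball of radius [2 * C * |u|] instead of [r0]: a fixed
    point of size proportional to [u] is what makes [h u - ell u] quadratic. *)
Lemma LP_fixed u : `|u| <= delta0 -> exists Phi, adm (2 * C * `|u|) Phi /\
  forall t, 0 <= t -> Phi t = KLP u Phi t.
Proof.
move=> ud; pose r := 2 * C * `|u|.
have rr : 0 <= r <= r0.
  rewrite /r !mulr_ge0 ?(ltW C0)//= mulrC -ler_pdivlMr ?mulr_gt0//.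
have /andP[r0' _] := rr.
have hadm n : adm r (picard u n).
  elim: n => [|n IH]; first exact: adm0.
  exact: (KLP_adm rr (lexx _) IH).
have step n t : 0 <= t -> `|picard u n.+1 t - picard u n t| <= (r * 2^-1 ^+ n) * expR (mu * t).
  elim: n t => [|n IH] t t0.
    by rewrite /= subr0 expr0 mulr1; exact: (hadm 1%N).2.
  have d0 : 0 <= r * 2^-1 ^+ n by rewrite mulr_ge0// exprn_ge0// invr_ge0.
  have := KLP_diff u u rr d0 (hadm n.+1) (hadm n) IH t0.
  by rewrite subrr normr0 mulr0 add0r exprS => /le_trans; apply; rewrite ler_wpM2r ?expR_ge0//; lra.
have lim t : exists l, 0 <= t -> forall n, `|picard u n t - l| <= r * expR (mu * t) * (2 * 2^-1 ^+ n).
  have [t0|_] := boolP (0 <= t); last by exists 0.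
  have [n|l hl] := @fast_cauchy_cvg R V (fun n => picard u n t) (r * expR (mu * t)).
    by rewrite (le_trans (step n t t0))// mulrAC.
  by exists l.
have [Phi hPhi] := choice lim; exists Phi.
have half0 n : 0 <= (2^-1 : R) ^+ n by rewrite exprn_ge0// invr_ge0.
have hd n t : 0 <= t -> `|Phi t - picard u n t| <= (r * (2 * 2^-1 ^+ n)) * expR (mu * t).
  by move=> t0; rewrite distrC (le_trans (hPhi t t0 n))// mulrAC.
have aP : adm r Phi.
  split; last first.
    move=> t t0; apply: (@ler_small_half _ _ _ (2 * r * expR (mu * t))) => n.
    have -> : Phi t = picard u n t + (Phi t - picard u n t) by linmod R.
    have := (hadm n).2 t t0; have := hd n t t0; have := ler_normD (picard u n t) (Phi t - picard u n t).
    lra.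
  move=> b t tb e e0; have e3 : 0 < e / 3 by rewrite divr_gt0.
  have [n hn] : exists n, r * (2 * 2^-1 ^+ n) < e / 3.
    apply: contrapT => H; suff : e / 3 <= 0 by rewrite leNgt e3.
    apply: (@ler_small_half _ _ _ (2 * r)) => n; rewrite add0r.
    have [h|h] := leP (e / 3) (r * (2 * 2^-1 ^+ n)); first by lra.
    by case: H; exists n.
  have [d d0 hc] := (hadm n).1 b t tb _ e3; exists d => // s sb sd.
  have close z : 0 <= z <= b -> `|Phi z - picard u n z| < e / 3.
    move=> /andP[z0 _]; apply: le_lt_trans hn; apply: (le_trans (hd n z z0)).
    by have [_ e2] := emu1 z0; rewrite -[leRHS]mulr1; exact: (ler_wpM2l (mulr_ge0 r0' (mulr_ge0 (ler0n _ 2) (half0 n))) e2).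
  have -> : Phi s - Phi t = (Phi s - picard u n s) + (picard u n s - picard u n t) - (Phi t - picard u n t) by linmod R.
  have := ler_normB ((Phi s - picard u n s) + (picard u n s - picard u n t)) (Phi t - picard u n t).
  have := ler_normD (Phi s - picard u n s) (picard u n s - picard u n t).
  by have := close s sb; have := close t tb; have := hc s sb sd; lra.
split => // t t0; apply/eqP; rewrite -subr_eq0 -normr_le0.
apply: (@ler_small_half _ _ _ (2 * r * expR (mu * t))) => n; rewrite add0r.
have d0 : 0 <= r * (2 * 2^-1 ^+ n) := mulr_ge0 r0' (mulr_ge0 (ler0n _ 2) (half0 n)).
have hd' s : 0 <= s -> `|picard u n s - Phi s| <= (r * (2 * 2^-1 ^+ n)) * expR (mu * s).
  by move=> s0; rewrite distrC; exact: hd.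
have h1 := KLP_diff u u rr d0 (hadm n) aP hd' t0.
rewrite subrr normr0 mulr0 add0r in h1.
have {}h1 : `|picard u n.+1 t - KLP u Phi t| <= r * (2 * 2^-1 ^+ n) / 2 * expR (mu * t) := h1.
have h2 := hd n.+1 t t0; rewrite exprS in h2.
have -> : Phi t - KLP u Phi t = (Phi t - picard u n.+1 t) + (picard u n.+1 t - KLP u Phi t) by linmod R.
by have := ler_normD (Phi t - picard u n.+1 t) (picard u n.+1 t - KLP u Phi t); move: h1 h2; lra.
Qed.

(** The distance is at first only known to be at most [2 * r0 * exp(mu t)]. Each use of the
    contraction estimate halves this part and keeps the term [2 * C * |u - v|]. *)
Lemma LP_dist u v Phi Psi : `|u| <= delta0 -> `|v| <= delta0 ->
  adm (2 * C * `|u|) Phi -> (forall t, 0 <= t -> Phi t = KLP u Phi t) ->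
  adm (2 * C * `|v|) Psi -> (forall t, 0 <= t -> Psi t = KLP v Psi t) ->
  [/\ adm r0 Phi, adm r0 Psi & forall t, 0 <= t ->
    `|Phi t - Psi t| <= 2 * C * `|u - v| * expR (mu * t)].
Proof.
move=> ud vd a1 e1 a2 e2.
have wid (w : V) (Ph : R -> V) : `|w| <= delta0 -> adm (2 * C * `|w|) Ph -> adm r0 Ph.
  move=> wd [c1 b1]; split => // t t0; rewrite (le_trans (b1 t t0))// ler_wpM2r ?expR_ge0//.
  by rewrite mulrC -ler_pdivlMr// mulr_gt0.
have A1 := wid _ _ ud a1; have A2 := wid _ _ vd a2; split => // t t0.
have rr : 0 <= r0 <= r0 by rewrite lexx ltW.
have C0' := ltW C0; have D0 : 0 <= C * `|u - v| by rewrite mulr_ge0.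
have main n : forall s, 0 <= s ->
    `|Phi s - Psi s| <= (2 * C * `|u - v| + 2 * r0 * 2^-1 ^+ n) * expR (mu * s).
  elim: n => [|n IH] s s0.
    have := ler_normB (Phi s) (Psi s); have := A1.2 s s0; have := A2.2 s s0.
    by have := mulr_ge0 D0 (expR_ge0 (mu * s)); rewrite expr0; lra.
  have d0 : 0 <= 2 * C * `|u - v| + 2 * r0 * 2^-1 ^+ n.
    by rewrite addr_ge0 ?mulr_ge0 ?exprn_ge0 ?invr_ge0 ?(ltW r0_gt0).
  have := KLP_diff u v rr d0 A1 A2 IH s0; rewrite -e1// -e2// => /le_trans; apply.
  by rewrite ler_wpM2r ?expR_ge0// exprS; lra.
apply: (@ler_small_half _ _ _ (2 * r0 * expR (mu * t))) => n.
by have := main n t t0; lra.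
Qed.

Theorem lyapunov_perron : exists (dl L : R) (Phi : V -> R -> V) (h : V -> R),
  [/\ 0 < dl, 0 < L & forall u, `|u| <= dl ->
   [/\ forall b, cont_on 0 b (Phi u),
       forall t, 0 <= t -> `|Phi u t| <= L * `|u| * expR (mu * t),
       forall t, 0 <= t -> Phi u t =
         S t u + duhamel S (fun s => N (Phi u s)) t - (expR t * h u) *: ev,
       `|h u - ell u| <= L * `|u| ^+ 2 &
       forall v, `|v| <= dl -> `|h u - h v| <= L * `|u - v|]].
Proof.
have ex u : exists Phi, `|u| <= delta0 -> adm (2 * C * `|u|) Phi /\
    forall t, 0 <= t -> Phi t = KLP u Phi t.
  have [ud|_] := boolP (`|u| <= delta0); last by exists (fun=> 0).
  by have [Phi hP] := LP_fixed ud; exists Phi.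
have [Phi hPhi] := choice ex.
(* The whole growing component: that of the linear orbit plus that of the Duhamel integral. *)
pose h u := ell u + tl (fun s => N (Phi u s)).
pose L := 2 * C + C * (16 * K * C ^+ 2) + C * (1 + 8 * K * C).
have C0' := ltW C0; have K0' := ltW K0.
have CC : 0 <= C * (16 * K * C ^+ 2) by rewrite !mulr_ge0 ?sqr_ge0.
have CC2 : 0 <= C * (1 + 8 * K * C) by rewrite mulr_ge0// addr_ge0// !mulr_ge0.
have L1 : 2 * C <= L by rewrite /L; lra.
have L2 : C * (16 * K * C ^+ 2) <= L by rewrite /L; lra.
have L3 : C * (1 + 8 * K * C) <= L by rewrite /L; lra.
exists delta0, L, Phi, h; split; first by rewrite divr_gt0 ?mulr_gt0.
  by rewrite (lt_le_trans _ L1)// mulr_gt0.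
move=> u ud; have [a1 e1] := hPhi u ud.
have rr : 0 <= 2 * C * `|u| <= r0.
  by rewrite !mulr_ge0//= mulrC -ler_pdivlMr ?mulr_gt0.
have /andP[ru0 _] := rr; have [ru1 _] := r0_small rr.
have ru01 : 0 <= 2 * C * `|u| <= 1 by rewrite ru0.
have g := N_gok ru01 a1.
have Q0 : 0 <= 4 * K * (2 * C * `|u|) * (2 * C * `|u|) by rewrite !mulr_ge0.
split.
- exact: a1.1.
- move=> t t0; rewrite (le_trans (a1.2 t t0))// ler_wpM2r ?expR_ge0// ler_wpM2r//.
- move=> t t0; rewrite {1}e1// /KLP /Lop /h mulrDr; linmod R.
- rewrite /h addrAC subrr add0r (le_trans (tl_bound Q0 g))//.
  have := ler_wpM2r (sqr_ge0 `|u|) L2; rewrite !expr2; lra.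
move=> v vd; have [a2 e2] := hPhi v vd.
have [A1 A2 hd] := LP_dist ud vd a1 e1 a2 e2.
have d0 : 0 <= 2 * C * `|u - v| by rewrite !mulr_ge0.
have rr0 : 0 <= r0 <= r0 by rewrite lexx (ltW r0_gt0).
have [r01 _] := r0_small rr0.
have rr1 : 0 <= r0 <= 1 by rewrite (ltW r0_gt0).
have gd := N_diff rr1 d0 A1 A2 hd.
have Qr : 0 <= 4 * K * r0 * r0 by rewrite !mulr_ge0 ?(ltW r0_gt0).
have [_ E] := tlB Qr (N_gok rr1 A1) (N_gok rr1 A2).
have Qd : 0 <= 4 * K * r0 * (2 * C * `|u - v|) by rewrite !mulr_ge0 ?(ltW r0_gt0).
have k1 := tl_bound Qd gd; rewrite E in k1.
have -> : h u - h v = ell (u - v) + (tl (fun s => N (Phi u s)) - tl (fun s => N (Phi v s))).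
  by rewrite /h ellB; ring.
rewrite (le_trans (ler_normD _ _))//.
have k2 := ell_bound (u - v).
have k3 : C * (4 * K * r0 * (2 * C * `|u - v|)) <= C * (8 * K * C) * `|u - v|.
  have P : 0 <= C * (8 * K * C) * `|u - v| by rewrite !mulr_ge0.
  by have := ler_wpM2l P r01; lra.
by have := ler_wpM2r (normr_ge0 (u - v)) L3; move: k1 k2 k3; lra.
Qed.

End LyapunovPerron.

(** * Initial data and the choice of the blowup time *)

Section Scale.
Context {R : realType}.
Local Notation mu := (@lebesgue_measure R).
Notation Io r := (`]0%R, r[%classic : set R).
Notation I01 := (`]0%R, 1%R[%classic : set R).
Implicit Types (u : R -> R) (c r : R).

Let mx (c : R) : measurableTypeR R -> measurableTypeR R := *%R c.

Let m_mx c : measurable_fun setT (mx c).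
Proof. exact: mulrl_measurable. Qed.

Let push c : {measure set (measurableTypeR R) -> \bar R} :=
  measure_function_pushforward__canonical__measure_function_Measure mu (m_mx c).

Let scaled c (c0 : 0 <= c) : {measure set (measurableTypeR R) -> \bar R} :=
  mscale (NngNum c0) (push c).

(** The dilated measure agrees with Lebesgue measure on half-open intervals, so uniqueness of the
    latter applies. *)
Lemma lebesgue_scale c (A : set R) : 0 < c -> measurable A ->
  mu A = (c%:E * mu (mx c @^-1` A))%E.
Proof.
move=> c0 mA; suff -> : mu A = scaled (ltW c0) A by [].
apply: (@lebesgue_measure_unique R) => //.
move=> _ [[a b]] _ <-; rewrite /scaled /= /mscale /= /pushforward.
have -> : mx c @^-1` `]a, b] = `](a / c), (b / c)]%classic.
  apply/seteqP; split => x /=; rewrite /mx !in_itv/= ltr_pdivrMr// ler_pdivlMr//.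
    by rewrite mulrC.
  by rewrite mulrC.
rewrite !lebesgue_measure_itv /= !lte_fin ltr_pdivrMr// mulfVK ?gt_eqF//.
case: ifP => _; last by rewrite mule0.
by rewrite -!EFinD -EFinM; congr EFin; field; rewrite gt_eqF.
Qed.

Lemma ge0_integral_scale c (D : set R) (f : R -> \bar R) : 0 < c -> measurable D ->
  measurable_fun D f -> (forall x, D x -> (0 <= f x)%E) ->
  (\int[mu]_(x in D) f x = c%:E * \int[mu]_(x in mx c @^-1` D) f (c * x)%R)%E.
Proof.
move=> c0 mD mf f0.
have := @ge0_integral_pushforward _ _ _ _ _ (mx c) (m_mx c) mu D f mD mf _.
move=> <-; last by move=> x /set_mem; exact: f0.
rewrite -(@ge0_integral_mscale _ _ _ (push c) D mD (NngNum (ltW c0)) f mf f0)//.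
apply: eq_measure_integral => A mA _; exact: lebesgue_scale.
Qed.

Lemma sqi_scale c r r' u : 0 < c -> c * r = r' -> square_integrable (Io r') u ->
  square_integrable (Io r) (fun x => u (c * x)) /\
  snrm (Io r') u = Num.sqrt c * snrm (Io r) (fun x => u (c * x)).
Proof.
move=> c0 <- hu; have [mu_ iu] := hu.
have E : mx c @^-1` (Io (c * r)) = Io r.
  by apply/seteqP; split => x; rewrite /mx /= !in_itv/= pmulr_rgt0// ltr_pM2l.
have mc : measurable_fun [set: R] ( *%R c) by exact: mulrl_measurable.
have mcu : measurable_fun (Io r) (fun x => u (c * x)).
  apply: (measurable_comp (mIo (c * r)) _ mu_ (measurable_funTS mc)) => _ [x xr <-].
  by rewrite -E in xr.
have I : integral_sqr (Io (c * r)) u = (c%:E * integral_sqr `]0%R, r[%classic (fun x => u (c * x)%R))%E.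
  have := @ge0_integral_scale c (Io (c * r)) (fun x => (u x ^+ 2)%:E) c0 (mIo _) (measurable_EFinX2 mu_).
  by rewrite E; apply => x _; rewrite lee_fin sqr_ge0.
have hcu : square_integrable (Io r) (fun x => u (c * x)).
  split => //; move: iu; rewrite I; case: (integral_sqr _ _) => [x| |]//=.
    by rewrite !ltry.
  by rewrite gt0_muley ?lte_fin.
split => //; move: I; rewrite !integral_sqrE; [|exact: mIo|exact: hcu|exact: mIo|exact: hu].
by rewrite -EFinM => -[I]; rewrite /snrm I sqrtrM ?ltW.
Qed.

End Scale.

Section InitialDatum.
Context {R : realType}.
Local Notation mu := (@lebesgue_measure R).
Notation Io r := (`]0%R, r[%classic : set R).
Notation I01 := (`]0%R, 1%R[%classic : set R).
Notation V := (Vsp R).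
Implicit Types (F G : R -> R).

Lemma snrm_le_nrm (D : set R) (u : fpair R) : snrm D u.1 <= nrm D u /\ snrm D u.2 <= nrm D u.
Proof.
split; rewrite -ler_sqr ?nnegrE ?nrm_ge0 ?snrm_ge0// nrm_sqr snrm_sqr /ip2.
  by rewrite lerDl ip_ge0.
by rewrite lerDr ip_ge0.
Qed.

Lemma sqi_subset (D D' : set R) F : measurable D -> measurable D' -> D `<=` D' ->
  square_integrable D' F -> square_integrable D F /\ snrm D F <= snrm D' F.
Proof.
move=> mD mD' DD' [mF iF]; have mF' := measurable_funS mD' DD' mF.
have h : (integral_sqr D F <= integral_sqr D' F)%E.
  apply: ge0_subset_integral => //; first exact: measurable_EFinX2.
  by move=> x _; rewrite lee_fin sqr_ge0.
have sF : square_integrable D F by split => //; exact: le_lt_trans iF.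
split => //; have sF' : square_integrable D' F by split.
move: h; rewrite !integral_sqrE// lee_fin => h.
by rewrite /snrm ler_wsqrtr.
Qed.

Definition dpair F G (T : R) : fpair R := (fun x => F (T * x), fun x => G (T * x)).

Lemma sqi_within F : {within `[0, 3 / 2], continuous F} -> square_integrable (Io (3 / 2)) F.
Proof.
move=> cF; have h0 : (0 : R) <= 3 / 2 by lra.
have [M M0 hM] := cont_on_bounded h0 (within_cont_on cF).
apply: (sqi_bounded (M := M) (@mIo R (3 / 2)) (mu_Io_lty _)).
  apply: (@measurable_funS _ _ _ _ (`[0, 3 / 2]%classic : set R)) => //; first exact: subset_itv_oo_cc.
  exact: subspace_continuous_measurable_fun.
by move=> x /=; rewrite in_itv /= => /andP[/ltW x0 /ltW x1]; rewrite hM// x0.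
Qed.

Lemma sqi_dilate F T : square_integrable (Io (3 / 2)) F -> 2^-1 <= T <= 3 / 2 ->
  square_integrable I01 (fun x => F (T * x)) /\
  snrm I01 (fun x => F (T * x)) <= 2 * snrm (Io (3 / 2)) F.
Proof.
move=> sF /andP[T1 T2]; have T0 : 0 < T by lra.
have sub : Io T `<=` Io (3 / 2).
  by move=> x; rewrite /= !in_itv/= => /andP[-> /lt_le_trans]; apply.
have [sT h1] := sqi_subset (mIo T) (mIo _) sub sF.
have [s1 h2] := sqi_scale T0 (mulr1 T) sT; split => //.
move: h1; rewrite h2 => h1.
have q : 2^-1 <= Num.sqrt T.
  rewrite -[2^-1]ger0_norm ?invr_ge0// -sqrtr_sqr ler_wsqrtr// expr2; lra.
have := ler_wpM2r (snrm_ge0 I01 (fun x => F (T * x))) q; lra.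
Qed.

Lemma dpair_inH F G T : square_integrable (Io (3 / 2)) F -> square_integrable (Io (3 / 2)) G ->
  2^-1 <= T <= 3 / 2 -> inH (dpair F G T) /\
  `|cls (dpair F G T)| <= 4 * nrm (Io (3 / 2)) (F, G).
Proof.
move=> sF sG hT; have [s1 n1] := sqi_dilate sF hT; have [s2 n2] := sqi_dilate sG hT.
have iH : inH (dpair F G T) by split.
split => //; rewrite norm_cls// (le_trans (nrm_le_sum _ _))//=.
have [/= h1 h2] := snrm_le_nrm (Io (3 / 2)) (F, G); lra.
Qed.

(** Continuity in the blowup time, required by the intermediate value theorem, rests on uniform
    continuity of the data on [[0, 3 / 2]]. *)
Lemma dpair_cont F G : {within `[0, 3 / 2], continuous F} -> {within `[0, 3 / 2], continuous G} ->
  cont_on (V := V) 2^-1 (3 / 2) (fun T => cls (dpair F G T)).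
Proof.
move=> cF cG T hT e e0; have h0 : (0 : R) <= 3 / 2 by lra.
have e4 : 0 < e / 4 by rewrite divr_gt0.
have [d d0 hd] := cont_on_unif h0 (within_cont_on cF) e4.
have [d' d'0 hd'] := cont_on_unif h0 (within_cont_on cG) e4.
have iH S : 2^-1 <= S <= 3 / 2 -> inH (dpair F G S).
  by move=> hS; exact: (dpair_inH (sqi_within cF) (sqi_within cG) hS).1.
exists (Num.min d d'); first by rewrite lt_min d0.
move=> S hS; rewrite lt_min => /andP[Sd Sd'].
have iB := inL2B (@mI01 R) (iH S hS) (iH T hT).
rewrite -clsBE; [|exact: iH|exact: iH]; rewrite norm_cls//.
apply: (le_lt_trans (nrm_le_sum _ _)).
have key H dd : (forall x y : R, 0 <= x <= 3 / 2 -> 0 <= y <= 3 / 2 -> `|y - x| < dd -> `|H y - H x| < e / 4) ->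
    `|S - T| < dd -> square_integrable I01 (fun x => H (S * x) - H (T * x)) ->
    snrm I01 (fun x => H (S * x) - H (T * x)) <= e / 4.
  move=> hH Sdd sH; have := @snrm_le_bound R 1 _ (e / 4) ler01 (ltW e4) sH.
  rewrite sqrtr1 mul1r; apply => x /andP[x0 x1]; apply: ltW; apply: hH.
  - by move: hT => /andP[S1 S2]; apply/andP; split; nra.
  - by move: hS => /andP[S1 S2]; apply/andP; split; nra.
  rewrite -mulrBl normrM (gtr0_norm x0); apply: le_lt_trans Sdd.
  by rewrite ler_piMr// ltW.
have k1 := key F d hd Sd iB.1; have k2 := key G d' hd' Sd' iB.2.
by move: (lerD k1 k2) => /le_lt_trans; apply; lra.
Qed.

End InitialDatum.

Section PowerAtOne.
Context {R : realType}.

Lemma powR_at1 (b e : R) : 0 < e -> exists2 d : R, 0 < d & forall T, `|T - 1| < d ->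
  `|T `^ b - 1 - b * (T - 1)| <= e * `|T - 1|.
Proof.
move=> e0; have [d d0 hd] := deriv1_eps (is_derive1_powR b ltr01) e0.
exists d => // T hT; have := hd T hT; rewrite !powR1 mulr1 (mulrC b); exact.
Qed.

Lemma powR_cont (b : R) : cont_on (V := R^o) 2^-1 (3 / 2) (fun T => T `^ b).
Proof.
move=> T /andP[T1 _] e e0; have T0 : 0 < T by rewrite (lt_le_trans _ T1)// invr_gt0.
have h := deriv1_cont (is_derive1_powR b T0).
have /cvgrPdist_lt/(_ e e0)/nbhs_ballP[d /= d0 hd] := h.
by exists d => // S _ ST; rewrite distrC; apply: hd; rewrite /ball /= distrC.
Qed.

End PowerAtOne.

(** * Dependence of the datum on the blowup time *)

Section MainDatum.
Context {R : realType}.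
Local Notation mu := (@lebesgue_measure R).
Notation Io r := (`]0%R, r[%classic : set R).
Notation I01 := (`]0%R, 1%R[%classic : set R).
Notation V := (Vsp R).
Variable p : R.
Hypothesis p1 : 1 < p.
Local Notation kap := (kappa0 p `^ (p - 1)^-1).
Local Notation a := (pa p).

Lemma psi_ss_deriv (T t : R) : t < T ->
  is_derive t (1 : R) (psi_ss p T) (kap * (a * (T - t) `^ (- a - 1))).
Proof.
move=> tT; have T0 : 0 < T - t by rewrite subr_gt0.
have hl : is_derive t (1 : R) (fun s : R => T - s) (-1).
  by have := deriv1_lin (-1) T t; apply: deriv1_ext => // s; ring.
have := deriv1Z kap (@deriv1_comp R (fun x => x `^ (- a)) (fun s => T - s) t _ _ (is_derive1_powR _ T0) hl).
by apply: deriv1_ext => // ; ring.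
Qed.

Lemma psi_ss10 : psi_ss p 1 0 = kap.
Proof. by rewrite /psi_ss subr0 powR1 mulr1. Qed.

Lemma psi_ss10_deriv : derive1 (psi_ss p 1) 0 = a * kap.
Proof.
have h := psi_ss_deriv (ltr01 : (0 : R) < 1).
by rewrite derive1E derive_val subr0 powR1 mulr1 mulrC.
Qed.

Definition vX : V := iota_ 'X.
Definition v1 : V := iota_ 1.

Lemma iota_evec : iota_ (1 + (a + 1) *: 'X) = v1 + (a + 1) *: vX.
Proof. by rewrite iota_D iota_Z. Qed.

(** The datum is the dilated difference of the data and [psi^1], plus the difference of [psi^1] and
    [psi^T], which is explicit in [T]. The first part is small uniformly in [T]: dilating by
    [T >= 1 / 2] costs a factor 2 in each component, whence the constant 4. *)
Theorem datum_expansion (f g : R -> R) : radial_data f g ->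
  exists D : R -> V, [/\ cont_on 2^-1 (3 / 2) D,
    forall T, 2^-1 <= T <= 3 / 2 -> inH (initial_datum p T f g) /\
      cls (initial_datum p T f g) = T `^ a *: D T + (kap * (T `^ a - 1)) *: v1 +
        (kap * a * (T `^ (a + 1) - 1)) *: vX &
    forall dl, (energy_norm (3 / 2) (fun r => f r - psi_ss p 1 0)%R
       (fun r => g r - derive1 (psi_ss p 1) 0)%R < dl%:E)%E ->
      forall T, 2^-1 <= T <= 3 / 2 -> `|D T| <= 4 * dl].
Proof.
move=> [[cf [df cdf hdf]] cg].
have cid : {within `[0, 3 / 2], continuous (fun x : R => x)}.
  by apply: continuous_subspaceT => x; exact: cvg_id.
have ccst (k : R) : {within `[0, 3 / 2], continuous (fun x : R => k)}.
  by apply: continuous_subspaceT => x; exact: cvg_cst.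
pose A (r : R) : R := r * (g r - a * kap).
pose B (r : R) : R := r * df r + f r - kap.
have cA : {within `[0, 3 / 2], continuous A}.
  by move=> x; apply: cvgM; [exact: cid|apply: cvgB; [exact: cg|exact: ccst]].
have cB : {within `[0, 3 / 2], continuous B}.
  move=> x; apply: cvgB; last exact: ccst.
  by apply: cvgD; [apply: cvgM; [exact: cid|exact: cdf]|exact: cf].
have sA := sqi_within cA; have sB := sqi_within cB.
exists (fun T => cls (dpair A B T)); split; first exact: dpair_cont.
  move=> T hT; have [iD _] := dpair_inH sA sB hT; have /andP[T1 T2] := hT.
  have T0 : 0 < T by rewrite (lt_le_trans _ T1)// invr_gt0.
  have i1 := inL2Z (T `^ a) (@mI01 R) iD.
  have i2 := inL2Z (kap * (T `^ a - 1)) (@mI01 R) (iot_inH (1 : {poly R})).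
  have i3 := inL2Z (kap * a * (T `^ (a + 1) - 1)) (@mI01 R) (iot_inH ('X : {poly R})).
  have i12 := inL2D (@mI01 R) i1 i2; have i := inL2D (@mI01 R) i12 i3.
  have pT : T `^ (a + 1) = T `^ a * T by rewrite powRD ?powRr1 ?ltW// (gt_eqF T0) implybT.
  have pE : (p + 1) / (p - 1) = a + 1 by rewrite /pa; field; rewrite gt_eqF// subr_gt0.
  set w := T `^ a *: dpair A B T + (kap * (T `^ a - 1)) *: iot 1 + (kap * a * (T `^ (a + 1) - 1)) *: iot 'X in i.
  have o1 x : (opart (1 : {poly R})).[x] = 0 by rewrite horner_opart !hornerE subrr mul0r.
  have oX x : (opart ('X : {poly R})).[x] = x by rewrite horner_opart !hornerE; field.
  have e1 x : (epart (1 : {poly R})).[x] = 1 by rewrite horner_epart !hornerE; field.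
  have eX x : (epart ('X : {poly R})).[x] = 0 by rewrite horner_epart !hornerE subrr mul0r.
  have E1 x : I01 x -> w.1 x = (initial_datum p T f g).1 x.
    move=> _; transitivity (T `^ a * A (T * x) + (kap * (T `^ a - 1)) * (opart 1).[x] +
        (kap * a * (T `^ (a + 1) - 1)) * (opart 'X).[x]); first by [].
    rewrite o1 oX /initial_datum [RHS]/= pE pT -/(pa p) /A; move: (pa p) => aa; ring.
  have E2 x : I01 x -> w.2 x = (initial_datum p T f g).2 x.
    move=> xI; have /andP[x0 x1] : 0 < x < 1 by move: xI; rewrite /= in_itv.
    transitivity (T `^ a * B (T * x) + (kap * (T `^ a - 1)) * (epart 1).[x] +
        (kap * a * (T `^ (a + 1) - 1)) * (epart 'X).[x]); first by [].
    have Tx : 0 < T * x < 3 / 2.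
      by rewrite mulr_gt0//= (lt_le_trans _ T2)// gtr_pMr.
    rewrite e1 eX /initial_datum [RHS]/= -/(pa p) /B.
    have := hdf _ Tx => /@derive_val; rewrite derive1E => ->; move: (pa p) => aa; ring.
  have iu : inH (initial_datum p T f g).
    by split; [exact: eq_sqi E1 i.1|exact: eq_sqi E2 i.2].
  have E : Heq w (initial_datum p T f g).
    by split; apply: aeW => x xI; [exact: E1|exact: E2].
  split => //; rewrite -(cls_eq i iu E) /w clsDE// clsDE// !clsZE//; exact: iot_inH.
move=> dl hdl T hT; have [_ hn] := dpair_inH sA sB hT.
apply: (le_trans hn); rewrite ler_wpM2l//.
(* The energy norm lists the spatial component first, the space of pairs the velocity. *)
have iP : inL2 (Io (3 / 2)) (B, A) by split.
suff E : energy_norm (3 / 2) (fun r => f r - psi_ss p 1 0)%R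
       (fun r => g r - derive1 (psi_ss p 1) 0)%R = (nrm (Io (3 / 2)) (B, A))%:E.
  move: hdl; rewrite E lte_fin => /ltW; apply: le_trans.
  by rewrite /nrm /ip2 /= addrC.
have I F G : measurable_fun (Io (3 / 2)) F -> (forall x, Io (3 / 2) x -> G x = F x) ->
    integral_sqr `[0, 3 / 2] G = integral_sqr (Io (3 / 2)) F.
  move=> mF GF; rewrite /integral_sqr.
  rewrite (@integral_itv_bndoo R 0 (3 / 2) _ true false).
    by apply: eq_integral => x /set_mem xI; rewrite GF.
  apply: measurable_EFinX2; apply: eq_measurable_fun mF => x /set_mem xI; by rewrite GF.
rewrite -(norm2E (mIo (3 / 2)) iP).
rewrite /energy_norm /norm2 (I B)//=; [|exact: sB.1|].
  by rewrite (I A)//=; [exact: sA.1|move=> x _; rewrite psi_ss10_deriv].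
move=> x; rewrite /= in_itv/= => xI.
have h := hdf x xI; rewrite psi_ss10 /B.
have : is_derive x (1 : R) (fun r => f r - kap) (df x).
  by have := deriv1D h (deriv1_cst (- kap) x); rewrite addr0.
by move=> /@derive_val; rewrite derive1E => ->; rewrite addrA.
Qed.

End MainDatum.

(** * The choice of the blowup time *)

Section ChoiceOfT.
Context {R : realType}.
Notation V := (Vsp R).

Lemma cont_on_ivt (f : R -> R) (x y : R) : x <= y -> cont_on (V := R^o) x y f ->
  f x <= 0 -> 0 <= f y -> exists2 c, x <= c <= y & f c = 0.
Proof.
move=> xy cf fx fy.
have cw : {within `[x, y], continuous f}.
  apply/subspace_continuousP => z /=; rewrite in_itv /= => zxy.
  apply/cvgrPdist_lt => e e0; have [d d0 hd] := cf z zxy e e0.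
  near=> s; rewrite distrC; apply: hd.
    near: s; apply: filterS (withinT _ _) => //.
  by near: s; apply: cvg_within; exists d => // s /=; rewrite distrC.
have [|c cxy fc] := @IVT R f x y 0 xy cw.
- by rewrite ge_min fx/= le_max fy orbT.
by exists c => //; move: cxy; rewrite in_itv.
Unshelve. all: by end_near. Qed.

Lemma window_dist (x e : R) : 1 - e <= x <= 1 + e -> `|x - 1| <= e.
Proof. by move=> /andP[? ?]; rewrite ler_norml; apply/andP; split; lra. Qed.

Lemma window_half (s e eta : R) : e <= eta / 2 -> eta < 2^-1 -> `|s| <= e ->
  2^-1 <= 1 + s <= 3 / 2.
Proof. by move=> h1 h2; rewrite ler_norml => /andP[? ?]; apply/andP; split; lra. Qed.

Lemma window_open (x e eta : R) : 0 < eta -> e <= eta / 2 -> `|x - 1| <= e ->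
  1 - eta < x < 1 + eta.
Proof. by move=> h1 h2; rewrite ler_norml => /andP[? ?]; apply/andP; split; lra. Qed.

Lemma window_sub (e eta : R) : e <= eta / 2 -> eta < 2^-1 -> 2^-1 <= 1 - e /\ 1 + e <= 3 / 2.
Proof. by move=> h1 h2; split; lra. Qed.

Lemma window_lt (s e d : R) : `|s| <= e -> e <= d / 2 -> 0 < d -> `|s| < d.
Proof. by lra. Qed.

Lemma increment_le (a s e eta k P : R) : 0 <= a -> k <= 1 -> e <= eta / 2 -> eta < 2^-1 ->
  `|s| <= e -> `|P - 1 - a * s| <= k * `|s| -> P <= a + 2.
Proof.
move=> a0 k1 h1 h2 se /(le_trans (ler_norm _)) h3.
have s1 : `|s| <= 1 by lra.
have := ler_wpM2l a0 (le_trans (ler_norm s) s1); have := ler_wpM2r (normr_ge0 s) k1.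
by move: h3 s1; lra.
Qed.

Variable p : R.
Hypothesis p1 : 1 < p.
Local Notation kap := (kappa0 p `^ (p - 1)^-1).
Local Notation a := (pa p).
Variables (ell h : V -> R) (C dl L : R).
Hypotheses (C0 : 0 < C) (dl0 : 0 < dl) (L0 : 0 < L).
Hypothesis ell_lin : forall k x y, ell (k *: x + y) = k * ell x + ell y.
Hypothesis ell_bound : forall x, `|ell x| <= C * `|x|.
Hypothesis ell_ev : ell (iota_ (1 + (a + 1) *: 'X)) = 1.
Hypothesis h_ell : forall u, `|u| <= dl -> `|h u - ell u| <= L * `|u| ^+ 2.
Hypothesis h_lip : forall u v, `|u| <= dl -> `|v| <= dl -> `|h u - h v| <= L * `|u - v|.

Let nu : R := kap * a.
Let nu0 : 0 < nu.
Proof.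
by rewrite mulr_gt0 ?pa_gt0// powR_gt0// /kappa0 divr_gt0 ?mulr_gt0 ?exprn_gt0 ?subr_gt0//; have := p1; lra.
Qed.

(** To first order the explicit part of the datum is [nu * (T - 1)] times the eigenvector, so [ell]
    of the datum is [nu * (T - 1)] plus an error. On [|T - 1| <= et] the Taylor remainder, the
    perturbation and the quadratic part of [h] contribute at most [nu * et / 4] each, so [h] changes
    sign between the ends of that interval. *)
Lemma choose_T (eta : R) : 0 < eta < 2^-1 -> exists2 delta : R, 0 < delta &
  forall f g, radial_data f g ->
    (energy_norm (3 / 2) (fun r => f r - psi_ss p 1 0)%R
       (fun r => g r - derive1 (psi_ss p 1) 0)%R < delta%:E)%E ->
  exists2 T : R, 1 - eta < T < 1 + eta & [/\ inH (initial_datum p T f g),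
    `|cls (initial_datum p T f g)| <= dl & h (cls (initial_datum p T f g)) = 0].
Proof.
move=> /andP[eta0 eta1]; have a0 := pa_gt0 p1; have kap0 : 0 <= kap by exact: powR_ge0.
pose m : R := kap * `|v1 : V| + nu * `|vX : V|.
have m0 : 0 <= m by apply: addr_ge0; apply: mulr_ge0 => //; exact: ltW nu0.
pose ev : V := iota_ (1 + (a + 1) *: 'X).
pose Q : R := nu * `|ev| + 1 + m.
have Q0 : 0 < Q by rewrite /Q -addrA addrC; apply: ltr_wpDr; [apply: mulr_ge0 => //; exact: ltW nu0|apply: ltr_wpDr].
(* The accuracy demanded of the expansions of [T^a] and [T^(a+1)] at 1. *)
pose e : R := Num.min 1 (nu / (4 * (C * m + 1))).
have Cm0 : 0 <= C * m := mulr_ge0 (ltW C0) m0.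
have P1 : 0 < 4 * (C * m + 1) by lra.
have P2 : 0 < 4 * (C + 1) by have := C0; lra.
have P3 : 0 < 4 * (L * Q ^+ 2 + 1).
  by have := mulr_ge0 (ltW L0) (sqr_ge0 Q); lra.
have e0 : 0 < e by rewrite lt_min ltr01 divr_gt0.
have e1 : e <= 1 by rewrite ge_min lexx.
have eC : C * (e * m) <= nu / 4.
  have : e <= nu / (4 * (C * m + 1)) by rewrite ge_min lexx orbT.
  rewrite ler_pdivlMr// => H; have := ltW e0; move: Cm0 H; lra.
(* The size allowed to the perturbation, relative to [et]. *)
pose e' : R := Num.min 1 (nu / (4 * (C + 1))).
have e'0 : 0 < e' by rewrite lt_min ltr01 divr_gt0.
have e'1 : e' <= 1 by rewrite ge_min lexx.
have e'C : C * e' <= nu / 4.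
  have : e' <= nu / (4 * (C + 1)) by rewrite ge_min lexx orbT.
  rewrite ler_pdivlMr// => H; have := ltW e'0; move: H; lra.
have [d1 d10 hd1] := powR_at1 a e0; have [d2 d20 hd2] := powR_at1 (a + 1) e0.
(* Half the width of the interval of times: inside the [eta] window and the ranges of both
   expansions, small enough for the quadratic error, and such that the datum has norm at most
   [dl]. *)
pose et : R := Num.min (Num.min (eta / 2) (Num.min (d1 / 2) (d2 / 2)))
   (Num.min (nu / (4 * (L * Q ^+ 2 + 1))) (dl / Q)).
have et0 : 0 < et by rewrite !lt_min !divr_gt0.
have : et <= et by []; rewrite {2}/et !le_min => /andP[/and3P[t1 t2 t3] /andP[t4 t5]].
rewrite ler_pdivlMr// in t4; rewrite ler_pdivlMr// in t5.
clearbody et e e'.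
(* The smallness required of the data: [4 * dd] bounds [D] and [a + 2] bounds [T^a] on the
   interval. *)
pose dd : R := e' * et / (4 * (a + 2)).
have a2 : 0 < 4 * (a + 2) by move: a0; lra.
have dd0 : 0 < dd by rewrite !divr_gt0// mulr_gt0.
have ddE : (a + 2) * (4 * dd) = e' * et by rewrite /dd; field; rewrite gt_eqF//; move: a0; lra.
clearbody dd; exists dd => // f g rd en; have [D [cD hD nD]] := datum_expansion p1 rd.
have hT s : `|s| <= et -> 2^-1 <= 1 + s <= 3 / 2.
  exact: window_half t1 eta1.
pose z (T : R) : V := cls (initial_datum p T f g).
pose rest (T : R) : V := T `^ a *: D T + (kap * (T `^ a - 1 - a * (T - 1))) *: v1 +
   (nu * (T `^ (a + 1) - 1 - (a + 1) * (T - 1))) *: vX.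
have zE T : 2^-1 <= T <= 3 / 2 -> z T = (nu * (T - 1)) *: ev + rest T.
  move=> T1; rewrite /z (hD T T1).2 /ev iota_evec /rest /nu; move: (D T) v1 vX => x y w.
  by linmod R.
have restB s : `|s| <= et -> `|rest (1 + s)| <= (e' + e * m) * et.
  move=> hs; have T1 := hT s hs; have T2 : 1 + s - 1 = s by ring.
  have s1 : `|1 + s - 1| < d1 by rewrite T2; exact: window_lt hs t2 d10.
  have s2 : `|1 + s - 1| < d2 by rewrite T2; exact: window_lt hs t3 d20.
  have k1 := hd1 _ s1; have k2 := hd2 _ s2; rewrite T2 in k1 k2.
  have k3 := nD _ en _ T1.
  have k4 : (1 + s) `^ a <= a + 2 := increment_le (ltW a0) e1 t1 eta1 hs k1.
  rewrite /rest T2 (le_trans (ler_normD _ _))// (le_trans (lerD (ler_normD _ _) (lexx _)))//.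
  have j1 : `|(1 + s) `^ a *: D (1 + s)| <= e' * et.
    rewrite normrZ (ger0_norm (powR_ge0 _ _)) -ddE; apply: ler_pM => //; exact: powR_ge0.
  have es : e * `|s| <= e * et by rewrite ler_wpM2l ?(ltW e0).
  have j2 : `|(kap * ((1 + s) `^ a - 1 - a * s)) *: v1| <= e * et * (kap * `|v1 : V|).
    rewrite normrZ normrM (ger0_norm kap0) mulrAC mulrC; apply: ler_wpM2r; first by apply: mulr_ge0.
    exact: le_trans es.
  have j3 : `|(nu * ((1 + s) `^ (a + 1) - 1 - (a + 1) * s)) *: vX| <= e * et * (nu * `|vX : V|).
    rewrite normrZ normrM (gtr0_norm nu0) mulrAC mulrC; apply: ler_wpM2r; first by apply: mulr_ge0 => //; exact: ltW nu0.
    exact: le_trans es.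
  apply: (le_trans (lerD (lerD j1 j2) j3)).
  by rewrite le_eqVlt; apply/orP; left; apply/eqP; rewrite /m; ring.
have zB s : `|s| <= et -> `|z (1 + s)| <= Q * et.
  move=> hs; rewrite (zE _ (hT s hs)) (le_trans (ler_normD _ _))//.
  have k1 := restB s hs; rewrite normrZ normrM (gtr0_norm nu0).
  have T2 : 1 + s - 1 = s by ring.
  rewrite T2; have k2 : nu * `|s| * `|ev| <= nu * `|ev| * et.
    by rewrite mulrAC; apply: ler_wpM2l => //; apply: mulr_ge0 => //; exact: ltW nu0.
  have k3 : e' * et <= et by rewrite ger_pMl.
  have k4 : e * m * et <= m * et by apply: ler_wpM2r; [exact: ltW|exact: ler_piMl].
  rewrite /Q; move: k1 k2 k3 k4; lra.
have zdl s : `|s| <= et -> `|z (1 + s)| <= dl.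
  by move=> hs; rewrite (le_trans (zB s hs))// mulrC.
have main s : `|s| <= et -> `|h (z (1 + s)) - nu * s| <= 3 / 4 * (nu * et).
  move=> hs; have k1 := h_ell (zdl s hs).
  have E : ell (z (1 + s)) = nu * s + ell (rest (1 + s)).
    by rewrite (zE _ (hT s hs)) ell_lin ell_ev mulr1; congr (_ * _ + _); ring.
  have k2 : C * `|rest (1 + s)| <= nu / 2 * et.
    have := ler_wpM2l (ltW C0) (restB s hs) => /le_trans; apply.
    have := ler_wpM2r (ltW et0) eC; have := ler_wpM2r (ltW et0) e'C; lra.
  have k3 : L * `|z (1 + s)| ^+ 2 <= nu / 4 * et.
    have q : `|z (1 + s)| ^+ 2 <= (Q * et) ^+ 2.
      by apply: lerXn2r (zB s hs); rewrite nnegrE ?normr_ge0// mulr_ge0// ltW.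
    have := ler_wpM2l (ltW L0) q; have := ler_wpM2r (ltW et0) t4.
    have := mulr_ge0 (ltW et0) (ltW et0); rewrite !expr2; lra.
  have -> : h (z (1 + s)) - nu * s = (h (z (1 + s)) - ell (z (1 + s))) + ell (rest (1 + s)).
    by rewrite E; ring.
  rewrite (le_trans (ler_normD _ _))//; have := ell_bound (rest (1 + s)).
  by move: k1 k2 k3; lra.
have cz : cont_on (V := R^o) (1 - et) (1 + et) (fun T => h (z T)).
  have czz : cont_on (1 - et) (1 + et) z.
    have sub : cont_on 2^-1 (3 / 2) (fun T => T `^ a *: D T + (kap * (T `^ a - 1)) *: v1 +
        (kap * a * (T `^ (a + 1) - 1)) *: vX).
      have cs (b k : R) (w : V) : cont_on 2^-1 (3 / 2) (fun T => (k * (T `^ b - 1)) *: w).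
        have c1 : cont_on 2^-1 (3 / 2) (fun _ : R => k *: w) by exact: cont_on_cst.
        have c2 := cont_onB (cont_on_scal (powR_cont b) c1) c1.
        by apply: cont_on_ext c2 => T _ /=; linmod R.
      apply: cont_onD; last exact: cs.
      apply: cont_onD; last exact: cs.
      exact: cont_on_scal (powR_cont a) cD.
    have sub' : cont_on 2^-1 (3 / 2) z by apply: cont_on_ext sub => T hT'; rewrite /z (hD T hT').2.
    have [e3 e4] := window_sub t1 eta1; exact: cont_on_subset e3 e4 sub'.
  move=> T TT w w0; have [d d0 hd] := czz T TT _ (divr_gt0 w0 L0).
  exists d => // S SS ST; have close X : 1 - et <= X <= 1 + et -> `|z X| <= dl.
    move=> Xe; have -> : X = 1 + (X - 1) by ring.
    exact: zdl (window_dist Xe).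
  apply: (le_lt_trans (h_lip (close S SS) (close T TT))).
  by have := hd S SS ST; rewrite ltr_pdivlMr// mulrC.
have ets : `|et| <= et by rewrite (gtr0_norm et0).
have etn : `|- et| <= et by rewrite normrN.
have b1 := main _ ets; have b2 := main _ etn.
have nE := mulr_gt0 nu0 et0.
have [|||T hTT hT0] := cont_on_ivt _ cz.
- by rewrite lerD2l (le_trans _ (ltW et0))// oppr_le0 ltW.
- by move: b2; rewrite ler_norml => /andP[_]; move: nE; lra.
- by move: b1; rewrite ler_norml => /andP[+ _]; move: nE; lra.
have sT : `|T - 1| <= et := window_dist hTT.
have TE : 1 + (T - 1) = T by ring.
exists T; first exact: window_open t1 sT.
have T1 := hT _ sT; have T2 := zdl _ sT; rewrite TE in T1 T2.
by split => //; exact: (hD T T1).1.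
Qed.

End ChoiceOfT.

(** * Mild solutions *)

Section MildUniqueness.
Context {R : realType} {V : completeNormedModType R}.
Variables (S : R -> V -> V) (N : V -> V) (K : R).
Hypotheses (hS : semigroupV S) (K0 : 0 < K).
Hypothesis N_lip : forall x y,
  `|N x - N y| <= K * `|x - y| * (`|x| + `|y| + `|x| ^+ 2 + `|y| ^+ 2).

Lemma cont_on_N (X : R -> V) a b : a <= b -> cont_on a b X -> cont_on a b (fun s => N (X s)).
Proof.
move=> ab cX; have [B B0 hB] := cont_on_bounded ab cX.
pose M := K * (B + B + B ^+ 2 + B ^+ 2) + 1.
have M0 : 0 < M.
  by rewrite /M ltr_wpDl// mulr_ge0 ?(ltW K0)// !addr_ge0 ?sqr_ge0 ?(ltW B0).
move=> t tab e e0; have [d d0 hd] := cX t tab _ (divr_gt0 e0 M0).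
exists d => // s sab sd; have := hd s sab sd; rewrite ltr_pdivlMr// => h.
apply: le_lt_trans h; apply: (le_trans (N_lip _ _)).
have q1 := hB s sab; have q2 := hB t tab.
have q3 : `|X s| ^+ 2 <= B ^+ 2 by rewrite ler_sqr ?nnegrE ?normr_ge0 ?(ltW B0).
have q4 : `|X t| ^+ 2 <= B ^+ 2 by rewrite ler_sqr ?nnegrE ?normr_ge0 ?(ltW B0).
have q5 := lerD (lerD (lerD q1 q2) q3) q4.
have := ler_wpM2l (mulr_ge0 (ltW K0) (normr_ge0 (X s - X t))) q5.
have := normr_ge0 (X s - X t); rewrite /M; lra.
Qed.

Definition mildV (x0 : V) (X : R -> V) := (forall b, cont_on 0 b X) /\
  forall t, 0 <= t -> X t = S t x0 + duhamel S (fun s => N (X s)) t.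

(** Gronwall's lemma by iteration: under the weight [exp(l t)] with [l = 2 * KS * M] the Duhamel
    term halves the distance. The Lipschitz constant [M] comes from bounds of both solutions on
    [[0, b]], so uniqueness holds among all continuous solutions. *)
Lemma mildV_unique x0 X Y : mildV x0 X -> mildV x0 Y -> forall t, 0 <= t -> X t = Y t.
Proof.
move=> [cX eX] [cY eY] b b0.
have [KS KS0 hKS] := sgV_bound hS b.
have [B B0 hB] := cont_on_bounded b0 (cX b); have [B' B'0 hB'] := cont_on_bounded b0 (cY b).
pose M := K * (B + B' + B ^+ 2 + B' ^+ 2) + 1.
have M0 : 0 < M.
  by rewrite /M ltr_wpDl// mulr_ge0 ?(ltW K0)// !addr_ge0 ?sqr_ge0 ?(ltW B0) ?(ltW B'0).
have hM s : 0 <= s <= b -> `|N (X s) - N (Y s)| <= M * `|X s - Y s|.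
  move=> sb; apply: (le_trans (N_lip _ _)).
  have q1 := hB s sb; have q2 := hB' s sb.
  have q3 : `|X s| ^+ 2 <= B ^+ 2 by rewrite ler_sqr ?nnegrE ?normr_ge0 ?(ltW B0).
  have q4 : `|Y s| ^+ 2 <= B' ^+ 2 by rewrite ler_sqr ?nnegrE ?normr_ge0 ?(ltW B'0).
  have q5 := lerD (lerD (lerD q1 q2) q3) q4.
  have := ler_wpM2l (mulr_ge0 (ltW K0) (normr_ge0 (X s - Y s))) q5.
  have := normr_ge0 (X s - Y s); rewrite /M; lra.
clearbody M; pose l := 2 * KS * M.
have l0 : 0 < l by rewrite !mulr_gt0.
have main n : forall t, 0 <= t <= b -> `|X t - Y t| <= (B + B') * 2^-1 ^+ n * expR (l * t).
  elim: n => [|n IH] t tb; have /andP[t0 tb'] := tb.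
    have := ler_normB (X t) (Y t); have := hB t tb; have := hB' t tb.
    have e1 : 1 <= expR (l * t) by rewrite -expR0 ler_expR mulr_ge0// ltW.
    have := ler_wpM2l (addr_ge0 (ltW B0) (ltW B'0)) e1; rewrite expr0; lra.
  have cNX := cont_on_N t0 (cX t); have cNY := cont_on_N t0 (cY t).
  rewrite eX// eY// opprD addrACA subrr add0r -(duhamelB hS t0 cNX cNY) /duhamel.
  pose q := (B + B') * 2^-1 ^+ n.
  have q0 : 0 <= q by rewrite mulr_ge0 ?exprn_ge0 ?invr_ge0// addr_ge0 ?(ltW B0) ?(ltW B'0).
  have dg s : is_derive s (1 : R) (fun s => q / 2 * expR (l * s)) (q * (KS * M) * expR (l * s)).
    by have := deriv1Z (q / 2) (deriv1_expR l s); apply: deriv1_ext => //; rewrite /l; field.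
  have cc : cont_on 0 t (fun s => S (t - s) (N (X s) - N (Y s))).
    by apply: (cont_on_sgV hS) => //; exact: cont_onB.
  have := Vint_le_deriv t0 cc dg => H.
  have {}H : `|Vint (fun s => S (t - s) (N (X s) - N (Y s))) 0 t| <=
      q / 2 * expR (l * t) - q / 2 * expR (l * 0).
    apply: H => s /andP[s0 st].
    have sb : 0 <= s <= b by rewrite s0 (le_trans st).
    apply: (le_trans (hKS _ _ _)); first by rewrite subr_ge0 st/=; lra.
    have := ler_wpM2l (ltW KS0) (le_trans (hM s sb) (ler_wpM2l (ltW M0) (IH s sb))).
    by rewrite -/q => /le_trans; apply; lra.
  apply: (le_trans H); rewrite mulr0 expR0 mulr1 exprS -/q.
  have -> : (B + B') * (2^-1 * 2^-1 ^+ n) * expR (l * t) = q / 2 * expR (l * t).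
    by rewrite /q; field.
  by rewrite gerBl divr_ge0.
apply/eqP; rewrite -subr_eq0 -normr_le0.
apply: (@ler_small_half _ _ _ ((B + B') * expR (l * b))) => n; rewrite add0r.
have bb : 0 <= b <= b by rewrite b0 lexx.
by have := main n b bb; lra.
Qed.

End MildUniqueness.

Section MildTransfer.
Context {R : realType}.
Notation V := (Vsp R).
Variable p : R.
Hypothesis hp : 1 < p <= 3.
Let p1 : 1 < p. Proof. by case/andP: hp. Qed.
Notation Sg := (St (pa p) (pc p)).
Let hSg : semigroupV Sg.
Proof. exact: St_sg (ltW (pa_gt0 p1)) (ltW (pc_gt0 p1)). Qed.
Let K : R := 2 * npow_cst p.
Let K0 : 0 < K. Proof. by rewrite mulr_gt0// npow_cst_gt0. Qed.

Variables (T : R) (f g : R -> R).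
Hypothesis iu0 : inH (initial_datum p T f g).
Notation u0 := (cls (initial_datum p T f g)).

(** The Duhamel integrand in similarity time, which starts at [- ln T]; solutions on classes start
    at 0, hence the shift by [ln T]. *)
Let FV (X : R -> V) tau s : V := Sg (tau - s) (NV p (X (s + ln T))).

Let cont_sh (X : R -> V) tau : (forall b, cont_on 0 b X) ->
  cont_on (- ln T) tau (fun s => X (s + ln T)).
Proof.
move=> cX s /andP[s1 s2] e e0; have s0 : 0 <= s + ln T <= tau + ln T by apply/andP; split; lra.
have [d d0 hd] := cX (tau + ln T) _ s0 e e0; exists d => // r /andP[r1 r2] rd.
by apply: hd; [apply/andP; split; lra|rewrite opprD addrACA subrr addr0].
Qed.

Let cFV (X : R -> V) tau : (forall b, cont_on 0 b X) -> - ln T <= tau ->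
  cont_on (- ln T) tau (FV X tau).
Proof.
move=> cX h; apply: (cont_on_sgV hSg) => //.
exact: (cont_on_N K0 (NV_lip hp) h (cont_sh cX)).
Qed.

Let conv_FV (X : R -> V) tau : (forall b, cont_on 0 b X) -> - ln T <= tau ->
  duhamel Sg (fun s => NV p (X s)) (tau + ln T) = Vint (FV X tau) (- ln T) tau.
Proof.
move=> cX h; have h0 : 0 <= tau + ln T by lra.
pose G s := Sg (tau + ln T - s) (NV p (X s)).
have cG : cont_on (- ln T + ln T) (tau + ln T) G.
  rewrite addNr; apply: (cont_on_sgV hSg (lexx _)).
  exact: (cont_on_N K0 (NV_lip hp) h0 (cX _)).
have := Vint_shift h cG; rewrite addNr => E; rewrite /duhamel; apply: (etrans E).
apply: (eq_Vint h) => s _; have key : tau + ln T - (s + ln T) = tau - s by ring.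
by rewrite /FV /G key.
Qed.

Lemma mild_of_mildV (X : R -> V) : mildV Sg (NV p) u0 X ->
  mild_solution p T f g (fun tau => vrep (X (tau + ln T))).
Proof.
move=> [cX eX]; split.
- by move=> tau _; exact: vrep_inH.
- move=> tau h.
  have iB s : inH (vrep (X (s + ln T)) - vrep (X (tau + ln T)))%R.
    by apply: inL2B; [exact: mI01|exact: vrep_inH|exact: vrep_inH].
  apply/Hnorm_cvg; first by near=> s; exact: iB.
  (* The interval is prolonged to [tau + 1] so that continuity is tested on both sides of [tau]. *)
  move=> e e0; have tt : - ln T <= tau <= tau + 1 by rewrite h/=; lra.
  have [d d0 hd] := cont_sh (tau := tau + 1) cX tt e0.
  near=> s; rewrite clsBE ?vrepK; [|exact: vrep_inH|exact: vrep_inH].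
  apply: ltW; apply: hd.
    apply/andP; split; first by near: s; exact: withinT.
    near: s; apply: cvg_within; exists 1 => [|s /=]; first exact: ltr01.
     rewrite ltr_norml => /andP[h1 h2]; move: h1 h2; lra.
  by near: s; apply: cvg_within; exists d => // s /=; rewrite distrC.
exists (S0 p); split; [exact: S0_C0|exact: S0_generator|].
move=> tau h; have h0 : 0 <= tau + ln T by lra.
have i2 : inH (S0 p (tau + ln T) (initial_datum p T f g)) by exact: vrep_inH.
have i1 := vrep_inH (X (tau + ln T)).
have iv := inL2B (@mI01 R) i1 i2.
have hF s : - ln T <= s <= tau ->
    inH (S0 p (tau - s) (nonlinN p (vrep (X (s + ln T))))) /\
    cls (S0 p (tau - s) (nonlinN p (vrep (X (s + ln T))))) = FV X tau s.
  move=> _; split; first exact: vrep_inH.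
  by rewrite S0_cls /FV (NV_cls hp (vrep_inH _)) vrepK.
apply: (is_HintegralP h hF (cFV cX h) iv).2.
rewrite (clsBE i1 i2) S0_cls vrepK -(conv_FV cX h) {1}(eX _ h0) addrAC subrr; exact: add0r.
Unshelve. all: by end_near. Qed.

(** This is where the semigroup hidden in the notion of solution is exchanged for [St]. *)
Lemma mildV_of_mild Phi : mild_solution p T f g Phi ->
  mildV Sg (NV p) u0 (fun t => cls (Phi (t - ln T))).
Proof.
move=> [iPhi cPhi [S [hS gS iS]]].
have cX b : cont_on (V := V) 0 b (fun t => cls (Phi (t - ln T))).
  move=> t /andP[t0 tb] e e0; have h : - ln T <= t - ln T by lra.
  have e2 : 0 < e / 2 by rewrite divr_gt0.
  have iH : \forall s \near within [set s | - ln T <= s] (nbhs (t - ln T)),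
      inH (Phi s - Phi (t - ln T))%R.
    near=> s; apply: inL2B; [exact: mI01| |exact: iPhi].
    by apply: iPhi; near: s; exact: withinT.
  have := (@Hnorm_cvg R _ _ (within_filter _ (nbhs_filter _)) (fun s => Phi s - Phi (t - ln T)) iH).1 (cPhi _ h) _ e2.
  rewrite near_withinE => /nbhs_ballP[d /= d0 hd]; exists d => // s /andP[s0 sb] sd.
  have hs : - ln T <= s - ln T by lra.
  have := hd (s - ln T) _ hs; rewrite clsBE; [|exact: iPhi|exact: iPhi].
  move=> /(_ _)/le_lt_trans; apply; last by lra.
  by rewrite /ball /= opprB addrA subrK distrC.
split => // t t0; pose tau := t - ln T; have h : - ln T <= tau by rewrite /tau; lra.
have Et : tau + ln T = t by rewrite /tau; lra.
have := iS tau h; rewrite Et => I.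
have i1 := iPhi tau h; have i2 := sg_stable hS t0 iu0; have iv := inL2B (@mI01 R) i1 i2.
have hF s : - ln T <= s <= tau -> inH (S (tau - s) (nonlinN p (Phi s))) /\
    cls (S (tau - s) (nonlinN p (Phi s))) = FV (fun t => cls (Phi (t - ln T))) tau s.
  move=> /andP[s1 s2]; have ts : 0 <= tau - s by rewrite subr_ge0.
  have iN := nonlinN_inH hp (iPhi s s1); split; first exact: (sg_stable hS ts iN).
  by rewrite (C0_semigroup_unique p1 hS gS ts iN) /FV addrK (NV_cls hp (iPhi s s1)).
have H := (is_HintegralP h hF (cFV cX h) iv).1 I.
rewrite -/tau -[cls (Phi tau)](subrK (cls (S t (initial_datum p T f g)))) -(clsBE i1 i2) H.
by rewrite addrC (C0_semigroup_unique p1 hS gS t0 iu0) -(conv_FV cX h) Et.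
Unshelve. all: by end_near. Qed.

Theorem mild_unique : unique_mild_solution p T f g.
Proof.
move=> Phi1 Phi2 h1 h2 tau h; have i1 := h1; have i2 := h2.
case: i1 => i1 _ _; case: i2 => i2 _ _.
apply: cls_inj; [exact: i1|exact: i2|].
have t0 : 0 <= tau + ln T by lra.
have := mildV_unique hSg K0 (NV_lip hp) (mildV_of_mild h1) (mildV_of_mild h2) t0.
by rewrite addrK.
Qed.

End MildTransfer.

(** * The energy norm and the time derivative *)

Section WeakDerivative.
Context {R : realType}.
Notation mu := (@lebesgue_measure R).
Notation Io r := (`]0%R, r[%classic : set R).
Notation I01 := (`]0%R, 1%R[%classic : set R).
Implicit Types (u v w : R -> R) (r x y : R).

Lemma ip_cauchy_schwarz (D : set R) u v : measurable D -> square_integrable D u ->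
  square_integrable D v -> `|ip D u v| <= snrm D u * snrm D v.
Proof.
move=> mD su sv.
have := ip2_cauchy_schwarz mD (sqi_pair su) (sqi_pair sv).
have E : ip2 D (u, fun=> 0) (v, fun=> 0) = ip D u v.
  rewrite /ip2 /= [X in _ + X](_ : _ = 0) ?addr0// /ip.
  by under eq_Rintegral do rewrite mul0r; rewrite Rintegral_cst// mul0r.
by rewrite E !snrmE.
Qed.

Lemma sqi_continuous r u : continuous u -> square_integrable (Io r) u.
Proof.
move=> cu; have cu' : cont_on (V := R^o) 0 `|r| u by exact: continuous_cont_on.
have [M M0 hM] := cont_on_bounded (normr_ge0 r) cu'.
apply: (sqi_bounded (M := M) (mIo r) (mu_Io_lty _)).
  by apply: measurable_funTS; exact: continuous_measurable_fun.
move=> x /=; rewrite in_itv /= => /andP[x0 x1]; apply: hM; rewrite (ltW x0)/=.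
exact: le_trans (ltW x1) (ler_norm r).
Qed.

Lemma intI_sub r u v x : square_integrable (Io r) u -> square_integrable (Io r) v -> x < r ->
  intI (fun s => u s - v s) x = intI u x - intI v x.
Proof.
move=> su sv xr; have sB := sqiB (mIo r) su sv.
by rewrite (intI_ip su xr) (intI_ip sv xr) (intI_ip sB xr) (ipBl (mIo r) su sv (sqi_ind r x)).
Qed.

Lemma dense_poly_Io r w (e : R) : 0 < r -> square_integrable (Io r) w -> 0 < e ->
  exists q : {poly R}, snrm (Io r) (fun x => w x - q.[x]) <= e.
Proof.
move=> r0 sw e0; have [s1 _] := sqi_scale r0 (mulr1 r) sw.
have sr : 0 < Num.sqrt r by rewrite sqrtr_gt0.
have [q hq] := dense_poly s1 (divr_gt0 e0 sr).
exists (q \Po (r^-1 *: 'X)).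
have sB := sqiB (mIo r) sw (sqi_horner_Io r (q \Po (r^-1 *: 'X))).
have [_ ->] := sqi_scale r0 (mulr1 r) sB.
rewrite mulrC -ler_pdivlMr//; apply: le_trans hq.
rewrite le_eqVlt; apply/orP; left; apply/eqP; congr snrm; apply/funext => x.
by rewrite horner_comp hornerZ hornerX mulrA mulVf ?mul1r ?gt_eqF.
Qed.

Section TestFunction.
Variables (r : R) (theta : R -> R).
Hypotheses (r0 : 0 < r) (tt : test_function r theta).
Let dt := derive1 theta.

Let t_deriv x : is_derive x (1 : R) theta (dt x).
Proof.
have [h _] := tt; have := h 0%N x; rewrite derive1n0 => d.
by apply: DeriveDef => //; rewrite -derive1E.
Qed.

Let ct : continuous theta. Proof. by move=> x; exact: deriv1_cont (t_deriv x). Qed.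

Let cdt : continuous dt.
Proof.
move=> x; have [h _] := tt; have d := h 1%N x; rewrite derive1n1 in d.
exact/differentiable_continuous/derivable1_diffP.
Qed.

Let t0 : theta 0 = 0 /\ theta r = 0.
Proof.
have [_ [a [b [a0 ab br h]]]] := tt; split; apply: h; rewrite negb_and -!ltNge.
  by rewrite a0.
by rewrite br orbT.
Qed.

Let by_parts_poly (q : {poly R}) :
  ip (Io r) (horner (pint q)) dt + ip (Io r) (horner q) theta = 0.
Proof.
pose F x := (pint q).[x] * theta x.
pose f x := (pint q).[x] * dt x + q.[x] * theta x.
have dF x : is_derive x (1 : R) F (f x).
  have h : is_derive x (1 : R) (horner (pint q)) q.[x].
    by apply: DeriveDef; [exact: derivable_horner|rewrite -derive1E -derivE deriv_pint].
  by have := deriv1M h (t_deriv x); apply: deriv1_ext => //; rewrite /f; ring.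
have cf : continuous f.
  move=> x; apply: cvgD; apply: cvgM;
    [exact: continuous_horner|exact: cdt|exact: continuous_horner|exact: ct].
have s1 := sqi_horner_Io r (pint q); have s2 := sqi_horner_Io r q.
have s3 := sqi_continuous r cdt; have s4 := sqi_continuous r ct.
have cF : continuous F by move=> x; exact: deriv1_cont (dF x).
have E : \int[mu]_(x in Io r) f x = 0.
  rewrite /Rintegral -(@integral_itv_bndoo R 0 r _ true false); last first.
    by apply/measurable_EFinP; apply: measurable_funTS; exact: continuous_measurable_fun.
  rewrite (@continuous_FTC2 _ f F)//.
  - by rewrite /F t0.1 t0.2 !mulr0 subee.
  - by apply: continuous_subspaceT.
  - split.
    + by move=> z _; have := dF z.
    + by apply: cvg_at_right_filter; exact: cF.
    + by apply: cvg_at_left_filter; exact: cF.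
  - by move=> z _; have := dF z => /@derive_val; rewrite derive1E.
apply: etrans E; rewrite /f /ip; apply/esym.
exact: (@RintegralD _ _ R mu (Io r) _ _ (mIo r) (sqi_mul (mIo r) s1 s3) (sqi_mul (mIo r) s2 s4)).
Qed.

(** For polynomials this is the fundamental theorem of calculus. Both sides are continuous in [w]
    for the L^2 norm, so density extends the identity. *)
Lemma by_parts_intI w : square_integrable (Io r) w ->
  ip (Io r) (intI w) dt = - ip (Io r) w theta.
Proof.
move=> sw; have s3 := sqi_continuous r cdt; have s4 := sqi_continuous r ct.
have mr := mIo r.
have final (x y k z t : R) : x <= r * k * z -> y <= k * t -> 0 <= k ->
    x + y <= k * (r * z + t + 1) by lra.
apply/eqP; rewrite -subr_eq0 opprK -normr_le0; apply/ler_addgt0Pr => e e0; rewrite add0r.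
pose M := r * snrm (Io r) dt + snrm (Io r) theta + 1.
have M0 : 0 < M by rewrite ltr_wpDl// addr_ge0 ?mulr_ge0 ?snrm_ge0 ?(ltW r0).
have [q hq] := dense_poly_Io r0 sw (divr_gt0 e0 M0).
have sq := sqi_horner_Io r q; have sB := sqiB mr sw sq.
have k1 : ip (Io r) w theta = ip (Io r) (fun x => w x - q.[x]) theta + ip (Io r) (horner q) theta.
  by rewrite (ipBl mr sw sq s4) subrK.
have k2 : ip (Io r) (intI w) dt = ip (Io r) (intI (fun x => w x - q.[x])) dt +
    ip (Io r) (horner (pint q)) dt.
  rewrite -[LHS](subrK (ip (Io r) (horner (pint q)) dt)); congr (_ + _).
  rewrite -(ipBl mr (sqi_intI sw) (sqi_horner_Io r _) s3) /ip.
  apply: eq_Rintegral => x /set_mem /=; rewrite in_itv /= => /andP[x0 xr].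
  by rewrite (intI_sub sw sq xr) intI_horner// ltW.
have k3 := by_parts_poly q; have sI := sqi_intI sB.
have n1 := ip_cauchy_schwarz mr sI s3; have n2 := ip_cauchy_schwarz mr sB s4.
have n3 := snrm_intI (ltW r0) sB.
have -> : ip (Io r) (intI w) dt + ip (Io r) w theta =
    ip (Io r) (intI (fun x => w x - q.[x])) dt + ip (Io r) (fun x => w x - q.[x]) theta.
  by rewrite k1 k2 addrACA k3 addr0.
apply: (le_trans (ler_normD _ _)); apply: (le_trans (lerD n1 n2)).
have d0 := snrm_ge0 (Io r) dt; have d1 := snrm_ge0 (Io r) theta.
have j1 := ler_wpM2r d0 (le_trans n3 (ler_wpM2l (ltW r0) hq)).
have j2 := ler_wpM2r d1 hq.
have E : e = e / M * M by rewrite divfK// gt_eqF.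
have j3 := divr_ge0 (ltW e0) (ltW M0).
rewrite [leRHS]E; exact: final j1 j2 j3.
Qed.

End TestFunction.

Lemma weak_derivative_intI r w : 0 < r -> square_integrable (Io r) w ->
  weak_derivative r (intI w) w.
Proof.
by move=> r0 sw; split => //; [exact: sqi_intI|move=> theta tt; exact: by_parts_intI].
Qed.

Lemma intI_cvg0 r w : 0 < r -> square_integrable (Io r) w -> intI w @ 0^'+ --> (0 : R).
Proof.
move=> r0 sw; apply/cvgrPdist_lt => e e0.
pose M := snrm (Io r) w + 1; have M0 : 0 < M by rewrite ltr_wpDl ?snrm_ge0.
have d0 : 0 < Num.min r ((e / M) ^+ 2) by rewrite lt_min r0 exprn_gt0// divr_gt0.
near=> x; have x0 : 0 < x by near: x; exact: nbhs_right_gt.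
have : x < Num.min r ((e / M) ^+ 2) by near: x; exact: nbhs_right_lt.
rewrite lt_min => /andP[xr xe]; rewrite sub0r normrN.
apply: (le_lt_trans (intI_le sw (ltW x0) xr)).
have : Num.sqrt x < e / M.
  by rewrite -(ger0_norm (divr_ge0 (ltW e0) (ltW M0))) -sqrtr_sqr ltr_sqrt// exprn_gt0// divr_gt0.
rewrite ltr_pdivlMr//; apply: le_lt_trans.
by rewrite ler_wpM2l ?sqrtr_ge0// /M lerDl.
Unshelve. all: by end_near. Qed.

Lemma dilate_pair (c : R) (u : fpair R) : 0 < c -> inH u ->
  let w i := fun s => (if i then u.2 else u.1) (s / c) in
  [/\ square_integrable (Io c) (w true), square_integrable (Io c) (w false) &
   nrm (Io c) (w true, w false) = Num.sqrt c * nrm I01 u].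
Proof.
move=> c0 [s1 s2] w; have ci : 0 < c^-1 by rewrite invr_gt0.
have E := mulVf (lt0r_neq0 c0).
have wE i : w i = (fun s => (if i then u.2 else u.1) (c^-1 * s)).
  by apply/funext => s; rewrite /w mulrC.
have [t1 n1] := sqi_scale ci E s1; have [t2 n2] := sqi_scale ci E s2.
rewrite !wE; split => //.
have sc : Num.sqrt c * Num.sqrt c^-1 = 1 :> R by rewrite -sqrtrM ?(ltW c0)// mulfV ?sqrtr1 ?gt_eqF.
apply/eqP; rewrite -(@eqrXn2 _ 2) ?mulr_ge0 ?nrm_ge0 ?sqrtr_ge0//.
have N1 : snrm I01 u.1 ^+ 2 = c^-1 * snrm (Io c) (fun x => u.1 (c^-1 * x)) ^+ 2.
  by rewrite n1 exprMn (sqr_sqrtr (ltW ci)).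
have N2 : snrm I01 u.2 ^+ 2 = c^-1 * snrm (Io c) (fun x => u.2 (c^-1 * x)) ^+ 2.
  by rewrite n2 exprMn (sqr_sqrtr (ltW ci)).
rewrite nrm_sqr exprMn nrm_sqr (sqr_sqrtr (ltW c0)) /ip2 -!snrm_sqr N1 N2 /=.
by apply/eqP; field; rewrite gt_eqF.
Qed.

(** In the application [f] and [g] are the perturbation in physical variables and [u] its profile.
    The weak derivative of [s * f s] is [k * u.2 (s / c)], and the dilation from the unit interval
    to radius [c] contributes the factor [sqrt c]. *)
Lemma weak_energy (c k : R) (u : fpair R) (f g : R -> R) : 0 < c -> 0 <= k -> inH u ->
  (forall s, 0 < s < c -> s * f s = k * intI (fun s => u.2 (s / c)) s) ->
  (forall s, 0 < s < c -> s * g s = k * u.1 (s / c)) ->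
  is_weak_energy_norm c f g (k * (Num.sqrt c * nrm I01 u)).
Proof.
move=> c0 k0 iu hf hg; have [/= s1 s2 n] := dilate_pair c0 iu.
set w := (fun s => u.2 (s / c)) in s1 n hf; set v := (fun s => u.1 (s / c)) in s2 n.
have mc := mIo c.
have hf' x : Io c x -> k * intI w x = x * f x by rewrite /= in_itv /= => /hf.
have hg' x : Io c x -> k * v x = x * g x by rewrite /= in_itv /= => /hg.
have [sI _ bp] := weak_derivative_intI c0 s1.
have sv : square_integrable (Io c) (fun s => s * g s) by exact: eq_sqi mc hg' (sqiZ k mc s2).
exists (fun s => k * w s); split => //.
- split; [exact: eq_sqi mc hf' (sqiZ k mc sI)|exact: sqiZ|].
  move=> theta tt.
  have cth : continuous theta.
    move=> x; have [h _] := tt; have d := h 0%N x; rewrite derive1n0 in d.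
    exact/differentiable_continuous/derivable1_diffP.
  have cdt : continuous (derive1 theta).
    move=> x; have [h _] := tt; have d := h 1%N x; rewrite derive1n1 in d.
    exact/differentiable_continuous/derivable1_diffP.
  transitivity (ip (Io c) (fun s => k * intI w s) (derive1 theta)).
    by apply: eq_Rintegral => x /set_mem xI; rewrite -hf'.
  have st := sqi_continuous c cth; have sdt := sqi_continuous c cdt.
  rewrite (ipZl k mc sI sdt) -[RHS]/(- ip (Io c) (fun s => k * w s) theta) (ipZl k mc s1 st).
  by rewrite -[ip _ _ _]/(\int[mu]_(x in Io c) (intI w x * derive1 theta x)) bp// mulrN.
- have h : (fun s => k * intI w s) @ 0^'+ --> (0 : R).
    by rewrite -[X in _ --> X](mulr0 k); apply: cvgM; [exact: cvg_cst|exact: intI_cvg0 s1].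
  apply: cvg_trans h; apply: near_eq_cvg; near=> x; apply: hf'; rewrite /= in_itv /=.
  by apply/andP; split; near: x; [exact: nbhs_right_gt|exact: nbhs_right_lt].
have i1 : inL2 (Io c) (fun s => k * w s, fun s => s * g s) by split => //; exact: sqiZ.
rewrite norm2E//; congr EFin.
have i2 : inL2 (Io c) (w, v) by split.
rewrite -n; have := nrmZ k mc i2; rewrite (ger0_norm k0) => <-; rewrite /nrm; congr Num.sqrt.
rewrite /ip2; congr (_ + _); rewrite /ip; apply: eq_Rintegral => x /set_mem xI.
by rewrite /= -hg'.
Unshelve. all: by end_near. Qed.

End WeakDerivative.

(** * Differentiating an observable along a mild solution *)

Section ObservedOrbit.
Context {R : realType} {V : completeNormedModType R}.
Variables (S : R -> V -> V) (N : V -> V) (K b B : R) (E M : R -> V -> V) (x0 : V) (X : R -> V).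
Variable (D : V -> Prop).
Hypotheses (hS : semigroupV S) (b0 : 0 <= b) (K0 : 0 < K) (B0 : 0 < B).
Hypothesis N_lip : forall x y,
  `|N x - N y| <= K * `|x - y| * (`|x| + `|y| + `|x| ^+ 2 + `|y| ^+ 2).
Hypothesis hX : mildV S N x0 X.
Hypothesis EB : forall t x y, 0 <= t <= b -> E t (x - y) = E t x - E t y.
Hypothesis MB : forall t x y, 0 <= t <= b -> M t (x - y) = M t x - M t y.
Hypothesis EZ : forall t k x, 0 <= t <= b -> E t (k *: x) = k *: E t x.
Hypothesis E_bound : forall t x, 0 <= t <= b -> `|E t x| <= B * `|x|.
Hypothesis M_bound : forall t x, 0 <= t <= b -> `|M t x| <= B * `|x|.
Hypothesis EN : forall t x, 0 <= t <= b -> E t (N x) = 0.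
Hypothesis D_dense : forall x e, 0 < e -> exists2 w, D w & `|x - w| <= e.
Hypothesis D_cont : forall w, D w -> cont_on 0 b (M^~ w).
Hypothesis D_prim : forall t0 w, 0 <= t0 <= b -> D w ->
  prim t0 b (fun t => M t (S (t - t0) w)) (fun t => E t (S (t - t0) w)).

Let KS := projT1 (cid2 (sgV_bound hS b)).
Let KS0 : 0 < KS. Proof. exact: (projT2 (cid2 (sgV_bound hS b))).1. Qed.
Let KSP t x : 0 <= t <= b -> `|S t x| <= KS * `|x|.
Proof. exact: (projT2 (cid2 (sgV_bound hS b))).2. Qed.

(** For [z] in the dense set this is the mean value inequality. The constant multiplying the norm of
    [z] is uniform, so the estimate extends to every vector, also when its orbit is not
    differentiable. *)
Let orbit_lip z t0 t : 0 <= t0 -> t0 <= t -> t <= b ->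
  `|E t (S (t - t0) z) - E t0 z| <= B * KS * (t - t0) * `|z|.
Proof.
move=> t00 t0t tb; apply/ler_addgt0Pr => e e0.
have h0 : 0 <= t - t0 by rewrite subr_ge0.
have tt : 0 <= t <= b by rewrite tb (le_trans t00).
have tt0 : 0 <= t0 <= b by rewrite t00 (le_trans t0t).
have hb : 0 <= t - t0 <= b by rewrite h0/=; lra.
pose Q := B * KS * (t - t0) + B * KS + B + 1.
have BK : 0 < B * KS by exact: mulr_gt0.
have BKt : 0 <= B * KS * (t - t0) by rewrite mulr_ge0// ltW.
have Q0 : 0 < Q by rewrite /Q; have := B0; lra.
have [w Dw hw] := D_dense z (divr_gt0 e0 Q0).
have pw := prim_subset (lexx _) tb (D_prim tt0 Dw).
have hwb s : t0 <= s <= t -> `|M s (S (s - t0) w)| <= B * (KS * `|w|).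
  move=> /andP[s1 s2]; apply: (le_trans (M_bound _ _)); first by apply/andP; split; lra.
  by rewrite ler_wpM2l ?(ltW B0)// KSP//; apply/andP; split; lra.
have := prim_le_cst t0t pw hwb; rewrite subrr (sgV_0 hS) => k1.
have -> : E t (S (t - t0) z) - E t0 z = (E t (S (t - t0) w) - E t0 w) +
   E t (S (t - t0) (z - w)) - E t0 (z - w).
  by rewrite (sgV_sub hS)// !EB//; linmod R.
have k2 : `|E t (S (t - t0) (z - w))| <= B * (KS * (e / Q)).
  apply: (le_trans (E_bound _ tt)); rewrite ler_wpM2l ?(ltW B0)//.
  by apply: (le_trans (KSP _ hb)); rewrite ler_wpM2l ?(ltW KS0).
have k3 : `|E t0 (z - w)| <= B * (e / Q).
  by apply: (le_trans (E_bound _ tt0)); rewrite ler_wpM2l ?(ltW B0).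
have k4 : `|w| <= `|z| + e / Q.
  have -> : w = z - (z - w) by linmod R.
  by apply: (le_trans (ler_normB _ _)); rewrite lerD2l.
have k5 := ler_wpM2l BKt k4.
apply: (le_trans (ler_normB _ _)); apply: (le_trans (lerD (ler_normD _ _) (lexx _))).
have EQ : e = e / Q * Q by rewrite divfK// gt_eqF.
have eQ := divr_ge0 (ltW e0) (ltW Q0).
apply: (@le_trans _ _ (B * KS * (t - t0) * `|z| + e / Q * Q)); last by rewrite -EQ.
have -> : e / Q * Q = (B * KS * (t - t0) + B * KS + B + 1) * (e / Q) by rewrite mulrC.
by move: k1 k2 k3 k5 eQ; lra.
Qed.

Let G t := M t (X t).
Let A t := E t (X t).

Let G_cont : cont_on 0 b G.
Proof.
move=> t tb e e0; pose q := e / (5 * B).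
have B5 : 0 < 5 * B by have := B0; lra.
have q0 : 0 < q by rewrite divr_gt0.
have EQ : e = 5 * B * q by rewrite /q mulrC divfK// gt_eqF.
have [w Dw hw] := D_dense (X t) q0.
have [d d0 hd] := hX.1 b t tb _ q0; have Bq : 0 < B * q by exact: mulr_gt0.
have [d' d'0 hd'] := D_cont Dw tb Bq.
exists (Num.min d d'); first by rewrite lt_min d0.
move=> s sb; rewrite lt_min => /andP[sd sd'].
have -> : G s - G t = M s (X s - X t) + M s (X t - w) + (M s w - M t w) - M t (X t - w).
  by rewrite /G !MB//; linmod R.
have h1 := ler_wpM2l (ltW B0) (ltW (hd s sb sd)); have h2 := ler_wpM2l (ltW B0) hw.
have k1 := le_trans (M_bound (X s - X t) sb) h1.
have k2 := le_trans (M_bound (X t - w) sb) h2.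
have k3 := le_trans (M_bound (X t - w) tb) h2.
have k4 := hd' s sb sd'.
apply: (le_lt_trans (ler_normB _ _)).
have := ler_normD (M s (X s - X t) + M s (X t - w)) (M s w - M t w).
have := ler_normD (M s (X s - X t)) (M s (X t - w)).
by move: k1 k2 k3 k4 Bq; rewrite EQ; lra.
Qed.

Let Z t0 t := Vint (fun s => S (t - s) (N (X s))) t0 t.

Let cN t : 0 <= t -> cont_on 0 t (fun s => N (X s)).
Proof. by move=> t0; exact: (cont_on_N K0 N_lip t0 (hX.1 t)). Qed.

Let X_step t0 t : 0 <= t0 -> t0 <= t -> X t = S (t - t0) (X t0) + Z t0 t.
Proof.
move=> t00 t0t; have t1 := le_trans t00 t0t; have h0 : 0 <= t - t0 by rewrite subr_ge0.
rewrite (hX.2 t t1) (hX.2 t0 t00) (duhamel_split hS t00 t0t (cN t1)) (sgV_add hS)// -(sgV_D hS)//.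
by rewrite subrK addrA.
Qed.

Let cZ t0 t : 0 <= t0 -> t0 <= t -> cont_on t0 t (fun s => S (t - s) (N (X s))).
Proof.
move=> t00 t0t; apply: (cont_on_subset t00 (lexx _)).
by apply: (cont_on_sgV hS) => //; apply: cN; exact: le_trans t0t.
Qed.

Let E_step t0 t : 0 <= t0 -> t0 <= t -> t <= b ->
  E t (X t) = E t (S (t - t0) (X t0)) + E t (Z t0 t).
Proof.
move=> t00 t0t tb; have tt : 0 <= t <= b by rewrite tb (le_trans t00).
rewrite {1}(X_step t00 t0t).
have -> : S (t - t0) (X t0) + Z t0 t = S (t - t0) (X t0) - (0 - Z t0 t) by linmod R.
have E0 : E t 0 = 0 by have := EB 0 0 tt; rewrite !subrr.
by rewrite !EB// E0; linmod R.
Qed.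

Let A_cont : cont_on 0 b A.
Proof.
have [Bx Bx0 hBx] := cont_on_bounded b0 (hX.1 b).
have [Bn Bn0 hBn] := cont_on_bounded b0 (cN b0).
pose L := B * KS * (Bx + Bn).
have main s t : 0 <= s -> s <= t -> t <= b -> `|A t - A s| <= L * (t - s).
  move=> s0 st tb; have tt : 0 <= t <= b by rewrite tb (le_trans s0).
  have ss : 0 <= s <= b by rewrite s0 (le_trans st).
  have k1 := orbit_lip (X s) s0 st tb; have k2 : `|E t (Z s t)| <= B * (KS * Bn * (t - s)).
    apply: (le_trans (E_bound _ tt)); rewrite ler_wpM2l ?(ltW B0)//.
    apply: Vint_le_cst => //; first exact: cZ.
    move=> r /andP[r1 r2]; apply: (le_trans (KSP _ _)); first by apply/andP; split; lra.
    by rewrite ler_wpM2l ?(ltW KS0)// hBn//; apply/andP; split; lra.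
  have k3 := hBx s ss; have k4 : 0 <= B * KS * (t - s).
    by rewrite mulr_ge0 ?subr_ge0// mulr_ge0// ltW.
  have k5 := ler_wpM2l k4 k3.
  have -> : A t - A s = (E t (S (t - s) (X s)) - E s (X s)) + E t (Z s t).
    by rewrite /A (E_step s0 st tb); linmod R.
  apply: (le_trans (ler_normD _ _)).
  by rewrite /L; move: k1 k2 k5; lra.
apply: (@cont_on_lip R V 0 b A L) => s t /andP[s0 sb] /andP[t0 tb].
have [st|/ltW ts] := leP s t.
  by rewrite (ger0_norm (_ : 0 <= t - s)) ?subr_ge0//; exact: main.
by rewrite distrC (distrC t) (ger0_norm (_ : 0 <= s - t)) ?subr_ge0//; exact: main.
Qed.

(** On [[t, y]] the solution is the linear orbit of [X t] plus an integral close to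
    [(y - t) * N (X t)], and [E] vanishes on the range of [N]. In the linear orbit, [X t] is
    replaced by an element of the dense set; by [orbit_lip] the error is proportional to [y - t]. *)
Let right_deriv t e : 0 <= t < b -> 0 < e -> exists2 d, 0 < d &
  forall y, t < y < t + d -> y <= b -> `|A y - A t - (y - t) *: G t| <= e * (y - t).
Proof.
move=> /andP[t0 tb] e0; have tt : 0 <= t <= b by rewrite t0 ltW.
pose Q := B * KS + B + 1 + B * (KS + 1).
have BK : 0 < B * KS by exact: mulr_gt0.
have Q0 : 0 < Q by rewrite /Q; have := B0; lra.
pose q := e / Q; have q0 : 0 < q by rewrite divr_gt0.
have EQ : e = Q * q by rewrite /q mulrC divfK// gt_eqF.
have [w Dw hw] := D_dense (X t) q0.
have ttb : t <= t <= b by rewrite lexx ltW.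
have [d d0 hd] := D_prim tt Dw ttb q0.
have [d1 d10 hd1] := cN b0 tt q0.
have [d2 d20 hd2] := sgV_cont0 hS (N (X t)) q0.
exists (Num.min d (Num.min d1 d2)); first by rewrite !lt_min d0 d10.
move=> y /andP[ty]; rewrite -ltrBlDl !lt_min => /and3P[yd yd1 yd2] yb.
have h0 : 0 < y - t by rewrite subr_gt0.
have yy : 0 <= y <= b by rewrite yb (le_trans t0 (ltW ty)).
have tyb : t <= y <= b by rewrite yb ltW.
have ayt : `|y - t| = y - t by rewrite gtr0_norm.
have k1 : `|E y (S (y - t) w) - E t w - (y - t) *: M t w| <= q * (y - t).
  have := hd y tyb; rewrite ayt subrr !(sgV_0 hS); exact.
have k2 : `|Z t y - (y - t) *: N (X t)| <= (KS * q + q) * (y - t).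
  apply: Vint_near; [exact: ltW|exact: cZ t0 (ltW ty)|].
  move=> s /andP[ts sy]; have ys : 0 <= y - s <= b by rewrite subr_ge0 sy (le_trans _ yb)// gerBl (le_trans t0).
  have -> : S (y - s) (N (X s)) - N (X t) = S (y - s) (N (X s) - N (X t)) + (S (y - s) (N (X t)) - N (X t)).
    by rewrite (sgV_sub hS); [linmod R|lra].
  apply: (le_trans (ler_normD _ _)); apply: lerD.
    apply: (le_trans (KSP _ ys)); rewrite ler_wpM2l ?(ltW KS0)//.
    have sb : 0 <= s <= b by rewrite (le_trans t0 ts) (le_trans sy yb).
    have st1 : `|s - t| < d1 by rewrite ger0_norm ?subr_ge0// (le_lt_trans _ yd1)// lerB.
    exact: ltW (hd1 s sb st1).
  have [->|sy'] := eqVneq s y; first by rewrite subrr (sgV_0 hS) subrr normr0 ltW.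
  have sy2 : s < y by rewrite lt_neqAle sy'.
  by apply: hd2; rewrite subr_gt0 sy2 (le_lt_trans _ yd2)// lerB.
have zw := orbit_lip (X t - w) t0 (ltW ty) yb.
have -> : A y - A t - (y - t) *: G t =
   (E y (S (y - t) w) - E t w - (y - t) *: M t w) +
   (E y (S (y - t) (X t - w)) - E t (X t - w)) - (y - t) *: M t (X t - w) +
   E y (Z t y - (y - t) *: N (X t)).
  rewrite /A /G (E_step t0 (ltW ty) yb) !EB// !MB// EZ// EN// (sgV_sub hS) ?(ltW h0)// EB// scaler0; linmod R.
have k3 : `|E y (Z t y - (y - t) *: N (X t))| <= B * ((KS * q + q) * (y - t)).
  by apply: (le_trans (E_bound _ yy)); rewrite ler_wpM2l ?(ltW B0).
have k4 : `|(y - t) *: M t (X t - w)| <= (y - t) * (B * q).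
  rewrite normrZ (gtr0_norm h0) ler_wpM2l ?(ltW h0)//.
  by apply: (le_trans (M_bound _ tt)); rewrite ler_wpM2l ?(ltW B0).
have k5 : B * KS * (y - t) * `|X t - w| <= B * KS * (y - t) * q.
  by rewrite ler_wpM2l// mulr_ge0 ?(ltW BK) ?(ltW h0).
set v1 := (E y (S (y - t) w) - _ - _) in k1 *; set v2 := (E y _ - _) in zw *.
set v3 := (y - t) *: M t (X t - w) in k4 *; set v4 := E y _ in k3 *.
have n1 := ler_normD (v1 + v2 - v3) v4; have n2 := ler_normB (v1 + v2) v3.
have n3 := ler_normD v1 v2.
rewrite EQ /Q; move: n1 n2 n3 k1 zw k3 k4 k5; lra.
Qed.

(** The solution is only known to be continuous, but its observable has a continuous right
    derivative, and the one-sided mean value inequality [dini_mvt] turns this into a two-sided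
    one. *)
Theorem observed_prim : prim 0 b G A.
Proof.
move=> t tb e e0; have e2 : 0 < e / 2 by rewrite divr_gt0.
have [d d0 hd] := G_cont tb e2.
have main s1 s2 : 0 <= s1 -> s1 <= s2 -> s2 <= b -> `|s1 - t| < d -> `|s2 - t| < d ->
    `|A s2 - A s1 - (s2 - s1) *: G t| <= e * (s2 - s1).
  move=> s10 s12 s2b h1 h2.
  pose f s := A s - s *: G t; pose g (s : R) : R := e * s.
  have cid : continuous (fun s : R => s) by move=> s; exact: cvg_id.
  have cid' : cont_on (V := R^o) s1 s2 (fun s : R => s) by exact: continuous_cont_on cid.
  have cf : cont_on s1 s2 f.
    apply: cont_onB; first by apply: cont_on_subset A_cont.
    have cc : cont_on s1 s2 (fun _ : R => G t) by exact: cont_on_cst.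
    exact: cont_on_scal cid' cc.
  have cg : cont_on (V := R^o) s1 s2 g.
    apply: (continuous_cont_on (V := R^o)) => s; apply: cvgM; [exact: cvg_cst|exact: cvg_id].
  have := dini_mvt s12 cf cg _; rewrite /f /g => H.
  have -> : A s2 - A s1 - (s2 - s1) *: G t = A s2 - s2 *: G t - (A s1 - s1 *: G t) by linmod R.
  rewrite mulrBr; apply: H => x /andP[x1 x2] e' e'0.
  have xb : 0 <= x < b by rewrite (le_trans s10 x1) (lt_le_trans x2 s2b).
  have [dd dd0 hdd] := right_deriv xb e2.
  exists dd => // y xy ys2; have yb := le_trans ys2 s2b.
  have k1 := hdd y xy yb; have /andP[xy1 _] := xy.
  have xb' : 0 <= x <= b by rewrite (le_trans s10 x1) (le_trans (ltW x2) s2b).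
  have xd : `|x - t| < d.
    move: h1 h2; rewrite !ltr_norml => /andP[h11 h12] /andP[h21 h22].
    by rewrite (lt_le_trans h11) ?lerD2r//= (le_lt_trans _ h22)// lerD2r ltW.
  have k2 := hd x xb' xd.
  have -> : A y - y *: G t - (A x - x *: G t) =
     (A y - A x - (y - x) *: G x) + (y - x) *: (G x - G t) by linmod R.
  have y0 : 0 < y - x by rewrite subr_gt0.
  have k3 : `|(y - x) *: (G x - G t)| <= (y - x) * (e / 2).
    by rewrite normrZ (gtr0_norm y0) ler_wpM2l ?(ltW y0)// ltW.
  apply: (le_trans (ler_normD _ _)); have := mulr_ge0 (ltW e'0) (ltW y0).
  by move: k1 k3; lra.
exists d => // y yb yd; have td : `|t - t| < d by rewrite subrr normr0.
move: tb yb => /andP[t0 tb] /andP[y0 yb].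
have [ty|/ltW yt] := leP t y.
  by rewrite (ger0_norm (_ : 0 <= y - t)) ?subr_ge0//; exact: main.
rewrite (distrC y) (ger0_norm (_ : 0 <= t - y)) ?subr_ge0//.
have := main y t y0 yt tb yd td; apply: le_trans.
by rewrite -normrN le_eqVlt; apply/orP; left; apply/eqP; congr (`|_|); linmod R.
Qed.

End ObservedOrbit.

Section LiftOperator.
Context {R : realType}.
Notation I01 := (`]0%R, 1%R[%classic : set R).
Notation V := (Vsp R).
Variables (A : fpair R -> fpair R) (B : R).
Hypothesis A_bound : forall u, inH u -> inH (A u) /\ nrm I01 (A u) <= B * nrm I01 u.
Hypothesis A_B : forall u v, inH u -> inH v -> cls (A (u - v)%R) = cls (A u) - cls (A v).
Hypothesis A_Z : forall k u, inH u -> cls (A (k *: u)) = k *: cls (A u).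

Definition liftV (x : V) : V := cls (A (vrep x)).

Lemma liftV_bound x : `|liftV x| <= B * `|x|.
Proof. by have [i h] := A_bound (vrep_inH x); rewrite norm_cls// norm_vrep. Qed.

Lemma liftV_cls u : inH u -> liftV (cls u) = cls (A u).
Proof.
move=> iu; have iv := vrep_inH (cls u); apply/eqP; rewrite -subr_eq0 -normr_le0 /liftV -A_B//.
have iB := inL2B (@mI01 R) iv iu; have [i h] := A_bound iB.
by rewrite norm_cls// (le_trans h)// -norm_cls// clsBE// vrepK subrr normr0 mulr0.
Qed.

Lemma liftVB x y : liftV (x - y) = liftV x - liftV y.
Proof.
rewrite /liftV -A_B; [|exact: vrep_inH|exact: vrep_inH]; rewrite -[RHS]liftV_cls.
  by rewrite clsBE ?vrepK//; exact: vrep_inH.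
by apply: inL2B; [exact: mI01|exact: vrep_inH|exact: vrep_inH].
Qed.

Lemma liftVZ k x : liftV (k *: x) = k *: liftV x.
Proof.
rewrite /liftV -A_Z; last exact: vrep_inH.
rewrite -[RHS]liftV_cls; first by rewrite clsZE ?vrepK//; exact: vrep_inH.
by apply: inL2Z; [exact: mI01|exact: vrep_inH].
Qed.

End LiftOperator.

Section PointwiseClass.
Context {R : realType}.
Notation I01 := (`]0%R, 1%R[%classic : set R).

Lemma cls_pt (u v : fpair R) : inH u -> (forall y, 0 < y < 1 -> u.1 y = v.1 y /\ u.2 y = v.2 y) ->
  inH v /\ cls u = cls v.
Proof.
move=> [s1 s2] h.
have h1 y : I01 y -> u.1 y = v.1 y by rewrite /= in_itv /= => /h [].
have h2 y : I01 y -> u.2 y = v.2 y by rewrite /= in_itv /= => /h [].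
have iv : inH v by split; [exact: eq_sqi h1 s1|exact: eq_sqi h2 s2].
by split => //; apply: cls_eq => //; split; apply: aeW => y yI; [exact: h1|exact: h2].
Qed.

End PointwiseClass.

(** * Observables on a fixed ball *)

Section DilatedOperators.
Context {R : realType}.
Notation mu := (@lebesgue_measure R).
Notation Io r := (`]0%R, r[%classic : set R).
Notation I01 := (`]0%R, 1%R[%classic : set R).
Notation V := (Vsp R).
Variables (r c : R).
Hypotheses (r0 : 0 < r) (rc : r <= c).
Implicit Types (u v : fpair R).

Let c0 : 0 < c. Proof. exact: lt_le_trans rc. Qed.

(** With [c] the radius of the lightcone, [Er] and [Mr] read off the perturbations of [s psi] and
    [s psi_t], without their scalar prefactors, on the ball of fixed radius [r]. They are dilated to
    the unit interval and put in the first slot, so that their values lie in the same space of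
    classes. *)
Definition Er u : fpair R := (fun y => intI (fun s => u.2 (s / c)) (r * y), fun=> 0).
Definition Mr u : fpair R := (fun y => u.1 (r / c * y), fun=> 0).

Let rlt y : y < 1 -> r * y < c.
Proof. by move=> y1; rewrite (lt_le_trans _ rc)// gtr_pMr. Qed.

Let dil f : square_integrable I01 f -> square_integrable (Io c) (fun s => f (s / c)) /\
  snrm (Io c) (fun s => f (s / c)) = Num.sqrt c * snrm I01 f.
Proof.
move=> sf; have ci : 0 < c^-1 by rewrite invr_gt0.
have -> : (fun s => f (s / c)) = (fun s => f (c^-1 * s)) by apply/funext => s; rewrite mulrC.
have [s n] := sqi_scale ci (mulVf (lt0r_neq0 c0)) sf; split => //.
by rewrite n mulrA -sqrtrM ?(ltW c0)// mulfV ?gt_eqF// sqrtr1 mul1r.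
Qed.

Let nrm_fst f : nrm I01 (f, fun=> 0 : R) = snrm I01 f.
Proof. by rewrite snrmE. Qed.

Lemma Er_bound u : inH u -> inH (Er u) /\ nrm I01 (Er u) <= c * nrm I01 u.
Proof.
move=> [_ s2]; have [s n] := dil s2; have sI := sqi_intI s.
have sub : Io r `<=` Io c.
  by move=> x; rewrite /= !in_itv/= => /andP[-> /lt_le_trans]; apply.
have [sr _] := sqi_subset (mIo r) (mIo c) sub sI.
have [s' _] := sqi_scale r0 (mulr1 r) sr.
split; first by split => //; exact: sqi0.
have n0 : 0 <= c * nrm I01 u by rewrite mulr_ge0 ?nrm_ge0 ?(ltW c0).
rewrite /Er nrm_fst; have := snrm_le_bound ler01 n0 s'; rewrite sqrtr1 mul1r; apply.
move=> y /andP[y0 y1]; have ry : 0 <= r * y < c by rewrite mulr_ge0 ?(ltW r0) ?(ltW y0)//= rlt.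
apply: (le_trans (intI_bound s ry)); rewrite n mulrA -expr2 sqr_sqrtr ?(ltW c0)//.
by rewrite ler_wpM2l ?(ltW c0)// (snrm_le_nrm I01 u).2.
Qed.

Lemma Er_B u v : inH u -> inH v -> cls (Er (u - v)%R) = cls (Er u) - cls (Er v).
Proof.
move=> iu iv; have [i1 _] := Er_bound iu; have [i2 _] := Er_bound iv.
rewrite -clsBE//; apply/esym.
refine (proj2 (cls_pt (inL2B (@mI01 R) i1 i2) _)) => y /andP[y0 y1]; split; last exact: subrr.
by rewrite -[RHS]/(intI (fun s => u.2 (s / c) - v.2 (s / c)) (r * y)) (intI_sub (dil iu.2).1 (dil iv.2).1 (rlt y1)).
Qed.

Lemma Er_Z k u : inH u -> cls (Er (k *: u)) = k *: cls (Er u).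
Proof.
move=> iu; have [i1 _] := Er_bound iu; rewrite -clsZE//; apply/esym.
refine (proj2 (cls_pt (inL2Z k (@mI01 R) i1) _)) => y /andP[y0 y1]; split; last exact: mulr0.
have s := (dil iu.2).1; have mc := mIo c.
rewrite -[RHS]/(intI (fun s => k * u.2 (s / c)) (r * y)) (intI_ip (sqiZ k mc s) (rlt y1)).
by rewrite (ipZl k mc s (sqi_ind c (r * y))) -(intI_ip s (rlt y1)).
Qed.

Lemma Mr_bound u : inH u -> inH (Mr u) /\ nrm I01 (Mr u) <= c / r * nrm I01 u.
Proof.
move=> [s1 _]; have q0 : 0 < r / c by rewrite divr_gt0.
have q1 : r / c <= 1 by rewrite ler_pdivrMr// mul1r.
have sub : Io (r / c) `<=` I01.
  by move=> x; rewrite /= !in_itv/= => /andP[-> /lt_le_trans]; apply.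
have [sr nr] := sqi_subset (mIo (r / c)) (@mI01 R) sub s1.
have [s n] := sqi_scale q0 (mulr1 (r / c)) sr.
split; first by split => //; exact: sqi0.
rewrite /Mr nrm_fst.
have -> : c / r = (r / c)^-1 by rewrite invf_div.
rewrite ler_pdivlMl//.
apply: (@le_trans _ _ (Num.sqrt (r / c) * snrm I01 (fun y => u.1 (r / c * y)))).
  rewrite ler_wpM2r ?snrm_ge0//.
  by rewrite -{1}(ger0_norm (ltW q0)) -sqrtr_sqr ler_wsqrtr// expr2 ler_piMl// ltW.
by rewrite -n (le_trans nr)// (snrm_le_nrm I01 u).1.
Qed.

Lemma Mr_B u v : inH u -> inH v -> cls (Mr (u - v)%R) = cls (Mr u) - cls (Mr v).
Proof.
move=> iu iv; have [i1 _] := Mr_bound iu; have [i2 _] := Mr_bound iv.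
rewrite -clsBE//; apply/esym.
by refine (proj2 (cls_pt (inL2B (@mI01 R) i1 i2) _)) => y _; split => //; exact: subrr.
Qed.

Let cls_odd (u : fpair R) (Q : {poly R}) : (forall i, ~~ odd i -> Q`_i = 0) ->
  (forall y, 0 < y < 1 -> Q.[y] = u.1 y) -> u.2 = (fun=> 0) -> iota_ Q = cls u.
Proof.
move=> hQ h1 h2.
have oQ : opart Q = Q by apply/polyP => i; rewrite coef_opart; case: ifPn => // /hQ.
have eQ : epart Q = 0 by apply/polyP => i; rewrite coef_epart coef0; case: ifPn => // /hQ.
refine (proj2 (cls_pt (iot_inH Q) _)) => y hy.
by rewrite /iot /= oQ eQ h1// h2 horner0.
Qed.

Lemma Mr_poly (w : {poly R}) N : (size w <= N)%N -> cls (Mr (iot w)) =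
  iota_ (\poly_(i < N.+1) (if odd i then w`_i * (r / c) ^+ i else 0)).
Proof.
move=> sw; apply/esym; apply: cls_odd => //.
  by move=> i /negbTE oi; rewrite coef_poly oi if_same.
move=> y _; rewrite /Mr /= horner_poly (@horner_coef_wide _ N.+1); last first.
  by rewrite (leq_trans (size_poly _ _))// (leq_trans sw).
apply: eq_bigr => i _; rewrite coef_opart (exprMn i (r / c) y).
by case: ifP => _; rewrite ?mul0r ?mulrA.
Qed.

Lemma Er_poly (w : {poly R}) N : (size w <= N)%N -> cls (Er (iot w)) =
  iota_ (\poly_(i < N.+1) (if odd i then w`_i.-1 * c^-1 ^+ i.-1 * r ^+ i / i%:R else 0)).
Proof.
move=> sw; apply/esym; apply: cls_odd => //.
  by move=> i /negbTE oi; rewrite coef_poly oi if_same.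
move=> y /andP[y0 y1]; rewrite /Er /=.
pose e' : {poly R} := \poly_(n < N) ((epart w)`_n * c^-1 ^+ n).
have -> : (fun s => (epart w).[s / c]) = horner e'.
  apply/funext => s; rewrite /e' horner_poly (@horner_coef_wide _ N); last first.
    by rewrite (leq_trans (size_poly _ _)).
  by apply: eq_bigr => i _; rewrite exprMn; ring.
rewrite intI_horner ?mulr_ge0 ?(ltW r0) ?(ltW y0)// horner_poly.
have se : (size (pint e') <= N.+1)%N.
  apply/leq_sizeP => j; case: j => // j Nj; rewrite coef_pint /e' coef_poly.
  by rewrite ltnNge (_ : (N <= j)%N)// mul0r.
rewrite (horner_coef_wide _ se); apply: eq_bigr => i _; rewrite coef_pint.
case: i => -[|i] hi /=; first by rewrite !mul0r.
rewrite /e' coef_poly (_ : (i < N)%N)// coef_epart; case: odd => /=; last by rewrite exprMn; ring.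
by rewrite !mul0r.
Qed.

End DilatedOperators.

Section WaveOperators.
Context {R : realType}.
Notation I01 := (`]0%R, 1%R[%classic : set R).
Notation V := (Vsp R).
Variable p : R.
Hypothesis hp : 1 < p <= 3.
Let p1 : 1 < p. Proof. by case/andP: hp. Qed.
Let a := pa p.
Let k := pc p.
Let a0 : 0 <= a := ltW (pa_gt0 p1).
Let k0 : 0 <= k := ltW (pc_gt0 p1).
Notation Sg := (St (pa p) (pc p)).
Variables (lT b r : R).
Hypotheses (r0 : 0 < r) (b0 : 0 <= b) (rb : r <= expR (lT - b)).
Implicit Types (t : R) (x y : V).

Let cc t := expR (lT - t).
Let rc t : 0 <= t <= b -> r <= cc t.
Proof. by move=> /andP[_ tb]; rewrite (le_trans rb)// ler_expR lerD2l lerN2. Qed.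

(** Here [lT] is meant to be [ln T] and [exp(lT - t)] the radius of the cone. The exponent [a - 1]
    in [Mop] reflects the change of time: a derivative in similarity time is the radius times a
    derivative in physical time. *)
Definition Eop t x : V := expR (a * (t - lT)) *: liftV (Er r (expR (lT - t))) x.
Definition Mop t x : V := expR ((a - 1) * (t - lT)) *: liftV (Mr r (expR (lT - t))) x.

Let EB t x y : 0 <= t <= b -> Eop t (x - y) = Eop t x - Eop t y.
Proof.
move=> tb; have h := rc tb.
by rewrite /Eop (liftVB (Er_bound r0 h) (Er_B r0 h)) scalerBr.
Qed.

Let MB t x y : 0 <= t <= b -> Mop t (x - y) = Mop t x - Mop t y.
Proof.
move=> tb; have h := rc tb.
by rewrite /Mop (liftVB (Mr_bound r0 h) (Mr_B r0 h)) scalerBr.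
Qed.

Let EZ t m x : 0 <= t <= b -> Eop t (m *: x) = m *: Eop t x.
Proof.
move=> tb; have h := rc tb.
by rewrite /Eop (liftVZ (Er_bound r0 h) (Er_B r0 h) (Er_Z r0 h)) scalerA mulrC -scalerA.
Qed.

Let cont_expl (m l : R) : continuous (fun t : R => expR (m * (t - l))).
Proof.
move=> t; have h := deriv1_expR m (t - l).
have := @deriv1_comp R (fun s => expR (m * s)) (fun s => s - l) t _ _ h.
by move=> /(_ 1) H; apply: deriv1_cont; apply: H.
Qed.

Let opB_ex : exists2 B : R, 0 < B & forall t, 0 <= t <= b ->
  expR (a * (t - lT)) * cc t <= B /\ expR ((a - 1) * (t - lT)) * (cc t / r) <= B.
Proof.
have cb := @continuous_cont_on R R^o 0 b.
have [B1 B10 h1] := cont_on_bounded b0 (cb _ (@cont_expl (a - 1) lT)).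
have [B2 B20 h2] := cont_on_bounded b0 (cb _ (@cont_expl (a - 2) lT)).
have r0' := r0; exists (B1 + B2 / r); first by rewrite addr_gt0// divr_gt0.
move=> t tb; have := h1 t tb; have := h2 t tb; rewrite !ger0_norm ?expR_ge0// => k2 k1.
have E1 : expR (a * (t - lT)) * cc t = expR ((a - 1) * (t - lT)).
  by rewrite /cc -expRD; congr expR; ring.
have E2 : expR ((a - 1) * (t - lT)) * (cc t / r) = expR ((a - 2) * (t - lT)) / r.
  by rewrite mulrA /cc -expRD; congr (expR _ / r); ring.
rewrite E1 E2; have k3 : expR ((a - 2) * (t - lT)) / r <= B2 / r by rewrite ler_pM2r ?invr_gt0.
have : 0 <= expR ((a - 2) * (t - lT)) / r by rewrite divr_ge0 ?expR_ge0 ?(ltW r0).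
by move: B10 k1 k3; split; lra.
Qed.

Let B := projT1 (cid2 opB_ex).
Let B0 : 0 < B. Proof. exact: (projT2 (cid2 opB_ex)).1. Qed.
Let BP := (projT2 (cid2 opB_ex)).2.

Let E_bound t x : 0 <= t <= b -> `|Eop t x| <= B * `|x|.
Proof.
move=> tb; have h := rc tb; rewrite /Eop normrZ (ger0_norm (expR_ge0 _)).
have := ler_wpM2l (expR_ge0 (a * (t - lT))) (liftV_bound (Er_bound r0 h) x) => /le_trans; apply.
by rewrite mulrA ler_wpM2r// (BP tb).1.
Qed.

Let M_bound t x : 0 <= t <= b -> `|Mop t x| <= B * `|x|.
Proof.
move=> tb; have h := rc tb; rewrite /Mop normrZ (ger0_norm (expR_ge0 _)).
have := ler_wpM2l (expR_ge0 ((a - 1) * (t - lT))) (liftV_bound (Mr_bound r0 h) x) => /le_trans; apply.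
by rewrite mulrA ler_wpM2r// (BP tb).2.
Qed.

(** The nonlinearity occupies the first component, while [Er] reads the second. *)
Let EN t x : 0 <= t <= b -> Eop t (NV p x) = 0.
Proof.
move=> tb; have h := rc tb; have iN := nonlinN_inH hp (vrep_inH x).
rewrite /Eop /NV (liftV_cls (Er_bound r0 h) (Er_B r0 h) iN).
have -> : Er r (cc t) (nonlinN p (vrep x)) = 0.
  have i0 (y : R) : intI (fun _ : R => 0 : R) y = 0 by rewrite /intI Rintegral_cst// mul0r.
  by rewrite /Er /=; congr pair; apply/funext => y; exact: i0.
by rewrite cls0 scaler0.
Qed.

Let ecoef (w : {poly R}) t i : R :=
  if odd i then expR ((a + i.-1%:R) * (t - lT)) * w`_i.-1 * (r ^+ i / i%:R) else 0.

Let mcoef (w : {poly R}) t i : R :=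
  if odd i then expR ((a - 1 + i%:R) * (t - lT)) * w`_i * r ^+ i else 0.

Let Eop_poly (w : {poly R}) t N : 0 <= t <= b -> (size w <= N)%N ->
  Eop t (iota_ w) = \sum_(i < N.+1) ecoef w t i *: iota_ 'X^i.
Proof.
move=> tb sw; have h := rc tb.
rewrite /Eop (liftV_cls (Er_bound r0 h) (Er_B r0 h) (iot_inH w)) (@Er_poly R r _ r0 w N sw).
rewrite (@iota_sum R _ N.+1) ?size_poly// scaler_sumr; apply: eq_bigr => i _.
rewrite scalerA coef_poly ltn_ord /ecoef; case: ifPn => oi; last by rewrite mulr0.
have k1 n : (expR (lT - t))^-1 ^+ n = expR (n%:R * (t - lT)).
  by rewrite -expRN -expRM_natl; congr expR; ring.
by congr (_ *: _); rewrite k1 (mulrDl a) expRD; ring.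
Qed.

Let Mop_poly (w : {poly R}) t N : 0 <= t <= b -> (size w <= N)%N ->
  Mop t (iota_ w) = \sum_(i < N.+1) mcoef w t i *: iota_ 'X^i.
Proof.
move=> tb sw; have h := rc tb.
rewrite /Mop (liftV_cls (Mr_bound r0 h) (Mr_B r0 h) (iot_inH w)) (@Mr_poly R r _ w N sw).
rewrite (@iota_sum R _ N.+1) ?size_poly// scaler_sumr; apply: eq_bigr => i _.
rewrite scalerA coef_poly ltn_ord /mcoef; case: ifPn => oi; last by rewrite mulr0.
have k1 n : (r / expR (lT - t)) ^+ n = r ^+ n * expR (n%:R * (t - lT)).
  by rewrite exprMn -expRN -expRM_natl; congr (_ * expR _); ring.
by congr (_ *: _); rewrite k1 (mulrDl (a - 1)) expRD; ring.
Qed.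

Let d_exp (m t : R) : is_derive t (1 : R) (fun t => expR (m * (t - lT))) (m * expR (m * (t - lT))).
Proof.
have hl : is_derive t (1 : R) (fun s => s - lT) 1.
  by have := deriv1_lin 1 (- lT) t; apply: deriv1_ext => // s; rewrite mul1r.
have := @deriv1_comp R (fun s => expR (m * s)) (fun s => s - lT) t _ _ (deriv1_expR m (t - lT)) hl.
by apply: deriv1_ext => //; ring.
Qed.

Let D x := exists w, x = iota_ w.

Let D_dense x e : 0 < e -> exists2 w, D w & `|x - w| <= e.
Proof. by move=> e0; have [w hw] := dense_iota x e0; exists (iota_ w) => //; exists w. Qed.

Let prim_ext (F P F' P' : R -> V) u v : prim u v F P ->
  (forall t, u <= t <= v -> F t = F' t /\ P t = P' t) -> prim u v F' P'.
Proof.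
move=> h E t tb e e0; have [d d0 hd] := h t tb e e0; exists d => // y yb yd.
by have [<- <-] := E t tb; have [_ <-] := E y yb; exact: hd.
Qed.

Let D_cont x : D x -> cont_on 0 b (Mop^~ x).
Proof.
move=> [w ->]; have hs : cont_on 0 b (fun t => \sum_(i < (size w).+1) mcoef w t i *: iota_ 'X^i : V).
  pose m' (t : R) i := if odd i then (a - 1 + i%:R) * expR ((a - 1 + i%:R) * (t - lT)) * w`_i * r ^+ i else 0.
  apply: (@prim_cont R V _ _ (fun t => \sum_(i < (size w).+1) m' t i *: iota_ 'X^i)).
  apply: prim_sum => i; apply: prim_scal => t; rewrite /mcoef /m'; case: ifP => _.
    have := deriv1Z (w`_i * r ^+ i) (d_exp (a - 1 + i%:R) t).
    by apply: deriv1_ext => [s|]; ring.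
  exact: deriv1_cst.
move=> t tb e e0; have [d d0 hd] := hs t tb e e0; exists d => // s sb sd.
by rewrite !(@Mop_poly w _ (size w))//; exact: hd.
Qed.

Let D_prim t0 x : 0 <= t0 <= b -> D x ->
  prim t0 b (fun t => Mop t (Sg (t - t0) x)) (fun t => Eop t (Sg (t - t0) x)).
Proof.
move=> /andP[t00 t0b] [w ->].
have sw : (size w <= (size w).*2)%N by rewrite -addnn leq_addl.
have [W fW W0] := @flow_exists R a k (size w) w sw.
pose N := (size w).*2.
have h : prim t0 b (fun t => \sum_(i < N.+1) mcoef (W (t - t0)) t i *: iota_ 'X^i : V)
   (fun t => \sum_(i < N.+1) ecoef (W (t - t0)) t i *: iota_ 'X^i).
  apply: prim_sum => i; apply: prim_scal => t; rewrite /mcoef /ecoef; case: ifPn => oi; last exact: deriv1_cst.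
  have hl : is_derive t (1 : R) (fun s => s - t0) 1.
    by have := deriv1_lin 1 (- t0) t; apply: deriv1_ext => // s; rewrite mul1r.
  have dW := @deriv1_comp R (fun s => (W s)`_i.-1) (fun s => s - t0) t _ _ (fW.2 i.-1 (t - t0)) hl.
  have := deriv1Z (r ^+ i / i%:R) (deriv1M (d_exp (a + i.-1%:R) t) dW).
  apply: deriv1_ext => [s|]; first by ring.
  (* For even [j] the damping [- (j + a)] in [Lp] cancels against the derivative of the prefactor.
     What remains is [j + 1] times the coefficient of degree [j + 1], which belongs to the
     velocity. *)
  rewrite coef_Lp; case: (i : nat) oi => // j /= /negbTE -> /=.
  rewrite (_ : a - 1 + j.+1%:R = a + j%:R); last by rewrite -natr1; ring.
  have : j.+1%:R != 0 :> R by rewrite pnatr_eq0.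
  by move: (j.+1%:R : R) => q q0; field.
refine (prim_ext h _) => t /andP[t1 t2].
have tb : 0 <= t <= b by rewrite t2 (le_trans t00).
have ts : 0 <= t - t0 by rewrite subr_ge0.
have E : Sg (t - t0) (iota_ w) = iota_ (W (t - t0)).
  by rewrite -{1}W0; exact: (St_flow a0 k0 fW ts).
by rewrite E (Mop_poly tb (fW.1 _)) (Eop_poly tb (fW.1 _)).
Qed.

Theorem wave_prim x0 X : mildV Sg (NV p) x0 X ->
  prim 0 b (fun t => Mop t (X t)) (fun t => Eop t (X t)).
Proof.
move=> hX; have K0 : 0 < 2 * npow_cst p by rewrite mulr_gt0// npow_cst_gt0.
exact: (observed_prim (St_sg a0 k0) b0 K0 B0 (NV_lip hp) hX EB MB EZ E_bound M_bound EN
  D_dense D_cont D_prim).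
Qed.

End WaveOperators.

(** * The time derivative in physical variables *)

Section TimeDerivative.
Context {R : realType}.
Notation mu := (@lebesgue_measure R).
Notation Io r := (`]0%R, r[%classic : set R).
Notation I01 := (`]0%R, 1%R[%classic : set R).
Notation V := (Vsp R).

(** Dilating by [r] moves the statement to the unit interval, where norms of classes are
    available. *)
Lemma integral_sqr_cvg0 (r : R) (U : R -> R -> R) : 0 < r ->
  (forall e, 0 < e -> \forall h \near (0 : R)^',
    square_integrable I01 (fun y => U h (r * y)) /\ snrm I01 (fun y => U h (r * y)) <= e) ->
  integral_sqr `[0, r] (U h) @[h --> (0 : R)^'] --> 0%E.
Proof.
move=> r0 hU; pose q h := r * snrm I01 (fun y => U h (r * y)) ^+ 2.
have qE : \forall h \near (0 : R)^', (q h)%:E = integral_sqr `[0, r] (U h).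
  near=> h; have [s _] : square_integrable I01 (fun y => U h (r * y)) /\
      snrm I01 (fun y => U h (r * y)) <= 1 by near: h; exact: hU.
  have r1 : 0 < r^-1 by rewrite invr_gt0.
  have [s' n] := sqi_scale r1 (mulVf (lt0r_neq0 r0)) s.
  have sU : square_integrable (Io r) (U h).
    by apply: (eq_sqi (mIo r)) s' => x _; rewrite mulrA mulfV ?mul1r// gt_eqF.
  have [_ n'] := sqi_scale r0 (mulr1 r) sU.
  rewrite /integral_sqr (@integral_itv_bndoo R 0 r _ true false); last exact: measurable_EFinX2 sU.1.
  have -> : (\int[mu]_(x in Io r) (U h x ^+ 2)%:E)%E = integral_sqr (Io r) (U h) by [].
  rewrite (integral_sqrE (mIo r) sU) -snrm_sqr n' exprMn (sqr_sqrtr (ltW r0)); exact: erefl.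
suff hq : q h @[h --> (0 : R)^'] --> (0 : R).
  apply: cvg_EFin; first by apply: filterS qE => h <-.
  by apply: cvg_trans hq; apply: near_eq_cvg; apply: filterS qE => h /= <-.
apply/cvgr0Pnorm_le => e e0; pose w := Num.sqrt (e / r).
have w0 : 0 < w by rewrite sqrtr_gt0 divr_gt0.
near=> h; have [_ n] : square_integrable I01 (fun y => U h (r * y)) /\
    snrm I01 (fun y => U h (r * y)) <= w by near: h; exact: hU.
rewrite ger0_norm; last by rewrite mulr_ge0 ?sqr_ge0 ?(ltW r0).
have h2 : snrm I01 (fun y => U h (r * y)) ^+ 2 <= e / r.
  have er : 0 <= e / r by rewrite divr_ge0 ?(ltW e0) ?(ltW r0).
  by rewrite -(sqr_sqrtr er) ler_sqr ?nnegrE ?snrm_ge0 ?sqrtr_ge0.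
have := ler_wpM2l (ltW r0) h2; rewrite -/(q h) => /le_trans; apply.
by rewrite mulrC divfK// gt_eqF.
Unshelve. all: by end_near. Qed.

(** The chain rule for passing from similarity time to physical time; [th t] is interior, so
    increments of either sign are covered. *)
Lemma prim_chain (F A : R -> V) (a b : R) (th : R -> R) (t dth : R) :
  prim a b F A -> a < th t < b -> is_derive t (1 : R) th dth ->
  forall e, 0 < e -> exists2 d, 0 < d & forall h, `|h| < d ->
    `|A (th (t + h)) - A (th t) - (h * dth) *: F (th t)| <= e * `|h|.
Proof.
move=> hp /andP[at0 tb] dt e e0.
have D0 : 0 < `|dth| + 1 by rewrite ltr_wpDl.
have F0 : 0 < `|F (th t)| + 1 by rewrite ltr_wpDl.
pose q := Num.min 1 (e / (2 * (`|F (th t)| + 1))).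
have q0 : 0 < q by rewrite lt_min ltr01 divr_gt0// mulr_gt0.
have q1 : q <= 1 by rewrite ge_min lexx.
have qF : q * `|F (th t)| <= e / 2.
  have : q <= e / (2 * (`|F (th t)| + 1)) by rewrite ge_min lexx orbT.
  by rewrite ler_pdivlMr ?mulr_gt0// => H; move: q0 H; lra.
pose e1 := e / (2 * (`|dth| + 1)).
have e10 : 0 < e1 by rewrite divr_gt0// mulr_gt0.
have e1D : e1 * (`|dth| + 1) = e / 2 by rewrite /e1; field; rewrite gt_eqF.
have tab : a <= th t <= b by rewrite !ltW.
have [d1 d10 hd1] := hp (th t) tab e1 e10; have [d2 d20 hd2] := deriv1_eps dt q0.
pose m := Num.min d1 (Num.min (th t - a) (b - th t)).
have m0 : 0 < m by rewrite !lt_min d10 !subr_gt0 at0.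
clearbody e1 q; exists (Num.min d2 (m / (`|dth| + 1))); first by rewrite lt_min d20 divr_gt0.
move=> h; rewrite lt_min ltr_pdivlMr// => /andP[h2 hm].
have th_h : t + h - t = h by ring.
have k1 := hd2 (t + h); rewrite th_h in k1; have {}k1 := k1 h2.
pose k := th (t + h) - th t.
have kb : `|k| <= (`|dth| + 1) * `|h|.
  have -> : k = (k - h * dth) + h * dth by ring.
  apply: (le_trans (ler_normD _ _)); rewrite normrM.
  have := ler_wpM2r (normr_ge0 h) q1; move: k1; rewrite -/k; lra.
have km : `|k| < m by apply: le_lt_trans kb _; rewrite mulrC.
move: km; rewrite /m !lt_min => /and3P[kd1 ka kb'].
have thb : a <= th (t + h) <= b.
  move: ka kb'; rewrite !ltr_norml => /andP[ka1 ka2] /andP[kb1 kb2].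
  by apply/andP; split; move: ka1 kb2; rewrite /k; lra.
have k2 := hd1 _ thb kd1; rewrite -/k in k2.
have -> : A (th (t + h)) - A (th t) - (h * dth) *: F (th t) =
  (A (th (t + h)) - A (th t) - k *: F (th t)) + (k - h * dth) *: F (th t) by linmod R.
apply: (le_trans (ler_normD _ _)); rewrite normrZ.
have k3 := ler_wpM2r (normr_ge0 (F (th t))) k1; rewrite -/k in k3.
have k4 := ler_wpM2l (ltW e10) kb; rewrite mulrA e1D in k4.
have k5 := ler_wpM2r (normr_ge0 h) qF.
by move: k2 k3 k4 k5; lra.
Qed.

Variable p : R.
Hypothesis hp : 1 < p <= 3.
Let p1 : 1 < p. Proof. by case/andP: hp. Qed.
Notation Sg := (St (pa p) (pc p)).
Variables (T : R) (x0 : V) (X : R -> V).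
Hypothesis T0 : 0 < T.
Hypothesis hX : mildV Sg (NV p) x0 X.

Let a := pa p.
Let Phi (tau : R) : fpair R := vrep (X (tau + ln T)).

Definition psiX (t r : R) : R := psi_ss p T t + (T - t) `^ (- (2 / (p - 1))) * r^-1 *
  \int[mu]_(s in `[0, r]) (vrep (X (- ln (T - t) + ln T))).2 (s / (T - t)).

Definition psitX (t r : R) : R := derive1 (psi_ss p T) t +
  (T - t) `^ (- (2 / (p - 1))) * r^-1 * (vrep (X (- ln (T - t) + ln T))).1 (r / (T - t)).

Let th (t : R) : R := - ln (T - t) + ln T.

Let th_deriv t : t < T -> is_derive t (1 : R) th (T - t)^-1.
Proof.
move=> tT; have c0 : 0 < T - t by rewrite subr_gt0.
have hl : is_derive t (1 : R) (fun s : R => T - s) (-1).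
  by have := deriv1_lin (-1) T t; apply: deriv1_ext => // s; ring.
have := deriv1D (deriv1Z (-1) (@deriv1_comp R (@ln R) (fun s => T - s) t _ _ (is_derive1_ln c0) hl)) (deriv1_cst (ln T) t).
by apply: deriv1_ext => [s|]; rewrite ?mulN1r//; ring.
Qed.

Let k (t : R) : R := (T - t) `^ (- a).

Let RA r t : fpair R := k t *: Er r (T - t) (vrep (X (th t))).

Let RA_cls r t : 0 < r -> r <= T - t -> inH (RA r t) /\ Eop p (ln T) r (th t) (X (th t)) = cls (RA r t).
Proof.
move=> r0 rc; have c0 : 0 < T - t by exact: lt_le_trans rc.
have [i _] := Er_bound r0 rc (vrep_inH (X (th t))).
split; first exact: inL2Z (@mI01 R) i.
have E1 : expR (ln T - th t) = T - t by rewrite -[RHS](lnK c0) /th; congr expR; ring.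
have E2 : expR (pa p * (th t - ln T)) = k t.
  by rewrite /k /powR (gt_eqF c0) /th /a; congr expR; ring.
by rewrite /Eop E1 E2 /RA (clsZE _ i).
Qed.

Let RG r t : fpair R := k t *: Mr r (T - t) (vrep (X (th t))).

Let RG_cls r t : 0 < r -> r <= T - t -> inH (RG r t) /\
  (T - t)^-1 *: Mop p (ln T) r (th t) (X (th t)) = cls (RG r t).
Proof.
move=> r0 rc; have c0 : 0 < T - t by exact: lt_le_trans rc.
have [i _] := Mr_bound r0 rc (vrep_inH (X (th t))).
split; first exact: inL2Z (@mI01 R) i.
have E1 : expR (ln T - th t) = T - t by rewrite -[RHS](lnK c0) /th; congr expR; ring.
have E2 : (T - t)^-1 * expR ((pa p - 1) * (th t - ln T)) = k t.
  rewrite /k /powR (gt_eqF c0) -{1}(lnK c0) -expRN -expRD /th /a; congr expR; ring.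
by rewrite /Mop E1 scalerA E2 /RG (clsZE _ i).
Qed.

(** On a fixed ball, the difference quotient of the perturbation is that of an observable of the
    orbit composed with [th]; the explicit solution [psi^T] is differentiated separately. *)
Lemma psiX_time_derivative : time_derivative T psiX psitX.
Proof.
move=> t r /andP[t0 tT] /andP[r0 rc]; have c0 : 0 < T - t by rewrite subr_gt0.
(* The shifted similarity time at which the cone has shrunk to the radius [r]; [th t] lies strictly
   before it. *)
pose b := ln T - ln r.
have lrc : ln r < ln (T - t) by rewrite ltr_ln ?posrE.
have lcT : ln (T - t) < ln T by rewrite ltr_ln ?posrE// gtrBl.
have b0 : 0 <= b by rewrite /b; lra.
have rb : r <= expR (ln T - b) by rewrite /b opprB addrC subrK lnK.
have thb : 0 < th t < b by rewrite /th /b; apply/andP; split; lra.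
have pr := wave_prim hp r0 b0 rb hX.
have ch := prim_chain pr thb (th_deriv tT).
pose idr : fpair R := (fun y => r * y, fun=> 0).
have iid : inH idr.
  have s : square_integrable I01 (fun y : R => r * y).
    apply: sqi_continuous => y; apply: cvgM; [exact: cvg_cst|exact: cvg_id].
  by split => //; exact: sqi0.
pose Dp := derive1 (psi_ss p T) t.
have dP : is_derive t (1 : R) (psi_ss p T) Dp.
  have h := psi_ss_deriv p tT.
  by rewrite /Dp derive1E derive_val.
apply: integral_sqr_cvg0 => // e e0.
have e2 : 0 < e / 2 by rewrite divr_gt0.
have n0 : 0 < `|cls idr : V| + 1 by rewrite ltr_wpDl.
have [d1 d10 hd1] := ch _ e2.
have [d2 d20 hd2] := deriv1_eps dP (divr_gt0 e2 n0).
have d3 : 0 < T - t - r by rewrite subr_gt0.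
have dm : 0 < Num.min (Num.min d1 d2) (T - t - r) by rewrite !lt_min d10 d20.
near=> h.
have h0 : h != 0 by near: h; exact: nbhs_dnbhs_neq.
have : `|h| < Num.min (Num.min d1 d2) (T - t - r).
  near: h; apply: nbhs_dnbhs; exists (Num.min (Num.min d1 d2) (T - t - r)) => // s /=.
  by rewrite sub0r normrN.
rewrite !lt_min => /andP[/andP[hh1 hh2] hh3].
have rch : r <= T - (t + h) by have := ler_norm h; lra.
have [i1 E1] := RA_cls r0 rch; have [i2 E2] := RA_cls r0 (ltW rc).
have [i3 E3] := RG_cls r0 (ltW rc).
pose q := (psi_ss p T (t + h) - psi_ss p T t) / h - Dp.
pose W : fpair R := (h^-1 *: (RA r (t + h) - RA r t - h *: RG r t) + q *: idr)%R.
have i4 := inL2Z h (@mI01 R) i3; have i12 := inL2B (@mI01 R) i1 i2.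
have i124 := inL2B (@mI01 R) i12 i4.
have i5 := inL2Z h^-1 (@mI01 R) i124; have i6 := inL2Z q (@mI01 R) iid.
have iW : inH W := inL2D (@mI01 R) i5 i6.
pose P : fpair R := (fun y => r * y * ((psiX (t + h) (r * y) - psiX t (r * y)) / h - psitX t (r * y)), fun=> 0).
(* The error in the difference quotient of the whole solution is that of the observable plus [q],
   the error for [psi^T], times the radius. *)
have [iP cP] : inH P /\ cls W = cls P.
  apply: cls_pt iW _ => y /andP[y0 y1]; split; last first.
    transitivity (h^-1 * (k (t + h) * 0 - k t * 0 - h * (k t * 0)) + q * 0); first by [].
    by rewrite !mulr0 !subr0 mulr0 addr0.
  have ry : r * y != 0 by rewrite gt_eqF// mulr_gt0.
  have Ey : r / (T - t) * y = r * y / (T - t) by rewrite mulrAC.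
  rewrite /P /psiX /psitX -/(th t) -/(th (t + h)) -/(pa p) -/(k t) -/(k (t + h)).
  transitivity (h^-1 * (k (t + h) * intI (fun s => (vrep (X (th (t + h)))).2 (s / (T - (t + h)))) (r * y)
    - k t * intI (fun s => (vrep (X (th t))).2 (s / (T - t))) (r * y)
    - h * (k t * (vrep (X (th t))).1 (r / (T - t) * y))) + q * (r * y)); first by [].
  rewrite Ey /q /Dp /intI /=; set I1 := \int[mu]_(_ in _) _; set I2 := \int[mu]_(_ in _) _.
  move: (vrep _) (psi_ss p T (t + h)) (psi_ss p T t) (derive1 _ _) (k _) (k _) => u z1 z2 z3 z4 z5.
  by field; rewrite h0 !gt_eqF.
split; first exact: iP.1.
have -> : snrm I01 (fun y => r * y * ((psiX (t + h) (r * y) - psiX t (r * y)) / h - psitX t (r * y))) = `|cls P : V|.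
  by rewrite norm_cls// snrmE.
have k1 := hd1 h hh1; rewrite E1 E2 -scalerA E3 in k1.
have k2 : `|q| <= e / 2 / (`|cls idr : V| + 1).
  have := hd2 (t + h); have -> : t + h - t = h by ring.
  move=> /(_ hh2) H; have -> : q = h^-1 * (psi_ss p T (t + h) - psi_ss p T t - h * Dp).
    by rewrite /q; field.
  by rewrite normrM normfV ler_pdivrMl ?normr_gt0// (mulrC `|h|).
rewrite -cP /W (clsDE i5 i6) (clsZE _ i124) (clsZE _ iid) (clsBE i12 i4) (clsBE i1 i2) (clsZE _ i3).
apply: (le_trans (ler_normD _ _)); rewrite !normrZ normfV.
have k3 : `|h|^-1 * `|cls (RA r (t + h)) - cls (RA r t) - h *: cls (RG r t)| <= e / 2.
  by rewrite ler_pdivrMl ?normr_gt0// mulrC.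
have k4 : `|q| * `|cls idr : V| <= e / 2.
  apply: (@le_trans _ _ (e / 2 / (`|cls idr : V| + 1) * (`|cls idr : V| + 1))).
    by apply: ler_pM => //; rewrite lerDl.
  by rewrite divfK// gt_eqF.
by rewrite [e]splitr; exact: lerD k3 k4.
Unshelve. all: by end_near. Qed.

End TimeDerivative.

(** * Stable orbits and their energy norm *)

Section Stability.
Context {R : realType}.
Notation I01 := (`]0%R, 1%R[%classic : set R).
Notation V := (Vsp R).
Variable p : R.
Hypothesis hp : 1 < p <= 3.
Let p1 : 1 < p. Proof. by case/andP: hp. Qed.
Notation Sg := (St (pa p) (pc p)).

Lemma stable_orbits (mu : R) : -1 < mu -> mu < 0 -> 2^-1 - pa p <= mu ->
  exists2 M : R, 0 < M & forall eta : R, 0 < eta < 2^-1 ->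
  exists2 delta : R, 0 < delta & forall f g, radial_data f g ->
    (energy_norm (3 / 2) (fun r => f r - psi_ss p 1 0)%R
       (fun r => g r - derive1 (psi_ss p 1) 0)%R < delta%:E)%E ->
  exists2 T : R, 1 - eta < T < 1 + eta & inH (initial_datum p T f g) /\
    exists2 X : R -> V, mildV Sg (NV p) (cls (initial_datum p T f g)) X &
      forall t, 0 <= t -> `|X t| <= M * expR (mu * t).
Proof.
move=> mu1 mu0 mua; have a0 := pa_gt0 p1; have c0 := pc_gt0 p1.
have hS : semigroupV (Sg : R -> V -> V) := St_sg (ltW a0) (ltW c0).
have := @St_split R (pa p) mu a0 mu1 mua (ltW mu0).
rewrite -(pcE p1) => -[ell [C [C0 ell_lin ell_bound ell_ev hsplit]]].
have K0 : 0 < 2 * npow_cst p by rewrite mulr_gt0// npow_cst_gt0.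
have [dl [L [Phi [h [dl0 L0 hP]]]]] :=
  lyapunov_perron hS mu0 C0 K0 ell_lin ell_bound hsplit (NV0 hp) (NV_lip hp).
have h_ell u : `|u| <= dl -> `|h u - ell u| <= L * `|u| ^+ 2 by case/hP.
have h_lip u v : `|u| <= dl -> `|v| <= dl -> `|h u - h v| <= L * `|u - v|.
  by move=> ud vd; case: (hP u ud) => _ _ _ _; apply.
exists (L * dl); first exact: mulr_gt0.
move=> eta heta.
have [delta delta0 hd] := choose_T p1 C0 dl0 L0 ell_lin ell_bound ell_ev h_ell h_lip heta.
exists delta => // f g rd en; have [T hT [iu ud hu]] := hd f g rd en.
exists T => //; split => //; exists (Phi (cls (initial_datum p T f g))).
  have [cP _ eP _ _] := hP _ ud; split=> // t t0.
  by rewrite {1}(eP t t0) hu mulr0 scale0r subr0.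
have [_ bP _ _ _] := hP _ ud; move=> t t0; apply: (le_trans (bP t t0)).
by rewrite ler_wpM2r ?expR_ge0// ler_wpM2l ?(ltW L0).
Qed.

Lemma psiX_solution (T : R) (f g : R -> R) (X : R -> V) : 0 < T ->
  inH (initial_datum p T f g) -> mildV Sg (NV p) (cls (initial_datum p T f g)) X ->
  radial_solution p T f g (psiX p T X) (psitX p T X).
Proof.
move=> T0 iu hX; split; first exact: (psiX_time_derivative hp T0 hX).
by exists (fun tau => vrep (X (tau + ln T))); first exact: mild_of_mildV.
Qed.

(** The normalising power is the one for which all powers of [T - t] cancel: [(5 - p) / (2 (p - 1))
    - 2 / (p - 1) + 1 / 2 = 0]. *)
Lemma psiX_energy (T t : R) (X : R -> V) : t < T ->
  exists2 nrm : R, is_weak_energy_norm (T - t) (fun r => psiX p T X t r - psi_ss p T t)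
    (fun r => psitX p T X t r - derive1 (psi_ss p T) t) nrm &
    (T - t) `^ ((5 - p) / (2 * (p - 1))) * nrm = `|X (- ln (T - t) + ln T)|.
Proof.
move=> tT; have c0 : 0 < T - t by rewrite subr_gt0.
set c := T - t in c0 *; pose k := c `^ (- (2 / (p - 1))).
exists (k * (Num.sqrt c * nrm I01 (vrep (X (- ln c + ln T))))).
  apply: (weak_energy c0 (powR_ge0 _ _) (vrep_inH _)) => s /andP[s0 sc].
    rewrite /psiX -/c -/k addrC addKr /intI; set I := \int[_]_(_ in _) _.
    by field; rewrite gt_eqF.
  by rewrite /psitX -/c -/k addrC addKr; field; rewrite gt_eqF.
rewrite -norm_vrep; set x := `|X _|.
have -> : Num.sqrt c = c `^ 2^-1 by rewrite powR12_sqrt ?ltW.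
rewrite !mulrA /k -!powRD; try by rewrite (gt_eqF c0) implybT.
have -> : (5 - p) / (2 * (p - 1)) + - (2 / (p - 1)) + 2^-1 = 0.
  by field; rewrite gt_eqF// subr_gt0.
by rewrite powRr0 mul1r.
Qed.

End Stability.

Unset Implicit Arguments.
Set Strict Implicit.
Set Printing Implicit Defensive.

Theorem theorem1p2 (R : realType) (p eps : R) (hp : 1 < p <= 3)
    (heps : 0 < eps) :
  exists2 C : R, 0 < C &
  forall eta : R, 0 < eta < 2^-1 ->
  exists2 delta : R, 0 < delta &
  forall f g : R -> R,
    radial_data f g ->
    (energy_norm (3 / 2) (fun r => f r - psi_ss p 1 0)%R
       (fun r => g r - derive1 (psi_ss p 1) 0)%R < delta%:E)%E ->
    exists2 T : R, 1 - eta < T < 1 + eta &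
      unique_mild_solution p T f g /\
      exists psi psit : R -> R -> R,
        radial_solution p T f g psi psit /\
        forall t : R, 0 <= t < T ->
        exists2 nrm : R,
          is_weak_energy_norm (T - t) (fun r => psi t r - psi_ss p T t)
            (fun r => psit t r - derive1 (psi_ss p T) t) nrm &
          (T - t) `^ ((5 - p) / (2 * (p - 1))) * nrm
            <= C * (T - t) `^ (`|omega_p p| - eps).
Proof.
have /andP[p1 p3] := hp; have p0 : 0 < p - 1 by rewrite subr_gt0.
have a1 : 1 <= pa p by rewrite /pa ler_pdivlMr// mul1r; lra.
(* The loss is capped so that the rate [mu] stays negative, given that [omega_p <= -1/2]. *)
pose e := Num.min eps (4^-1).
have e0 : 0 < e by rewrite lt_min heps/= invr_gt0.
have ee : e <= eps by rewrite ge_min lexx.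
have e4 : e <= 4^-1 by rewrite ge_min lexx orbT.
pose mu := omega_p p + e.
have w1 : -1 <= omega_p p by rewrite le_max lexx.
have w2 : 2^-1 - pa p <= omega_p p by rewrite le_max lexx orbT.
have w3 : omega_p p <= - 2^-1 by rewrite ge_max -/(pa p); apply/andP; split; lra.
have mu1 : -1 < mu by rewrite /mu; lra.
have mu0 : mu < 0 by rewrite /mu; lra.
have mua : 2^-1 - pa p <= mu by rewrite /mu; lra.
have [M M0 hM] := stable_orbits hp mu1 mu0 mua.
have wE : `|omega_p p| = - omega_p p by rewrite ler0_norm//; lra.
(* This equals [eps - e], the power of [T - t] gained by the smaller loss. It is nonnegative, so
   [(T - t)^q] is at most [(3 / 2)^q]. *)
pose q := - mu - (`|omega_p p| - eps).
have q0 : 0 <= q by rewrite /q /mu wE; lra.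
pose Q := M * (2 * (3 / 2) `^ q).
have Q0 : 0 < Q by rewrite !mulr_gt0// powR_gt0//; lra.
exists Q => // eta heta; have [delta delta0 hd] := hM eta heta.
exists delta => // f g rd en; have [T hT [iu [X hX bX]]] := hd f g rd en.
have /andP[T1 T2] := hT; have /andP[eta0 eta1] := heta.
have Th : 2^-1 < T by lra.
have T0 : 0 < T by lra.
exists T => //; split; first exact: (mild_unique hp iu).
exists (psiX p T X), (psitX p T X); split; first exact: psiX_solution.
move=> t /andP[t0 tT]; have [nrm hn En] := psiX_energy hp X tT.
exists nrm => //; rewrite En; have c0 : 0 < T - t by rewrite subr_gt0.
have c1 : T - t <= 3 / 2 by lra.
have th0 : 0 <= - ln (T - t) + ln T by rewrite addrC subr_ge0 ler_ln ?posrE//; lra.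
apply: (le_trans (bX _ th0)); rewrite /Q -mulrA ler_wpM2l ?(ltW M0)//.
have -> : mu * (- ln (T - t) + ln T) = - mu * ln (T - t) + mu * ln T by ring.
have E1 : expR (- mu * ln (T - t)) = (T - t) `^ q * (T - t) `^ (`|omega_p p| - eps).
  rewrite -powRD; last by rewrite (gt_eqF c0) implybT.
  by rewrite /powR (gt_eqF c0); congr expR; rewrite /q; ring.
(* This is [T^mu <= 2], from [T > 1 / 2] and [-1 < mu < 0]. *)
have E2 : expR (mu * ln T) <= 2.
  have l2 : - ln 2 <= ln T by rewrite -lnV ?posrE// ler_ln ?posrE ?invr_gt0// ltW.
  rewrite -[leRHS](@lnK R) ?posrE// ler_expR.
  have l20 : 0 <= ln 2 :> R by rewrite ln_ge0// ler1n.
  by nra.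
rewrite expRD E1 [leLHS]mulrC mulrA ler_wpM2r ?powR_ge0//.
apply: (ler_pM (expR_ge0 _) (powR_ge0 _ _) E2).
by apply: ge0_ler_powR => //; rewrite nnegrE ?(ltW c0) ?divr_ge0.
Qed.
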